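(* There is an event $\hat{\Omega} \in \Sigma$ with $\mathbb{P}(\hat{\Omega}) = 1$ such that for every $\omega \in \hat{\Omega}$, every $e \in S^{d-1}$, every $x_{0} \in \mathbb{R}^{d}$ and every $\rho > 0$, \[ \tilde{\varphi}(e)\rho^{d-1} = \lim_{R \to \infty} R^{1-d} \tilde{\Phi}^{\omega}(e, Rx_{0}, RQ^{e}(x_{0},\rho)). \]
   Context: Setting: $d \geq 1$, $\lambda,\Lambda \in (0,\infty)$; $\mathscr{F}_{d}(\lambda,\Lambda)$ is the set of continuous $\varphi : S^{d-1} \to [0,\infty)$ with $\sqrt{\lambda} \leq \varphi \leq \sqrt{\Lambda}$ and convex one-homogeneous extension, with the Borel $\sigma$-algebra of the sup norm. $(\Omega,\mathscr{B},\mathbb{P})$ is a probability space with measurable $\Phi : \Omega \to \mathscr{F}_{d}(\lambda,\Lambda)$ and a jointly measurable group action $\tau : \mathbb{R}^{d} \times \Omega \to \Omega$ ($\tau_{x+y} = \tau_{x}\circ\tau_{y}$, $\tau_{0} = \mathrm{Id}$) preserving $\mathbb{P}$ and ergodic. $\varphi^{\omega}(x,p) = \|p\|\Phi^{\tau_{x}\omega}(p/\|p\|)$ for $p \neq 0$, $\varphi^{\omega}(x,0)=0$. $W : [-1,1] \to [0,\infty)$ is continuous with zero set $\{-1,1\}$. For open $A$ and $u \in H^{1}(A;[-1,1])$, $\mathcal{F}^{\omega}(u;A) = \int_{A} (\frac{1}{2}\varphi^{\omega}(x,Du)^{2} + W(u))\, dx$. Fix a smooth $q : \mathbb{R} \to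 [-1,1]$ with $\int_{\mathbb{R}}(\frac{\Lambda}{2}q'^{2} + W(q))\,ds < \infty$ and $q(s) \to \pm 1$ as $s \to \pm\infty$; $q_{e}(y) = q(\langle y,e \rangle)$ and $(T_{x}f)(y) = f(y - x)$. For $e \in S^{d-1}$, $x_{0} \in \mathbb{R}^{d}$ and bounded open $A \subseteq \mathbb{R}^{d}$: $\tilde{\Phi}^{\omega}(e,x_{0},A) = \inf\{\mathcal{F}^{\omega}(u;A) : u \in H^{1}(A;[-1,1]),\ u - T_{x_{0}}q_{e} \in H^{1}_{0}(A)\}$. Fix linear isometries $O_{e} : \mathbb{R}^{d-1} \to \langle e\rangle^{\perp}$ onto, write $A \oplus_{e} B = \{O_{e}(a) + be : a \in A, b \in B\}$, fix an orthonormal basis $e_{1},\dots,e_{d-1}$ of $\mathbb{R}^{d-1}$, $Q(y,r) = \{x \in \mathbb{R}^{d-1} : \max_{i}|\langle x - y, e_{i}\rangle| < r/2\}$, and $Q^{e}(x,r) = x + Q(0,r)\oplus_{e}(-r/2,r/2)$. With $\tilde{\varphi}^{\omega}(e,A,h) = \tilde{\Phi}^{\omega}(e,0,A\oplus_{e}(-h,h))$ for bounded open $A \subseteq \mathbb{R}^{d-1}$, let $\tilde{\varphi}^{\omega}(e) = \liminf_{R\to\infty} R^{1-d}\tilde{\varphi}^{\omega}(e,Q(0,R),R)$; $\tilde{\varphi}(e)$ denotes the deterministic constant such that $\tilde{\varphi}^{\omega}(e) = \tilde{\varphi}(e)$ almost surely. $\Sigma$ is the $\sigma$-algebra of events invariant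 under every $\tau_{x}$, $x \in \mathbb{R}^{d}$. *)

(* Defs.v *)
From HB Require Import structures.
From mathcomp Require Import all_boot all_order all_algebra.
From mathcomp Require Import all_classical all_reals all_analysis.
Set Implicit Arguments. Unset Strict Implicit. Unset Printing Implicit Defensive.
Import Order.TTheory GRing.Theory Num.Theory.
Import numFieldNormedType.Exports.
Local Open Scope classical_set_scope.
Local Open Scope ring_scope.

Definition dotp {R : realType} {n : nat} (x y : 'rV[R]_n) : R :=
  \sum_(i < n) x ord0 i * y ord0 i.
Definition enorm {R : realType} {n : nat} (x : 'rV[R]_n) : R := Num.sqrt (dotp x x).
Definition sphere (R : realType) (n : nat) : set 'rV[R]_n := [set p | enorm p = 1].
Arguments sphere R n : clear implicits.
Definition bvec {R : realType} {n : nat} (i : 'I_n) : 'rV[R]_n := delta_mx ord0 i.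

(* ---------- Borel sets of R^n (topology of 'rV_n = Euclidean topology) ---------- *)
Definition borelRd (R : realType) (n : nat) : set (set 'rV[R]_n) := <<s open >>.
Arguments borelRd R n : clear implicits.
Definition borel_fun (R : realType) (n : nat) (f : 'rV[R]_n -> R) : Prop :=
  forall B : set R, measurable B -> borelRd R n (f @^-1` B).

(* ---------- Lebesgue integral on R^n of nonnegative functions ----------
   Iterated Lebesgue integral (equal to the integral w.r.t. Lebesgue measure on
   R^n for Borel functions, by Tonelli). R^0 carries the Dirac mass at 0. *)
Definition rvcons {R : realType} {n : nat} (t : R) (y : 'rV[R]_n) : 'rV[R]_n.+1 :=
  \row_(i < n.+1) match unlift ord0 i with Some j => y ord0 j | None => t end.
Fixpoint intRd {R : realType} (n : nat) : ('rV[R]_n -> \bar R) -> \bar R :=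
  match n with
  | 0 => fun f => f 0
  | n'.+1 => fun f =>
      (\int[@lebesgue_measure R]_t intRd (fun y : 'rV[R]_n' => f (rvcons t y)))%E
  end.
Definition intA {R : realType} {n : nat} (A : set 'rV[R]_n) (f : 'rV[R]_n -> R) : \bar R :=
  intRd (fun x => (\1_A x * f x)%:E).

Fixpoint Ck {R : realType} {n : nat} (k : nat) (f : 'rV[R]_n -> R) : Prop :=
  match k with
  | 0 => continuous f
  | k'.+1 => continuous f /\
      forall i : 'I_n, (forall x, derivable f x (bvec i)) /\
                       Ck k' (fun x => 'D_(bvec i) f x)
  end.
Definition smooth {R : realType} {n : nat} (f : 'rV[R]_n -> R) : Prop :=
  forall k, Ck k f.
Definition grad {R : realType} {n : nat} (f : 'rV[R]_n -> R) (x : 'rV[R]_n) : 'rV[R]_n :=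
  \row_(i < n) 'D_(bvec i) f x.
Definition Cc_infty {R : realType} {n : nat} (A : set 'rV[R]_n) (f : 'rV[R]_n -> R) : Prop :=
  smooth f /\ exists K, compact K /\ K `<=` A /\ (forall x, ~ K x -> f x = 0).

Definition hom_ext {R : realType} {d : nat} (phi : 'rV[R]_d -> R) (p : 'rV[R]_d) : R :=
  if p == 0 then 0 else enorm p * phi ((enorm p)^-1 *: p).
Definition Fd (R : realType) (d : nat) (lam Lam : R) : set ('rV[R]_d -> R) :=
  [set phi | {within sphere R d, continuous phi} /\
     (forall p, sphere R d p -> Num.sqrt lam <= phi p <= Num.sqrt Lam) /\
     (forall p q (t : R), 0 <= t <= 1 ->
        hom_ext phi (t *: p + (1 - t) *: q) <= t * hom_ext phi p + (1 - t) * hom_ext phi q)].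
Arguments Fd R d lam Lam : clear implicits.
Definition supdist {R : realType} {d : nat} (f g : 'rV[R]_d -> R) : \bar R :=
  ereal_sup [set (`|f p - g p|)%:E | p in sphere R d].
Definition Fd_open (R : realType) (d : nat) (lam Lam : R) : set (set ('rV[R]_d -> R)) :=
  [set U | U `<=` Fd R d lam Lam /\ forall f, U f -> exists2 eps : R, 0 < eps &
     forall g, Fd R d lam Lam g -> (supdist f g < eps%:E)%E -> U g].
Arguments Fd_open R d lam Lam : clear implicits.
Definition Fd_borel (R : realType) (d : nat) (lam Lam : R) : set (set ('rV[R]_d -> R)) :=
  <<s Fd R d lam Lam, Fd_open R d lam Lam >>.

Arguments Fd_borel R d lam Lam : clear implicits.

Definition phiw {R : realType} {d : nat} {T : Type} (Phi : T -> 'rV[R]_d -> R)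
  (tau : 'rV[R]_d -> T -> T) (w : T) (x p : 'rV[R]_d) : R :=
  hom_ext (Phi (tau x w)) p.
(* F^omega(u;A), u having (weak) gradient g on A *)
Definition energy {R : realType} {d : nat} {T : Type} (Phi : T -> 'rV[R]_d -> R)
  (tau : 'rV[R]_d -> T -> T) (W : R -> R) (w : T) (A : set 'rV[R]_d)
  (u : 'rV[R]_d -> R) (g : 'rV[R]_d -> 'rV[R]_d) : \bar R :=
  intA A (fun x => 2^-1 * (phiw Phi tau w x (g x)) ^+ 2 + W (u x)).

Definition Tqe {R : realType} {d : nat} (q : R -> R) (e x0 : 'rV[R]_d) (y : 'rV[R]_d) : R :=
  q (dotp (y - x0) e).

(* H^1_0(A) with gradient: v belongs to H^1_0(A) (the H^1(A)-closure of
   C_c^oo(A)) and gv is its weak gradient on A. *)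
Definition H10_grad {R : realType} {d : nat} (A : set 'rV[R]_d)
  (v : 'rV[R]_d -> R) (gv : 'rV[R]_d -> 'rV[R]_d) : Prop :=
  exists psi : nat -> 'rV[R]_d -> R,
    (forall k, Cc_infty A (psi k)) /\
    (fun k => intA A (fun x => (psi k x - v x) ^+ 2)) @ \oo --> 0%E /\
    (fun k => intA A (fun x => dotp (grad (psi k) x - gv x) (grad (psi k) x - gv x)))
      @ \oo --> 0%E.

(* admissible competitors for tilde Phi^omega(e,x0,A): u in H^1(A;[-1,1]) with
   weak gradient g on A and u - T_{x0} q_e in H^1_0(A) *)
Definition admissible {R : realType} {d : nat} (q : R -> R) (e x0 : 'rV[R]_d)
  (A : set 'rV[R]_d) (u : 'rV[R]_d -> R) (g : 'rV[R]_d -> 'rV[R]_d) : Prop :=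
  borel_fun u /\ (forall i, borel_fun (fun x => g x ord0 i)) /\
  (forall x, A x -> -1 <= u x <= 1) /\
  (intA A (fun x => dotp (g x) (g x)) < +oo)%E /\
  H10_grad A (fun x => u x - Tqe q e x0 x) (fun x => g x - grad (Tqe q e x0) x).

Definition Phit {R : realType} {d : nat} {T : Type} (Phi : T -> 'rV[R]_d -> R)
  (tau : 'rV[R]_d -> T -> T) (W : R -> R) (q : R -> R) (w : T)
  (e x0 : 'rV[R]_d) (A : set 'rV[R]_d) : \bar R :=
  ereal_inf [set E | exists u g, admissible q e x0 A u g /\
                                  E = energy Phi tau W w A u g].

Definition oplus_e {R : realType} {d : nat} (O : 'rV[R]_d -> 'rV[R]_d.-1 -> 'rV[R]_d)
  (e : 'rV[R]_d) (A : set 'rV[R]_d.-1) (B : set R) : set 'rV[R]_d :=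
  [set O e a + b *: e | a in A & b in B].
Definition Qcube {R : realType} {d : nat} (b : 'I_d.-1 -> 'rV[R]_d.-1)
  (y : 'rV[R]_d.-1) (r : R) : set 'rV[R]_d.-1 :=
  [set x | forall i, `|dotp (x - y) (b i)| < r / 2].
Definition Qe {R : realType} {d : nat} (O : 'rV[R]_d -> 'rV[R]_d.-1 -> 'rV[R]_d)
  (b : 'I_d.-1 -> 'rV[R]_d.-1) (e x : 'rV[R]_d) (r : R) : set 'rV[R]_d :=
  [set x + z | z in oplus_e O e (Qcube b 0 r) `](- (r / 2)), (r / 2)[ ].
Definition scale_set {R : realType} {d : nat} (r : R) (S : set 'rV[R]_d) : set 'rV[R]_d :=
  [set r *: y | y in S].

Definition liminf_pinfty {R : realType} (f : R -> \bar R) : \bar R :=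
  ereal_sup [set ereal_inf (f @` [set r | M <= r]) | M in [set: R]].

Definition tphiw {R : realType} {d : nat} {T : Type} (Phi : T -> 'rV[R]_d -> R)
  (tau : 'rV[R]_d -> T -> T) (W : R -> R) (q : R -> R)
  (O : 'rV[R]_d -> 'rV[R]_d.-1 -> 'rV[R]_d) (b : 'I_d.-1 -> 'rV[R]_d.-1)
  (w : T) (e : 'rV[R]_d) : \bar R :=
  liminf_pinfty (fun r => ((r ^- d.-1)%:E *
     Phit Phi tau W q w e 0 (oplus_e O e (Qcube b 0 r) `](- r)%R, r%R[))%E).

Definition jointly_measurable {R : realType} {d : nat} {dT : measure_display}
  {T : measurableType dT} (tau : 'rV[R]_d -> T -> T) : Prop :=
  forall E : set T, measurable E ->
    <<s [set X | exists A B, borelRd R d A /\ measurable B /\ X = A `*` B] >>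
      [set xw | E (tau xw.1 xw.2)].

(* Main.v *)
Require Import Defs.
From HB Require Import structures.
From mathcomp Require Import all_boot all_order all_algebra.
From mathcomp Require Import all_classical all_reals all_analysis.
From mathcomp Require Import measurable_realfun simple_functions measurable_fun_approximation.
From mathcomp Require Import lebesgue_integral_fubini.
From mathcomp Require Import ring lra zify.
Set Implicit Arguments. Unset Strict Implicit. Unset Printing Implicit Defensive.
Import Order.TTheory GRing.Theory Num.Theory.
Import numFieldNormedType.Exports.
Local Open Scope classical_set_scope.
Local Open Scope ring_scope.

(* Put [E(t) = Lam/2 q'(t)^2 + W(q(t))] and let [F(x,r)] be the least energy on the cylinder of
   base side [r] centred at [x] and adapted to a unit vector [e].  Gluing competitors by
   [q o l], with [l] smooth and close to a planar coordinate, costs only the integral of [E]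
   off the glued pieces; hence [F] is subadditive up to boundary terms and up to tails of [E],
   and [F <= C r^(d-1)].
   The liminf hypothesis at the origin and a Vitali selection of lattice cubes on which [F] is
   almost optimal give [F(0,r) <= (tphi e + eps) r^(d-1)] with probability close to one for all
   large [r] (the constant is improved by a fixed proportion of its distance to [tphi e], so the
   best constant is [tphi e]).  A maximal inequality for the lattice shifts, again by Vitali,
   then shows that almost surely every ball [B(x, delta R)] with [|x| <= K R] contains a centre
   [x'] whose plane is tiled by cubes of one fixed size, all but a small fraction of which are
   almost optimal, and at which the lower bound holds at all large scales.  Comparing an
   arbitrary cube in a direction near [e] with such a tiled plane, from above (tiles inside the
   cube) and from below (a large cylinder is the cube plus the tiles outside), gives the limit
   uniformly in the centre and locally uniformly in the direction.  Countably many directions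
   suffice, and the set of [w] for which almost every translate is good is invariant. *)

(** * Lebesgue measure on R^n *)

(** Shifts along one hyperplane preserve the probability but need not be ergodic, so subadditivity
    along a plane would by itself give a random limit. The constant comes from the liminf at the
    origin being deterministic: by stationarity this holds at every fixed centre, and Vitali
    coverings turn the liminf into a limit in probability. The second obstacle is the order of
    quantifiers. One event must serve all directions and centres, so the tolerance [dl] in direction
    and centre has to depend on the error only and not on the direction; hence the quantitative
    comparison of two planes. Centres at distance of order R form too large a family for a union
    bound, hence a maximal inequality in all of space. The recurring factor 8 is 4, a bound for the
    squared gradient of l, times 2, the inverse of its least slope. Cylinders keep a free
    half-height between r/2 and r because the liminf is taken over half-height r and the cubes of
    the theorem have half-height r/2. *)

Definition Rd (R : realType) (n : nat) := g_sigma_algebraType (@open 'rV[R]_n).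
Arguments Rd R n : clear implicits.
HB.instance Definition _ R n := Measurable.on (Rd R n).

Section Rd_measurability.
Context {R : realType}.

Lemma borel_funE n (f : 'rV[R]_n -> R) :
  borel_fun f <-> measurable_fun setT (f : Rd R n -> R).
Proof.
split=> [bf _ B mB|mf B mB]; first by rewrite setTI; exact: bf.
by have := mf measurableT B mB; rewrite setTI.
Qed.

Lemma open_measurableRd n (A : set 'rV[R]_n) :
  open A -> measurable (A : set (Rd R n)).
Proof. exact: sub_sigma_algebra. Qed.

Lemma continuous_measurableRd n (f : 'rV[R]_n -> R) :
  continuous f -> measurable_fun setT (f : Rd R n -> R).
Proof.
move=> /continuousP cf.
apply: (measurability _ (RGenOpens.measurableE R)) => _ [_ [a [b ->] <-]].
by rewrite setTI; apply: open_measurableRd; apply: cf; exact: interval_open.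
Qed.

Lemma measurable_coord n (i : 'I_n) :
  measurable_fun setT (fun z : Rd R n => (z : 'rV[R]_n) ord0 i).
Proof. by apply: continuous_measurableRd => z; exact: coord_continuous. Qed.

Lemma ball_rVE n (c : 'rV[R]_n) (r : R) : 0 < r ->
  ball c r = [set z | forall i, `|c ord0 i - z ord0 i| < r].
Proof.
move=> r0; apply/seteqP; split => z /=; first by case=> _ h i; exact: h.
by move=> h; split => // i j; rewrite ord1; exact: h.
Qed.

Lemma rV_ratr_dense n (z : 'rV[R]_n) (r : R) : 0 < r ->
  exists c : 'rV[rat]_n, ball z r (map_mx ratr c).
Proof.
move=> r0.
have h i : exists c : rat, `|z ord0 i - ratr c| < r.
  have [|c] := @rat_in_itvoo R (z ord0 i - r) (z ord0 i + r); first lra.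
  by rewrite in_itv /= => /andP[h1 h2]; exists c; rewrite ltr_norml; lra.
have /choice[c hc] := h.
by exists (\row_i c i); rewrite ball_rVE //= => i; rewrite !mxE.
Qed.

(** An open set is the union of the sup-norm balls with rational centre and radius that it contains.
    These are countably many, and the preimage of each is a finite intersection of coordinate
    conditions. *)
Lemma measurable_fun_rV d (X : measurableType d) n (f : X -> Rd R n) :
  (forall i, measurable_fun setT (fun x => (f x : 'rV[R]_n) ord0 i)) ->
  measurable_fun setT f.
Proof.
move=> mf; have E : @measurable _ (Rd R n) = <<s (@open 'rV[R]_n : set (set (Rd R n))) >> by [].
apply: (measurability _ E) => _ [U oU <-]; rewrite setTI.
pose B (cr : 'rV[rat]_n * rat) : set X :=
  [set x | 0 < (ratr cr.2 : R) /\
    ball (map_mx ratr cr.1 : 'rV[R]_n) (ratr cr.2) `<=` U] `&`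
  \bigcap_(i in [set: 'I_n]) [set x |
    `|ratr (cr.1 ord0 i) - (f x : 'rV[R]_n) ord0 i| < ratr cr.2].
suff -> : f @^-1` U = \bigcup_cr B cr.
  apply: countable_bigcupT_measurable => // -[c r]; apply: measurableI.
    have [h|h] := pselect (0 < (ratr r : R) /\
       ball (map_mx ratr c : 'rV[R]_n) (ratr r) `<=` U).
      by rewrite (_ : [set _ | _] = setT) //; apply/seteqP; split.
    by rewrite (_ : [set _ | _] = set0) //; apply/seteqP; split.
  apply: fin_bigcap_measurable => // i _ /=.
  rewrite (_ : [set x | _] =
    (fun x => `|ratr (c ord0 i) - (f x : 'rV[R]_n) ord0 i|) @^-1` `]-oo, ratr r[);
    last by apply/seteqP; split => x /=; rewrite in_itv.
  rewrite -[X in measurable X]setTI.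
  apply: (measurableT_comp (@normr_measurable R setT)) => //.
  exact: measurable_funB.
apply/seteqP; split => [x Ux|x [[c r] _ [/= [r0 sub] h]]]; last first.
  by apply: sub; rewrite ball_rVE //= => i; rewrite mxE; exact: h.
have /nbhs_ballP[e /= e0 eU] : nbhs (f x : 'rV[R]_n) U by apply: open_nbhs_nbhs.
have [|r] := @rat_in_itvoo R 0 (e / 2); first lra.
rewrite in_itv /= => /andP[r0 re2].
have [c hc] := rV_ratr_dense (f x : 'rV[R]_n) r0.
exists (c, r) => //; split => /=.
  split => // z; rewrite ball_rVE //= => hz; apply: eU.
  rewrite ball_rVE //= => i.
  move: hc; rewrite ball_rVE //= => /(_ i); rewrite mxE => hc.
  have := hz i; rewrite mxE => hzi.
  have := ler_distD (ratr (c ord0 i)) ((f x : 'rV[R]_n) ord0 i) (z ord0 i); lra.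
by move=> i _ /=; move: hc; rewrite ball_rVE //= => /(_ i); rewrite mxE distrC.
Qed.

Lemma measurable_rvcons n :
  measurable_fun setT (fun ty : R * Rd R n => rvcons ty.1 ty.2 : Rd R n.+1).
Proof.
apply: measurable_fun_rV => i.
under eq_fun do rewrite mxE; case: (unliftP ord0 i) => [j|] _ //.
  exact: (measurableT_comp (measurable_coord j)).
exact: measurable_fst.
Qed.

Definition rvbehead n (z : 'rV[R]_n.+1) : 'rV[R]_n := \row_j z ord0 (lift ord0 j).

Lemma rvcons0 n t (y : 'rV[R]_n) : rvcons t y ord0 ord0 = t.
Proof. by rewrite mxE unlift_none. Qed.

Lemma rvconsS n t (y : 'rV[R]_n) j : rvcons t y ord0 (lift ord0 j) = y ord0 j.
Proof. by rewrite mxE liftK. Qed.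

Lemma measurable_rvbehead n :
  measurable_fun setT (fun z : Rd R n.+1 => rvbehead z : Rd R n).
Proof.
by apply: measurable_fun_rV => i; under eq_fun do rewrite mxE; exact: measurable_coord.
Qed.

End Rd_measurability.

Section muRd.
Context {R : realType}.
Local Open Scope ereal_scope.

Lemma prod_sigma_finite d1 d2 (T1 : measurableType d1) (T2 : measurableType d2)
    (m1 : {sigma_finite_measure set T1 -> \bar R})
    (m2 : {sigma_finite_measure set T2 -> \bar R}) : sigma_finite setT (m1 \x m2).
Proof.
have /sigma_finiteP[F [TF ndF Foo]] := sigma_finiteT m1.
have /sigma_finiteP[G [TG ndG Goo]] := sigma_finiteT m2.
exists (fun k => F k `*` G k).
  apply/esym/seteqP; split => // -[x y] _.
  have [i _ Fx] : (\bigcup_i F i) x by rewrite -TF.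
  have [j _ Gy] : (\bigcup_i G i) y by rewrite -TG.
  exists (maxn i j) => //; split => /=.
    by move: x Fx; exact/subsetPset/ndF/leq_maxl.
  by move: y Gy; exact/subsetPset/ndG/leq_maxr.
move=> k; have [mF F_oo] := Foo k; have [mG G_oo] := Goo k.
split; first exact: measurableX.
by rewrite product_measure1E //; rewrite lte_mul_pinfty // ge0_fin_numE.
Qed.

(** The induction step takes the image of Lebesgue measure times [m] under [rvcons]. The identity
    with the iterated integral [intRd] is part of the statement because the next dimension uses it
    for the previous one; sigma-finiteness is carried back through the measurable inverse of
    [rvcons]. *)
Lemma muRd_sig n : {m : {sigma_finite_measure set (Rd R n) -> \bar R} |
  forall f : Rd R n -> \bar R, measurable_fun setT f -> (forall x, 0 <= f x) ->
    intRd f = \int[m]_x f x}.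
Proof.
elim: n => [|n [m IH]].
  exists [the {sigma_finite_measure set (Rd R 0) -> \bar R} of \d_((0%R : 'rV[R]_0) : Rd R 0)].
  move=> f mf f0 /=; rewrite integral_dirac //.
  by rewrite diracT mul1e.
have mc := @measurable_rvcons R n.
pose c := fun ty : R * Rd R n => rvcons ty.1 ty.2 : Rd R n.+1.
have @nu : {measure set (Rd R n.+1) -> \bar R}.
  by refine (pushforward (@lebesgue_measure R \x m) c); exact: mc.
have snu : sigma_finite setT nu.
  have [F TF mF] := prod_sigma_finite (@lebesgue_measure R) m.
  have muc : measurable_fun setT
      (fun z : Rd R n.+1 => ((z : 'rV[R]_n.+1) ord0 ord0, rvbehead z : Rd R n)).
    by apply: measurable_fun_pair; [exact: measurable_coord|exact: measurable_rvbehead].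
  exists (fun k => (fun z : Rd R n.+1 =>
     ((z : 'rV[R]_n.+1) ord0 ord0, rvbehead z : Rd R n)) @^-1` F k).
    by rewrite -preimage_bigcup -TF preimage_setT.
  move=> k; split; first by rewrite -[X in measurable X]setTI; apply: muc => //; case: (mF k).
  have [_] := mF k; rewrite /nu /= /pushforward.
  congr (_ < _); congr (_ _); apply/seteqP; split => -[t y] /=;
  by rewrite /c/= rvcons0 (_ : rvbehead _ = y) //; apply/rowP => j; rewrite mxE rvconsS.
have snu' := @Measure_isSigmaFinite.Build _ _ _ nu snu.
exists (HB.pack_for {sigma_finite_measure set (Rd R n.+1) -> \bar R} (Measure.sort nu) snu' nu).
move=> f mf f0 /=.
transitivity (\int[pushforward (@lebesgue_measure R \x m) c]_x f x); last by [].
rewrite ge0_integral_pushforward // preimage_setT fubini_tonelli1 //=; last first.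
  by apply: measurableT_comp.
apply: eq_integral => t _; rewrite IH //.
exact: (measurableT_comp mf (measurableT_comp mc (pair1_measurable t))).
Qed.

Definition muRd n : {sigma_finite_measure set (Rd R n) -> \bar R} := sval (muRd_sig n).

Lemma intRdE n (f : Rd R n -> \bar R) :
  measurable_fun setT f -> (forall x, 0 <= f x) -> intRd f = \int[muRd n]_x f x.
Proof. exact: (svalP (muRd_sig n)). Qed.

Lemma intAE n (A : set (Rd R n)) (f : Rd R n -> R) : measurable A ->
  measurable_fun A f -> (forall x, A x -> (0 <= f x)%R) ->
  intA A f = \int[muRd n]_(x in A) (f x)%:E.
Proof.
move=> mA mf f0.
have -> : intA A f = intRd ((EFin \o f) \_ A).
  rewrite /intA; congr intRd; apply/funext => x; rewrite patchE indicE.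
  by case: ifP => _; rewrite ?mul1r ?mul0r.
rewrite intRdE -?integral_mkcond //.
- apply: (measurable_restrictT (EFin \o f) mA).1.
  by apply: (measurable_EFinP A f).2.
- by move=> x; rewrite patchE; case: ifPn => // /set_mem /f0; rewrite lee_fin.
Qed.

Lemma ge0_integral_muRdS n (f : Rd R n.+1 -> \bar R) :
  measurable_fun setT f -> (forall x, 0 <= f x) ->
  \int[muRd n.+1]_z f z =
  \int[@lebesgue_measure R]_t \int[muRd n]_y f (rvcons t y : Rd R n.+1).
Proof.
move=> mf f0; rewrite -intRdE //=; apply: eq_integral => t _; rewrite intRdE //.
exact: (measurableT_comp mf
  (measurableT_comp (@measurable_rvcons R n) (pair1_measurable t))).
Qed.

Lemma ge0_integral_muRdS_swap n (f : Rd R n.+1 -> \bar R) :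
  measurable_fun setT f -> (forall x, 0 <= f x) ->
  \int[muRd n.+1]_z f z =
  \int[muRd n]_y \int[@lebesgue_measure R]_t f (rvcons t y : Rd R n.+1).
Proof.
move=> mf f0; rewrite ge0_integral_muRdS //.
rewrite (fubini_tonelli (m1 := @lebesgue_measure R) (m2 := muRd n)
  (fun ty => f (rvcons ty.1 ty.2 : Rd R n.+1))) //.
exact: measurableT_comp mf (@measurable_rvcons R n).
Qed.

(** The image of Lebesgue measure under the shift gives each half-open interval its length, and this
    determines Lebesgue measure. *)
Lemma lebesgue_shift (c : R) (f : R -> \bar R) : measurable_fun setT f ->
  (forall x, 0 <= f x) ->
  \int[@lebesgue_measure R]_t f (t + c)%R = \int[@lebesgue_measure R]_t f t.
Proof.
move=> mf f0.
have ms : measurable_fun setT (fun t : R => (t + c)%R : measurableTypeR R).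
  by apply: measurable_funD.
have E A : measurable A -> lebesgue_measure A =
    pushforward (@lebesgue_measure R) (fun t : R => (t + c)%R : measurableTypeR R) A.
  move=> mA.
  have @nu : {measure set (measurableTypeR R) -> \bar R}.
    by refine (pushforward (@lebesgue_measure R) (fun t : R => (t + c)%R : measurableTypeR R)); exact: ms.
  apply: (@lebesgue_measure_unique R nu) => // _ [[a b]] _ <-.
  rewrite /nu /= /pushforward /=.
  rewrite (_ : _ @^-1` _ = `](a - c)%R, (b - c)%R]%classic); last first.
    by apply/seteqP; split => t /=; rewrite !in_itv /=; lra.
  rewrite !lebesgue_measure_itv /= !lte_fin.
  have -> : (a - c < b - c)%R = (a < b)%R by apply/idP/idP; lra.
  case: ifPn => // _; rewrite -!EFinB; congr (_%:E); lra.
transitivity (\int[pushforward (@lebesgue_measure R)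
    (fun t : R => (t + c)%R : measurableTypeR R)]_t f t).
  by rewrite ge0_integral_pushforward.
by apply: eq_measure_integral => A mA _; apply/esym; exact: E.
Qed.

Lemma measurable_addRd n (c : 'rV[R]_n) :
  measurable_fun setT (fun z : Rd R n => z + c : Rd R n)%R.
Proof.
apply: measurable_fun_rV => i; under eq_fun do rewrite mxE.
by apply: measurable_funD => //; exact: measurable_coord.
Qed.

Lemma measurable_mulRd n (M : 'M[R]_n) :
  measurable_fun setT (fun z : Rd R n => z *m M : Rd R n)%R.
Proof.
apply: measurable_fun_rV => i; under eq_fun do rewrite mxE.
apply: measurable_sum => j; apply: measurable_funM => //; exact: measurable_coord.
Qed.

Lemma muRd_shift n (c : 'rV[R]_n) (f : Rd R n -> \bar R) : measurable_fun setT f ->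
  (forall x, 0 <= f x) ->
  \int[muRd n]_z f (z + c)%R = \int[muRd n]_z f z.
Proof.
elim: n c f => [|n IH] c f mf f0.
  by apply: eq_integral => z _; congr f; apply/rowP => -[].
have mfc : measurable_fun setT (fun z : Rd R n.+1 => f (z + c)%R).
  exact: measurableT_comp mf (measurable_addRd c).
rewrite !ge0_integral_muRdS_swap //.
pose G : Rd R n -> \bar R :=
  fun y => \int[@lebesgue_measure R]_t f (rvcons t y : Rd R n.+1).
transitivity (\int[muRd n]_y G (y + rvbehead c)%R); last first.
  apply: IH; last by move=> y; apply: integral_ge0.
  have := measurable_fun_fubini_tonelli_G (m1 := @lebesgue_measure R)
      (fun ty : measurableTypeR R * Rd R n => f (rvcons ty.1 ty.2 : Rd R n.+1)).
  move/(_ (measurableT_comp mf (@measurable_rvcons R n)) (fun _ => f0 _)).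
  by [].
apply: eq_integral => y _ /=.
apply: (etrans _ (lebesgue_shift (c ord0 ord0)
  (f := fun t => f (rvcons t (y + rvbehead c)%R)) _ _)) => //; last first.
  exact: (measurableT_comp mf
   (measurableT_comp (@measurable_rvcons R n) (pair2_measurable _))).
apply: eq_integral => t _; congr f.
apply/rowP => i; rewrite !mxE; case: (unliftP ord0 i) => [j|] ->; by rewrite ?mxE.
Qed.

Lemma ge0_integralZr_Rd n (f : Rd R n -> \bar R) k : measurable_fun setT f ->
  (forall x, 0 <= f x) -> 0 <= k ->
  \int[muRd n]_z (f z * k) = (\int[muRd n]_z f z) * k.
Proof.
move=> mf f0 k0; rewrite muleC -ge0_integralZl //.
by apply: eq_integral => z _; rewrite muleC.
Qed.

(* The uniqueness argument for Haar measure: two applications of Tonelli and of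
   translation invariance. *)
Lemma haar_swap n (M N : 'M[R]_n) (f g : Rd R n -> \bar R) : N *m M = 1%:M ->
  measurable_fun setT f -> (forall x, 0 <= f x) ->
  measurable_fun setT g -> (forall x, 0 <= g x) ->
  (\int[muRd n]_z f (z *m M)) * \int[muRd n]_z g z =
  (\int[muRd n]_z f (- z)%R) * \int[muRd n]_z g (z *m M).
Proof.
move=> NM mf f0 mg g0.
pose F : Rd R n -> \bar R := fun z => f (z *m M).
pose G : Rd R n -> \bar R := fun z => g (z *m M).
have mF : measurable_fun setT F := measurableT_comp mf (measurable_mulRd M).
have mG : measurable_fun setT G := measurableT_comp mg (measurable_mulRd M).
have mopp : measurable_fun setT (fun z : Rd R n => - z : Rd R n)%R.
  apply: measurable_fun_rV => i; under eq_fun do rewrite mxE.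
  by apply: measurableT_comp => //; exact: measurable_coord.
have mfo : measurable_fun setT (fun z : Rd R n => f (- z)%R).
  exact: measurableT_comp mf mopp.
pose s : Rd R n * Rd R n -> Rd R n := fun zy => (zy.2 + zy.1 *m M :> 'rV[R]_n)%R.
have ms : measurable_fun setT s.
  apply: measurable_fun_rV => i; under eq_fun do rewrite mxE.
  apply: measurable_funD; first exact: (measurableT_comp (measurable_coord i)).
  exact: (measurableT_comp (measurable_coord i)
    (measurableT_comp (measurable_mulRd M) measurable_fst)).
pose r : Rd R n * Rd R n -> Rd R n := fun zy => (zy.1 *m M - zy.2 :> 'rV[R]_n)%R.
have mr : measurable_fun setT r.
  apply: measurable_fun_rV => i; under eq_fun do rewrite !mxE.
  apply: measurable_funB; last exact: (measurableT_comp (measurable_coord i)).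
  have := (measurableT_comp (measurable_coord i)
    (measurableT_comp (measurable_mulRd M) (@measurable_fst _ _ (Rd R n) (Rd R n)))).
  by rewrite /comp; under eq_fun do rewrite mxE.
rewrite -ge0_integralZr_Rd //; last by apply: integral_ge0.
transitivity (\int[muRd n]_z \int[muRd n]_y (F z * g (s (z, y)))).
  apply: eq_integral => z _; rewrite ge0_integralZl //=.
  - by congr (_ * _); apply/esym; exact: (muRd_shift (z *m M)%R mg g0).
  - by apply: measurableT_comp mg _; exact: (measurableT_comp ms (pair1_measurable z)).
  - exact: f0.
rewrite (fubini_tonelli (m1 := muRd n) (m2 := muRd n)
   (fun zy => F zy.1 * g (s zy))) //=; last first.
  by move=> zy; rewrite mule_ge0 //; exact: f0.
  apply: emeasurable_funM; first exact: (measurableT_comp mF measurable_fst).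
  exact: measurableT_comp mg ms.
transitivity (\int[muRd n]_y \int[muRd n]_z (f (r (z, y)) * G z)).
  apply: eq_integral => y _.
  apply: (etrans _ (muRd_shift (y *m N)%R (f := fun z => f (r (z, y)) * G z) _ _)).
  - apply: eq_integral => z _; rewrite /F /G /s /r /=.
    by rewrite mulmxDl -mulmxA NM mulmx1 addrK addrC.
  - apply: emeasurable_funM => //.
    exact: (measurableT_comp mf (measurableT_comp mr (pair2_measurable y))).
  - by move=> z; rewrite mule_ge0 //; exact: g0.
have mH : measurable_fun setT (fun zy : Rd R n * Rd R n => f (r zy) * G zy.1).
  apply: emeasurable_funM; last exact: (measurableT_comp mG measurable_fst).
  exact: measurableT_comp mf mr.
have H0 zy : 0 <= f (r zy) * G zy.1 by rewrite mule_ge0 //; exact: g0.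
rewrite -(fubini_tonelli (m1 := muRd n) (m2 := muRd n)
   (fun zy => f (r zy) * G zy.1) mH H0) /=.
have cf0 : 0 <= \int[muRd n]_z f (- z)%R by apply: integral_ge0.
have G0 z : 0 <= G z by exact: g0.
rewrite muleC -(ge0_integralZr_Rd mG G0 cf0).
apply: eq_integral => z _.
have mz : measurable_fun setT (fun y => f (r (z, y))).
  exact: (measurableT_comp mf (measurableT_comp mr (pair1_measurable z))).
rewrite (ge0_integralZr_Rd mz (fun _ => f0 _) (G0 z)) muleC; congr (_ * _).
apply: (etrans _ (muRd_shift (- (z *m M))%R (f := fun y => f (- y)%R) _ _)) => //.
by apply: eq_integral => y _; rewrite /r /= opprD opprK addrC.
Qed.

End muRd.

(** * Measure of cubes and invariance under isometries *)

Section muRd.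
Context {R : realType}.
Local Open Scope ereal_scope.

Lemma emeasurable_indic d (T : measurableType d) (A : set T) : measurable A ->
  measurable_fun setT (fun x => (\1_A x)%:E : \bar R).
Proof. by move=> mA; apply: (measurable_EFinP _ _).2; exact: measurable_indic. Qed.

Lemma measurable_rvprod n (A : set R) (B : set (Rd R n)) : measurable A ->
  measurable B ->
  measurable ([set z : Rd R _ | A (z ord0 ord0) /\ B (rvbehead z)] : set (Rd R n.+1)).
Proof.
move=> mA mB; apply: (@measurableI _ (Rd R n.+1)).
  by rewrite -[X in measurable X]setTI; exact: (measurable_coord ord0).
by rewrite -[X in measurable X]setTI; exact: measurable_rvbehead.
Qed.

Lemma rvbehead_cons n t (y : 'rV[R]_n) : rvbehead (rvcons t y) = y.
Proof. by apply/rowP => j; rewrite mxE rvconsS. Qed.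

Lemma muRd_prod n (A : set R) (B : set (Rd R n)) : measurable A -> measurable B ->
  muRd n.+1 ([set z : Rd R _ | A (z ord0 ord0) /\ B (rvbehead z)] : set (Rd R n.+1)) =
  lebesgue_measure A * muRd n B.
Proof.
move=> mA mB; have mAB := measurable_rvprod mA mB.
set C := [set z : Rd R _ | _] in mAB *.
transitivity (\int[muRd n.+1]_z (\1_C z)%:E); first by rewrite integral_indic // setIT.
rewrite (ge0_integral_muRdS (emeasurable_indic mAB)) //.
transitivity (\int[@lebesgue_measure R]_t ((\1_A t)%:E * muRd n B)).
  apply: eq_integral => t _.
  have -> : muRd n B = \int[muRd n]_y (\1_B y)%:E by rewrite integral_indic // setIT.
  rewrite -(ge0_integralZl _ _ (emeasurable_indic mB)) //.
  apply: eq_integral => y _; rewrite -EFinM !indicE; congr (_%:E).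
  rewrite -natrM mulnb; congr (nat_of_bool _)%:R%R.
  apply/idP/idP => [/set_mem[] /=|/andP[/set_mem At /set_mem By]].
    by rewrite rvcons0 rvbehead_cons => At By; apply/andP; split; exact/mem_set.
  by apply/mem_set; split => /=; rewrite ?rvcons0 ?rvbehead_cons.
under eq_integral do rewrite muleC.
rewrite ge0_integralZl //; last by apply: (measurable_EFinP _ _).2; exact: measurable_indic.
by rewrite integral_indic // setIT muleC.
Qed.

Definition cubeRd n (r : R) : set (Rd R n) := [set z : Rd R _ | forall i, (`|z ord0 i| < r / 2)%R].

Arguments cubeRd : clear implicits.

Lemma measurable_cubeRd n r : measurable (cubeRd n r).
Proof.
rewrite (_ : cubeRd n r = \bigcap_(i in [set: 'I_n])
   ((fun z : Rd R n => `|z ord0 i|%R) @^-1` `]-oo, (r / 2)%R[)); last first.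
  apply/seteqP; split => z /= h i; last by have := h i I; rewrite /= in_itv.
  by rewrite /= in_itv /= h.
apply: fin_bigcap_measurable => // i _; rewrite -[X in measurable X]setTI.
apply: (measurableT_comp (@normr_measurable R setT)) => //.
exact: measurable_coord.
Qed.

Lemma lebesgue_sym (h : R) : (0 <= h)%R ->
  lebesgue_measure [set t : R | (`|t| < h)%R] = (h *+ 2)%:E.
Proof.
move=> h0; rewrite (_ : [set _ | _] = `](- h)%R, h[%classic); last first.
  by apply/seteqP; split => t /=; rewrite in_itv /= ltr_norml.
rewrite lebesgue_measure_itv /= lte_fin; case: ltP => hh; rewrite -?EFinB.
  by congr (_%:E); rewrite opprK mulr2n.
by congr (_%:E); lra.
Qed.

Lemma measurable_sym (h : R) : measurable [set t : R | (`|t| < h)%R].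
Proof.
rewrite (_ : [set _ | _] = `](- h)%R, h[%classic) //.
by apply/seteqP; split => t /=; rewrite in_itv /= ltr_norml.
Qed.

Lemma muRd_cube n r : (0 <= r)%R -> muRd n (cubeRd n r) = (r ^+ n)%:E.
Proof.
move=> r0; elim: n => [|n IH].
  transitivity (\int[muRd 0]_z (\1_(cubeRd 0 r) z)%:E).
    by rewrite integral_indic ?setIT //; exact: measurable_cubeRd.
  rewrite -(intRdE (emeasurable_indic (@measurable_cubeRd 0 r))) //=.
  by rewrite indicE mem_set // => -[].
rewrite (_ : cubeRd n.+1 r =
   [set z : Rd R _ | [set t : R | (`|t| < r / 2)%R] (z ord0 ord0) /\ cubeRd n r (rvbehead z)]).
  rewrite muRd_prod; [|exact: measurable_sym|exact: measurable_cubeRd].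
  rewrite IH lebesgue_sym; last lra.
  by rewrite -EFinM exprS; congr (_%:E); lra.
apply/seteqP; split => z /= => [h|[h0 h] i]; first by split => [|i]; rewrite ?mxE h.
by case: (unliftP ord0 i) => [j|] -> //; have := h j; rewrite mxE.
Qed.

Lemma muRd_hyperplane n (i : 'I_n) (c : R) :
  muRd n ([set z : Rd R _ | z ord0 i = c] : set (Rd R n)) = 0.
Proof.
elim: n i => [[] []//|n IH] i.
case: (unliftP ord0 i) => [j|] -> {i}.
  rewrite (_ : [set z : Rd R _ | _] = [set z : Rd R _ | setT (z ord0 ord0) /\
    ([set y : Rd R _ | y ord0 j = c] : set (Rd R n)) (rvbehead z)]); last first.
    by apply/seteqP; split => z /=; rewrite mxE //; case.
  rewrite muRd_prod ?IH ?mule0 //.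
  rewrite -[X in measurable X]setTI; exact: (measurable_coord j measurableT (measurable_set1 c)).
rewrite (_ : [set z : Rd R _ | _] = [set z : Rd R _ | [set c] (z ord0 ord0) /\ setT (rvbehead z)]).
  by rewrite muRd_prod // lebesgue_measure_set1 mul0e.
by apply/seteqP; split => z /= => [->|[]].
Qed.

Lemma dotpC n (x y : 'rV[R]_n) : dotp x y = dotp y x.
Proof. by apply: eq_bigr => i _; rewrite mulrC. Qed.

Lemma dotpE n (x y : 'rV[R]_n) : dotp x y = (x *m y^T) ord0 ord0.
Proof. by rewrite mxE; apply: eq_bigr => i _; rewrite mxE. Qed.

Lemma dotp_orth n (M : 'M[R]_n) (x y : 'rV[R]_n) : M *m M^T = 1%:M ->
  dotp (x *m M) (y *m M) = dotp x y.
Proof.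
by move=> MM; rewrite !dotpE trmx_mul mulmxA -(mulmxA x) MM mulmx1.
Qed.

(** Take for [g] in [haar_swap] the indicator of the Euclidean unit ball, whose integral is finite,
    positive and unchanged by [M]. The same identity for the identity matrix has the same right-hand
    side, so cancelling the measure of the ball leaves the claim. *)
Lemma muRd_orth n (M : 'M[R]_n) (f : Rd R n -> \bar R) : M *m M^T = 1%:M ->
  measurable_fun setT f -> (forall x, 0 <= f x) ->
  \int[muRd n]_z f (z *m M) = \int[muRd n]_z f z.
Proof.
move=> MM mf f0.
pose B : set (Rd R n) := [set z : Rd R _ | (dotp z z < 1)%R].
have mB : measurable B.
  rewrite (_ : B = (fun z : Rd R n => dotp z z) @^-1` `]-oo, 1%R[); last first.
    by apply/seteqP; split => z /=; rewrite in_itv.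
  rewrite -[X in measurable X]setTI.
  have : measurable_fun setT (fun z : Rd R n => dotp z z).
    by apply: measurable_sum => i; apply: measurable_funM; exact: measurable_coord.
  exact.
pose g : Rd R n -> \bar R := fun z => (\1_B z)%:E.
have mg : measurable_fun setT g by exact: emeasurable_indic.
have g0 z : 0 <= g z by rewrite lee_fin.
have gE : \int[muRd n]_z g z = muRd n B by rewrite integral_indic ?setIT.
have gM : \int[muRd n]_z g (z *m M) = muRd n B.
  rewrite -gE; apply: eq_integral => z _; rewrite /g !indicE; congr (_%:R%:E)%R.
  by congr nat_of_bool; apply/idP/idP => /set_mem h; apply/mem_set;
     move: h; rewrite /B /= dotp_orth.
have fin : muRd n B \is a fin_num.
  rewrite ge0_fin_numE //; apply: (@le_lt_trans _ _ (muRd n (cubeRd n 2))).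
    apply: le_measure; rewrite ?inE //; first exact: measurable_cubeRd.
    move=> z /= zB i.
    have : (z ord0 i ^+ 2 < 1)%R.
      apply: le_lt_trans zB; rewrite /dotp (bigD1 i) //= -expr2 lerDl.
      by apply: sumr_ge0 => j _; rewrite -expr2 sqr_ge0.
    by rewrite divrr ?unitfE // -[in X in X -> _]real_normK ?num_real // expr_lt1.
  by rewrite muRd_cube // ltry.
have pos : muRd n B != 0.
  rewrite gt_eqF //; pose r : R := n.+1%:R^-1%R.
  have r0 : (0 < r)%R by rewrite invr_gt0.
  have : 0 < muRd n (cubeRd n r) by rewrite muRd_cube ?lte_fin ?exprn_gt0 // ltW.
  move=> h; apply: lt_le_trans h _; apply: le_measure; rewrite ?inE //.
    exact: measurable_cubeRd.
  move=> z /= h.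
  apply: (@le_lt_trans _ _ (\sum_(i < n) r)%R).
    apply: ler_sum => i _; rewrite -expr2 -real_normK ?num_real //.
    have := h i => hi; have : (r <= 1)%R by rewrite invf_le1 // ler1n.
    have := normr_ge0 (z ord0 i); nra.
  rewrite sumr_const card_ord -[X in (X < _)%R]mulr_natl /r ltr_pdivrMr //.
  by rewrite mul1r ltr_nat.
have MM' : M^T *m M = 1%:M by exact: mulmx1C.
have H1 := haar_swap MM' mf f0 mg g0.
have H2 := haar_swap (mulmx1 (1%:M : 'M[R]_n)) mf f0 mg g0.
have F1 : \int[muRd n]_z f (z *m 1%:M) = \int[muRd n]_z f z.
  by apply: eq_integral => z _; rewrite mulmx1.
have F2 : \int[muRd n]_z g (z *m 1%:M) = \int[muRd n]_z g z.
  by apply: eq_integral => z _; rewrite mulmx1.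
rewrite F1 F2 gE in H2; rewrite gM gE in H1.
have cancel (x y : \bar R) : x * muRd n B = y * muRd n B -> x = y.
  move=> e; have := congr1 (fun w => w * (fine (muRd n B))^-1%:E) e.
  rewrite -!muleA -(fineK fin) -EFinM divff ?mule1 //.
  by apply: contra pos => /eqP h; rewrite -(fineK fin) h.
by rewrite (cancel _ _ H1) (cancel _ _ H2).
Qed.

Lemma muRd_frame n (M : 'M[R]_n) (x : 'rV[R]_n) (f : Rd R n -> \bar R) :
  M *m M^T = 1%:M -> measurable_fun setT f -> (forall x, 0 <= f x) ->
  \int[muRd n]_z f z = \int[muRd n]_y f (x + y *m M)%R.
Proof.
move=> MM mf f0; rewrite -(muRd_shift x) // -(muRd_orth MM).
- by apply: eq_integral => z _; rewrite addrC.
- exact: (measurableT_comp mf (measurable_addRd _)).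
- by [].
Qed.

End muRd.
Arguments cubeRd {R} n r _.

(** * Smooth functions *)

Section smooth_calculus.
Context {R : realType}.

Lemma is_derive_line n (f : 'rV[R]_n -> R) (x v : 'rV[R]_n) (df : R) :
  is_derive (0 : R) 1 (fun h : R => f (h *: v + x)) df <-> is_derive x v f df.
Proof.
have E : 'D_1 (fun h : R => f (h *: v + x)) 0 = 'D_v f x.
  rewrite /derive; set g1 := fun h => h^-1 *: _; set g2 := fun h => h^-1 *: _.
  suff -> : g1 = g2 by [].
  by apply/funext => h; rewrite /g1 /g2 /= addr0 scale0r add0r [_%:A]mulr1.
split=> -[d1 d2].
  by split; [apply/derivable1P; exact: d1|rewrite -d2 E].
by split; [apply/(derivable1P f x v); exact: d1|rewrite -d2 E].
Qed.

Lemma is_derive_comp1 n (f : 'rV[R]_n -> R) (g : R -> R) x v (df dg : R) :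
  is_derive x v f df -> is_derive (f x) 1 g dg ->
  is_derive x v (fun z => g (f z)) (dg * df).
Proof.
move=> /is_derive_line hf hg; apply/is_derive_line.
apply: (@is_derive1_comp _ g (fun h : R => f (h *: v + x))).
by rewrite scale0r add0r.
Qed.

(** A Gateaux gradient: all directional derivatives exist and are linear in the direction. The
    notion is stable under sums, products and composition with functions of one variable, and it
    determines [grad]. *)
Definition hasgrad n (f : 'rV[R]_n -> R) (G : 'rV[R]_n -> 'rV[R]_n) :=
  forall x v, is_derive x v f (dotp (G x) v).

Lemma dotpDl n (x y z : 'rV[R]_n) : dotp (x + y) z = dotp x z + dotp y z.
Proof. by rewrite -big_split; apply: eq_bigr => i _ /=; rewrite mxE mulrDl. Qed.

Lemma dotpZl n (a : R) (x z : 'rV[R]_n) : dotp (a *: x) z = a * dotp x z.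
Proof. by rewrite mulr_sumr; apply: eq_bigr => i _ /=; rewrite mxE mulrA. Qed.

Lemma dotpNl n (x z : 'rV[R]_n) : dotp (- x) z = - dotp x z.
Proof. by rewrite -scaleN1r dotpZl mulN1r. Qed.

Lemma dotpBl n (x y z : 'rV[R]_n) : dotp (x - y) z = dotp x z - dotp y z.
Proof. by rewrite dotpDl dotpNl. Qed.

Lemma dotpDr n (x y z : 'rV[R]_n) : dotp x (y + z) = dotp x y + dotp x z.
Proof. by rewrite dotpC dotpDl !(dotpC x). Qed.

Lemma dotpZr n (a : R) (x z : 'rV[R]_n) : dotp x (a *: z) = a * dotp x z.
Proof. by rewrite dotpC dotpZl dotpC. Qed.

Lemma dotpNr n (x y : 'rV[R]_n) : dotp x (- y) = - dotp x y.
Proof. by rewrite dotpC dotpNl dotpC. Qed.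

Lemma dotpBr n (x y z : 'rV[R]_n) : dotp x (y - z) = dotp x y - dotp x z.
Proof. by rewrite dotpDr dotpNr. Qed.

Lemma dotp0l n (z : 'rV[R]_n) : dotp 0 z = 0.
Proof. by rewrite -(scale0r 0) dotpZl mul0r. Qed.

Lemma dotp_bvec n (x : 'rV[R]_n) i : dotp x (bvec i) = x ord0 i.
Proof.
rewrite /dotp (bigD1 i) //= mxE !eqxx mulr1 big1 ?addr0 // => j ji.
by rewrite mxE eqxx /= (negbTE ji) mulr0.
Qed.

Lemma hasgrad_grad n (f : 'rV[R]_n -> R) G : hasgrad f G -> grad f = G.
Proof.
move=> h; apply/funext => x; apply/rowP => i; rewrite mxE.
by have [_ ->] := h x (bvec i); rewrite dotp_bvec.
Qed.

Lemma hasgrad_lin n (c : 'rV[R]_n) (k : R) : hasgrad (fun z => dotp z c + k) (fun=> c).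
Proof.
move=> x v; apply/is_derive_line.
rewrite (_ : (fun h => _) = (fun h : R => dotp v c * h + (dotp x c + k))).
  have h := is_deriveD (is_deriveZ (dotp v c) (is_derive_id (0 : R) (1 : R)))
              (is_derive_cst (dotp x c + k) (0 : R) (1 : R)).
  by apply: (is_derive_eq h); rewrite addr0 [_ *: _]mulr1 dotpC.
by apply/funext => h; rewrite dotpDl dotpZl; ring.
Qed.

Lemma hasgradD n (f g : 'rV[R]_n -> R) F G : hasgrad f F -> hasgrad g G ->
  hasgrad (fun z => f z + g z) (fun z => F z + G z).
Proof. by move=> hf hg x v; rewrite dotpDl; exact: is_deriveD. Qed.

Lemma hasgradM n (f g : 'rV[R]_n -> R) F G : hasgrad f F -> hasgrad g G ->
  hasgrad (fun z => f z * g z) (fun z => f z *: G z + g z *: F z).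
Proof. by move=> hf hg x v; rewrite dotpDl !dotpZl; exact: is_deriveM. Qed.

Lemma hasgrad_comp n (f : 'rV[R]_n -> R) F (g : R -> R) : hasgrad f F ->
  (forall x, derivable g x 1) ->
  hasgrad (fun z => g (f z)) (fun z => (derive1 g (f z)) *: F z).
Proof.
move=> hf hg x v; rewrite dotpZl; apply: is_derive_comp1 => //.
by rewrite derive1E; exact: derivableP.
Qed.

Lemma CkS n k (f : 'rV[R]_n -> R) : Ck k.+1 f -> Ck k f.
Proof.
elim: k f => [|k IH] f; first by case.
by move=> [cf h]; split => // i; have [? ?] := h i; split => //; exact: IH.
Qed.

Lemma CkD n k (f g : 'rV[R]_n -> R) : Ck k f -> Ck k g -> Ck k (fun z => f z + g z).
Proof.
elim: k f g => [|k IH] f g; first by move=> cf cg x; exact: (continuousD (cf x) (cg x)).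
move=> [cf hf] [cg hg]; split; first by move=> x; exact: (continuousD (cf x) (cg x)).
move=> i; have [df kf] := hf i; have [dg kg] := hg i; split.
  by move=> x; exact: derivableD.
rewrite (_ : (fun x => _) = fun z => 'D_(bvec i) f z + 'D_(bvec i) g z); first exact: IH.
by apply/funext => x; rewrite -deriveD.
Qed.

Lemma CkM n k (f g : 'rV[R]_n -> R) : Ck k f -> Ck k g -> Ck k (fun z => f z * g z).
Proof.
elim: k f g => [|k IH] f g; first by move=> cf cg x; exact: (continuousM (cf x) (cg x)).
move=> Cf Cg; have [cf hf] := Cf; have [cg hg] := Cg.
split; first by move=> x; exact: (continuousM (cf x) (cg x)).
move=> i; have [df kf] := hf i; have [dg kg] := hg i; split.
  by move=> x; exact: derivableM.
rewrite (_ : (fun x => _) = fun z => f z * 'D_(bvec i) g z + g z * 'D_(bvec i) f z).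
  by apply: CkD; apply: IH => //; exact: CkS.
by apply/funext => x; rewrite (deriveM (f := f) (g := g)).
Qed.

Lemma Ck_cst n k (c : R) : Ck k (fun _ : 'rV[R]_n => c).
Proof.
elim: k c => [|k IH] c; first exact: cst_continuous.
split; first exact: cst_continuous.
move=> i; split; first by move=> x; exact: derivable_cst.
rewrite (_ : (fun x : 'rV[R]_n => 'D_(bvec i) (fun _ => c) x) = fun=> 0); [exact: IH|apply/funext => x].
exact: derive_cst.
Qed.

Lemma continuous_sumr (X : topologicalType) (I : Type) (r : seq I) (F : I -> X -> R) :
  (forall i, continuous (F i)) -> continuous (fun z => \sum_(i <- r) F i z).
Proof.
move=> cF; elim: r => [|i r IH].
  rewrite (_ : (fun z => _) = fun=> 0); first exact: cst_continuous.
  by apply/funext => z; rewrite big_nil.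
rewrite (_ : (fun z => _) = (fun z => F i z + \sum_(i <- r) F i z)).
  by move=> x; exact: (continuousD (cF i x) (IH x)).
by apply/funext => z; rewrite big_cons.
Qed.

Lemma coord_sum_continuous n (c : 'rV[R]_n) (k : R) : continuous (fun z => dotp z c + k).
Proof.
have cd : continuous (fun z => dotp z c).
  apply: continuous_sumr => i x.
  exact: (continuousM (@coord_continuous _ _ _ ord0 i x) (@cst_continuous _ _ (c ord0 i) x)).
by move=> x; exact: (continuousD (cd x) (@cst_continuous _ _ k x)).
Qed.

Lemma Ck_lin n k (c : 'rV[R]_n) (a : R) : Ck k (fun z => dotp z c + a).
Proof.
case: k => [|k]; first exact: coord_sum_continuous.
split; first exact: coord_sum_continuous.
move=> i; split; first by move=> x; have [] := hasgrad_lin c a x (bvec i).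
rewrite (_ : (fun x => _) = fun=> c ord0 i); first exact: Ck_cst.
by apply/funext => x; have [_ ->] := hasgrad_lin c a x (bvec i); rewrite dotp_bvec.
Qed.

Fixpoint C1k (k : nat) (g : R -> R) : Prop :=
  match k with
  | 0 => True
  | k'.+1 => (forall x, derivable g x 1) /\ C1k k' (derive1 g)
  end.

Lemma C1k_iter (g : R -> R) :
  (forall k x, derivable (iter k (@derive1 R R) g) x 1) -> forall k, C1k k g.
Proof.
move=> h k; elim: k g h => // k IH g h; split; first by move=> x; exact: (h 0%N).
by apply: IH => j x; rewrite -iterSr; exact: h.
Qed.

Lemma derivable_cont (g : R -> R) : (forall x, derivable g x 1) -> continuous g.
Proof. by move=> dg x; apply: differentiable_continuous; exact/derivable1_diffP. Qed.

Lemma Ck_comp n k (f : 'rV[R]_n -> R) (g : R -> R) :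
  (forall k, C1k k g) -> Ck k f -> Ck k (fun z => g (f z)).
Proof.
elim: k f g => [|k IH] f g Cg Cf.
  move=> x; apply: continuous_comp; first exact: Cf.
  by apply: derivable_cont; have [] := Cg 1%N.
have [dg _] := Cg 1%N; have [cf hf] := Cf.
split.
  by move=> x; apply: continuous_comp; [exact: cf|exact: derivable_cont].
move=> i; have [df kf] := hf i.
have D x : is_derive x (bvec i) (fun z => g (f z))
    (derive1 g (f x) * 'D_(bvec i) f x).
  apply: is_derive_comp1; first exact: derivableP.
  by rewrite derive1E; exact: derivableP.
split; first by move=> x; have [] := D x.
rewrite (_ : (fun x => _) = fun z => derive1 g (f z) * 'D_(bvec i) f z).
  apply: CkM => //; apply: IH; last exact: CkS.
  by move=> j; have [] := Cg j.+1.
by apply/funext => x; have [_ ->] := D x.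
Qed.

Lemma C1kD k (f g : R -> R) : C1k k f -> C1k k g -> C1k k (fun x => f x + g x).
Proof.
elim: k f g => // k IH f g [df kf] [dg kg]; split.
  by move=> x; exact: derivableD.
rewrite (_ : derive1 _ = fun x => derive1 f x + derive1 g x); first exact: IH.
by apply/funext => x; rewrite !derive1E deriveD.
Qed.

Lemma C1kZ k (c : R) (f : R -> R) : C1k k f -> C1k k (fun x => c * f x).
Proof.
elim: k f => // k IH f [df kf]; split.
  by move=> x; exact: (derivableZ (f := f)).
rewrite (_ : derive1 _ = fun x => c * derive1 f x); first exact: IH.
by apply/funext => x; rewrite !derive1E (deriveZ (f := f)).
Qed.

(** The functions x^-m exp(-1/x), extended by 0. Each derivative is a combination of members with
    larger exponent ([flat_derive]), so one induction makes all of them smooth. *)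
Definition flat (m : nat) (x : R) : R := if 0 < x then x ^- m * expR (- x^-1) else 0.

Lemma flat_ge0 m x : 0 <= flat m x.
Proof.
rewrite /flat; case: ifPn => // x0.
by rewrite mulr_ge0 ?expR_ge0 // invr_ge0 exprn_ge0 // ltW.
Qed.

(** With y = 1/x, exp y is at least (1 + y/m)^m, hence at least (y/m)^m. *)
Lemma flat_bound m x : flat m x <= m%:R ^+ m.
Proof.
rewrite /flat; case: ifPn => [x0|_]; last by rewrite exprn_ge0.
rewrite -exprVn; set y := x^-1; have y0 : 0 < y by rewrite invr_gt0.
case: m => [|m]; first by rewrite !expr0 mul1r -expR0 ler_expR oppr_le0 ltW.
have m0 : 0 < m.+1%:R :> R by rewrite ltr0n.
have h : (y / m.+1%:R) ^+ m.+1 <= expR y.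
  have -> : y = m.+1%:R * (y / m.+1%:R) by rewrite mulrC divfK // gt_eqF.
  rewrite [X in (X / _) ^+ _ <= _]mulrC divfK ?gt_eqF //.
  rewrite expRM_natl; apply: lerXn2r; rewrite ?nnegrE ?expR_ge0 //.
    by rewrite divr_ge0 // ltW.
  by apply: le_trans (expR_ge1Dx _); rewrite lerDr.
rewrite expRN ler_pdivrMr ?expR_gt0 //; move: h; rewrite expr_div_n.
by rewrite ler_pdivrMr ?exprn_gt0 // mulrC.
Qed.

(** Together with the bound on [flat m.+1], the factor x gives the continuity at 0 and also the
    Caratheodory quotient for the derivative at 0. *)
Lemma flat_step m x : flat m x = x * flat m.+1 x.
Proof.
rewrite /flat; case: ifPn => x0; last by rewrite mulr0.
by rewrite exprS invfM mulrA mulrA divff ?mul1r // gt_eqF.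
Qed.

Lemma flat_le0 m x : x <= 0 -> flat m x = 0.
Proof. by move=> x0; rewrite /flat ltNge x0. Qed.

Lemma flat_cont0 m : {for 0, continuous (flat m)}.
Proof.
rewrite /prop_for /continuous_at flat_le0 //.
pose C : R := m.+1%:R ^+ m.+1; have C0 : 0 < C by rewrite exprn_gt0.
apply/cvgrPdist_le => e e0; near=> x.
rewrite sub0r normrN flat_step normrM (ger0_norm (flat_ge0 _ _)).
apply: (@le_trans _ _ (`|x| * C)); first by apply: ler_wpM2l => //; exact: flat_bound.
rewrite -ler_pdivlMr //; near: x.
apply/nbhs_ballP; exists (e / C) => /=; first exact: divr_gt0.
by move=> y; rewrite /ball /= sub0r normrN => /ltW.
Unshelve. all: by end_near. Qed.

Lemma flat_derive m x : is_derive x (1 : R) (flat m)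
  (flat m.+2 x - m%:R * flat m.+1 x).
Proof.
case: (ltrgtP x 0) => [x0|x0|->].
- rewrite !(flat_le0 _ (ltW x0)) mulr0 subr0.
  apply: (@near_eq_is_derive R R R (cst (0 : R))).
  near=> y; rewrite flat_le0 //; apply: ltW; near: y; exact: lt_nbhsl.
- apply: (@near_eq_is_derive R R R (fun x => x ^- m * expR (- x^-1))).
    near=> y; rewrite /flat ifT //; near: y; exact: lt_nbhsr.
  have xn0 : x != 0 by rewrite gt_eqF.
  pose g := fun y : R => y ^+ m * expR (- y).
  have dg : is_derive (x^-1) (1 : R) g
      (m%:R * x^-1 ^+ m.-1 * expR (- x^-1) - x^-1 ^+ m * expR (- x^-1)).
    have d2 : is_derive (x^-1) (1 : R) (fun y : R => expR (- y)) (- expR (- x^-1)).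
      have := is_derive1_comp (is_derive_expR (- x^-1)) (@is_deriveNid R R (x^-1) 1).
      by move=> h; apply: (is_derive_eq h); rewrite mulrN1.
    have d1 : is_derive (x^-1) (1 : R) (fun y : R => y ^+ m) (m%:R * x^-1 ^+ m.-1).
      rewrite (_ : (fun y => _) = (id : R -> R) ^+ m); last first.
        by apply/funext => y; rewrite fctE.
      have h := @is_deriveX R R id m (x^-1) 1 1 (is_derive_id _ _).
      by apply: (is_derive_eq h); rewrite /= [_ *: 1]mulr1.
    apply: (is_derive_eq (is_deriveM d1 d2)).
    by rewrite /GRing.scale /=; ring.
  have dV : is_derive x (1 : R) (fun y : R => y^-1) (- x ^- 2).
    have := @is_deriveV R id x 1 1 xn0 (is_derive_id _ _).
    by move=> h; apply: (is_derive_eq h); rewrite [_ *: 1]mulr1.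
  have := is_derive1_comp dg dV.
  rewrite (_ : g \o _ = (fun x => x ^- m * expR (- x^-1))); last first.
    by apply/funext => y; rewrite /g /= exprVn.
  move=> h; apply: (is_derive_eq h); rewrite /flat x0.
  rewrite -!exprVn; case: m @g {dg h} => [|m] g /=.
    by rewrite !mul0r subr0 expr0; field.
  by rewrite !exprS expr0; ring.
- rewrite !flat_le0 // mulr0 subr0; apply/is_derive1_caratheodory.
  exists (flat m.+1); split; [|exact: flat_cont0|by rewrite flat_le0].
  by move=> z; rewrite (flat_le0 m (lexx 0)) !subr0 flat_step mulrC.
Unshelve. all: by end_near. Qed.

Lemma C1k_flat k m : C1k k (flat m).
Proof.
elim: k m => // k IH m; split; first by move=> x; have [] := flat_derive m x.
rewrite (_ : derive1 _ = fun x => flat m.+2 x + (- m%:R) * flat m.+1 x).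
  by apply: C1kD => //; exact: C1kZ.
by apply/funext => x; rewrite derive1E; have [_ ->] := flat_derive m x; rewrite mulNr.
Qed.

(** A smooth step from 1 (t at most 0) down to 0 (t at least 1). The variable enters only through
    compositions with [flat 0], and the denominator is constant, so no quotient has to be
    differentiated. *)
Definition sstep (t : R) : R := flat 0 (flat 0 1 - flat 0 t) / flat 0 (flat 0 1).

Lemma flat0_gt0 x : 0 < x -> 0 < flat 0 x.
Proof. by move=> x0; rewrite /flat x0 expr0 invr1 mul1r expR_gt0. Qed.

Lemma flat0_homo x y : x <= y -> flat 0 x <= flat 0 y.
Proof.
move=> xy; case: (lerP x 0) => x0; first by rewrite flat_le0 // flat_ge0.
rewrite /flat x0 (lt_le_trans x0 xy) !expr0 !invr1 !mul1r ler_expR lerN2.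
by rewrite lef_pV2 // ?posrE // (lt_le_trans x0 xy).
Qed.

Lemma sstep_ge0 t : 0 <= sstep t.
Proof. by rewrite divr_ge0 // flat_ge0. Qed.

Lemma sstep_le1 t : sstep t <= 1.
Proof.
rewrite ler_pdivrMr ?mul1r; last exact/flat0_gt0/flat0_gt0.
by apply: flat0_homo; rewrite lerBlDr lerDl flat_ge0.
Qed.

Lemma sstep0 t : t <= 0 -> sstep t = 1.
Proof.
move=> t0; rewrite /sstep (flat_le0 _ t0) subr0 divff //.
by rewrite gt_eqF //; apply: flat0_gt0; exact: flat0_gt0.
Qed.

Lemma sstep1 t : 1 <= t -> sstep t = 0.
Proof.
by move=> t1; rewrite /sstep [X in X / _]flat_le0 ?mul0r // subr_le0 flat0_homo.
Qed.

Lemma Ck_sstep n k (f : 'rV[R]_n -> R) : Ck k f -> Ck k (fun z => sstep (f z)).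
Proof.
move=> Cf; rewrite /sstep; apply: CkM; last exact: Ck_cst.
apply: (@Ck_comp n k (fun z => flat 0 1 - flat 0 (f z))).
  by move=> j; exact: C1k_flat.
apply: CkD; first exact: Ck_cst.
rewrite (_ : (fun z => _) = fun z => (-1) * flat 0 (f z)); last first.
  by apply/funext => z; rewrite mulN1r.
apply: CkM; first exact: Ck_cst.
by apply: Ck_comp => // j; exact: C1k_flat.
Qed.

Lemma sstep_derive : exists ds : R -> R, (forall t, is_derive t (1 : R) sstep (ds t)) /\
  exists2 C : R, 0 < C & forall t, `|ds t| <= C.
Proof.
set A := flat 0 1; set B := flat 0 A.
exists (fun t => - (B^-1 * (flat 2 (A - flat 0 t) * flat 2 t))); split.
  move=> t.
  have d1 : is_derive t (1 : R) (fun t => A - flat 0 t) (- flat 2 t).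
    have := is_deriveB (is_derive_cst A t (1 : R)) (flat_derive 0 t).
    by move=> h; apply: (is_derive_eq h); rewrite mul0r subr0 sub0r.
  have := @is_derive1_comp _ (flat 0) (fun t => A - flat 0 t) t _ _ (flat_derive 0 (A - flat 0 t)) d1.
  rewrite mul0r subr0 => h.
  have := is_deriveZ B^-1 h.
  rewrite (_ : B^-1 \*: _ = sstep); last by apply/funext => u; rewrite /sstep mulrC.
  by move=> h2; apply: (is_derive_eq h2); rewrite /GRing.scale /=; ring.
exists (B^-1 * (2%:R ^+ 2 * 2%:R ^+ 2)); first by rewrite mulr_gt0 // invr_gt0 flat0_gt0 // flat0_gt0.
move=> t; rewrite normrN normrM ger0_norm; last by rewrite invr_ge0 flat_ge0.
apply: ler_wpM2l; first by rewrite invr_ge0 flat_ge0.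
by rewrite normrM !ger0_norm ?flat_ge0 //; apply: ler_pM; rewrite ?flat_ge0 ?flat_bound.
Qed.

End smooth_calculus.

(** * Surface energy densities *)

Section euclid.
Context {R : realType} {n : nat}.
Implicit Types (x y z p : 'rV[R]_n).

Lemma dotp_ge0 x : 0 <= dotp x x.
Proof. by apply: sumr_ge0 => i _; rewrite -expr2 sqr_ge0. Qed.

Lemma dotp_eq0 x : (dotp x x == 0) = (x == 0).
Proof.
apply/idP/eqP => [|->]; last by rewrite dotp0l.
rewrite psumr_eq0 => [/allP h|i _]; last by rewrite -expr2 sqr_ge0.
apply/rowP => i; rewrite mxE; have := h i (mem_index_enum _).
by rewrite -expr2 sqrf_eq0 => /eqP.
Qed.

Lemma enorm_sq x : enorm x ^+ 2 = dotp x x.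
Proof. by rewrite sqr_sqrtr // dotp_ge0. Qed.

Lemma enorm_ge0 x : 0 <= enorm x. Proof. exact: sqrtr_ge0. Qed.

Lemma cauchy_schwarz_sq x y : dotp x y ^+ 2 <= dotp x x * dotp y y.
Proof.
have [y0|y0] := eqVneq (dotp y y) 0.
  by move/eqP: y0; rewrite dotp_eq0 => /eqP ->; rewrite dotpC !dotp0l expr0n mulr0.
have yp : 0 < dotp y y by rewrite lt_neqAle eq_sym y0 dotp_ge0.
have := dotp_ge0 (dotp y y *: x - dotp x y *: y).
rewrite dotpBl !dotpBr !dotpZl !dotpZr (dotpC y x).
rewrite (_ : _ - _ = dotp y y * (dotp x x * dotp y y - dotp x y ^+ 2)); last ring.
by rewrite pmulr_rge0 // subr_ge0.
Qed.

Lemma cauchy_schwarz x y : `|dotp x y| <= enorm x * enorm y.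
Proof.
rewrite -sqrtrM ?dotp_ge0 // -sqrtr_sqr; apply: ler_wsqrtr.
exact: cauchy_schwarz_sq.
Qed.

Lemma enormD x y : enorm (x + y) <= enorm x + enorm y.
Proof.
rewrite -(@ler_pXn2r _ 2) ?nnegrE ?addr_ge0 ?enorm_ge0 //.
rewrite enorm_sq dotpDl !dotpDr sqrrD !enorm_sq (dotpC y x).
have := le_trans (ler_norm _) (cauchy_schwarz x y); lra.
Qed.

Lemma enormZ a x : enorm (a *: x) = `|a| * enorm x.
Proof.
by rewrite /enorm dotpZl dotpZr mulrA -expr2 sqrtrM ?sqr_ge0 // sqrtr_sqr.
Qed.

Lemma enormN x : enorm (- x) = enorm x.
Proof. by rewrite -scaleN1r enormZ normrN1 mul1r. Qed.

Lemma enorm0 : enorm (0 : 'rV[R]_n) = 0.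
Proof. by rewrite /enorm dotp0l sqrtr0. Qed.

Lemma enorm_eq0 x : (enorm x == 0) = (x == 0).
Proof. by rewrite -dotp_eq0 -enorm_sq sqrf_eq0. Qed.

Lemma sphere_normalize x : x != 0 -> sphere R n ((enorm x)^-1 *: x).
Proof.
move=> x0; rewrite /sphere /= enormZ ger0_norm ?invr_ge0 ?enorm_ge0 //.
by rewrite mulVf // enorm_eq0.
Qed.

Lemma enorm_rat_dense x (e : R) : 0 < e ->
  exists c : 'rV[rat]_n, enorm (x - map_mx ratr c) < e.
Proof.
move=> e0; have r0 : 0 < e / n.+1%:R by rewrite divr_gt0.
have [c] := rV_ratr_dense x r0; rewrite ball_rVE //= => h; exists c.
rewrite -(@ltr_pXn2r _ 2) ?nnegrE ?enorm_ge0 ?(ltW e0) // enorm_sq.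
apply: (@le_lt_trans _ _ (\sum_(i < n) (e / n.+1%:R) ^+ 2)).
  apply: ler_sum => i _; rewrite -expr2 !mxE -real_normK ?num_real //.
  by apply: lerXn2r; rewrite ?nnegrE ?(ltW r0) //; have := h i; rewrite mxE => /ltW.
rewrite sumr_const card_ord -[X in X < _]mulr_natl expr_div_n mulrA ltr_pdivrMr ?exprn_gt0 //.
rewrite mulrC ltr_pM2l ?exprn_gt0 // -natrX ltr_nat.
by rewrite expnS expn1 mulSn; lia.
Qed.

Lemma measurable_enormB (c : 'rV[R]_n) :
  measurable_fun setT (fun z : Rd R n => enorm (z - c)).
Proof.
apply: (measurableT_comp (continuous_measurable_fun (@sqrt_continuous R))).
apply: measurable_sum => i; apply: measurable_funM;
by under eq_fun do rewrite !mxE; apply: measurable_funB => //; exact: measurable_coord.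
Qed.

End euclid.

(** * One-homogeneous extensions *)

Section hom_ext.
Context {R : realType} {n : nat} (lam Lam : R) (phi : 'rV[R]_n -> R).
Hypothesis Lam0 : 0 < Lam.
Hypothesis phiF : Fd R n lam Lam phi.

Lemma hom_ext_ge0 p : 0 <= hom_ext phi p.
Proof.
rewrite /hom_ext; case: ifPn => // p0; rewrite mulr_ge0 ?enorm_ge0 //.
have [_ [b _]] := phiF; have /andP[+ _] := b _ (sphere_normalize p0).
by apply: le_trans; exact: sqrtr_ge0.
Qed.

Lemma hom_ext_le p : hom_ext phi p <= Num.sqrt Lam * enorm p.
Proof.
rewrite /hom_ext; case: ifPn => [/eqP ->|p0]; first by rewrite enorm0 mulr0.
rewrite mulrC; apply: ler_wpM2r; first exact: enorm_ge0.
by have [_ [b _]] := phiF; have /andP[] := b _ (sphere_normalize p0).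
Qed.

Lemma hom_extZ a p : 0 < a -> hom_ext phi (a *: p) = a * hom_ext phi p.
Proof.
move=> a0; rewrite /hom_ext scaler_eq0 gt_eqF //=.
case: ifPn => p0; first by rewrite mulr0.
rewrite enormZ gtr0_norm // -mulrA; congr (_ * (_ * phi _)).
by rewrite scalerA invfM mulrAC mulVf ?gt_eqF // mul1r.
Qed.

Lemma hom_extD p p' : hom_ext phi (p + p') <= hom_ext phi p + hom_ext phi p'.
Proof.
have [_ [_ c]] := phiF.
have := c p p' 2^-1; rewrite (_ : 1 - 2^-1 = 2^-1 :> R); last by field.
rewrite -scalerDr hom_extZ ?invr_gt0 //.
have h : 0 <= (2^-1 : R) <= 1 by lra.
by move/(_ h); lra.
Qed.

Lemma hom_ext_lip p p' : hom_ext phi p <= hom_ext phi p' + Num.sqrt Lam * enorm (p - p').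
Proof.
rewrite -{1}(subrK p' p) addrC; apply: le_trans (hom_extD _ _) _.
by rewrite lerD2l; exact: hom_ext_le.
Qed.

Lemma hom_ext_sq_le p : hom_ext phi p ^+ 2 <= Lam * dotp p p.
Proof.
rewrite -[X in X * _](sqr_sqrtr (ltW Lam0)) -enorm_sq -exprMn.
by apply: lerXn2r; rewrite ?nnegrE ?hom_ext_ge0 ?mulr_ge0 ?sqrtr_ge0 ?enorm_ge0 ?hom_ext_le.
Qed.

End hom_ext.

(* The data of the problem without ergodicity: directions and geometry enter later. *)
Record model (R : realType) (n : nat) (dT : measure_display) (T : measurableType dT) := Model {
  mP : probability T R;
  mlam : R; mLam : R;
  mPhi : T -> 'rV[R]_n -> R;
  mtau : 'rV[R]_n -> T -> T;
  mW : R -> R; mq : R -> R;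
  mLam0 : 0 < mLam;
  mPhiF : forall w, Fd R n mlam mLam (mPhi w);
  mPhim : forall B, Fd_borel R n mlam mLam B -> measurable (mPhi @^-1` B);
  mtaum : jointly_measurable mtau;
  mtauD : forall x y, mtau (x + y) = mtau x \o mtau y;
  mtau0 : mtau 0 = id;
  mtauP : forall x E, measurable E -> mP (mtau x @^-1` E) = mP E;
  mWc : {within `[-1, 1], continuous mW};
  mW0 : forall s, -1 <= s <= 1 -> 0 <= mW s;
  mqs : forall k, C1k k mq;
  mq1 : forall s, -1 <= mq s <= 1;
  mEoo : (\int[@lebesgue_measure R]_s
     ((mLam / 2) * (derive1 mq s) ^+ 2 + mW (mq s))%:E < +oo)%E }.

(** * Joint measurability of the energy density *)

Section measurability.
Context {R : realType} {n : nat} {dT : measure_display} {T : measurableType dT}.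
Variable S : model R n T.
Let Phi := mPhi S.
Let tau := mtau S.
Let W := mW S.
Let Lam := mLam S.

Lemma measurable_tau : measurable_fun setT (fun xw : Rd R n * T => tau xw.1 xw.2).
Proof.
move=> _ E mE; rewrite setTI.
have := @mtaum _ _ _ _ S E mE.
apply: smallest_sub; first exact: (@sigma_algebra_measurable _ (Rd R n * T)%type).
by move=> _ [A [B [mA [mB ->]]]]; exact: (@measurableX _ _ (Rd R n) T).
Qed.

Lemma measurable_tau2 (x : 'rV[R]_n) : measurable_fun setT (tau x).
Proof. exact: (measurableT_comp measurable_tau (pair1_measurable (x : Rd R n))). Qed.

(** Evaluation at a unit vector e is continuous for the sup distance: the set f(e) < c contains
    around f the ball of radius c - f(e). *)
Lemma measurable_hom_ext_at p : measurable_fun setT (fun w => hom_ext (Phi w) p).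
Proof.
rewrite /hom_ext; have [p0|p0] := boolP (p == 0).
  exact: measurable_cst.
apply: measurable_funM => //.
set e := (enorm p)^-1 *: p.
have se : sphere R n e by exact: sphere_normalize.
apply: (measurability _ (RGenInftyO.measurableE R)) => _ [_ [c ->] <-].
rewrite setTI.
rewrite (_ : (fun w => Phi w e) @^-1` `]-oo, c[%classic = Phi @^-1` [set f | Fd R n (mlam S) Lam f /\ f e < c]); last first.
  apply/seteqP; split => w /=; rewrite in_itv /=; last by case.
  by move=> h; split => //; exact: mPhiF.
apply: mPhim; apply: sub_sigma_algebra; split; first by move=> f [].
move=> f [fF fe]; exists (c - f e); first by rewrite subr_gt0.
move=> g gF; rewrite /supdist => h; split => //.
have : (`|f e - g e|%:E < (c - f e)%:E)%E.
  by apply: le_lt_trans h; apply: ereal_sup_ubound; exists e.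
by rewrite lte_fin ltr_norml; lra.
Qed.

(** [hom_ext] is Lipschitz in p uniformly in w, so its value at p is below a exactly when for some
    rational c the value at c plus the Lipschitz error is below a. The sublevel set becomes a
    countable union of measurable sets. *)
Lemma measurable_hom_ext :
  measurable_fun setT (fun wp : T * Rd R n => hom_ext (Phi wp.1) wp.2).
Proof.
apply: (measurability _ (RGenInftyO.measurableE R)) => _ [_ [a ->] <-].
rewrite setTI.
pose B (c : 'rV[rat]_n) : set (T * Rd R n) := [set wp |
  hom_ext (Phi wp.1) (map_mx ratr c) + Num.sqrt Lam * enorm (wp.2 - map_mx ratr c) < a].
rewrite (_ : (fun wp : T * Rd R n => hom_ext (Phi wp.1) wp.2) @^-1` `]-oo, a[%classic =
  \bigcup_c B c).
  apply: countable_bigcupT_measurable => // c.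
  rewrite (_ : B c = (fun wp : T * Rd R n => hom_ext (Phi wp.1) (map_mx ratr c) +
    Num.sqrt Lam * enorm (wp.2 - map_mx ratr c)) @^-1` `]-oo, a[); last first.
    by apply/seteqP; split => wp /=; rewrite in_itv.
  rewrite -[X in measurable X]setTI.
  have : measurable_fun setT (fun wp : T * Rd R n => hom_ext (Phi wp.1) (map_mx ratr c) +
    Num.sqrt Lam * enorm (wp.2 - map_mx ratr c)).
    apply: measurable_funD.
      exact: (measurableT_comp (measurable_hom_ext_at _) measurable_fst).
    apply: measurable_funM => //.
    exact: (measurableT_comp (measurable_enormB _) measurable_snd).
  exact.
apply/seteqP; split => -[w p] /=; rewrite in_itv /=.
  move=> h.
  have L0 : 0 <= Num.sqrt Lam by exact: sqrtr_ge0.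
  (* Going from p to c and back costs twice the Lipschitz error; the added 1 makes the denominator
     positive. *)
  pose e := (a - hom_ext (Phi w) p) / (2 * Num.sqrt Lam + 1).
  have e0 : 0 < e by apply: divr_gt0; [rewrite subr_gt0|lra].
  have [c hc] := enorm_rat_dense p e0; exists c => //; rewrite /B /=.
  have := hom_ext_lip (mPhiF S w) (map_mx ratr c) p.
  rewrite -enormN opprB => lip.
  have : e * (2 * Num.sqrt Lam + 1) = a - hom_ext (Phi w) p.
    by rewrite divfK // gt_eqF //; lra.
  have := enorm_ge0 (p - map_mx ratr c); rewrite -/Lam -/Phi in lip *; nra.
move=> [c _]; rewrite /B /=; apply: le_lt_trans.
exact: (hom_ext_lip (mPhiF S w)).
Qed.

(** [W] is continuous on [-1,1] only, and a competitor takes its values there only on its own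
    domain. Composition with the projection onto [-1,1] gives a continuous, bounded, nonnegative
    function on the whole line. *)
Definition Wclamp (s : R) : R := W (Num.max (-1) (Num.min s 1)).

Lemma WclampE s : -1 <= s <= 1 -> Wclamp s = W s.
Proof. by move=> /andP[h1 h2]; rewrite /Wclamp min_l // max_r. Qed.

Lemma clamp_itv (s : R) : -1 <= Num.max (-1) (Num.min s 1) <= 1.
Proof. by rewrite le_max lexx /= ge_max ge_min lexx orbT andbT; lra. Qed.

Lemma Wclamp_ge0 s : 0 <= Wclamp s.
Proof. by apply: mW0; exact: clamp_itv. Qed.

Lemma Wclamp_cont : continuous Wclamp.
Proof.
move=> s.
have cc : {for s, continuous (fun x : R => Num.max (-1) (Num.min x 1))}.
  apply/cvgrPdist_lt => e e0; near=> x.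
  have : `|s - x| < e by near: x; apply/nbhs_ballP; exists e.
  by rewrite /Num.max /Num.min !ltr_norml; do !case: ifPn; rewrite -?leNgt; lra.
have h := (subspace_continuousP _ _).1 (@mWc _ _ _ _ S)
  (Num.max (-1) (Num.min s 1)) ltac:(by rewrite /= in_itv /=; exact: clamp_itv).
apply: (@cvg_comp _ _ _ (fun x : R => Num.max (-1) (Num.min x 1)) W _ _ _ _ h) => B; rewrite /within /= => nB.
have h2 : nbhs s (fun x : R => `[(-1 : R), 1]%classic (Num.max (-1) (Num.min x 1)) ->
   B (Num.max (-1) (Num.min x 1))) by exact: (cc _ nB).
apply: filterS h2 => x; apply.
by rewrite /= in_itv /=; exact: clamp_itv.
Unshelve. all: by end_near. Qed.

Lemma Wclamp_bounded : exists2 C : R, 0 < C & forall s, Wclamp s <= C.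
Proof.
have ab : (-1 : R) <= 1 by lra.
have [c _ h] := EVT_max ab (continuous_subspaceT Wclamp_cont).
exists (`|Wclamp c| + 1); first by have := normr_ge0 (Wclamp c); lra.
move=> s; have /h : Num.max (-1) (Num.min s 1) \in `[(-1 : R), 1].
  by rewrite in_itv /=; exact: clamp_itv.
have -> : Wclamp (Num.max (-1) (Num.min s 1)) = Wclamp s.
  by rewrite WclampE ?clamp_itv.
by move=> hs; apply: (le_trans hs); have := ler_norm (Wclamp c); lra.
Qed.

Definition dens (w : T) (u : 'rV[R]_n -> R) (g : 'rV[R]_n -> 'rV[R]_n) (x : 'rV[R]_n) : R :=
  2^-1 * (phiw Phi tau w x (g x)) ^+ 2 + Wclamp (u x).

Lemma dens_ge0 w u g x : 0 <= dens w u g x.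
Proof. by rewrite addr_ge0 ?Wclamp_ge0 // mulr_ge0 ?sqr_ge0 // invr_ge0. Qed.

Lemma measurable_dens2 (u : Rd R n -> R) (g : Rd R n -> Rd R n) :
  measurable_fun setT u -> measurable_fun setT g ->
  measurable_fun setT (fun xw : Rd R n * T => dens xw.2 u g xw.1).
Proof.
move=> mu mg; apply: measurable_funD.
  apply: measurable_funM => //; apply: measurable_funX.
  have m1 : measurable_fun setT (fun xw : Rd R n * T => (tau xw.1 xw.2, g xw.1)).
    apply: measurable_fun_pair; first exact: measurable_tau.
    exact: (measurableT_comp mg measurable_fst).
  exact: (measurableT_comp measurable_hom_ext m1).
apply: (measurableT_comp (continuous_measurable_fun Wclamp_cont)).
exact: (measurableT_comp mu measurable_fst).
Qed.

Lemma measurable_dens w (u : Rd R n -> R) (g : Rd R n -> Rd R n) :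
  measurable_fun setT u -> measurable_fun setT g ->
  measurable_fun setT (fun x : Rd R n => dens w u g x).
Proof.
by move=> mu mg; exact: (measurableT_comp (measurable_dens2 mu mg) (pair2_measurable w)).
Qed.

Lemma energyE w (A : set (Rd R n)) (u : Rd R n -> R) (g : Rd R n -> Rd R n) :
  measurable A -> measurable_fun setT u -> measurable_fun setT g ->
  (forall x, A x -> -1 <= u x <= 1) ->
  energy Phi tau W w A u g = (\int[muRd n]_(x in A) (dens w u g x)%:E)%E.
Proof.
move=> mA mu mg u1; rewrite -intAE //; last first.
- by move=> x _; exact: dens_ge0.
- exact: measurable_funTS (measurable_dens w mu mg).
rewrite /energy /intA; congr intRd; apply/funext => x; congr (_%:E).
rewrite indicE; case: (boolP (x \in A)) => [/set_mem Ax|_]; last by rewrite !mul0r.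
by rewrite /dens WclampE // u1.
Qed.

Lemma measurable_energy (A : set (Rd R n)) (u : Rd R n -> R) (g : Rd R n -> Rd R n) :
  measurable A -> measurable_fun setT u -> measurable_fun setT g ->
  (forall x, A x -> -1 <= u x <= 1) ->
  measurable_fun setT (fun w => energy Phi tau W w A u g).
Proof.
move=> mA mu mg u1.
pose f (xw : Rd R n * T) : \bar R := (\1_A xw.1 * dens xw.2 u g xw.1)%:E.
have mf : measurable_fun setT f.
  apply/measurable_EFinP; apply: measurable_funM; last exact: measurable_dens2.
  exact: (measurableT_comp (measurable_indic mA) measurable_fst).
have f0 xw : (0 <= f xw)%E.
  by rewrite lee_fin mulr_ge0 // ?dens_ge0 // indicE ler0n.
have := measurable_fun_fubini_tonelli_G (m1 := muRd n) f mf f0.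
congr measurable_fun; apply/funext => w.
rewrite energyE // integral_mkcond; apply: eq_integral => x _.
by rewrite /f /= patchE indicE; case: ifP => _; rewrite ?mul1r ?mul0r.
Qed.

Lemma dens_le w (u : Rd R n -> R) (g : Rd R n -> Rd R n) x :
  dens w u g x <= Lam / 2 * dotp (g x) (g x) + Wclamp (u x).
Proof.
rewrite lerD2r mulrC -[Lam / 2 * _]mulrA [2^-1 * _]mulrC mulrA ler_pM2r ?invr_gt0 //.
exact: (hom_ext_sq_le (mLam0 S) (mPhiF S _)).
Qed.

End measurability.

(** * Gluing competitors *)

Section H10.
Context {R : realType} {n : nat}.
Implicit Types (A B : set (Rd R n)).
Local Open Scope ereal_scope.

Lemma intA_ext A B (f g : 'rV[R]_n -> R) :
  (forall x, (\1_A x * f x = \1_B x * g x)%R) -> intA A f = intA B g.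
Proof. by move=> h; rewrite /intA; congr intRd; apply/funext => x; rewrite h. Qed.

Lemma intA0 A (f : 'rV[R]_n -> R) : (forall x, A x -> f x = 0%R) -> intA A f = 0.
Proof.
move=> h; rewrite /intA (_ : (fun x => _) = cst 0).
  by rewrite intRdE // integral0.
apply/funext => x; rewrite indicE; case: (boolP (x \in A)) => [/set_mem/h ->|_].
  by rewrite mulr0.
by rewrite mul0r.
Qed.

Lemma intA_ge0 A (f : 'rV[R]_n -> R) : measurable A ->
  measurable_fun A (f : Rd R n -> R) -> (forall x, A x -> (0 <= f x)%R) -> 0 <= intA A f.
Proof.
by move=> mA mf f0; rewrite intAE //; apply: integral_ge0 => x Ax; rewrite lee_fin f0.
Qed.

Lemma H10_Cc A (psi : 'rV[R]_n -> R) : Cc_infty A psi -> H10_grad A psi (grad psi).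
Proof.
move=> h; exists (fun=> psi); split => //; split.
  rewrite (_ : (fun k => _) = fun=> 0); first exact: cvg_cst.
  by apply/funext => k; apply: intA0 => x _; rewrite subrr expr0n.
rewrite (_ : (fun k => _) = fun=> 0); first exact: cvg_cst.
by apply/funext => k; apply: intA0 => x _; rewrite subrr dotp0l.
Qed.

Lemma Cc_infty_sub A B (psi : 'rV[R]_n -> R) : A `<=` B -> Cc_infty A psi -> Cc_infty B psi.
Proof.
by move=> AB [s [K [cK [KA h]]]]; split => //; exists K; do !split => //; exact: subset_trans KA AB.
Qed.

Lemma Cc_infty_off A (psi : 'rV[R]_n -> R) x : Cc_infty A psi -> ~ A x ->
  psi x = 0%R /\ grad psi x = 0%R.
Proof.
move=> [s [K [cK [KA h]]]] Ax; have nK : ~ K x by move/KA.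
split; first exact: h.
apply/rowP => i; rewrite !mxE (@near_eq_derive _ _ _ psi (cst 0%R)) ?derive_cst //.
have oK : open (~` K) by apply: closed_openC; exact: compact_closed cK.
by have := open_nbhs_nbhs (conj oK nK); apply: filterS => y; exact: h.
Qed.

(** The same test functions serve: off [A] they vanish together with their gradients, so the
    integrals over [B] equal those over [A]. *)
Lemma H10_ext A B (v : 'rV[R]_n -> R) (g : 'rV[R]_n -> 'rV[R]_n) : A `<=` B ->
  H10_grad A v g -> H10_grad B (fun x => if x \in A then v x else 0%R)
    (fun x => if x \in A then g x else 0%R).
Proof.
move=> AB [psi [Cpsi [c1 c2]]]; exists psi; split.
  by move=> k; exact: Cc_infty_sub (Cpsi k).
split.
  rewrite [X in X @ _](_ : _ = (fun k => intA A (fun x => (psi k x - v x) ^+ 2)%R)) //.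
  apply/funext => k; apply: intA_ext => x.
  rewrite !indicE; case: (boolP (x \in A)) => [/set_mem Ax|/negP xA].
    by rewrite (mem_set (AB _ Ax)).
  have [-> _] := Cc_infty_off (Cpsi k) (fun h => xA (mem_set h)).
  by rewrite subr0 expr0n mulr0 mul0r.
rewrite [X in X @ _](_ : _ = (fun k => intA A
  (fun x => dotp (grad (psi k) x - g x) (grad (psi k) x - g x))%R)) //.
apply/funext => k; apply: intA_ext => x.
rewrite !indicE; case: (boolP (x \in A)) => [/set_mem Ax|/negP xA].
  by rewrite (mem_set (AB _ Ax)).
have [_ ->] := Cc_infty_off (Cpsi k) (fun h => xA (mem_set h)).
by rewrite subr0 dotp0l mulr0 mul0r.
Qed.

Lemma smoothD (f g : 'rV[R]_n -> R) : smooth f -> smooth g -> smooth (fun x => f x + g x)%R.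
Proof. by move=> sf sg k; apply: CkD. Qed.

Lemma Cc_inftyD A (f g : 'rV[R]_n -> R) : Cc_infty A f -> Cc_infty A g ->
  Cc_infty A (fun x => f x + g x)%R.
Proof.
move=> [sf [K [cK [KA h]]]] [sg [L [cL [LA k]]]]; split; first exact: smoothD.
exists (K `|` L); split; first exact: compactU.
split; first by move=> x [/KA|/LA].
by move=> x /not_orP[/h -> /k ->]; rewrite addr0.
Qed.

Lemma smooth_derivable (f : 'rV[R]_n -> R) : smooth f -> forall x i, derivable f x (bvec i).
Proof. by move=> sf x i; have [_ /(_ i)[]] := sf 1%N. Qed.

Lemma gradD (f g : 'rV[R]_n -> R) x : smooth f -> smooth g ->
  grad (fun x => f x + g x)%R x = (grad f x + grad g x)%R.
Proof.
move=> sf sg; apply/rowP => i; rewrite !mxE deriveD //; exact: smooth_derivable.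
Qed.

Lemma smooth_measurable (f : 'rV[R]_n -> R) : smooth f ->
  measurable_fun setT (f : Rd R n -> R).
Proof. by move=> sf; exact: continuous_measurableRd (sf 0%N). Qed.

Lemma smooth_measurable_grad (f : 'rV[R]_n -> R) : smooth f ->
  measurable_fun setT (grad f : Rd R n -> Rd R n).
Proof.
move=> sf; apply: measurable_fun_rV => i; under eq_fun do rewrite mxE.
apply: continuous_measurableRd.
by have [_ /(_ i)[]] := sf 1%N.
Qed.

Lemma measurable_dotp2 d (X : measurableType d) (f g : X -> Rd R n) :
  measurable_fun setT f -> measurable_fun setT g ->
  measurable_fun setT (fun x => dotp (f x) (g x)).
Proof.
move=> mf mg; apply: measurable_sum => i.
by apply: measurable_funM; exact: (measurableT_comp (measurable_coord i)).
Qed.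

Lemma measurable_subRd d (X : measurableType d) (f g : X -> Rd R n) :
  measurable_fun setT f -> measurable_fun setT g ->
  measurable_fun setT (fun x => f x - g x : Rd R n)%R.
Proof.
move=> mf mg; apply: measurable_fun_rV => i; under eq_fun do rewrite !mxE.
by apply: measurable_funB; exact: (measurableT_comp (measurable_coord i)).
Qed.

Lemma dotp_sqD (a b : 'rV[R]_n) : (dotp (a + b) (a + b) <= 2 * dotp a a + 2 * dotp b b)%R.
Proof.
have := dotp_ge0 (a - b); rewrite dotpBl !dotpBr !dotpDl !dotpDr (dotpC b a); lra.
Qed.

Lemma cvg_squeeze0 (a b c : nat -> \bar R) : (forall k, 0 <= a k) ->
  (forall k, a k <= 2%:E * b k + 2%:E * c k) ->
  b @ \oo --> 0 -> c @ \oo --> 0 -> a @ \oo --> 0.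
Proof.
move=> a0 ab cb cc.
have h : (fun k => 2%:E * b k + 2%:E * c k) @ \oo --> 0.
  rewrite -[X in _ --> X](_ : 2%:E * 0 + 2%:E * 0 = 0); last by rewrite mule0 adde0.
  by apply: cvgeD => //; apply: cvgeZl.
by apply: (squeeze_cvge _ (@cvg_cst _ 0 _ \oo _) h); apply: nearW => k; rewrite a0 ab.
Qed.

Lemma intA_le2 A (f g h : 'rV[R]_n -> R) : measurable A ->
  measurable_fun setT (f : Rd R n -> R) -> measurable_fun setT (g : Rd R n -> R) ->
  measurable_fun setT (h : Rd R n -> R) ->
  (forall x, (0 <= f x)%R) -> (forall x, (0 <= g x)%R) -> (forall x, (0 <= h x)%R) ->
  (forall x, (f x <= 2 * g x + 2 * h x)%R) ->
  intA A f <= 2%:E * intA A g + 2%:E * intA A h.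
Proof.
move=> mA mf mg mh f0 g0 h0 fgh; rewrite !intAE //; try exact: measurable_funTS.
rewrite -!ge0_integralZl //; try (by move=> x _; rewrite lee_fin);
  try (exact/measurable_EFinP/measurable_funTS).
rewrite -ge0_integralD //; try (by move=> x _; rewrite -EFinM lee_fin mulr_ge0);
  try (by apply/measurable_EFinP/measurable_funM => //; exact: measurable_funTS).
apply: ge0_le_integral => //; last by move=> x _; rewrite -!EFinM -EFinD lee_fin.
- by move=> x _; rewrite lee_fin.
- exact/measurable_EFinP/measurable_funTS.
- by apply: emeasurable_funD; apply: measurable_funeM; exact/measurable_EFinP/measurable_funTS.
Qed.

Lemma H10_add A (v1 v2 : 'rV[R]_n -> R) (g1 g2 : 'rV[R]_n -> 'rV[R]_n) :
  measurable A ->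
  measurable_fun setT (v1 : Rd R n -> R) -> measurable_fun setT (v2 : Rd R n -> R) ->
  measurable_fun setT (g1 : Rd R n -> Rd R n) -> measurable_fun setT (g2 : Rd R n -> Rd R n) ->
  H10_grad A v1 g1 -> H10_grad A v2 g2 ->
  H10_grad A (fun x => v1 x + v2 x)%R (fun x => g1 x + g2 x)%R.
Proof.
move=> mA mv1 mv2 mg1 mg2 [p1 [C1 [c1 d1]]] [p2 [C2 [c2 d2]]].
have mp1 k := smooth_measurable (C1 k).1; have mp2 k := smooth_measurable (C2 k).1.
have mq1 k := smooth_measurable_grad (C1 k).1.
have mq2 k := smooth_measurable_grad (C2 k).1.
have mv12 : measurable_fun setT (fun x : Rd R n => v1 x + v2 x)%R by exact: measurable_funD.
have mg12 : measurable_fun setT (fun x : Rd R n => g1 x + g2 x : Rd R n)%R.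
  apply: measurable_fun_rV => i; under eq_fun do rewrite mxE.
  by apply: measurable_funD; exact: (measurableT_comp (measurable_coord i)).
have C12 k : Cc_infty A (fun x => p1 k x + p2 k x)%R by exact: Cc_inftyD.
have mp12 k := smooth_measurable (C12 k).1.
have mq12 k := smooth_measurable_grad (C12 k).1.
exists (fun k x => p1 k x + p2 k x)%R; split => //; split.
  apply: cvg_squeeze0 c1 c2 => k.
    apply: intA_ge0 => // [|x _]; last exact: sqr_ge0.
    by apply: measurable_funTS; apply: measurable_funX; exact: measurable_funB.
  apply: intA_le2 => //; try (by apply: measurable_funX; exact: measurable_funB);
    try (by move=> x; exact: sqr_ge0).
  move=> x; have := sqr_ge0 (p1 k x - v1 x - (p2 k x - v2 x)); nra.
apply: cvg_squeeze0 d1 d2 => k.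
  apply: intA_ge0 => // [|x _]; last exact: dotp_ge0.
  by apply: measurable_funTS; apply: measurable_dotp2; exact: measurable_subRd.
apply: intA_le2 => //; try (by apply: measurable_dotp2; exact: measurable_subRd);
  try (by move=> x; exact: dotp_ge0).
move=> x; rewrite gradD ?(C1 k).1 ?(C2 k).1 //; last 2 first.
- exact: (C1 k).1.
- exact: (C2 k).1.
by rewrite opprD addrACA; exact: dotp_sqD.
Qed.

End H10.

(** * Replacing a competitor on disjoint open pieces *)

Section patch.
Context {R : realType} {n : nat} {dT : measure_display} {T : measurableType dT}.
Variable S : model R n T.
Implicit Types (A B : set (Rd R n)) (w : T) (e x : 'rV[R]_n).

Notation adm := (admissible (mq S)).
Notation Ph := (Phit (mPhi S) (mtau S) (mW S) (mq S)).

Lemma adm_measurable_u e x A u g : adm e x A u g -> measurable_fun setT (u : Rd R n -> R).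
Proof. by case=> /borel_funE. Qed.

Lemma adm_measurable_g e x A u g : adm e x A u g ->
  measurable_fun setT (g : Rd R n -> Rd R n).
Proof. by case=> _ [bg _]; apply: measurable_fun_rV => i; exact/borel_funE. Qed.

Lemma TqeE (q : R -> R) e x : Tqe q e x = (fun y => q (dotp y e + - dotp x e)) :> ('rV[R]_n -> R).
Proof. by apply/funext => y; rewrite /Tqe dotpBl. Qed.

Lemma smooth_q (l : 'rV[R]_n -> R) : smooth l -> smooth (fun z => mq S (l z)).
Proof. by move=> sl k; apply: Ck_comp => //; exact: mqs. Qed.

Lemma smooth_Tqe (e x : 'rV[R]_n) : smooth (Tqe (mq S) e x).
Proof. by rewrite TqeE; apply: smooth_q => k; exact: Ck_lin. Qed.

Lemma hasgrad_q (l : 'rV[R]_n -> R) G : hasgrad l G ->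
  hasgrad (fun z => mq S (l z)) (fun z => (derive1 (mq S) (l z)) *: G z).
Proof. by move=> hl; apply: hasgrad_comp => //; have [] := mqs S 1. Qed.

(** On [A] the function [U] is the planar profile of [u]. Hence the new function minus the profile
    of [A'] is the sum of [U] minus that profile and of the extension by zero of [u] minus its own
    profile, both in the [H^1_0] class of [A']. *)
Lemma patch1 e' x' A' U G e x A u g : open A' -> open A -> A `<=` A' ->
  adm e' x' A' U G -> adm e x A u g ->
  (forall z, A z -> U z = Tqe (mq S) e x z /\ G z = grad (Tqe (mq S) e x) z) ->
  adm e' x' A' (fun z => if z \in A then u z else U z) (fun z => if z \in A then g z else G z).
Proof.
move=> oA' oA AA' aU au UT.
have mA : measurable A by exact: open_measurableRd.
have mA' : measurable A' by exact: open_measurableRd.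
have mu := adm_measurable_u au; have mg := adm_measurable_g au.
have mU := adm_measurable_u aU; have mG := adm_measurable_g aU.
have mT := smooth_measurable (smooth_Tqe e' x').
have mT' := smooth_measurable_grad (smooth_Tqe e' x').
have mTe := smooth_measurable (smooth_Tqe e x).
have mTe' := smooth_measurable_grad (smooth_Tqe e x).
have mA1 : measurable_fun setT (fun z : Rd R n => z \in A).
  by apply: (@measurable_fun_bool _ _ _ _ true); rewrite setTI (_ : _ @^-1` _ = A) //;
     apply/seteqP; split => z /= => [/set_mem|/mem_set].
have mif (f h : Rd R n -> R) : measurable_fun setT f -> measurable_fun setT h ->
    measurable_fun setT (fun z : Rd R n => if z \in A then f z else h z).
  by move=> mf mh; exact: measurable_fun_ifT.
have mifv (f h : Rd R n -> Rd R n) : measurable_fun setT f -> measurable_fun setT h ->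
    measurable_fun setT (fun z : Rd R n => if z \in A then f z else h z).
  by move=> mf mh; exact: measurable_fun_ifT.
have mg' := mifv _ _ mg mG.
have [_ [_ [U1 [Goo HU]]]] := aU; have [_ [_ [u1 [goo Hu]]]] := au.
split; first by apply/borel_funE; exact: mif.
split; first by move=> i; apply/borel_funE; exact: (measurableT_comp (measurable_coord i) mg').
split; first by move=> z A'z; case: ifPn => [/set_mem/u1//|_]; exact: U1.
split.
  have mdot (f : Rd R n -> Rd R n) (D : set (Rd R n)) : measurable_fun setT f ->
      measurable_fun D (fun z => (dotp (f z) (f z))%:E).
    by move=> mf; apply/measurable_EFinP/measurable_funTS; exact: measurable_dotp2.
  have midot (D : set (Rd R n)) : measurable_fun D (fun z => (\1_A z * dotp (g z) (g z))%:E).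
    apply/measurable_EFinP/measurable_funTS; apply: measurable_funM; last exact: measurable_dotp2.
    exact: measurable_indic.
  have dot0 (f : Rd R n -> Rd R n) (D : set (Rd R n)) z : D z -> (0 <= (dotp (f z) (f z))%:E)%E.
    by rewrite lee_fin dotp_ge0.
  have idot0 (D : set (Rd R n)) z : D z -> (0 <= (\1_A z * dotp (g z) (g z))%:E)%E.
    by rewrite lee_fin mulr_ge0 // ?dotp_ge0 // indicE.
  rewrite intAE //; last 2 first.
  - by apply: measurable_funTS; exact: measurable_dotp2.
  - by move=> z _; exact: dotp_ge0.
  apply: (@le_lt_trans _ _ (\int[muRd n]_(z in A') ((\1_A z * dotp (g z) (g z))%:E +
       (dotp (G z) (G z))%:E))%E).
    apply: (ge0_le_integral _ mA' (dot0 _ _) (mdot _ _ mg')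
       (emeasurable_funD (midot _) (mdot _ _ mG))).
    move=> z _; rewrite -EFinD lee_fin indicE; case: ifPn => _.
      by rewrite mul1r lerDl dotp_ge0.
    by rewrite mul0r add0r.
  rewrite (ge0_integralD _ mA' (idot0 _) (midot _) (dot0 _ _) (mdot _ _ mG)).
  apply: lte_add_pinfty; last first.
    by move: Goo; rewrite intAE //; [exact: measurable_funTS (measurable_dotp2 mG mG)
       |move=> z _; exact: dotp_ge0].
  move: goo; rewrite intAE //; last 2 first.
  - exact: measurable_funTS (measurable_dotp2 mg mg).
  - by move=> z _; exact: dotp_ge0.
  move=> h; apply: le_lt_trans h; rewrite integral_mkcond [leRHS]integral_mkcond.
  apply: ge0_le_integral => //.
  - by move=> z _; rewrite patchE; case: ifP => // _; exact: (idot0 setT).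
  - exact: (measurable_restrictT _ mA').1 (midot _).
  - exact: (measurable_restrictT _ mA).1 (mdot _ _ mg).
  - move=> z _; rewrite !patchE indicE; case: (z \in A').
      by case: (z \in A); rewrite lee_fin ?mul1r ?mul0r.
    by case: (z \in A) => //; rewrite lee_fin dotp_ge0.
have -> : (fun z => (if z \in A then u z else U z) - Tqe (mq S) e' x' z) =
   (fun z => (U z - Tqe (mq S) e' x' z) + (if z \in A then u z - Tqe (mq S) e x z else 0)).
  apply/funext => z; case: ifPn => [/set_mem/UT[-> _]|_]; last by rewrite addr0.
  by ring.
have -> : (fun z => (if z \in A then g z else G z) - grad (Tqe (mq S) e' x') z) =
   (fun z => (G z - grad (Tqe (mq S) e' x') z) +
      (if z \in A then g z - grad (Tqe (mq S) e x) z else 0)).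
  apply/funext => z; case: ifPn => [/set_mem/UT[_ ->]|_]; last by rewrite addr0.
  by apply/rowP => j; rewrite !mxE; ring.
apply: H10_add => //.
- exact: measurable_funB.
- by apply: mif; [exact: measurable_funB|exact: measurable_cst].
- exact: measurable_subRd.
- by apply: mifv; [exact: measurable_subRd|exact: (@measurable_cst _ _ (Rd R n) (Rd R n))].
exact: H10_ext.
Qed.

(** The pieces are inserted one at a time. The middle clause keeps the function equal to [v] off the
    pieces already inserted, so the next piece, disjoint from them, still finds its planar
    profile. *)
Lemma patch_seq (I : eqType) (s : seq I) (A_ : I -> set (Rd R n))
    (e_ x_ : I -> 'rV[R]_n) (u_ : I -> 'rV[R]_n -> R) (g_ : I -> 'rV[R]_n -> 'rV[R]_n)
    e' x' A' v gv w :
  uniq s -> open A' -> adm e' x' A' v gv ->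
  (forall i, i \in s -> open (A_ i) /\ A_ i `<=` A') ->
  (forall i, i \in s -> adm (e_ i) (x_ i) (A_ i) (u_ i) (g_ i)) ->
  (forall i z, i \in s -> A_ i z -> v z = Tqe (mq S) (e_ i) (x_ i) z /\
      gv z = grad (Tqe (mq S) (e_ i) (x_ i)) z) ->
  (forall i j, i \in s -> j \in s -> i != j -> A_ i `&` A_ j = set0) ->
  exists U G, [/\ adm e' x' A' U G,
    forall z, (forall i, i \in s -> ~ A_ i z) -> U z = v z /\ G z = gv z &
    forall B, measurable B ->
    (\int[muRd n]_(z in B) (dens S w U G z)%:E <=
     \sum_(i <- s) \int[muRd n]_(z in A_ i) (dens S w (u_ i) (g_ i) z)%:E +
     \int[muRd n]_(z in B `\` \big[setU/set0]_(i <- s) A_ i) (dens S w v gv z)%:E)%E].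
Proof.
move=> us oA' av; elim: s us => [_ _ _ _ _|i s IH /= /andP[nis us] hA hu hT hd].
  exists v, gv; split => // B mB; rewrite !big_nil setD0 add0e.
  by rewrite le_refl.
have [||||U [G [aU offU hB]]] := IH us.
- by move=> j js; apply: hA; rewrite inE js orbT.
- by move=> j js; apply: hu; rewrite inE js orbT.
- by move=> j z js; apply: hT; rewrite inE js orbT.
- by move=> j k js ks; apply: hd; rewrite inE ?js ?ks orbT.
have iis : i \in i :: s by rewrite mem_head.
have [oAi AiA'] := hA _ iis.
have mAi : measurable (A_ i) by exact: open_measurableRd.
have disj j z : j \in s -> A_ i z -> ~ A_ j z.
  move=> js Aiz Ajz; have jis : j \in i :: s by rewrite inE js orbT.
  have ij : i != j by apply: contraNneq nis => ->.
  by have : (A_ i `&` A_ j) z by []; rewrite hd.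
have UT z : A_ i z -> U z = Tqe (mq S) (e_ i) (x_ i) z /\
    G z = grad (Tqe (mq S) (e_ i) (x_ i)) z.
  move=> Aiz; have [-> ->] := offU z (fun j js => disj j z js Aiz).
  exact: hT.
have aU' := patch1 oA' oAi AiA' aU (hu _ iis) UT.
exists (fun z => if z \in A_ i then u_ i z else U z),
       (fun z => if z \in A_ i then g_ i z else G z); split => //.
  move=> z h; rewrite ifN; last by apply/negP => /set_mem; exact: h.
  rewrite ifN; last by apply/negP => /set_mem; exact: h.
  by apply: offU => j js; apply: h; rewrite inE js orbT.
move=> B mB.
set U' := (fun z => if z \in A_ i then u_ i z else U z) in aU' *.
set G' := (fun z => if z \in A_ i then g_ i z else G z) in aU' *.
have mD : measurable_fun setT (fun z : Rd R n => (dens S w U' G' z)%:E).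
  apply/measurable_EFinP; apply: measurable_dens.
    exact: adm_measurable_u aU'.
  exact: adm_measurable_g aU'.
rewrite -[X in (\int[_]_(z in X) _ <= _)%E](setUIDK B (A_ i)).
have mBA : measurable (B `&` A_ i) by exact: measurableI.
have mBD : measurable (B `\` A_ i) by exact: measurableD.
have dBA : disj_set (B `&` A_ i) (B `\` A_ i).
  by rewrite disj_set2E; apply/eqP; rewrite setDE setIACA setICr setI0.
have d0 (D : set (Rd R n)) z : D z -> (0 <= (dens S w U' G' z)%:E)%E.
  by move=> _; rewrite lee_fin dens_ge0.
have E := ge0_integral_setU (muRd n) mBA mBD (measurable_funTS mD) (d0 _) dBA.
rewrite E {E}.
rewrite !big_cons -[leRHS]addeA; apply: leeD.
  have -> : (\int[muRd n]_(z in B `&` A_ i) (dens S w U' G' z)%:E =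
      \int[muRd n]_(z in B `&` A_ i) (dens S w (u_ i) (g_ i) z)%:E)%E.
    by apply: eq_integral => z /set_mem[_ Aiz]; rewrite /dens /U' /G' !(mem_set Aiz).
  apply: ge0_subset_integral => //.
  - apply/measurable_EFinP/measurable_funTS; apply: measurable_dens.
      exact: adm_measurable_u (hu _ iis).
    exact: adm_measurable_g (hu _ iis).
  - by move=> z _; rewrite lee_fin dens_ge0.
have -> : (\int[muRd n]_(z in B `\` A_ i) (dens S w U' G' z)%:E =
      \int[muRd n]_(z in B `\` A_ i) (dens S w U G z)%:E)%E.
  apply: eq_integral => z /set_mem[_ Aiz]; rewrite /dens /U' /G' !ifN //;
  by apply/negP => /set_mem.
by apply: le_trans (hB _ mBD) _; rewrite setDDl.
Qed.

(** The strict bounds provide an actual competitor on each piece; the background q o l pays for the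
    rest. The background is admissible in [A'] because l is the planar coordinate off a compact
    subset, so its difference from the profile is a test function. *)
Lemma patch_Phit (I : eqType) (s : seq I) (A_ : I -> set (Rd R n))
    (e_ x_ : I -> 'rV[R]_n) (c_ : I -> R) e' x' A' (l : 'rV[R]_n -> R) w :
  uniq s -> open A' -> smooth l ->
  (exists K, [/\ compact K, K `<=` A' & forall z, ~ K z -> l z = dotp (z - x') e']) ->
  (intA A' (fun z => dotp (grad (fun z => mq S (l z)) z) (grad (fun z => mq S (l z)) z)) < +oo)%E ->
  (forall i, i \in s -> open (A_ i) /\ A_ i `<=` A') ->
  (forall i z, i \in s -> A_ i z -> l z = dotp (z - x_ i) (e_ i)) ->
  (forall i j, i \in s -> j \in s -> i != j -> A_ i `&` A_ j = set0) ->
  (forall i, i \in s -> (Ph w (e_ i) (x_ i) (A_ i) < (c_ i)%:E)%E) ->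
  (Ph w e' x' A' <= (\sum_(i <- s) c_ i)%:E +
     \int[muRd n]_(z in A' `\` \big[setU/set0]_(i <- s) A_ i)
        (dens S w (fun z => mq S (l z)) (grad (fun z => mq S (l z))) z)%:E)%E.
Proof.
move=> us oA' sl [K [cK KA' lK]] goo hA hl hd hc.
set v := fun z => mq S (l z) in goo *.
have sv : smooth v by exact: smooth_q.
have mv := smooth_measurable sv; have mgv := smooth_measurable_grad sv.
have sT := smooth_Tqe e' x'.
have av : adm e' x' A' v (grad v).
  split; first exact/borel_funE.
  split; first by move=> i; apply/borel_funE; exact: (measurableT_comp (measurable_coord i) mgv).
  split; first by move=> z _; exact: mq1.
  split => //.
  have sNT : smooth (fun z => - Tqe (mq S) e' x' z).
    move=> k; rewrite (_ : (fun z => _) = fun z => (-1) * Tqe (mq S) e' x' z).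
      by apply: CkM; [exact: Ck_cst|exact: sT].
    by apply/funext => z; rewrite mulN1r.
  have -> : (fun z => grad v z - grad (Tqe (mq S) e' x') z) =
     grad (fun z => v z - Tqe (mq S) e' x' z).
    apply/funext => z; rewrite gradD //; congr (_ + _).
    apply/rowP => i; rewrite !mxE deriveN //; exact: smooth_derivable.
  apply: H10_Cc; split; first exact: smoothD.
  by exists K; do !split => //; move=> z /lK h; rewrite /v h /Tqe subrr.
have : forall i, exists ug : ('rV[R]_n -> R) * ('rV[R]_n -> 'rV[R]_n), i \in s ->
    adm (e_ i) (x_ i) (A_ i) ug.1 ug.2 /\
    (\int[muRd n]_(z in A_ i) (dens S w ug.1 ug.2 z)%:E < (c_ i)%:E)%E.
  move=> i; have [is_|nis] := boolP (i \in s); last by exists (v, grad v) => /=.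
  have [_ [u [g [au ->]]] ugc] := ereal_inf_lt (hc _ is_).
  exists (u, g) => _ /=; split => //; move: ugc; rewrite energyE //.
  - by apply: open_measurableRd; have [] := hA _ is_.
  - exact: adm_measurable_u au.
  - exact: adm_measurable_g au.
  - by have [_ [_ []]] := au.
move/choice => [ug hug].
have [|||U [G [aU _ hB]]] := @patch_seq I s A_ e_ x_ (fun i => (ug i).1) (fun i => (ug i).2)
   e' x' A' v (grad v) w us oA' av hA.
- by move=> i is_; have [] := hug i is_.
(* [A_ i] is open, so the equality of the functions passes to their gradients. *)
- move=> i z is_ Aiz; have E : \near z, v z = Tqe (mq S) (e_ i) (x_ i) z.
    have [oAi _] := hA _ is_.
    have := open_nbhs_nbhs (conj oAi Aiz); apply: filterS => y Aiy.
    by rewrite /v (hl i).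
  split; first exact: nbhs_singleton E.
  by apply/rowP => j; rewrite !mxE; exact: near_eq_derive.
- exact: hd.
have mA' : measurable (A' : set (Rd R n)) by exact: open_measurableRd.
apply: (@le_trans _ _ (energy (mPhi S) (mtau S) (mW S) w A' U G)).
  by apply: ereal_inf_lbound; exists U, G.
rewrite energyE //; [|exact: adm_measurable_u aU|exact: adm_measurable_g aU|by have [_ [_ []]] := aU].
apply: le_trans (hB _ mA') _; rewrite leeD2r // -sumEFin.
rewrite big_seq [leRHS]big_seq; apply: lee_sum => i is_.
by have [_ /ltW] := hug i is_.
Qed.

End patch.

(** * Energy of graph-like competitors *)

Section frames.
Context {R : realType} {n : nat}.
Implicit Types (M : 'M[R]_n.+1) (x z : 'rV[R]_n.+1).

(** Coordinates of z - x in the orthonormal frame formed by the rows of [M]: row 0 is the normal of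
    the plane, the other rows span it. *)
Definition co M x z : 'rV[R]_n.+1 := (z - x) *m M^T.

Lemma coE M x z i : co M x z ord0 i = dotp (z - x) (row i M).
Proof. by rewrite mxE; apply: eq_bigr => j _; rewrite !mxE. Qed.

Lemma co_frame M x y : M *m M^T = 1%:M -> co M x (x + y *m M) = y.
Proof. by move=> MM; rewrite /co addrC addKr -mulmxA MM mulmx1. Qed.

Lemma frame_co M x z : M *m M^T = 1%:M -> x + co M x z *m M = z.
Proof. by move=> /mulmx1C MM; rewrite /co -mulmxA MM mulmx1 addrC subrK. Qed.

Lemma measurable_co M x : measurable_fun setT (fun z : Rd R n.+1 => co M x z : Rd R n.+1).
Proof. exact: (measurableT_comp (measurable_mulRd _) (measurable_addRd _)). Qed.

Lemma continuous_co M x i : continuous (fun z => co M x z ord0 i).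
Proof.
rewrite (_ : (fun z => _) = fun z => dotp z (row i M) + - dotp x (row i M)).
  exact: coord_sum_continuous.
by apply/funext => z; rewrite coE dotpBl.
Qed.

Definition base M x z : 'rV[R]_n := rvbehead (co M x z).

Lemma measurable_base M x : measurable_fun setT (fun z : Rd R n.+1 => base M x z : Rd R n).
Proof. exact: (measurableT_comp (@measurable_rvbehead R n) (measurable_co M x)). Qed.

(** [r] is the full side of the base but [h] is the half-height: a cube of side r is
    [box M x r (r / 2)]. *)
Definition box M x (r h : R) : set (Rd R n.+1) :=
  [set z | `|co M x z ord0 ord0| < h /\ cubeRd n r (base M x z)].

Lemma boxP M x r h z : box M x r h z <->
  `|dotp (z - x) (row ord0 M)| < h /\
  (forall i, `|dotp (z - x) (row (lift ord0 i) M)| < r / 2).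
Proof.
rewrite /box /= coE; split => -[h0 hi]; split => // i; have := hi i;
by rewrite /base mxE coE.
Qed.

Lemma open_box M x r h : open (box M x r h : set 'rV[R]_n.+1).
Proof.
have oi i c : open [set z : 'rV[R]_n.+1 | `|co M x z ord0 i| < c].
  rewrite (_ : [set z | _] = (fun z => co M x z ord0 i) @^-1` `](- c), c[%classic).
    have /continuousP := @continuous_co M x i; apply; exact: interval_open.
  by apply/seteqP; split => z /=; rewrite in_itv /= ltr_norml.
rewrite openE => z [h1 h2]; rewrite /interior.
have n1 : nbhs z [set z : 'rV[R]_n.+1 | `|co M x z ord0 ord0| < h].
  exact: (open_nbhs_nbhs (conj (oi _ _) h1)).
have n2 : nbhs z (fun y : 'rV[R]_n.+1 => forall i, `|co M x y ord0 (lift ord0 i)| < r / 2).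
  apply: (@filter_forall _ 'I_n (fun i y => `|co M x y ord0 (lift ord0 i)| < r / 2) (nbhs z)).
  move=> i; apply: (open_nbhs_nbhs (conj (oi (lift ord0 i) (r / 2)) _)) => /=.
  by have := h2 i; rewrite /base mxE.
apply: filterS2 n1 n2 => y k1 k2; split => // i.
by rewrite /base mxE; exact: k2.
Qed.

Lemma measurable_box M x r h : measurable (box M x r h).
Proof. by apply: open_measurableRd; exact: (@open_box M x r h). Qed.

Lemma mu_base M x (A : set R) (B : set (Rd R n)) : M *m M^T = 1%:M ->
  measurable A -> measurable B ->
  muRd n.+1 [set z : Rd R n.+1 | A (co M x z ord0 ord0) /\ B (base M x z)] =
  (lebesgue_measure A * muRd n B)%E.
Proof.
move=> MM mA mB; rewrite -(muRd_prod mA mB).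
set C := (X in muRd _ X = _); set D := (X in _ = muRd _ X).
have mD : measurable D by exact: measurable_rvprod.
have mC : measurable C.
  have := measurable_co M x measurableT mD; rewrite setTI; congr measurable.
have -> : muRd n.+1 D = (\int[muRd n.+1]_z (\1_D z)%:E)%E by rewrite integral_indic ?setIT.
have -> : muRd n.+1 C = (\int[muRd n.+1]_z (\1_C z)%:E)%E by rewrite integral_indic ?setIT.
rewrite (muRd_frame x MM) //; last exact: emeasurable_indic.
apply: eq_integral => y _; congr (_%:E); rewrite !indicE; congr (nat_of_bool _)%:R.
by apply/idP/idP => /set_mem h; apply/mem_set; move: h;
  rewrite /C /D /= /base co_frame.
Qed.

Lemma mu_box M x r h : M *m M^T = 1%:M -> 0 <= r -> 0 <= h ->
  muRd n.+1 (box M x r h) = (h *+ 2 * r ^+ n)%:E.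
Proof.
move=> MM r0 h0.
have := mu_base x MM (measurable_sym h) (@measurable_cubeRd R n r).
by rewrite lebesgue_sym // muRd_cube // EFinM => <-.
Qed.

Lemma null_coord M x i (c : R) : M *m M^T = 1%:M ->
  muRd n.+1 [set z : Rd R n.+1 | co M x z ord0 i = c] = 0%E.
Proof.
move=> MM; rewrite -(@muRd_hyperplane R n.+1 i c).
set C := (X in muRd _ X = _); set D := (X in _ = muRd _ X).
have mD : measurable D.
  rewrite -[X in measurable X]setTI; exact: (measurable_coord i measurableT (measurable_set1 c)).
have mC : measurable C.
  have := measurable_co M x measurableT mD; rewrite setTI; congr measurable.
have -> : muRd n.+1 D = (\int[muRd n.+1]_z (\1_D z)%:E)%E by rewrite integral_indic ?setIT.
have -> : muRd n.+1 C = (\int[muRd n.+1]_z (\1_C z)%:E)%E by rewrite integral_indic ?setIT.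
rewrite (muRd_frame x MM) //; last exact: emeasurable_indic.
apply: eq_integral => y _; congr (_%:E); rewrite !indicE; congr (nat_of_bool _)%:R.
by apply/idP/idP => /set_mem h; apply/mem_set; move: h; rewrite /C /D /= co_frame.
Qed.

Lemma rvcons_mul M t (y : 'rV[R]_n) :
  rvcons t y *m M = t *: row ord0 M + rvcons 0 y *m M.
Proof.
apply/rowP => j; rewrite !mxE !big_ord_recl !rvcons0 mul0r add0r; congr (_ + _).
by apply: eq_bigr => i _; rewrite !rvconsS.
Qed.

End frames.

(** * Change of variables along lines transversal to a graph *)

Section graph.
Context {R : realType} {n : nat}.
Variables (M : 'M[R]_n.+1) (x : 'rV[R]_n.+1).
Variables (l : 'rV[R]_n.+1 -> R) (G : 'rV[R]_n.+1 -> 'rV[R]_n.+1).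
Variables (e' x' : 'rV[R]_n.+1) (K : set 'rV[R]_n.+1).
Hypothesis MM : M *m M^T = 1%:M.
Hypothesis sl : smooth l.
Hypothesis lG : hasgrad l G.
Hypothesis cK : compact K.
Hypothesis lK : forall z, ~ K z -> l z = dotp (z - x') e'.
Hypothesis G2 : forall z, 2^-1 <= dotp (G z) (row ord0 M).
Local Notation mu := (@lebesgue_measure R).

Variable g : R -> R.
Hypothesis cg : continuous g.
Hypothesis g0 : forall s, 0 <= g s.

Let gam (y : 'rV[R]_n) (t : R) := x + rvcons t y *m M.
Let F (y : 'rV[R]_n) (t : R) := l (gam y t).

Let F_derive y t : is_derive t (1 : R) (F y) (dotp (G (gam y t)) (row ord0 M)).
Proof.
have h := (is_derive_line l (gam y t) (row ord0 M) _).2 (lG (gam y t) (row ord0 M)).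
have := @is_derive1_comp _ (fun h => l (h *: row ord0 M + gam y t)) (fun s => s - t) t _ 1.
rewrite subrr => /(_ _ h).
have hs : is_derive t (1 : R) (fun s => s - t) 1.
  have := is_deriveB (is_derive_id t (1 : R)) (is_derive_cst t t (1 : R)).
  by move=> h'; apply: (is_derive_eq h'); rewrite subr0.
move=> /(_ hs); rewrite mulr1.
rewrite (_ : _ \o _ = F y) //; apply/funext => s; rewrite /F /gam /=; congr l.
rewrite (rvcons_mul M s) (rvcons_mul M t) scalerBl.
by rewrite addrCA !addrA subrK addrC addrA.
Qed.

Let gam_cont y : continuous (gam y).
Proof.
move=> t; rewrite /gam.
under eq_fun do rewrite rvcons_mul.
apply: cvgD; first exact: cvg_cst.
apply: cvgD; last exact: cvg_cst.
by apply: cvgZl; exact: cvg_id.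
Qed.

(** Along the direction [row ord0 M] the slope of l is at least 1/2, so s = l is a change of
    variable with dt at most 2 ds. Off the compact set [K] it is affine, which gives the limits at
    both ends that the substitution formula requires. *)
Lemma graph_line (y : 'rV[R]_n) :
  (\int[mu]_t (g (l (x + rvcons t y *m M)))%:E <= 2%:E * \int[mu]_s (g s)%:E)%E.
Proof.
have dF t : derivable (F y) t 1 by have [] := F_derive y t.
have F'E t : derive1 (F y) t = dotp (G (gam y t)) (row ord0 M).
  by rewrite derive1E; have [_ ->] := F_derive y t.
have cF' : continuous (derive1 (F y)).
  rewrite (_ : derive1 (F y) = fun t => \sum_(i < n.+1) ('D_(bvec i) l (gam y t)) * row ord0 M ord0 i).
    apply: continuous_sumr => i t.
    apply: (@continuousM _ _ (fun t => 'D_(bvec i) l (gam y t)) (fun=> row ord0 M ord0 i));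
      last exact: cst_continuous.
    apply: (@continuous_comp _ _ _ (gam y) ('D_(bvec i) l)); first exact: gam_cont.
    by have [_ /(_ i)[_ ci]] := sl 1; exact: (ci (gam y t)).
  apply/funext => t; rewrite F'E; apply: eq_bigr => i _; congr (_ * _).
  by rewrite -(hasgrad_grad lG) mxE.
have F'pos t : 2^-1 <= derive1 (F y) t by rewrite F'E.
have incF : {homo F y : s t / s < t}.
  move=> s t st; have [||u _ E] := @MVT R (F y) (derive1 (F y)) s t st.
  - by move=> u _; rewrite derive1E; exact: derivableP.
  - by apply: continuous_subspaceT; exact: derivable_cont.
  have st0 : 0 < t - s by rewrite subr_gt0.
  rewrite -subr_gt0 E; apply: mulr_gt0 => //.
  by have := F'pos u; lra.
have [rho Krho] : exists rho : R, forall z, K z -> `|dotp (z - x) (row ord0 M)| <= rho.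
  have cd : continuous (fun z : 'rV[R]_n.+1 => dotp z (row ord0 M) + - dotp x (row ord0 M)).
    exact: coord_sum_continuous.
  have := continuous_compact (continuous_subspaceT cd) cK.
  move=> /compact_bounded[B [_ hB]]; exists (B + 1) => z Kz.
  have := hB (B + 1); rewrite ltrDl ltr01 => /(_ isT); apply.
  by exists z => //; rewrite dotpBl.
have gamK t : rho < `|t| -> ~ K (gam y t).
  move=> rt /Krho h.
  have E := coE M x (gam y t) ord0; rewrite co_frame // rvcons0 in E.
  by move: h; rewrite -E leNgt rt.
have Gf t : rho < `|t| -> F y t = dotp (row ord0 M) e' * t + (dotp (gam y 0 - x') e').
  move=> rt; rewrite /F lK; last exact: gamK.
  have -> : gam y t = t *: row ord0 M + gam y 0 by rewrite /gam rvcons_mul addrCA.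
  by rewrite !dotpBl dotpDl dotpZl; ring.
have GK t : rho < `|t| -> dotp (G (gam y t)) (row ord0 M) = dotp (row ord0 M) e'.
  move=> rt; have nK := gamK _ rt.
  have E : nbhs (gam y t) (fun z => l z = dotp z e' + - dotp x' e').
    have oK : open (~` K) by apply: closed_openC; exact: compact_closed cK.
    have := open_nbhs_nbhs (conj oK nK); apply: filterS => z nKz.
    by rewrite lK // dotpBl.
  have [_ <-] := lG (gam y t) (row ord0 M); rewrite (near_eq_derive (g := fun z => dotp z e' + - dotp x' e') _ E).
  by have [_ ->] := hasgrad_lin e' (- dotp x' e') (gam y t) (row ord0 M); rewrite dotpC.
set c := dotp (row ord0 M) e' in Gf GK.
(* The slope at infinity is attained on the line itself, at any point beyond [rho]. *)
have c2 : 2^-1 <= c.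
  rewrite -(GK (`|rho| + 1)); first exact: G2.
  have := ler_norm rho; have := ler_norm (`|rho| + 1); lra.
have cvg1 : derive1 (F y) t @[t --> +oo] --> c.
  apply: cvg_near_cst; near=> t; rewrite F'E GK //.
  by apply: lt_le_trans (ler_norm _); near: t; exact: (nbhs_pinfty_gt (num_real _)).
have cvg2 : derive1 (F y) t @[t --> -oo] --> c.
  apply: cvg_near_cst; near=> t; rewrite F'E GK // -normrN.
  apply: lt_le_trans (ler_norm _); rewrite ltrNr; near: t; exact: (nbhs_ninfty_lt (num_real _)).
set b := dotp (gam y 0 - x') e' in Gf.
have lim1 : F y t @[t --> +oo] --> +oo.
  apply/cvgryPge => A; near=> t.
  have rt : rho < `|t| by apply: lt_le_trans (ler_norm _); near: t; exact: (nbhs_pinfty_gt (num_real _)).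
  rewrite Gf //.
  have t0 : 0 < t by near: t; exact: (nbhs_pinfty_gt (num_real _)).
  have : 2 * (`|A| + `|b|) < t by near: t; exact: (nbhs_pinfty_gt (num_real _)).
  have := ler_norm A; have := ler_norm (- b); rewrite normrN; nra.
have lim2 : F y t @[t --> -oo] --> -oo.
  apply/cvgrNyPle => A; near=> t.
  have rt : rho < `|t|.
    rewrite -normrN; apply: lt_le_trans (ler_norm _); rewrite ltrNr; near: t; exact: (nbhs_ninfty_lt (num_real _)).
  rewrite Gf //.
  have t0 : t < 0 by near: t; exact: (nbhs_ninfty_lt (num_real _)).
  have : t < - (2 * (`|A| + `|b|)) by near: t; exact: (nbhs_ninfty_lt (num_real _)).
  have := ler_norm (- A); have := ler_norm b; rewrite normrN; nra.
have := increasing_ge0_integration_by_substitutionT incF cF' (cvgP _ cvg2) (cvgP _ cvg1)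
  dF lim2 lim1 cg g0.
move=> ->; rewrite -ge0_integralZl //; last 2 first.
- apply/measurable_EFinP; apply: continuous_measurable_fun => t.
  apply: continuousM; last exact: cF'.
  by apply: continuous_comp; [exact: derivable_cont|exact: cg].
- move=> t _; rewrite lee_fin; apply: mulr_ge0; first exact: g0.
  by apply: le_trans (F'pos t); rewrite invr_ge0.
apply: ge0_le_integral => //.
- by move=> t _; rewrite lee_fin.
- apply/measurable_EFinP; apply: continuous_measurable_fun => t.
  by apply: (@continuous_comp _ _ _ (F y) g); [exact: derivable_cont|exact: cg].
- apply: measurable_funeM; apply/measurable_EFinP; apply: continuous_measurable_fun => t.
  apply: continuousM; last exact: cF'.
  by apply: continuous_comp; [exact: derivable_cont|exact: cg].
move=> t _; rewrite -EFinM lee_fin.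
have h1 := F'pos t; have h2 := g0 (F y t).
change (g (F y t) <= 2 * (g (F y t) * derive1 (F y) t)); nra.
Unshelve. all: by end_near. Qed.

End graph.

(** * The one-dimensional profile energy and its tails *)

Section profile.
Context {R : realType} {n : nat} {dT : measure_display} {T : measurableType dT}.
Variable S : model R n.+1 T.
Local Notation mu := (@lebesgue_measure R).
Local Notation q := (mq S).

Definition pE (t : R) : R := mLam S / 2 * (derive1 q t) ^+ 2 + Wclamp S (q t).

Lemma pE_ge0 t : 0 <= pE t.
Proof.
rewrite addr_ge0 ?Wclamp_ge0 // mulr_ge0 ?sqr_ge0 // divr_ge0 //.
exact/ltW/mLam0.
Qed.

Lemma pE_cont : continuous pE.
Proof.
have [dq [dq' _]] := mqs S 2.
move=> t; apply: (@continuousD _ _ _ (fun t => mLam S / 2 * (derive1 q t) ^+ 2)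
   (fun t => Wclamp S (q t))).
  apply: (@continuousM _ _ (fun=> mLam S / 2) (fun t => (derive1 q t) ^+ 2)).
    exact: cst_continuous.
  apply: (@continuous_comp _ _ _ (derive1 q) (fun x => x ^+ 2)).
    exact: derivable_cont.
  exact: exprn_continuous.
apply: continuous_comp; first exact: derivable_cont.
exact: Wclamp_cont.
Qed.

Lemma pE_lty : (\int[mu]_t (pE t)%:E < +oo)%E.
Proof.
have := mEoo S; congr (_ < _)%E; apply: eq_integral => t _; congr (_%:E).
by rewrite /pE WclampE // mq1.
Qed.

Definition IE : R := fine (\int[mu]_t (pE t)%:E)%E.

Lemma IEE : (\int[mu]_t (pE t)%:E)%E = IE%:E.
Proof.
rewrite fineK // ge0_fin_numE ?pE_lty //; apply: integral_ge0 => t _.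
by rewrite lee_fin pE_ge0.
Qed.

Lemma IE_ge0 : 0 <= IE.
Proof. by apply: fine_ge0; apply: integral_ge0 => t _; rewrite lee_fin pE_ge0. Qed.

(** A continuous ramp, 0 for |t| up to h - 1 and 1 from h on, in place of the indicator of |t| >= h,
    because [graph_line] is stated for continuous integrands. Thus [tail h] dominates the profile
    energy beyond h and still tends to 0. *)
Definition cutoff (h t : R) : R := Num.min 1 (Num.max 0 (`|t| - h + 1)).

Lemma cutoff_ge0 h t : 0 <= cutoff h t.
Proof. by rewrite le_min ler01 le_max lexx. Qed.

Lemma cutoff_le1 h t : cutoff h t <= 1.
Proof. by rewrite ge_min lexx. Qed.

Lemma cutoff1 h t : h <= `|t| -> cutoff h t = 1.
Proof. by move=> ht; rewrite /cutoff min_l // le_max; apply/orP; right; lra. Qed.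

Lemma cutoff0 h t : `|t| <= h - 1 -> cutoff h t = 0.
Proof.
move=> ht; rewrite /cutoff max_l ?min_r //; lra.
Qed.

Lemma cutoff_homo h h' t : h <= h' -> cutoff h' t <= cutoff h t.
Proof.
move=> hh; rewrite /cutoff /Num.min /Num.max.
by do !case: ifPn; rewrite -?leNgt; lra.
Qed.

Lemma cutoff_cont h : continuous (cutoff h).
Proof.
move=> t; apply/cvgrPdist_lt => e e0; near=> x.
have xt : `|t - x| < e by near: x; apply/nbhs_ballP; exists e.
have : `| `|t| - `|x| | < e by apply: le_lt_trans xt; exact: ler_dist_dist.
rewrite /cutoff /Num.max /Num.min !ltr_norml; move: (`|t|) (`|x|) => a b.
by do !case: ifPn; rewrite -?leNgt; lra.
Unshelve. all: by end_near. Qed.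

Definition pT (h t : R) : R := pE t * cutoff h t.

Lemma pT_ge0 h t : 0 <= pT h t.
Proof. by rewrite mulr_ge0 ?pE_ge0 ?cutoff_ge0. Qed.

Lemma pT_cont h : continuous (pT h).
Proof. by move=> t; exact: (continuousM (@pE_cont t) (@cutoff_cont h t)). Qed.

Lemma pT_le h t : pT h t <= pE t.
Proof. by rewrite ler_piMr ?pE_ge0 ?cutoff_le1. Qed.

Lemma measurable_pE : measurable_fun setT (fun t : R => (pE t)%:E).
Proof. by apply/measurable_EFinP; exact: continuous_measurable_fun pE_cont. Qed.

Lemma measurable_pT h : measurable_fun setT (fun t : R => (pT h t)%:E).
Proof. by apply/measurable_EFinP; exact: continuous_measurable_fun (@pT_cont h). Qed.

Definition tail (h : R) : R := fine (\int[mu]_t (pT h t)%:E)%E.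

Lemma tailE h : (\int[mu]_t (pT h t)%:E)%E = (tail h)%:E.
Proof.
rewrite fineK // ge0_fin_numE; last by apply: integral_ge0 => t _; rewrite lee_fin pT_ge0.
apply: le_lt_trans pE_lty; apply: ge0_le_integral => //.
- by move=> t _; rewrite lee_fin pT_ge0.
- exact: measurable_pT.
- exact: measurable_pE.
- by move=> t _; rewrite lee_fin pT_le.
Qed.

Lemma tail_ge0 h : 0 <= tail h.
Proof. by apply: fine_ge0; apply: integral_ge0 => t _; rewrite lee_fin pT_ge0. Qed.

Lemma tail_homo h h' : h <= h' -> tail h' <= tail h.
Proof.
move=> hh; rewrite -lee_fin -!tailE; apply: ge0_le_integral => //.
- by move=> t _; rewrite lee_fin pT_ge0.
- exact: measurable_pT.
- exact: measurable_pT.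
- by move=> t _; rewrite lee_fin ler_wpM2l ?pE_ge0 // cutoff_homo.
Qed.

Lemma tail_small (eps : R) : 0 < eps -> exists h0 : R, forall h, h0 <= h -> tail h <= eps.
Proof.
move=> e0.
have pEi : mu.-integrable setT (fun t : R => (pE t)%:E).
  apply/integrableP; split; first exact: measurable_pE.
  apply: le_lt_trans pE_lty; apply: ge0_le_integral => //.
  - by apply: measurableT_comp => //; exact: measurable_pE.
  - exact: measurable_pE.
  - by move=> t _; rewrite gee0_abs // lee_fin pE_ge0.
have [||_ _ c] := @dominated_convergence _ _ _ mu setT measurableT
  (fun k t => (pT k%:R t)%:E) (cst 0)%E (fun t => (pE t)%:E)
  (fun k => measurable_pT k%:R) (measurable_cst _) _ pEi _.
- apply: aeW => t _; apply: cvg_near_cst; near=> k; congr (_%:E).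
  rewrite /pT cutoff0 ?mulr0 // lerBrDr.
  near: k; exact: nbhs_infty_ger.
- apply: aeW => t k _; rewrite gee0_abs; last by rewrite lee_fin pT_ge0.
  by rewrite lee_fin pT_le.
rewrite integral0 in c.
have c2 : (fun k => tail k%:R) @ \oo --> (0 : R) by exact: (fine_cvg c).
have [k _ /(_ k (leqnn k)) /= hk] := cvgr_lt _ c2 eps e0.
exists k%:R => h hh; apply: le_trans (ltW hk); exact: tail_homo.
Unshelve. all: by end_near. Qed.

Lemma dens_q_le w (l : 'rV[R]_n.+1 -> R) G z : hasgrad l G -> dotp (G z) (G z) <= 4 ->
  dens S w (fun z => q (l z)) (grad (fun z => q (l z))) z <= 4 * pE (l z).
Proof.
move=> lG G4; apply: le_trans (dens_le _ _ _ _ _) _.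
rewrite (hasgrad_grad (hasgrad_q S lG)) dotpZl dotpZr mulrDr; apply: lerD; last first.
  by have := Wclamp_ge0 S (q (l z)); lra.
have L0 := mLam0 S; set a := derive1 q (l z).
have a0 := sqr_ge0 a; rewrite [a * (a * _)]mulrA -expr2.
have : a ^+ 2 * dotp (G z) (G z) <= a ^+ 2 * 4 by exact: ler_wpM2l.
move=> h; rewrite [leRHS]mulrCA; apply: ler_wpM2l; first by rewrite divr_ge0 // ltW.
by rewrite [4 * _]mulrC.
Qed.

Lemma grad_q_le (l : 'rV[R]_n.+1 -> R) G z : hasgrad l G -> dotp (G z) (G z) <= 4 ->
  dotp (grad (fun z => q (l z)) z) (grad (fun z => q (l z)) z) <= 8 / mLam S * pE (l z).
Proof.
move=> lG G4; have L0 := mLam0 S.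
rewrite (hasgrad_grad (hasgrad_q S lG)) dotpZl dotpZr.
set a := derive1 q (l z); have a0 := sqr_ge0 a; rewrite [a * (a * _)]mulrA -expr2.
have h : a ^+ 2 * dotp (G z) (G z) <= a ^+ 2 * 4 by exact: ler_wpM2l.
apply: (le_trans h); rewrite [leRHS]mulrAC ler_pdivlMr // /pE -/a.
by have := Wclamp_ge0 S (q (l z)); nra.
Qed.

Section integral_bound.
Variables (l : 'rV[R]_n.+1 -> R) (G : 'rV[R]_n.+1 -> 'rV[R]_n.+1).
Variables (e' x' : 'rV[R]_n.+1) (K : set 'rV[R]_n.+1).
Hypothesis sl : smooth l.
Hypothesis lG : hasgrad l G.
Hypothesis cK : compact K.
Hypothesis lK : forall z, ~ K z -> l z = dotp (z - x') e'.

Lemma measurable_l : measurable_fun setT (l : Rd R n.+1 -> R).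
Proof. exact: smooth_measurable. Qed.

(** Tonelli in the coordinates of the frame, with [graph_line] on each line over a point of [B]. *)
Lemma graph_int (M : 'M[R]_n.+1) x (B : set (Rd R n)) (g : R -> R) :
  M *m M^T = 1%:M -> (forall z, 2^-1 <= dotp (G z) (row ord0 M)) ->
  continuous g -> (forall s, 0 <= g s) -> measurable B ->
  (\int[muRd n.+1]_z (\1_B (base M x z) * g (l z))%:E <=
   2%:E * (muRd n B * \int[mu]_s (g s)%:E))%E.
Proof.
move=> MM G2 cg g0 mB.
have mg := continuous_measurable_fun cg.
have mf : measurable_fun setT (fun z : Rd R n.+1 => (\1_B (base M x z) * g (l z))%:E).
  apply/measurable_EFinP; apply: measurable_funM.
    exact: (measurableT_comp (measurable_indic mB) (measurable_base M x)).
  exact: (measurableT_comp mg measurable_l).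
have f0 z : (0 <= (\1_B (base M x z) * g (l z))%:E)%E.
  by rewrite lee_fin mulr_ge0 // indicE.
have mfr : measurable_fun setT (fun y : Rd R n.+1 =>
    (\1_B (base M x (x + y *m M)) * g (l (x + y *m M)))%:E).
  have m1 : measurable_fun setT (fun y : Rd R n.+1 => x + y *m M : Rd R n.+1).
    have := measurableT_comp (measurable_addRd x) (measurable_mulRd M).
    by congr measurable_fun; apply/funext => y /=; rewrite addrC.
  exact: (measurableT_comp mf m1).
rewrite (muRd_frame x MM mf f0) (ge0_integral_muRdS_swap mfr); last by move=> y; exact: f0.
have cI : (0 <= 2%:E * \int[mu]_s (g s)%:E)%E.
  by rewrite mule_ge0 //; apply: integral_ge0 => s _; rewrite lee_fin.
apply: (@le_trans _ _ (\int[muRd n]_y ((2%:E * \int[mu]_s (g s)%:E) * (\1_B y)%:E))%E); last first.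
  rewrite ge0_integralZl //; last exact: emeasurable_indic.
  by rewrite integral_indic // setIT -muleA [(_ * muRd n B)%E]muleC.
apply: ge0_le_integral => //.
- move=> y _; apply: integral_ge0 => t _; exact: f0.
- have := measurable_fun_fubini_tonelli_G (m1 := mu)
      (fun ty : measurableTypeR R * Rd R n => (\1_B (base M x (x + rvcons ty.1 ty.2 *m M)) *
         g (l (x + rvcons ty.1 ty.2 *m M)))%:E).
  by move/(_ (measurableT_comp mfr (@measurable_rvcons R n)) (fun _ => f0 _)).
- by apply: measurable_funeM; exact: emeasurable_indic.
move=> y _; have bE t : base M x (x + rvcons t y *m M) = y.
  by rewrite /base co_frame // rvbehead_cons.
under eq_integral do rewrite bE EFinM.
rewrite ge0_integralZl //; last 2 first.
- apply/measurable_EFinP; apply: (measurableT_comp mg).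
  have m2 : measurable_fun setT (fun t : R => x + rvcons t y *m M : Rd R n.+1).
    have m3 := measurableT_comp (measurable_mulRd M)
      (measurableT_comp (@measurable_rvcons R n) (pair2_measurable (y : Rd R n))).
    have := measurableT_comp (measurable_addRd x) m3.
    by congr measurable_fun; apply/funext => t /=; rewrite addrC.
  exact: (measurableT_comp measurable_l m2).
- by move=> t _; rewrite lee_fin.
rewrite muleC; apply: lee_wpmul2r; first by rewrite lee_fin indicE.
exact: (@graph_line R n M x l G e' x' K MM sl lG cK lK G2 g cg g0 y).
Qed.

End integral_bound.

End profile.

(** * The general gluing estimate *)

Section master.
Context {R : realType} {n : nat} {dT : measure_display} {T : measurableType dT}.
Variable S : model R n.+1 T.
Local Notation mu := (@lebesgue_measure R).
Local Notation q := (mq S).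
Notation Ph := (Phit (mPhi S) (mtau S) (mW S) (mq S)).

Lemma open_big_measurable (I : eqType) (s : seq I) (A_ : I -> set (Rd R n.+1)) :
  (forall i, i \in s -> open (A_ i : set 'rV[R]_n.+1)) ->
  measurable (\big[setU/set0]_(i <- s) A_ i).
Proof.
move=> oA; rewrite big_seq; apply: bigsetU_measurable => i /oA.
exact: open_measurableRd.
Qed.

Lemma mem_bigsetU (X : Type) (I : eqType) (s : seq I) (A_ : I -> set X) i z :
  i \in s -> A_ i z -> (\big[setU/set0]_(i <- s) A_ i) z.
Proof.
elim: s => // j s IH; rewrite inE big_cons => /orP[/eqP -> ?|/IH h /h ?]; by [left|right].
Qed.

(** Every uncovered point is charged to one of three terms: the tail of the profile where |l| >= h,
    or the full profile energy over [B1] or over [B2]. Two frames are allowed because a leftover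
    region may be a column over either of two planes; the null set [Z] absorbs the walls between
    tiles. *)
Lemma master_patch (I : eqType) (s : seq I) (A_ : I -> set (Rd R n.+1))
    (e_ x_ : I -> 'rV[R]_n.+1) (c_ : I -> R) (e' x' : 'rV[R]_n.+1) (A' : set (Rd R n.+1))
    (l : 'rV[R]_n.+1 -> R) (G : 'rV[R]_n.+1 -> 'rV[R]_n.+1) (K : set 'rV[R]_n.+1)
    (M1 M2 : 'M[R]_n.+1) (x1 x2 : 'rV[R]_n.+1) (B0 B1 B2 : set (Rd R n))
    (b0 b1 b2 h : R) (Z : set (Rd R n.+1)) w :
  uniq s -> open (A' : set 'rV[R]_n.+1) -> smooth l -> hasgrad l G ->
  (forall z, dotp (G z) (G z) <= 4) ->
  compact K -> K `<=` A' -> (forall z, ~ K z -> l z = dotp (z - x') e') ->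
  (forall i, i \in s -> open (A_ i : set 'rV[R]_n.+1) /\ A_ i `<=` A') ->
  (forall i z, i \in s -> A_ i z -> l z = dotp (z - x_ i) (e_ i)) ->
  (forall i j, i \in s -> j \in s -> i != j -> A_ i `&` A_ j = set0) ->
  (forall i, i \in s -> (Ph w (e_ i) (x_ i) (A_ i) < (c_ i)%:E)%E) ->
  M1 *m M1^T = 1%:M -> (forall z, 2^-1 <= dotp (G z) (row ord0 M1)) ->
  M2 *m M2^T = 1%:M -> (forall z, 2^-1 <= dotp (G z) (row ord0 M2)) ->
  measurable B0 -> muRd n B0 = b0%:E -> measurable B1 -> (muRd n B1 <= b1%:E)%E ->
  measurable B2 -> (muRd n B2 <= b2%:E)%E -> measurable Z -> muRd n.+1 Z = 0%E ->
  (forall z, A' z -> B0 (base M1 x1 z)) ->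
  (forall z, A' z -> (forall i, i \in s -> ~ A_ i z) -> ~ Z z ->
     h <= `|l z| \/ B1 (base M1 x1 z) \/ B2 (base M2 x2 z)) ->
  (Ph w e' x' A' <= (\sum_(i <- s) c_ i + 8 * (b0 * tail S h + (b1 + b2) * IE S))%:E)%E.
Proof.
move=> us oA' sl lG G4 cK KA' lK hA hl hd hc MM1 G1 MM2 G2 mB0 hB0 mB1 hB1 mB2 hB2 mZ Z0 hA' hout.
have mA' : measurable A' by exact: open_measurableRd.
have ml := measurable_l sl.
have mpE : measurable_fun setT (fun z : Rd R n.+1 => pE S (l z)).
  exact: (measurableT_comp (continuous_measurable_fun (@pE_cont _ _ _ _ S)) ml).
have mpT : measurable_fun setT (fun z : Rd R n.+1 => pT S h (l z)).
  exact: (measurableT_comp (continuous_measurable_fun (@pT_cont _ _ _ _ S h)) ml).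
have b00 : 0 <= b0 by rewrite -lee_fin -hB0.
have mind (M : 'M[R]_n.+1) (x : 'rV[R]_n.+1) (B : set (Rd R n)) : measurable B ->
    measurable_fun setT (fun z : Rd R n.+1 => \1_B (base M x z) : R).
  by move=> mB; exact: (measurableT_comp (measurable_indic mB) (measurable_base M x)).
have ind0 (B : set (Rd R n)) y : 0 <= (\1_B y : R) by rewrite indicE ler0n.
have sv : smooth (fun z => q (l z)) by exact: smooth_q.
(* The background has finite Dirichlet energy: its density is bounded by a multiple of the profile
   energy over the base [B0], which has finite measure. *)
have goo : (intA A' (fun z => dotp (grad (fun z => q (l z)) z) (grad (fun z => q (l z)) z))
    < +oo)%E.
  rewrite intAE //; last 2 first.
  - by apply: measurable_funTS; apply: measurable_dotp2; exact: smooth_measurable_grad.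
  - by move=> z _; exact: dotp_ge0.
  have c0 : 0 <= 8 / mLam S by rewrite divr_ge0 // ltW // mLam0.
  apply: (@le_lt_trans _ _ (\int[muRd n.+1]_z ((8 / mLam S)%:E *
       (\1_B0 (base M1 x1 z) * pE S (l z))%:E))%E).
    rewrite integral_mkcond; apply: ge0_le_integral => //.
    - by move=> z _; rewrite patchE; case: ifP => // _; rewrite lee_fin dotp_ge0.
    - apply: (measurable_restrictT _ mA').1; apply/measurable_EFinP/measurable_funTS.
      by apply: measurable_dotp2; exact: smooth_measurable_grad.
    - apply: measurable_funeM; apply/measurable_EFinP; apply: measurable_funM => //.
      exact: mind.
    - move=> z _; rewrite patchE; case: ifPn => [/set_mem A'z|_]; rewrite -EFinM lee_fin.
        rewrite indicE (mem_set (hA' _ A'z)) mul1r.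
        exact: grad_q_le.
      by rewrite mulr_ge0 // mulr_ge0 ?pE_ge0 ?ind0.
  rewrite ge0_integralZl //; last 2 first.
  - by apply/measurable_EFinP; apply: measurable_funM => //; exact: mind.
  - by move=> z _; rewrite lee_fin mulr_ge0 ?pE_ge0 ?ind0.
  have := graph_int sl lG cK lK x1 MM1 G1 (@pE_cont _ _ _ _ S) (pE_ge0 S) mB0.
  rewrite hB0 IEE -!EFinM => hle.
  rewrite lte_mul_pinfty //; exact: le_lt_trans hle (ltry _).
have P := patch_Phit us oA' sl (ex_intro _ K (And3 cK KA' lK)) goo hA hl hd hc.
apply: (le_trans P); rewrite EFinD leeD2l //.
set U := \big[setU/set0]_(i <- s) A_ i.
have mU : measurable U by apply: open_big_measurable => i /hA[].
have mD : measurable (A' `\` U) by exact: measurableD.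
have md : measurable_fun setT (fun z : Rd R n.+1 =>
    (dens S w (fun z => q (l z)) (grad (fun z => q (l z))) z)%:E).
  apply/measurable_EFinP; apply: measurable_dens; first exact: smooth_measurable.
  exact: smooth_measurable_grad.
pose f1 (z : Rd R n.+1) : \bar R := (\1_B0 (base M1 x1 z) * pT S h (l z))%:E.
pose f2 (z : Rd R n.+1) : \bar R := (\1_B1 (base M1 x1 z) * pE S (l z))%:E.
pose f3 (z : Rd R n.+1) : \bar R := (\1_B2 (base M2 x2 z) * pE S (l z))%:E.
have mf1 : measurable_fun setT f1 by apply/measurable_EFinP; apply: measurable_funM => //; exact: mind.
have mf2 : measurable_fun setT f2 by apply/measurable_EFinP; apply: measurable_funM => //; exact: mind.
have mf3 : measurable_fun setT f3 by apply/measurable_EFinP; apply: measurable_funM => //; exact: mind.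
have f10 z : (0 <= f1 z)%E by rewrite lee_fin mulr_ge0 ?pT_ge0 ?ind0.
have f20 z : (0 <= f2 z)%E by rewrite lee_fin mulr_ge0 ?pE_ge0 ?ind0.
have f30 z : (0 <= f3 z)%E by rewrite lee_fin mulr_ge0 ?pE_ge0 ?ind0.
have I1 : (\int[muRd n.+1]_z f1 z <= (2 * (b0 * tail S h))%:E)%E.
  have := graph_int sl lG cK lK x1 MM1 G1 (@pT_cont _ _ _ _ S h) (pT_ge0 S h) mB0.
  by rewrite hB0 tailE -!EFinM.
have IE0 := IE_ge0 S.
have I2 : (\int[muRd n.+1]_z f2 z <= (2 * (b1 * IE S))%:E)%E.
  have := graph_int sl lG cK lK x1 MM1 G1 (@pE_cont _ _ _ _ S) (pE_ge0 S) mB1.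
  move=> h2; apply: (le_trans h2); rewrite IEE !EFinM lee_wpmul2l // lee_wpmul2r //.
have I3 : (\int[muRd n.+1]_z f3 z <= (2 * (b2 * IE S))%:E)%E.
  have := graph_int sl lG cK lK x2 MM2 G2 (@pE_cont _ _ _ _ S) (pE_ge0 S) mB2.
  move=> h2; apply: (le_trans h2); rewrite IEE !EFinM lee_wpmul2l // lee_wpmul2r //.
apply: (@le_trans _ _ (\int[muRd n.+1]_z (4%:E * (f1 z + (f2 z + f3 z))))%E); last first.
  rewrite ge0_integralZl //; last 2 first.
  - by apply: emeasurable_funD => //; apply: emeasurable_funD.
  - by move=> z _; rewrite !adde_ge0.
  rewrite ge0_integralD //; last 2 first.
  - by move=> z _; rewrite adde_ge0.
  - exact: emeasurable_funD.
  rewrite ge0_integralD //.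
  apply: (@le_trans _ _ (4%:E * ((2 * (b0 * tail S h))%:E +
     ((2 * (b1 * IE S))%:E + (2 * (b2 * IE S))%:E)))%E).
    by rewrite lee_wpmul2l // leeD // leeD.
  by rewrite -!EFinD -EFinM lee_fin; nra.
have mDZ' : measurable ((A' `\` U) `\` Z) by exact: measurableD.
rewrite (ge0_negligible_integral mZ mD (measurable_funTS md) _ Z0); last first.
  by move=> z _; rewrite lee_fin dens_ge0.
rewrite integral_mkcond; apply: ge0_le_integral => //.
- by move=> z _; rewrite patchE; case: ifP => // _; rewrite lee_fin dens_ge0.
- by apply: (measurable_restrictT _ mDZ').1; exact: measurable_funTS.
- by apply: measurable_funeM; do !apply: emeasurable_funD => //.
move=> z _; rewrite patchE; case: ifPn => [/set_mem[[A'z nU] nZ]|_]; last first.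
  by rewrite mule_ge0 // !adde_ge0.
have nA i : i \in s -> ~ A_ i z.
  by move=> is_ Aiz; apply: nU; exact: (mem_bigsetU is_).
apply: (@le_trans _ _ (4 * pE S (l z))%:E); first by rewrite lee_fin; exact: dens_q_le lG (G4 z).
rewrite EFinM lee_wpmul2l //.
have [hl1|[B1z|B2z]] := hout z A'z nA nZ.
- apply: (@le_trans _ _ (f1 z)); last by rewrite leeDl // adde_ge0.
  by rewrite lee_fin indicE (mem_set (hA' _ A'z)) mul1r /pT cutoff1 // mulr1.
- apply: (@le_trans _ _ (f2 z)); last by rewrite (le_trans (leeDl _ (f30 z))) // leeDr.
  by rewrite lee_fin indicE (mem_set B1z) mul1r.
- apply: (@le_trans _ _ (f3 z)); last by rewrite (le_trans (leeDr _ (f20 z))) // leeDr.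
  by rewrite lee_fin indicE (mem_set B2z) mul1r.
Qed.

End master.

(** * Measurability of the minimal energy *)

Import HBNNSimple.

Section separability.
Context {R : realType} {n : nat}.
Local Notation m := (@muRd R n).

Definition rbox (ab : 'rV[rat]_n * 'rV[rat]_n) : set (Rd R n) :=
  [set z | forall i, ratr (ab.1 ord0 i) < (z : 'rV[R]_n) ord0 i < ratr (ab.2 ord0 i)].

Lemma measurable_rbox ab : measurable (rbox ab).
Proof.
rewrite (_ : rbox ab = \bigcap_(i in [set: 'I_n])
   ((fun z : Rd R n => (z : 'rV[R]_n) ord0 i) @^-1` `]ratr (ab.1 ord0 i), ratr (ab.2 ord0 i)[)).
  apply: fin_bigcap_measurable => // i _; rewrite -[X in measurable X]setTI.
  exact: (measurable_coord i).
apply/seteqP; split => z /= h i; first by move=> _; rewrite /= in_itv /=; exact: h.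
by have := h i I; rewrite /= in_itv.
Qed.

Lemma rbox_setI : setI_closed (range rbox).
Proof.
move=> _ _ [[a b] _ <-] [[a' b'] _ <-].
exists (\row_i Num.max (a ord0 i) (a' ord0 i), \row_i Num.min (b ord0 i) (b' ord0 i)) => //.
have rM (x y : rat) (t : R) : (ratr (Num.max x y) < t) = (ratr x < t) && (ratr y < t).
  rewrite /Num.max; case: ifPn => [xy|]; last rewrite -leNgt => yx.
    apply/idP/andP => [h|[]//]; split => //; apply: le_lt_trans h; by rewrite ler_rat ltW.
  apply/idP/andP => [h|[]//]; split => //; apply: le_lt_trans h; by rewrite ler_rat.
have rm (x y : rat) (t : R) : (t < ratr (Num.min x y)) = (t < ratr x) && (t < ratr y).
  rewrite /Num.min; case: ifPn => [xy|]; last rewrite -leNgt => yx.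
    apply/idP/andP => [h|[]//]; split => //; apply: (lt_le_trans h); by rewrite ler_rat ltW.
  apply/idP/andP => [h|[]//]; split => //; apply: (lt_le_trans h); by rewrite ler_rat.
apply/seteqP; split => z /= => [h|[h1 h2] i].
  by split => i; have := h i; rewrite !mxE rM rm => /andP[/andP[p1 p2] /andP[p3 p4]]; apply/andP.
by have /andP[p1 p2] := h1 i; have /andP[p3 p4] := h2 i; rewrite !mxE rM rm p1 p2 p3 p4.
Qed.

Lemma rat_above (t u : R) : t < u -> exists c : rat, t < ratr c <= u.
Proof.
move=> tu; have [c] := rat_in_itvoo tu; rewrite in_itv /= => /andP[h1 h2].
by exists c; rewrite h1 ltW.
Qed.

Lemma rbox_gen : @measurable _ (Rd R n) = <<s range rbox >>.
Proof.
apply/seteqP; split; last first.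
  apply: smallest_sub; first exact: sigma_algebra_measurable.
  by move=> _ [ab _ <-]; exact: measurable_rbox.
pose X := g_sigma_algebraType (range rbox).
have mid : measurable_fun setT (fun x : X => (x : 'rV[R]_n) : Rd R n).
  apply: measurable_fun_rV => i.
  apply: (measurability _ (RGenInftyO.measurableE R)) => _ [_ [a ->] <-].
  rewrite setTI.
  pose F (ab : 'rV[rat]_n * 'rV[rat]_n) : set X :=
    if ratr (ab.2 ord0 i) <= a then rbox ab else set0.
  rewrite (_ : (fun x : X => (x : 'rV[R]_n) ord0 i) @^-1` `]-oo, a[%classic = \bigcup_ab F ab).
    apply: countable_bigcupT_measurable => // ab; rewrite /F; case: ifP => _; last exact: measurable0.
    by apply: sub_sigma_algebra; exists ab.
  apply/seteqP; split => z /=; rewrite in_itv /=.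
    move=> za.
    have hl j : exists c : rat, z ord0 j - 1 < ratr c < z ord0 j.
      have [|c] := @rat_in_itvoo R (z ord0 j - 1) (z ord0 j); first lra.
      by rewrite in_itv /= => h; exists c.
    have hu j : exists c : rat, z ord0 j < ratr c <= (if j == i then a else z ord0 j + 1).
      by apply: rat_above; case: eqP => [->//|_]; lra.
    have /choice[cl hcl] := hl; have /choice[cu hcu] := hu.
    exists (\row_j cl j, \row_j cu j) => //; rewrite /F /= mxE.
    have := hcu i; rewrite eqxx => /andP[_ ->] j /=; rewrite !mxE.
    by have /andP[_ ->] := hcl j; have /andP[-> _] := hcu j.
  move=> [ab _]; rewrite /F; case: ifPn => // h /(_ i) /andP[_ h2].
  exact: lt_le_trans h2 h.
by move=> B mB; have := mid measurableT B mB; rewrite setTI.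
Qed.

(** Rational combinations of indicators of rational boxes: a countable family, indexed by finite
    sequences, that is dense in [L^2] of a bounded set. *)
Definition step (c : seq (rat * ('rV[rat]_n * 'rV[rat]_n))) (z : Rd R n) : R :=
  \sum_(p <- c) ratr p.1 * \1_(rbox p.2) z.

Lemma measurable_step c : measurable_fun setT (step c).
Proof.
apply: measurable_sum => p; apply: measurable_funM => //.
by apply: measurable_indic; exact: measurable_rbox.
Qed.

Lemma step_bound c : exists2 C : R, 0 <= C & forall z, `|step c z| <= C.
Proof.
elim: c => [|p c [C C0 h]]; first by exists 0 => // z; rewrite /step big_nil normr0.
exists (`|ratr p.1| + C); first by rewrite addr_ge0.
move=> z; rewrite /step big_cons; apply: le_trans (ler_normD _ _) _.
apply: lerD; last exact: h.
by rewrite normrM ler_piMr // indicE; case: (_ \in _); rewrite ?normr1 ?normr0.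
Qed.

Implicit Types f g h : Rd R n -> R.

Variable A : set (Rd R n).
Hypothesis mA : measurable A.
Hypothesis Aoo : (m A < +oo)%E.
Hypothesis Abd : exists ab, A `<=` rbox ab.

Definition L2d (f g : Rd R n -> R) : \bar R := (\int[m]_(z in A) ((f z - g z) ^+ 2)%:E)%E.

Lemma L2d_ge0 f g : (0 <= L2d f g)%E.
Proof. by apply: integral_ge0 => z _; rewrite lee_fin sqr_ge0. Qed.

Lemma measurable_L2 (f g : Rd R n -> R) : measurable_fun setT f -> measurable_fun setT g ->
  measurable_fun A (fun z => ((f z - g z) ^+ 2)%:E).
Proof.
move=> mf mg; apply/measurable_EFinP/measurable_funTS; apply: measurable_funX.
exact: measurable_funB.
Qed.

(* a version of the triangle inequality in which squares need no roots *)
Lemma L2d_tri f g h (k : Rd R n -> R) : measurable_fun setT f -> measurable_fun setT g ->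
  measurable_fun setT h -> measurable_fun setT k ->
  (L2d (fun z => f z + g z)%R (fun z => h z + k z)%R <= 2%:E * L2d f h + 2%:E * L2d g k)%E.
Proof.
move=> mf mg mh mk; rewrite /L2d -!ge0_integralZl //; try exact: measurable_L2;
  try (by move=> z _; rewrite lee_fin sqr_ge0).
rewrite -ge0_integralD //; last first.
- by apply: measurable_funeM; exact: measurable_L2.
- by move=> z _; rewrite -EFinM lee_fin mulr_ge0 ?sqr_ge0.
- by apply: measurable_funeM; exact: measurable_L2.
- by move=> z _; rewrite -EFinM lee_fin mulr_ge0 ?sqr_ge0.
apply: ge0_le_integral => //.
- by move=> z _; rewrite lee_fin sqr_ge0.
- by apply: measurable_L2; exact: measurable_funD.
- by apply: emeasurable_funD; apply: measurable_funeM; exact: measurable_L2.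
- move=> z _; rewrite -!EFinM -EFinD lee_fin.
  by have := sqr_ge0 (f z - h z - (g z - k z)); nra.
Qed.

(** Measurable functions in the [L^2(A)]-closure of the step functions. The class is enlarged by
    sums, multiples and dominated limits until it contains all of [L^2(A)]. *)
Definition app (f : Rd R n -> R) := measurable_fun setT f /\
  forall eps : R, 0 < eps -> exists c, (L2d f (step c) < eps%:E)%E.

Lemma app_add f g : app f -> app g -> app (fun z => f z + g z).
Proof.
move=> [mf hf] [mg hg]; split; first exact: measurable_funD.
move=> e e0; have e4 : 0 < e / 4 by rewrite divr_gt0.
have [c hc] := hf _ e4; have [c' hc'] := hg _ e4; exists (c ++ c').
rewrite (_ : step _ = fun z => step c z + step c' z); last first.
  by apply/funext => z; rewrite /step big_cat.
apply: le_lt_trans (L2d_tri mf mg (measurable_step c) (measurable_step c')) _.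
have E : e%:E = (2%:E * (e / 4)%:E + 2%:E * (e / 4)%:E)%E.
  by rewrite -!EFinM -EFinD; congr (_%:E); lra.
by rewrite E; apply: lteD; rewrite lte_pmul2l.
Qed.

Lemma app_lim f : measurable_fun setT f ->
  (forall eps : R, 0 < eps -> exists g, app g /\ (L2d f g < eps%:E)%E) -> app f.
Proof.
move=> mf h; split => // e e0; have e4 : 0 < e / 4 by rewrite divr_gt0.
have [g [[mg hg] fg]] := h _ e4; have [c hc] := hg _ e4; exists c.
have mfg : measurable_fun setT (fun z => f z - g z) by exact: measurable_funB.
have := L2d_tri mfg mg (@measurable_cst _ _ (Rd R n) R setT 0) (measurable_step c).
rewrite (_ : L2d (fun z => f z - g z + g z) _ = L2d f (step c)); last first.
  by apply: eq_integral => z _; rewrite subrK add0r.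
rewrite (_ : L2d (fun z => f z - g z) _ = L2d f g); last first.
  by apply: eq_integral => z _; rewrite subr0.
move=> h1; apply: le_lt_trans h1 _.
have E : e%:E = (2%:E * (e / 4)%:E + 2%:E * (e / 4)%:E)%E.
  by rewrite -!EFinM -EFinD; congr (_%:E); lra.
by rewrite E; apply: lteD; rewrite lte_pmul2l.
Qed.

Lemma app_step c : app (step c).
Proof.
split; first exact: measurable_step.
move=> e e0; exists c; rewrite /L2d integral0_eq ?lte_fin //.
by move=> z _; rewrite subrr expr0n.
Qed.

Lemma L2d_scale (a : R) f g : measurable_fun setT f -> measurable_fun setT g ->
  L2d (fun z => a * f z) (fun z => a * g z) = ((a ^+ 2)%:E * L2d f g)%E.
Proof.
move=> mf mg; rewrite /L2d -ge0_integralZl //; first last.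
- by rewrite lee_fin sqr_ge0.
- by move=> z _; rewrite lee_fin sqr_ge0.
- exact: measurable_L2.
by apply: eq_integral => z _; rewrite -EFinM -mulrBr exprMn.
Qed.

Lemma app_scale_step (a : R) c : app (fun z => a * step c z).
Proof.
have ms := measurable_step c.
apply: app_lim; first exact: measurable_funM.
move=> e e0; have [C C0 hC] := step_bound c.
have mAf : m A \is a fin_num by rewrite ge0_fin_numE.
set v := fine (m A); have v0 : 0 <= v by exact: fine_ge0.
(* The coefficient a is replaced by a rational within t: t <= 1 gives t^2 <= t, and C^2 v bounds the
   squared norm of the step function. *)
pose t := Num.min 1 (e / (C ^+ 2 * v + 1)).
have D0 : 0 < C ^+ 2 * v + 1 by rewrite ltr_wpDl // mulr_ge0 ?sqr_ge0.
have t0 : 0 < t by rewrite lt_min ltr01 divr_gt0.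
have [|r] := @rat_in_itvoo R (a - t) a; first lra.
rewrite in_itv /= => /andP[r1 r2].
exists (step [seq (r * p.1, p.2) | p <- c]); split; first exact: app_step.
have E z : step [seq (r * p.1, p.2) | p <- c] z = ratr r * step c z.
  rewrite /step big_map mulr_sumr; apply: eq_bigr => p _ /=.
  by rewrite rmorphM mulrA.
apply: (@le_lt_trans _ _ (\int[m]_(z in A) (cst ((a - ratr r) ^+ 2 * C ^+ 2)%:E) z)%E).
  apply: ge0_le_integral => //.
  - by move=> z _; rewrite lee_fin sqr_ge0.
  - by apply: measurable_L2; [exact: measurable_funM|exact: measurable_step].
  - move=> z _ /=; rewrite lee_fin E -mulrBl exprMn ler_wpM2l ?sqr_ge0 //.
    by rewrite -real_normK ?num_real // lerXn2r ?nnegrE.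
have -> : (\int[m]_(z in A) (cst ((a - ratr r) ^+ 2 * C ^+ 2)%:E) z)%E =
    ((a - ratr r) ^+ 2 * C ^+ 2 * v)%:E by rewrite integral_cst // [RHS]EFinM /v fineK.
rewrite lte_fin.
have tt : t * t <= t by rewrite ler_piMr ?(ltW t0) // ge_min lexx.
have te : t * (C ^+ 2 * v + 1) <= e by rewrite -ler_pdivlMr // ge_min lexx orbT.
have cv : 0 <= C ^+ 2 * v by rewrite mulr_ge0 ?sqr_ge0.
have : (a - ratr r) ^+ 2 <= t by apply: le_trans tt; nra.
rewrite -mulrA; move: ((a - ratr r) ^+ 2) (sqr_ge0 (a - ratr r)) => s; nra.
Qed.

Lemma app_scale (a : R) f : app f -> app (fun z => a * f z).
Proof.
move=> [mf hf]; apply: app_lim; first exact: measurable_funM.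
move=> e e0.
have a1 : 0 < a ^+ 2 + 1 by rewrite ltr_wpDl ?sqr_ge0.
have [|c hc] := hf (e / (a ^+ 2 + 1)); first by rewrite divr_gt0.
exists (fun z => a * step c z); split; first exact: app_scale_step.
rewrite L2d_scale //; last exact: measurable_step.
have [a0|a0] := eqVneq (a ^+ 2) 0; first by rewrite a0 mul0e lte_fin.
have a2 : 0 < a ^+ 2 by rewrite lt_neqAle eq_sym a0 sqr_ge0.
have : ((a ^+ 2)%:E * L2d f (step c) < (a ^+ 2)%:E * (e / (a ^+ 2 + 1))%:E)%E.
  by rewrite lte_pmul2l // lte_fin.
move=> h; apply: (lt_le_trans h); rewrite -EFinM lee_fin mulrA ler_pdivrMr //; nra.
Qed.

Lemma app_sum (I : Type) (s : seq I) (f : I -> Rd R n -> R) :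
  (forall i, app (f i)) -> app (fun z => \sum_(i <- s) f i z).
Proof.
move=> h; elim: s => [|i s IH].
  have := app_step [::]; rewrite (_ : step [::] = fun z => \sum_(i <- [::]) f i z) //.
  by apply/funext => z; rewrite /step !big_nil.
rewrite (_ : (fun z => _) = fun z => f i z + \sum_(i <- s) f i z); first exact: app_add.
by apply/funext => z; rewrite big_cons.
Qed.

Lemma app_eq_on f g : measurable_fun setT g -> (forall z, A z -> f z = g z) -> app f -> app g.
Proof.
move=> mg fg [mf hf]; split => // e e0; have [c hc] := hf _ e0; exists c.
move: hc; congr (_ < _)%E; apply: eq_integral => z /set_mem Az; by rewrite fg.
Qed.

Lemma app_dominated f (g_ : nat -> Rd R n -> R) : measurable_fun setT f ->
  (forall k, app (g_ k)) -> (L2d f (fun=> 0%R) < +oo)%E ->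
  (forall z k, (f z - g_ k z) ^+ 2 <= f z ^+ 2) ->
  (forall z, (fun k => g_ k z) @ \oo --> f z) -> app f.
Proof.
move=> mf ag f2 dom cg; apply: app_lim => // e e0.
have mg k : measurable_fun setT (g_ k) by have [] := ag k.
have i2 : m.-integrable A (fun z => (f z ^+ 2)%:E).
  apply/integrableP; split; first by apply/measurable_EFinP/measurable_funTS/measurable_funX.
  apply: le_lt_trans f2; rewrite /L2d; apply: ge0_le_integral => //.
  - apply: measurableT_comp => //; by apply/measurable_EFinP/measurable_funTS/measurable_funX.
  - by apply: measurable_L2 => //; exact: measurable_cst.
  - by move=> z _; rewrite subr0 gee0_abs // lee_fin sqr_ge0.
have [||_ _ c] := @dominated_convergence _ _ _ m A mA
  (fun k z => ((f z - g_ k z) ^+ 2)%:E) (cst 0)%E (fun z => (f z ^+ 2)%:E)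
  (fun k => measurable_L2 mf (mg k)) (measurable_cst _) _ i2 _.
- apply: aeW => z _; apply: cvg_EFin; first by near=> k.
  have h : (fun k => f z - g_ k z) @ \oo --> 0.
    by rewrite -[X in _ --> X](subrr (f z)); apply: cvgB; [exact: cvg_cst|exact: cg].
  rewrite (_ : fine \o _ = fun k => (f z - g_ k z) * (f z - g_ k z)); last first.
    by apply/funext => k /=; rewrite expr2.
  by have hh := cvgM h h; rewrite mulr0 in hh; exact: (hh _).
- apply: aeW => z k _; rewrite gee0_abs; last by rewrite lee_fin sqr_ge0.
  by rewrite lee_fin dom.
rewrite integral0 in c.
have c2 : (fun k => fine (L2d f (g_ k))) @ \oo --> (0 : R) by exact: (fine_cvg c).
have [k _ /(_ k (leqnn k)) /= hk] := cvgr_lt _ c2 e e0.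
exists (g_ k); split => //; move: hk; rewrite -lte_fin fineK //.
rewrite ge0_fin_numE ?L2d_ge0 //; apply: le_lt_trans f2.
apply: ge0_le_integral => //.
- by move=> z _; rewrite lee_fin sqr_ge0.
- exact: measurable_L2.
- by apply: measurable_L2 => //; exact: measurable_cst.
- by move=> z _; rewrite subr0 lee_fin dom.
Unshelve. all: by end_near. Qed.

(** Dynkin's argument: rational boxes are stable under intersection and generate the Borel sets. The
    constant 1 is reached because [A] lies in one rational box, complements by subtraction, disjoint
    unions by dominated convergence. *)
Lemma app_indic (B : set (Rd R n)) : measurable B -> app (\1_B).
Proof.
move=> mB; move: (mB); rewrite rbox_gen.
have mi (C : set (Rd R n)) : measurable C -> measurable_fun setT (\1_C : Rd R n -> R).
  exact: measurable_indic.
have box1 ab : app (\1_(rbox ab)).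
  have := app_step [:: (1%:Q, ab)]; rewrite (_ : step _ = \1_(rbox ab)) //.
  by apply/funext => z; rewrite /step big_seq1 /= rmorph1 mul1r.
have one : app (\1_setT).
  have [ab hab] := Abd; apply: (app_eq_on _ _ (box1 ab)); first exact: mi.
  by move=> z /hab h; rewrite !indicE !mem_set.
apply: (@dynkin_induction _ (Rd R n) _ (fun C => app (\1_C)) rbox_gen rbox_setI) => //.
- by move=> _ [ab _ <-].
- move=> C mC aC; apply: (app_eq_on _ _ (app_add one (app_scale (-1) aC))).
    by apply: mi; exact: measurableC.
  move=> z _; rewrite !indicE in_setC in_setT mulN1r.
  by case: (z \in C); rewrite ?subr0 ?subrr.
move=> F mF tF aF.
have sumF z j k : F j z -> \sum_(i <- index_iota 0 k) (\1_(F i) z : R) = (j < k)%N%:R.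
  move=> Fj; rewrite big_mkord.
  have Fi i : (\1_(F i) z : R) = (i == j)%:R.
    rewrite indicE; congr (nat_of_bool _)%:R; apply/idP/eqP => [/set_mem Fi|->]; last exact: mem_set.
    by apply: contrapT => /eqP ij; have /trivIsetP /(_ i j I I ij) := tF;
       move/seteqP => [/(_ z (conj Fi Fj))].
  under eq_bigr do rewrite Fi.
  case: ltnP => jk; last first.
    by rewrite big1 // => i _; rewrite (ltn_eqF (leq_trans (ltn_ord i) jk)).
  rewrite (bigD1 (Ordinal jk)) //= eqxx big1 ?addr0 // => i ij.
  by case: eqP => // ijE; move: ij; rewrite -val_eqE /= ijE eqxx.
apply: (@app_dominated _ (fun k z => \sum_(i <- index_iota 0 k) \1_(F i) z)).
- by apply: mi; exact: bigcupT_measurable.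
- by move=> k; exact: app_sum.
- apply: (@le_lt_trans _ _ (\int[m]_(z in A) (cst 1%:E) z)%E); last first.
    by rewrite integral_cst // mul1e.
  apply: ge0_le_integral => //.
  - by apply: measurable_L2; [apply: mi; exact: bigcupT_measurable|exact: measurable_cst].
  - move=> z _; rewrite subr0 lee_fin indicE; case: (_ \in _); by rewrite ?expr1n ?expr0n.
- move=> z k; have [[j Fj]|nF] := pselect (exists j, F j z).
    rewrite (sumF z j k Fj) indicE mem_set; last by exists j.
    by case: (j < k)%N; rewrite ?subrr ?subr0 ?expr1n ?expr0n ?ler01.
  rewrite big1 ?subr0 // => i _; rewrite indicE memNset // => Fi.
  by apply: nF; exists i.
- move=> z; have [[j Fj]|nF] := pselect (exists j, F j z).
    apply: cvg_near_cst; near=> k; rewrite (sumF z j k Fj) indicE mem_set; last by exists j.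
    by have -> : (j < k)%N by near: k; exact: nbhs_infty_gt.
  apply: cvg_near_cst; near=> k; rewrite big1 ?indicE ?memNset //.
    by move=> [i _ Fi]; apply: nF; exists i.
  by move=> i _; rewrite indicE memNset // => Fi; apply: nF; exists i.
Unshelve. all: by end_near. Qed.

Lemma app_ge0 (f : Rd R n -> R) : measurable_fun setT f -> (forall z, 0 <= f z) ->
  (L2d f (fun=> 0%R) < +oo)%E -> app f.
Proof.
move=> mf f0 f2.
have mEf : measurable_fun setT (EFin \o f) by exact/measurable_EFinP.
pose g := nnsfun_approx measurableT mEf.
have Ef0 z : [set: Rd R n] z -> (0 <= (EFin \o f) z)%E by move=> _; rewrite /= lee_fin.
have gf i z : g i z <= f z.
  by have := le_approx i Ef0 (I : [set: Rd R n] z); rewrite -lee_fin /g nnsfun_approxE.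
apply: (@app_dominated _ (fun i z => g i z)) => //.
- move=> i.
  have -> : (fun z => g i z) = _ := funext (fimfunEord (g i)).
  by apply: app_sum => y; apply: app_scale; apply: app_indic.
- move=> z i; apply: lerXn2r; rewrite ?nnegrE ?subr_ge0 //.
  by rewrite lerBlDr lerDl; exact: fun_ge0.
- move=> z; have := cvg_nnsfun_approx measurableT mEf Ef0 (I : [set: Rd R n] z).
  by move/fine_cvg.
Qed.

Lemma app_L2 (f : Rd R n -> R) : measurable_fun setT f ->
  (L2d f (fun=> 0%R) < +oo)%E -> app f.
Proof.
move=> mf f2.
have mp : measurable_fun setT (fun z => Num.max (f z) 0).
  by apply: measurable_maxr => //; exact: measurable_cst.
have mn : measurable_fun setT (fun z => Num.max (- f z) 0).
  by apply: measurable_maxr; [exact: measurableT_comp|exact: measurable_cst].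
have m0 : measurable_fun setT (fun _ : Rd R n => (0 : R)) by exact: measurable_cst.
have le2 h : measurable_fun setT h -> (forall z, h z ^+ 2 <= f z ^+ 2) ->
    (L2d h (fun=> 0%R) < +oo)%E.
  move=> mh hf; apply: le_lt_trans f2; apply: ge0_le_integral => //.
  - by move=> z _; rewrite lee_fin sqr_ge0.
  - exact: measurable_L2.
  - exact: measurable_L2.
  - by move=> z _; rewrite !subr0 lee_fin.
have ap : app (fun z => Num.max (f z) 0).
  apply: app_ge0 => //; first by move=> z; rewrite le_max lexx orbT.
  apply: le2 => // z; rewrite /Num.max; case: ifP => // _; by rewrite expr0n sqr_ge0.
have an : app (fun z => Num.max (- f z) 0).
  apply: app_ge0 => //; first by move=> z; rewrite le_max lexx orbT.
  apply: le2 => // z; rewrite /Num.max; case: ifP => _; by rewrite ?sqrrN // expr0n sqr_ge0.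
apply: (app_eq_on mf _ (app_add ap (app_scale (-1) an))) => z _.
by rewrite /Num.max mulN1r oppr_lt0; case: ltrgt0P; lra.
Qed.

End separability.

(** * Reduction of the infimum to countably many competitors *)

Section Phit_measurable.
Context {R : realType} {n : nat} {dT : measure_display} {T : measurableType dT}.
Variable S : model R n T.
Local Notation m := (@muRd R n).
Notation adm := (admissible (mq S)).
Notation Ph := (Phit (mPhi S) (mtau S) (mW S) (mq S)).
Notation En := (energy (mPhi S) (mtau S) (mW S)).
Local Notation ugT := (('rV[R]_n -> R) * ('rV[R]_n -> 'rV[R]_n))%type.

(** The energy depends on u only through W(u), so W(u) itself is component 0 and no modulus of
    continuity of [W] enters; the other components are those of the gradient. *)
Definition comp (ug : ugT) (i : 'I_n.+1) : Rd R n -> R :=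
  if unlift ord0 i is Some j then fun z => ug.2 z ord0 j else fun z => Wclamp S (ug.1 z).

Lemma comp_sum (ug ug' : ugT) z : \sum_i (comp ug i z - comp ug' i z) ^+ 2 =
  (Wclamp S (ug.1 z) - Wclamp S (ug'.1 z)) ^+ 2 + dotp (ug.2 z - ug'.2 z) (ug.2 z - ug'.2 z).
Proof.
rewrite big_ord_recl /comp unlift_none; congr (_ + _).
by apply: eq_bigr => j _; rewrite liftK !mxE expr2.
Qed.

(** Young's inequality with weight [eta], once for the gradient part and once for the difference of
    the potentials. The coefficients do not depend on w, which is what lets a selection made without
    w serve every w. *)
Lemma dens_near w (ug ug' : ugT) (eta : R) z : 0 < eta ->
  dens S w ug'.1 ug'.2 z <= (1 + eta) * dens S w ug.1 ug.2 z + eta +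
    ((1 + eta^-1) * mLam S + eta^-1) * \sum_i (comp ug i z - comp ug' i z) ^+ 2.
Proof.
move=> e0; have L0 := mLam0 S; rewrite comp_sum /dens.
have := hom_ext_lip (mPhiF S (mtau S z w)) (ug'.2 z) (ug.2 z).
have := hom_ext_ge0 (mPhiF S (mtau S z w)) (ug'.2 z).
have := hom_ext_ge0 (mPhiF S (mtau S z w)) (ug.2 z).
rewrite -/(phiw (mPhi S) (mtau S) w z _) -/(phiw (mPhi S) (mtau S) w z _).
rewrite -enormN opprB.
set f := phiw _ _ _ _ (ug.2 z); set f' := phiw _ _ _ _ (ug'.2 z) => f0 f'0.
set D := dotp _ _; set s := Num.sqrt _ * _ => ff.
have sD : s ^+ 2 = mLam S * D by rewrite /s exprMn sqr_sqrtr ?ltW // enorm_sq.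
have s0 : 0 <= s by rewrite mulr_ge0 ?sqrtr_ge0 ?enorm_ge0.
have D0 : 0 <= D by exact: dotp_ge0.
set a := Wclamp S (ug.1 z); set a' := Wclamp S (ug'.1 z).
have a0 : 0 <= a by exact: Wclamp_ge0.
set v := eta^-1; have v0 : 0 < v by rewrite invr_gt0.
have ev : eta * v = 1 by rewrite divff // gt_eqF.
have f2 : f' ^+ 2 <= (1 + eta) * f ^+ 2 + (1 + v) * s ^+ 2.
  apply: (@le_trans _ _ ((f + s) ^+ 2)); first by rewrite lerXn2r ?nnegrE // addr_ge0.
  have : 0 <= v * (eta * f - s) ^+ 2 by rewrite mulr_ge0 ?sqr_ge0 // ltW.
  have -> : v * (eta * f - s) ^+ 2 = (eta * v) * eta * f ^+ 2 - 2 * (eta * v) * f * s + v * s ^+ 2 by ring.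
  by rewrite ev; nra.
have W2 : a' <= a + eta + v * (a - a') ^+ 2.
  have : 0 <= v * (eta - (a' - a) / 2) ^+ 2 by rewrite mulr_ge0 ?sqr_ge0 // ltW.
  have -> : v * (eta - (a' - a) / 2) ^+ 2 =
    (eta * v) * eta - (eta * v) * (a' - a) + v * (a - a') ^+ 2 / 4 by field.
  rewrite ev; have : 0 <= v * (a - a') ^+ 2 by rewrite mulr_ge0 ?sqr_ge0 // ltW.
  by lra.
rewrite sD in f2.
have v1 : 0 < 1 + v by lra.
have h1 : 0 <= ((1 + v) * mLam S) * (a - a') ^+ 2.
  by apply: mulr_ge0; [apply: mulr_ge0; exact: ltW|exact: sqr_ge0].
have h2 : 0 <= v * D by rewrite mulr_ge0 // ltW.
have h3 : 0 <= (1 + v) * mLam S * D by apply: mulr_ge0 => //; apply: mulr_ge0; exact: ltW.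
have h4 : 0 <= eta * a by rewrite mulr_ge0 // ltW.
move: f2 W2 h1 h2 h3 h4; rewrite !mulrDl !mulrDr !mul1r; lra.
Qed.

Variables (A : set (Rd R n)) (e x : 'rV[R]_n).
Hypothesis oA : open (A : set 'rV[R]_n).
Hypothesis Aoo : (m A < +oo)%E.
Hypothesis Abd : exists ab, A `<=` @rbox R n ab.

Let mA : measurable A. Proof. exact: open_measurableRd. Qed.

Lemma measurable_comp (ug : ugT) i : adm e x A ug.1 ug.2 -> measurable_fun setT (comp ug i).
Proof.
move=> a; rewrite /comp; case: unliftP => [j|] _.
  exact: (measurableT_comp (measurable_coord j) (adm_measurable_g a)).
exact: (measurableT_comp (continuous_measurable_fun (@Wclamp_cont _ _ _ _ S)) (adm_measurable_u a)).
Qed.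

Lemma comp_L2 (ug : ugT) i : adm e x A ug.1 ug.2 -> (L2d A (comp ug i) (fun=> 0%R) < +oo)%E.
Proof.
move=> a; have mc := measurable_comp i a.
have mc2 : measurable_fun A (fun z => ((comp ug i z - 0) ^+ 2)%:E).
  by apply: measurable_L2 => //; exact: measurable_cst.
case: (unliftP ord0 i) => [j ij|i0].
  have [_ [_ [_ [+ _]]]] := a; rewrite intAE //; last 2 first.
  - by apply: measurable_funTS; apply: measurable_dotp2; exact: adm_measurable_g a.
  - by move=> z _; exact: dotp_ge0.
  apply: le_lt_trans; apply: ge0_le_integral => //.
  - by move=> z _; rewrite lee_fin sqr_ge0.
  - apply/measurable_EFinP/measurable_funTS; apply: measurable_dotp2; exact: adm_measurable_g a.
  - move=> z _; rewrite lee_fin subr0 /comp ij liftK /dotp (bigD1 j) //= expr2 lerDl.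
    by apply: sumr_ge0 => k _; rewrite -expr2 sqr_ge0.
have [C C0 hC] := Wclamp_bounded S.
apply: (@le_lt_trans _ _ (\int[m]_(z in A) (cst (C ^+ 2)%:E) z)%E).
  apply: ge0_le_integral => //.
  - by move=> z _; rewrite lee_fin sqr_ge0.
  - move=> z _; rewrite /= lee_fin subr0 /comp i0 unlift_none lerXn2r ?nnegrE ?Wclamp_ge0 //.
    exact: ltW.
rewrite integral_cst //; apply: lte_mul_pinfty => //; rewrite lee_fin sqr_ge0 //.
Qed.

Lemma energy_near w (ug ug' : ugT) (eta : R) : 0 < eta -> adm e x A ug.1 ug.2 ->
  adm e x A ug'.1 ug'.2 ->
  (En w A ug'.1 ug'.2 <= (1 + eta)%:E * En w A ug.1 ug.2 + eta%:E * m A +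
    ((1 + eta^-1) * mLam S + eta^-1)%:E * \sum_i L2d A (comp ug i) (comp ug' i))%E.
Proof.
move=> e0 a a'; set C := (1 + eta^-1) * mLam S + eta^-1.
have C0 : 0 <= C.
  have := mLam0 S => L0; have v0 : 0 < eta^-1 by rewrite invr_gt0.
  have v1 : 0 < 1 + eta^-1 by lra.
  by apply: addr_ge0; [apply: mulr_ge0; exact: ltW|exact: ltW].
have mu := adm_measurable_u a; have mg := adm_measurable_g a.
have mu' := adm_measurable_u a'; have mg' := adm_measurable_g a'.
have md : measurable_fun A (fun z : Rd R n => (dens S w ug.1 ug.2 z)%:E).
  by apply/measurable_EFinP/measurable_funTS; exact: measurable_dens.
have md' : measurable_fun A (fun z : Rd R n => (dens S w ug'.1 ug'.2 z)%:E).
  by apply/measurable_EFinP/measurable_funTS; exact: measurable_dens.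
have mc i := measurable_L2 (A := A) (measurable_comp i a) (measurable_comp i a').
have msum : measurable_fun A (fun z => (\sum_i ((comp ug i z - comp ug' i z) ^+ 2)%:E)%E).
  exact: emeasurable_sum.
have d0 (vg : ugT) z : A z -> (0 <= (dens S w vg.1 vg.2 z)%:E)%E by rewrite lee_fin dens_ge0.
rewrite !energyE //; [|by have [_ [_ []]] := a|by have [_ [_ []]] := a'].
have -> : (\sum_i L2d A (comp ug i) (comp ug' i) =
   \int[m]_(z in A) \sum_i ((comp ug i z - comp ug' i z) ^+ 2)%:E)%E.
  by rewrite ge0_integral_sum // => i z _; rewrite lee_fin sqr_ge0.
have -> : (eta%:E * m A = \int[m]_(z in A) (cst eta%:E) z)%E by rewrite integral_cst.
rewrite -ge0_integralZl //; last 2 first.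
- exact: d0.
- by rewrite lee_fin addr_ge0 // ltW.
rewrite -ge0_integralZl //; last first.
- by move=> z _; apply: sume_ge0 => i _; rewrite lee_fin sqr_ge0.
have p1 z : A z -> (0 <= (1 + eta)%:E * (dens S w ug.1 ug.2 z)%:E)%E.
  by move=> Az; rewrite mule_ge0 // ?d0 // lee_fin addr_ge0 // ltW.
have p2 z : A z -> (0 <= C%:E * \sum_i ((comp ug i z - comp ug' i z) ^+ 2)%:E)%E.
  by move=> Az; rewrite mule_ge0 //; apply: sume_ge0 => i _; rewrite lee_fin sqr_ge0.
have p3 z : A z -> (0 <= cst eta%:E z :> \bar R)%E by move=> _; rewrite lee_fin ltW.
rewrite -ge0_integralD //; last by apply: measurable_funeM.
rewrite -ge0_integralD //; last first.
- exact: measurable_funeM.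
- by apply: emeasurable_funD => //; exact: measurable_funeM.
- by move=> z Az; rewrite adde_ge0 // ?p1 // lee_fin ltW.
apply: ge0_le_integral => //.
- exact: d0.
- by do 2?[apply: emeasurable_funD => //]; exact: measurable_funeM.
- move=> z _; rewrite sumEFin -!EFinM -!EFinD lee_fin.
  exact: dens_near.
Qed.

Lemma L2d_sub (f g h : Rd R n -> R) : measurable_fun setT f -> measurable_fun setT g ->
  measurable_fun setT h -> (L2d A f g <= 2%:E * L2d A f h + 2%:E * L2d A g h)%E.
Proof.
move=> mf mg mh.
have := L2d_tri mA mf mh mh mg.
rewrite (_ : L2d A (fun z => f z + h z) _ = L2d A f g); last first.
  by apply: eq_integral => z _; congr (_%:E); ring.
by rewrite (_ : L2d A h g = L2d A g h) //; apply: eq_integral => z _; congr (_%:E); ring.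
Qed.

(** For every tuple of step functions and every precision, one admissible pair near the tuple is
    selected, if there is one, independently of w. A pair almost optimal for a given w is near some
    tuple, and the pair selected there has almost the same energy at this w; so the infimum runs
    over countably many measurable functions. *)
Lemma measurable_Phit : measurable_fun setT (fun w => Ph w e x A).
Proof.
have [[ug0 a0]|na] := pselect (exists ug : ugT, adm e x A ug.1 ug.2); last first.
  rewrite (_ : (fun w => _) = cst +oo%E); first exact: measurable_cst.
  apply/funext => w; rewrite /Phit (_ : [set E | _] = set0) ?ereal_inf0 //.
  by apply/seteqP; split => // E [u [g [a _]]]; apply: na; exists (u, g).
pose J := ({ffun 'I_n.+1 -> seq (rat * ('rV[rat]_n * 'rV[rat]_n))} * nat)%type.
pose P (j : J) (ug : ugT) := adm e x A ug.1 ug.2 /\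
  forall i, (L2d A (comp ug i) (step (j.1 i)) < (j.2.+1%:R^-1)%:E)%E.
(* Where no pair is near [j], the fixed pair [ug0] keeps the selection admissible. *)
have /choice[sel hsel] : forall j : J, exists ug : ugT,
    adm e x A ug.1 ug.2 /\ ((exists ug', P j ug') -> P j ug).
  move=> j; have [[ug hug]|no] := pselect (exists ug', P j ug'); last by exists ug0.
  by exists ug; split => //; case: hug.
apply: (measurability _ (ErealGenInftyO.measurableE R)) => _ [_ [a ->] <-].
rewrite setTI.
rewrite (_ : (fun w => Ph w e x A) @^-1` `]-oo, a%:E[%classic = \bigcup_j ((fun w => En w A (sel j).1 (sel j).2) @^-1` `]-oo, a%:E[)).
  apply: countable_bigcupT_measurable; first exact: countableP.
  move=> j; rewrite -[X in measurable X]setTI.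
  have [aj _] := hsel j.
  apply: measurable_energy => //.
  - exact: adm_measurable_u aj.
  - exact: adm_measurable_g aj.
  - by have [_ [_ []]] := aj.
- exact: emeasurable_itv.
apply/seteqP; split => w /=; rewrite in_itv /=; last first.
  move=> [j _] /=; rewrite in_itv /= => h; apply: le_lt_trans h.
  by apply: ereal_inf_lbound; exists (sel j).1, (sel j).2; split => //; have [] := hsel j.
move=> /ereal_inf_lt[_ [u [g [au ->]]] ha].
pose ug : ugT := (u, g).
have aug : adm e x A ug.1 ug.2 by [].
have E0 : (0 <= En w A u g)%E.
  rewrite energyE //; [|exact: adm_measurable_u au|exact: adm_measurable_g au|by have [_ [_ []]] := au].
  by apply: integral_ge0 => z _; rewrite lee_fin dens_ge0.
have Ef : En w A u g \is a fin_num by rewrite ge0_fin_numE // (lt_trans ha) // ltry.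
have vf : m A \is a fin_num by rewrite ge0_fin_numE.
set E := fine (En w A u g); set v := fine (m A).
have EE : En w A u g = E%:E by rewrite fineK.
have vE : m A = v%:E by rewrite fineK.
have E00 : 0 <= E by rewrite -lee_fin -EE.
have v0 : 0 <= v by rewrite -lee_fin -vE.
have Ea : E < a by rewrite -lte_fin -EE.
(* Then eta (E + v) + eta is half of the gap a - E; the second eta pays for the [L^2] error. *)
pose eta := (a - E) / (2 * (E + v + 1)).
have D0 : 0 < 2 * (E + v + 1) by lra.
have e0 : 0 < eta by rewrite divr_gt0 // subr_gt0.
have etaE : eta * (2 * (E + v + 1)) = a - E by rewrite divfK // gt_eqF.
set C := (1 + eta^-1) * mLam S + eta^-1.
have C0 : 0 < C.
  have L0 := mLam0 S; have i0 : 0 < eta^-1 by rewrite invr_gt0.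
  have v1 : 0 < 1 + eta^-1 by lra.
  by rewrite ltr_wpDl //; apply: mulr_ge0; exact: ltW.
(* There are n+1 components, each within 4/(k+1) by the triangle inequality for squares. *)
pose B := C * (4 * n.+1%:R) + 1.
have B0 : 0 < B by rewrite ltr_wpDl // mulr_ge0 ?ltW // mulr_gt0.
have eB : 0 < eta / B by rewrite divr_gt0.
have [k hk] : exists k : nat, k.+1%:R^-1 < eta / B.
  have [k _ /(_ k (leqnn k))] := near_infty_natSinv_lt (PosNum eB); by exists k.
have kp : 0 < k.+1%:R^-1 :> R by rewrite invr_gt0.
have : forall i, exists c, (L2d A (comp ug i) (step c) < (k.+1%:R^-1)%:E)%E.
  move=> i; have [_ h] := app_L2 mA Aoo Abd (measurable_comp i aug) (comp_L2 i aug).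
  exact: h.
move=> /choice[c hc]; pose j : J := ([ffun i => c i], k).
have Pj : P j ug by split => // i /=; rewrite ffunE.
have [aj /(_ (ex_intro _ ug Pj)) [_ hj]] := hsel j.
exists j => //=; rewrite in_itv /=.
have := @energy_near w ug (sel j) eta e0 aug aj; rewrite EE vE -/C => h.
have hs : (\sum_i L2d A (comp ug i) (comp (sel j) i) <= (4 * n.+1%:R * k.+1%:R^-1)%:E)%E.
  apply: (@le_trans _ _ (\sum_(i < n.+1) (4 * k.+1%:R^-1)%:E)%E).
    apply: lee_sum => i _.
    apply: le_trans (L2d_sub (measurable_comp i aug) (measurable_comp i aj) (measurable_step (c i))) _.
    have -> : ((4 * k.+1%:R^-1)%:E = 2%:E * (k.+1%:R^-1)%:E + 2%:E * (k.+1%:R^-1)%:E :> \bar R)%E.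
      by rewrite -!EFinM -EFinD; congr (_%:E); move: (k.+1%:R^-1) => t; lra.
    apply: leeD; rewrite lee_pmul2l //; apply: ltW; first exact: hc.
    by have := hj i; rewrite /= ffunE.
  by rewrite sumEFin sumr_const card_ord -[X in (X%:E <= _)%E]mulr_natr lee_fin mulrAC.
apply: (le_lt_trans h).
apply: (@le_lt_trans _ _ ((1 + eta) * E + eta * v + C * (4 * n.+1%:R * k.+1%:R^-1))%:E).
  by rewrite !EFinD !EFinM leeD2l // lee_pmul2l // lte_fin.
rewrite lte_fin.
have : C * (4 * n.+1%:R * k.+1%:R^-1) <= B * k.+1%:R^-1.
  have -> : B * k.+1%:R^-1 = C * (4 * n.+1%:R * k.+1%:R^-1) + k.+1%:R^-1.
    by rewrite /B; ring.
  by rewrite lerDl ltW.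
have : B * k.+1%:R^-1 < eta by rewrite mulrC -ltr_pdivlMr.
move: (B * _) (C * _) => t1 t2.
have -> : (1 + eta) * E + eta * v = E + eta * (E + v) by ring.
have : eta * (E + v) = (a - E) / 2 - eta by rewrite -etaE; field.
by move=> -> h1 h2; lra.
Qed.

End Phit_measurable.

(** * Stationarity *)

Section shift.
Context {R : realType} {n : nat}.
Implicit Types (x y z v : 'rV[R]_n) (f : 'rV[R]_n -> R) (A : set (Rd R n)).

Lemma derive_sh y f z v : 'D_v (fun x => f (x + y)) z = 'D_v f (z + y).
Proof.
rewrite /derive; set g1 := fun h => h^-1 *: _; set g2 := fun h => h^-1 *: _.
by suff -> : g1 = g2 by []; apply/funext => h; rewrite /g1 /g2 /= addrA.
Qed.

Lemma derivable_sh y f z v : derivable f (z + y) v -> derivable (fun x => f (x + y)) z v.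
Proof.
rewrite /derivable; set g1 := fun h => h^-1 *: _; set g2 := fun h => h^-1 *: _.
by suff -> : g1 = g2 by []; apply/funext => h; rewrite /g1 /g2 /= addrA.
Qed.

Lemma continuous_sh y f : continuous f -> continuous (fun x => f (x + y)).
Proof.
move=> cf z; apply: (@continuous_comp _ _ _ (fun x : 'rV[R]_n => x + y) f); last exact: cf.
by apply: (@continuousD _ _ _ (fun x : 'rV[R]_n => x) (fun=> y)); [exact: cvg_id|exact: cst_continuous].
Qed.

Lemma Ck_sh y k f : Ck k f -> Ck k (fun x => f (x + y)).
Proof.
elim: k f => [|k IH] f; first exact: continuous_sh.
move=> [cf h]; split; first exact: continuous_sh.
move=> i; have [d c] := h i; split; first by move=> x; exact: derivable_sh.
rewrite (_ : (fun x : 'rV[R]_n => 'D_(bvec i) (fun x => f (x + y)) x) =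
  fun x => ('D_(bvec i) f) (x + y)); first exact: (IH ('D_(bvec i) f)).
by apply/funext => x; rewrite derive_sh.
Qed.

Lemma grad_sh y f z : grad (fun x => f (x + y)) z = grad f (z + y).
Proof. by apply/rowP => i; rewrite !mxE derive_sh. Qed.

Definition trans A y : set (Rd R n) := [set z | A (z - y)].

Lemma measurable_trans A y : measurable A -> measurable (trans A y).
Proof.
by move=> mA; have := measurable_addRd (- y) measurableT mA; rewrite setTI.
Qed.

Lemma Cc_infty_sh y A f : Cc_infty (trans A y) f -> Cc_infty A (fun x => f (x + y)).
Proof.
move=> [sf [K [cK [KA h]]]]; split; first by move=> k; exact: Ck_sh.
exists ((fun z : 'rV[R]_n => z - y) @` K); split.
  apply: continuous_compact => //; apply: continuous_subspaceT => z.
  by apply: (@continuousD _ _ _ (fun x : 'rV[R]_n => x) (fun=> - y)); [exact: cvg_id|exact: cst_continuous].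
split; first by move=> _ [z Kz <-]; exact: KA.
by move=> z nK; apply: h => Kz; apply: nK; exists (z + y) => //; rewrite addrK.
Qed.

Lemma int_trans A y (f : Rd R n -> R) : measurable A -> measurable_fun setT f ->
  (forall z, 0 <= f z) ->
  (\int[muRd n]_(z in A) (f (z + y))%:E = \int[muRd n]_(z in trans A y) (f z)%:E)%E.
Proof.
move=> mA mf f0; have mA' := measurable_trans y mA.
rewrite integral_mkcond [RHS]integral_mkcond.
have mF : measurable_fun setT ((fun z => (f z)%:E) \_ (trans A y)).
  by apply: (measurable_restrictT _ mA').1; apply/measurable_EFinP; exact: measurable_funTS.
rewrite -(muRd_shift y mF); last by move=> z; rewrite patchE; case: ifP => // _; rewrite lee_fin.
apply: eq_integral => z _; rewrite !patchE.
by have -> : (z + y \in trans A y) = (z \in A)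
  by apply/idP/idP => /set_mem h; apply/mem_set; move: h; rewrite /trans /= addrK.
Qed.

Lemma intA_trans A y (f : 'rV[R]_n -> R) : measurable A -> measurable_fun setT (f : Rd R n -> R) ->
  (forall z, 0 <= f z) -> intA A (fun z => f (z + y)) = intA (trans A y) f.
Proof.
move=> mA mf f0; have mA' := measurable_trans y mA.
rewrite !intAE //; last 2 first.
- exact: measurable_funTS.
- by apply: measurable_funTS; exact: (measurableT_comp mf (measurable_addRd y)).
exact: int_trans.
Qed.

End shift.

Section stationarity.
Context {R : realType} {n : nat} {dT : measure_display} {T : measurableType dT}.
Variable S : model R n T.
Notation adm := (admissible (mq S)).
Notation Ph := (Phit (mPhi S) (mtau S) (mW S) (mq S)).

Lemma Tqe_sh (q : R -> R) (e x y z : 'rV[R]_n) : Tqe q e (x + y) (z + y) = Tqe q e x z.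
Proof. by rewrite /Tqe opprD addrACA subrr addr0. Qed.

Lemma Phit_shift_le w e x y (A : set (Rd R n)) : measurable A ->
  (Ph (mtau S y w) e x A <= Ph w e (x + y)%R (trans A y))%E.
Proof.
move=> mA; have mA' := measurable_trans y mA.
apply: le_ereal_inf_tmp => _ [u [g [a ->]]].
have mu := adm_measurable_u a; have mg := adm_measurable_g a.
have may := measurable_addRd y.
pose u' := fun z => u (z + y); pose g' := fun z => g (z + y).
have mu' : measurable_fun setT (u' : Rd R n -> R) by exact: (measurableT_comp mu may).
have mg' : measurable_fun setT (g' : Rd R n -> Rd R n) by exact: (measurableT_comp mg may).
have [_ [_ [u1 [goo [psi [Cpsi [c1 c2]]]]]]] := a.
have u1' z : A z -> -1 <= u' z <= 1 by move=> Az; apply: u1; rewrite /trans /= addrK.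
have mT := smooth_measurable (smooth_Tqe S e (x + y)).
have mT' := smooth_measurable_grad (smooth_Tqe S e (x + y)).
have gT z : grad (Tqe (mq S) e x) z = grad (Tqe (mq S) e (x + y)) (z + y).
  rewrite -(grad_sh y (Tqe (mq S) e (x + y)) z); congr (grad _ z).
  by apply/funext => t; rewrite Tqe_sh.
have a' : adm e x A u' g'.
  split; first exact/borel_funE.
  split; first by move=> i; apply/borel_funE; exact: (measurableT_comp (measurable_coord i) mg').
  split => //; split.
    rewrite (@intA_trans _ _ _ _ (fun z => dotp (g z) (g z))) //.
      exact: measurable_dotp2.
    by move=> z; exact: dotp_ge0.
  exists (fun k z => psi k (z + y)); split; first by move=> k; exact: Cc_infty_sh.
  have mp k := smooth_measurable (Cpsi k).1.
  have mp' k := smooth_measurable_grad (Cpsi k).1.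
  split.
    rewrite [X in X @ _](_ : _ = fun k => intA (trans A y)
      (fun z => (psi k z - (u z - Tqe (mq S) e (x + y) z)) ^+ 2)) //.
    apply/funext => k; rewrite -intA_trans //.
    - by apply: intA_ext => z; rewrite /u' Tqe_sh.
    - by apply: measurable_funX; apply: measurable_funB => //; exact: measurable_funB.
    - by move=> z; exact: sqr_ge0.
  pose G k := fun z : 'rV[R]_n => dotp (grad (psi k) z - (g z - grad (Tqe (mq S) e (x + y)) z))
                   (grad (psi k) z - (g z - grad (Tqe (mq S) e (x + y)) z)).
  have mG k : measurable_fun setT (G k : Rd R n -> R).
    by apply: measurable_dotp2; do 2?[apply: measurable_subRd => //].
  have G0 k z : 0 <= G k z by exact: dotp_ge0.
  have c3 : (fun k => intA A (fun z => G k (z + y))) @ \oo --> 0%E.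
    have -> : (fun k => intA A (fun z => G k (z + y))) = fun k => intA (trans A y) (G k).
      by apply/funext => k; exact: (intA_trans y mA (mG k) (G0 k)).
    exact: c2.
  apply: cvg_trans c3; apply: near_eq_cvg; apply: nearW => k.
  by apply: intA_ext => z; rewrite /G /g' grad_sh gT.
apply: (@le_trans _ _ (energy (mPhi S) (mtau S) (mW S) (mtau S y w) A u' g')).
  by apply: ereal_inf_lbound; exists u', g'.
rewrite !energyE //.
have -> : (\int[muRd n]_(z in A) (dens S (mtau S y w) u' g' z)%:E =
   \int[muRd n]_(z in A) (dens S w u g (z + y))%:E)%E.
  apply: eq_integral => z _; congr (_%:E); rewrite /dens /phiw.
  by have -> : mtau S z (mtau S y w) = mtau S (z + y) w by rewrite mtauD.
rewrite int_trans //; first exact: measurable_dens.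
by move=> z; exact: dens_ge0.
Qed.

(** The reverse inequality is [Phit_shift_le] for the shift by -y. *)
Lemma Phit_shift w e x y (A : set (Rd R n)) : measurable A ->
  Ph (mtau S y w) e x A = Ph w e (x + y) (trans A y).
Proof.
move=> mA; apply/le_anti; rewrite Phit_shift_le //=.
have := @Phit_shift_le (mtau S y w) e (x + y) (- y) (trans A y) (measurable_trans y mA).
have -> : mtau S (- y) (mtau S y w) = w.
  by have := congr1 (@^~ w) (mtauD S (- y) y); rewrite addNr mtau0 /= => <-.
rewrite addrK (_ : trans (trans A y) (- y) = A) //.
by apply/seteqP; split => z; rewrite /trans /= opprK addrK.
Qed.

End stationarity.

(** * Energies on cylinders adapted to a frame *)

Section cylinders.
Context {R : realType} {n : nat} {dT : measure_display} {T : measurableType dT}.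
Variable S : model R n.+1 T.
Notation Ph := (Phit (mPhi S) (mtau S) (mW S) (mq S)).

Definition Fc w (M : 'M[R]_n.+1) x r h : \bar R := Ph w (row ord0 M) x (box M x r h).

Lemma trans_box (M : 'M[R]_n.+1) x y r h : trans (box M x r h) y = box M (x + y) r h.
Proof.
have hz (z : 'rV[R]_n.+1) : z - y - x = z - (x + y) by rewrite opprD addrA addrAC.
by apply/seteqP; split => z; rewrite /trans /= /box /base /co /= hz.
Qed.

Lemma Fc_shift w (M : 'M[R]_n.+1) x y r h : Fc (mtau S y w) M x r h = Fc w M (x + y) r h.
Proof. by rewrite /Fc Phit_shift ?trans_box //; exact: measurable_box. Qed.

Lemma Fc_ge0 w M x r h : (0 <= Fc w M x r h)%E.
Proof.
apply: le_ereal_inf_tmp => _ [u [g [a ->]]]; rewrite energyE.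
- by apply: integral_ge0 => z _; rewrite lee_fin dens_ge0.
- exact: measurable_box.
- exact: adm_measurable_u a.
- exact: adm_measurable_g a.
- by have [_ [_ []]] := a.
Qed.

Lemma row0_unit (M : 'M[R]_n.+1) i : M *m M^T = 1%:M -> dotp (row i M) (row i M) = 1.
Proof.
move=> /matrixP /(_ i i); rewrite !mxE eqxx /= mulr1n => <-.
by apply: eq_bigr => j _; rewrite !mxE.
Qed.

Lemma co_le (M : 'M[R]_n.+1) x z i : M *m M^T = 1%:M -> `|co M x z ord0 i| <= enorm (z - x).
Proof.
move=> MM; rewrite coE; apply: le_trans (cauchy_schwarz _ _) _.
by rewrite [X in _ * X](_ : _ = 1) ?mulr1 // /enorm row0_unit // sqrtr1.
Qed.

Lemma coord_le m (z : 'rV[R]_m) i : `|z ord0 i| <= enorm z.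
Proof.
rewrite -dotp_bvec; apply: le_trans (cauchy_schwarz _ _) _.
by rewrite [X in _ * X](_ : _ = 1) ?mulr1 // /enorm dotp_bvec mxE !eqxx sqrtr1.
Qed.

Lemma enorm_coord m (z : 'rV[R]_m) (c : R) : (forall i, `|z ord0 i| <= c) -> 0 <= c ->
  enorm z <= m%:R * c.
Proof.
move=> h c0; rewrite -(@ler_pXn2r _ 2) ?nnegrE ?enorm_ge0 ?mulr_ge0 // enorm_sq.
apply: (@le_trans _ _ (\sum_(i < m) c ^+ 2)).
  by apply: ler_sum => i _; rewrite -expr2 -real_normK ?num_real // lerXn2r ?nnegrE.
rewrite sumr_const card_ord -[X in X <= _]mulr_natl exprMn ler_wpM2r ?sqr_ge0 //.
by rewrite -natrX ler_nat; case: (m) => // k; rewrite expnS expn1 leq_pmulr.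
Qed.

Lemma enorm_co (M : 'M[R]_n.+1) x z : M *m M^T = 1%:M -> enorm (co M x z) = enorm (z - x).
Proof.
move=> MM; rewrite -{2}(frame_co x z MM) addrC addKr.
by rewrite /enorm dotp_orth.
Qed.

Lemma box_bound (M : 'M[R]_n.+1) x r h z : M *m M^T = 1%:M -> 0 <= r -> 0 <= h ->
  box M x r h z -> enorm (z - x) <= n.+1%:R * (r + h).
Proof.
move=> MM r0 h0 [h1 h2]; rewrite -(enorm_co x z MM); apply: enorm_coord; last by rewrite addr_ge0.
move=> i; case: (unliftP ord0 i) => [j|] ->; last by apply: ltW; lra.
by have := h2 j; rewrite /base mxE; lra.
Qed.

Lemma box_rbox (M : 'M[R]_n.+1) x r h : M *m M^T = 1%:M -> 0 <= r -> 0 <= h ->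
  exists ab, box M x r h `<=` rbox ab.
Proof.
move=> MM r0 h0; set C := n.+1%:R * (r + h) + enorm x.
have hz z i : box M x r h z -> `|z ord0 i| <= C.
  move=> /(box_bound MM r0 h0) hb; apply: le_trans (coord_le _ _) _.
  have -> : z = (z - x) + x by rewrite subrK.
  by apply: le_trans (enormD _ _) _; rewrite lerD2r.
have [c] := @rat_in_itvoo R C (C + 1) ltac:(lra); rewrite in_itv /= => /andP[Cc _].
exists (\row_i (- c), \row_i c) => z /hz hb i /=; rewrite !mxE rmorphN -ltr_norml.
exact: le_lt_trans (hb i) Cc.
Qed.

Lemma measurable_Fc M x r h : M *m M^T = 1%:M -> 0 <= r -> 0 <= h ->
  measurable_fun setT (fun w => Fc w M x r h).
Proof.
move=> MM r0 h0; apply: measurable_Phit.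
- exact: open_box.
- by rewrite mu_box // ltry.
- exact: box_rbox.
Qed.

Lemma planar_smooth (e x : 'rV[R]_n.+1) : smooth (fun z => dotp (z - x) e).
Proof.
move=> k; rewrite (_ : (fun z => _) = fun z => dotp z e + - dotp x e); first exact: Ck_lin.
by apply/funext => z; rewrite dotpBl.
Qed.

Lemma planar_hasgrad (e x : 'rV[R]_n.+1) : hasgrad (fun z => dotp (z - x) e) (fun=> e).
Proof.
rewrite (_ : (fun z => _) = fun z => dotp z e + - dotp x e); first exact: hasgrad_lin.
by apply/funext => z; rewrite dotpBl.
Qed.

(** [master_patch] when all planes coincide: l is the planar coordinate itself, so [K] is empty and
    a single leftover set [B1] suffices. *)
Lemma aligned_patch (I : eqType) (s : seq I) (M : 'M[R]_n.+1) (x : 'rV[R]_n.+1)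
    (x_ : I -> 'rV[R]_n.+1) (r_ h_ : I -> R) (c_ : I -> R) (r h h0 b1 : R)
    (B1 : set (Rd R n)) (Z : set (Rd R n.+1)) w :
  M *m M^T = 1%:M -> 0 <= r -> uniq s ->
  (forall i, i \in s -> box M (x_ i) (r_ i) (h_ i) `<=` box M x r h) ->
  (forall i, i \in s -> dotp (x_ i - x) (row ord0 M) = 0) ->
  (forall i j, i \in s -> j \in s -> i != j ->
     box M (x_ i) (r_ i) (h_ i) `&` box M (x_ j) (r_ j) (h_ j) = set0) ->
  (forall i, i \in s -> (Fc w M (x_ i) (r_ i) (h_ i) < (c_ i)%:E)%E) ->
  measurable B1 -> (muRd n B1 <= b1%:E)%E -> measurable Z -> muRd n.+1 Z = 0%E ->
  (forall z, box M x r h z -> (forall i, i \in s -> ~ box M (x_ i) (r_ i) (h_ i) z) -> ~ Z z ->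
     h0 <= `|dotp (z - x) (row ord0 M)| \/ B1 (base M x z)) ->
  (Fc w M x r h <= (\sum_(i <- s) c_ i + 8 * (r ^+ n * tail S h0 + b1 * IE S))%:E)%E.
Proof.
move=> MM r0 us sub pl disj cost mB1 hB1 mZ Z0 out.
have e1 := row0_unit ord0 MM.
have h1 (z : 'rV[R]_n.+1) : dotp (row ord0 M) (row ord0 M) <= 4 by rewrite e1 (ler1n _ 4).
have h2 (z : 'rV[R]_n.+1) : 2^-1 <= dotp (row ord0 M) (row ord0 M).
  by rewrite e1 invf_le1 ?ltr0n // (ler1n _ 2).
have := @master_patch R n dT T S I s (fun i => box M (x_ i) (r_ i) (h_ i)) (fun=> row ord0 M)
  x_ c_ (row ord0 M) x (box M x r h) (fun z => dotp (z - x) (row ord0 M)) (fun=> row ord0 M)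
  set0 M M x x (cubeRd n r) B1 set0 (r ^+ n) b1 0 h0 Z w us (@open_box R n M x r h)
  (planar_smooth _ _) (planar_hasgrad _ _) h1 (@compact0 _) (@sub0set _ _) (fun _ _ => erefl).
rewrite addr0; apply => //.
- by move=> i is_; split; [exact: open_box|exact: sub].
- move=> i z is_ _; have := pl _ is_; rewrite !dotpBl => /eqP; rewrite subr_eq0 => /eqP ->.
  by [].
- exact: measurable_cubeRd.
- by rewrite muRd_cube.
- by rewrite measure0.
- by move=> z [].
- by move=> z bz nz nZ; have [?|?] := out z bz nz nZ; [left|right; left].
Qed.

(** The planar profile alone is a competitor. With no pieces, the tail term and the term of the full
    base each cost at most 8 IE r^n, whence 16. *)
Lemma planar_bound w M x r h : M *m M^T = 1%:M -> 0 <= r ->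
  (Fc w M x r h <= (16 * IE S * r ^+ n)%:E)%E.
Proof.
move=> MM r0.
have := @aligned_patch nat [::] M x (fun=> x) (fun=> 0) (fun=> 0) (fun=> 0) r h 0 (r ^+ n)
  (cubeRd n r) set0 w MM r0 isT.
rewrite big_nil add0r => H; apply: le_trans (H _ _ _ _ _ _ _ _ _) _ => //.
- exact: measurable_cubeRd.
- by rewrite muRd_cube.
- by move=> z [_ ?] _ _; right.
rewrite lee_fin.
have : tail S 0 <= IE S.
  rewrite -lee_fin -tailE -IEE; apply: ge0_le_integral => //.
  - by move=> t _; rewrite lee_fin pT_ge0.
  - exact: measurable_pT.
  - exact: measurable_pE.
  - by move=> t _; rewrite lee_fin pT_le.
by have := exprn_ge0 n r0; nra.
Qed.

End cylinders.

(** * Lattice cubes and a Vitali selection *)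

Section lattice.
Local Open Scope set_scope.
Variable n : nat.
Definition lat N := {ffun 'I_n -> 'I_N}.
(** Subtraction is truncated, so one summand vanishes and the sum is |a - b|. *)
Definition ndist (a b : nat) := (a - b + (b - a))%N.
Definition lcube N (k : lat N) j : {set lat N} :=
  [set k' : lat N | [forall i, (ndist (k i) (k' i) <= j)%N]].
Definition inside N j : {set lat N} :=
  [set k : lat N | [forall i, (j <= k i)%N && (k i + j < N)%N]].

Lemma card_itvord N lo hi :
  #|[pred a : 'I_N | (lo <= a < hi)%N]| = (minn hi N - lo)%N.
Proof.
rewrite -sum1_card big_mkcond /=.
elim: N => [|N IH]; first by rewrite big_ord0; lia.
rewrite big_ord_recr /= {}IH inE /=; case: ifPn; lia.
Qed.

Lemma card_latbox N (lo hi : 'I_n -> nat) :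
  #|[set k : lat N | [forall i, (lo i <= k i < hi i)%N]]| =
  (\prod_i (minn (hi i) N - lo i))%N.
Proof.
rewrite (_ : #|_| = #|family (fun i => [pred a : 'I_N | (lo i <= a < hi i)%N])|).
  rewrite card_family foldrE big_map big_enum /=.
  by apply: eq_bigr => i _; exact: card_itvord.
apply: eq_card => k; rewrite inE; apply/forallP/familyP => h i; have := h i; by rewrite !inE.
Qed.

Lemma lcube_box N (k : lat N) j :
  lcube k j = [set k' : lat N | [forall i, (k i - j <= k' i < (k i + j).+1)%N]].
Proof.
by apply/setP => k'; rewrite !inE; apply/eq_forallb => i; rewrite /ndist; lia.
Qed.

Lemma card_lcube_le N (k : lat N) j : (#|lcube k j| <= j.*2.+1 ^ n)%N.
Proof.
rewrite lcube_box card_latbox -[X in (_ <= _ ^ X)%N](card_ord n) -prod_nat_const.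
by apply: leq_prod => i _; lia.
Qed.

Lemma card_lcube N (k : lat N) j : k \in inside N j -> #|lcube k j| = (j.*2.+1 ^ n)%N.
Proof.
rewrite inE => /forallP hk.
rewrite lcube_box card_latbox -[X in (_ ^ X)%N](card_ord n) -prod_nat_const.
by apply: eq_bigr => i _; have := hk i; lia.
Qed.

Lemma card_inside N j : #|inside N j| = ((N - j.*2) ^ n)%N.
Proof.
rewrite (_ : inside N j = [set k : lat N | [forall i, (j <= k i < N - j)%N]]).
  rewrite card_latbox -[X in (_ ^ X)%N](card_ord n) -prod_nat_const.
  by apply: eq_bigr => i _; lia.
by apply/setP => k; rewrite !inE; apply/eq_forallb => i; have := ltn_ord (k i); lia.
Qed.

Lemma card_lat N : #|{: lat N}| = (N ^ n)%N.
Proof. by rewrite card_ffun !card_ord. Qed.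

Definition far N (j : lat N -> nat) (k k' : lat N) :=
  exists i, (j k + j k' < ndist (k i) (k' i))%N.

Lemma far_disjoint N (j : lat N -> nat) k k' : far j k k' ->
  lcube k (j k) :&: lcube k' (j k') = finset.set0.
Proof.
move=> [i h]; apply/setP => l; rewrite !inE; apply/negP => /andP[/forallP/(_ i) a /forallP/(_ i)].
by move: h a; rewrite /ndist; lia.
Qed.

Lemma sum_card_disj (I T : finType) (sel : {set I}) (F : I -> {set T}) (D : {set T}) :
  (forall k k', k \in sel -> k' \in sel -> k != k' -> F k :&: F k' = finset.set0) ->
  (forall k, k \in sel -> F k \subset D) -> (\sum_(k in sel) #|F k| <= #|D|)%N.
Proof.
move=> hd hs; rewrite -[X in (_ <= X)%N]sum1_card.
have -> : (\sum_(k in sel) #|F k| = \sum_(k in sel) \sum_(x in D) (x \in F k))%N.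
  apply: eq_bigr => k ks; rewrite -sum1_card [LHS]big_mkcond [RHS]big_mkcond /=.
  apply: eq_bigr => x _; case: (boolP (x \in F k)) => h; last by case: ifP.
  by rewrite (fintype.subsetP (hs _ ks) _ h).
rewrite exchange_big /=; apply: leq_sum => x _.
have [k0 /andP[ks xk]|nk] := pickP [pred k | (k \in sel) && (x \in F k)].
  rewrite (bigD1 k0) //= xk big1 // => k /andP[ks' kk].
  have := hd _ _ ks' ks kk; move/setP/(_ x); rewrite !inE xk andbT.
  by move=> ->.
by rewrite big1 // => k ks; have := nk k; rewrite /= ks /= => ->.
Qed.

(** Greedy selection: take a point k of largest radius, discard the points within 2 j(k) of it, and
    recurse. The remaining points have radius at most j(k), so their cubes miss that of k; the
    discarded ones number at most (4 j(k) + 1)^n, which is at most 2^n (2 j(k) + 1)^n. *)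
Lemma vitali N (Gd : {set lat N}) (j : lat N -> nat) : exists sel : {set lat N},
  [/\ sel \subset Gd, (forall k k', k \in sel -> k' \in sel -> k != k' -> far j k k') &
      (#|Gd| <= 2 ^ n * \sum_(k in sel) (j k).*2.+1 ^ n)%N].
Proof.
have [m] := ubnP #|Gd|; elim: m Gd => // m IH Gd /ltnSE le.
have [->|[k0 k0G]] := set_0Vmem Gd.
  by exists finset.set0; split; rewrite ?cards0 ?finset.sub0set // => k k'; rewrite inE.
have [k kG kmax] := @arg_maxnP _ k0 (mem Gd) j k0G.
have kk : k \in lcube k (j k).*2 by rewrite inE; apply/forallP => i; rewrite /ndist; lia.
have lt : (#|Gd :\: lcube k (j k).*2| < m)%N.
  apply: leq_trans le; apply: proper_card; apply/fintype.properP; split; first exact: finset.subsetDl.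
  by exists k => //; rewrite finset.in_setD kk.
have [sel [sub f cd]] := IH _ lt.
have fk k' : k' \in sel -> far j k k'.
  move=> /(fintype.subsetP sub); rewrite finset.in_setD => /andP[]; rewrite inE => /forallPn[i hi] /kmax hk.
  by exists i; move: hi hk; rewrite /=; lia.
have ksel : k \notin sel.
  by apply/negP => /(fintype.subsetP sub); rewrite finset.in_setD kk.
exists (k |: sel); split.
- by apply/fintype.subsetP => l /finset.setU1P[->//|/(fintype.subsetP sub)]; rewrite finset.in_setD => /andP[].
- move=> a b /finset.setU1P[->|as_] /finset.setU1P[->|bs]; rewrite ?eqxx // => ab.
  + exact: fk.
  + by have [i h] := fk _ as_; exists i; move: h; rewrite /ndist; lia.
  + exact: f.
rewrite big_setU1 //= mulnDr (cardsD Gd (lcube k (j k).*2)) in cd *.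
have c1 : (#|Gd :&: lcube k (j k).*2| <= 2 ^ n * (j k).*2.+1 ^ n)%N.
  apply: leq_trans (subset_leq_card (finset.subsetIr _ _)) _; apply: leq_trans (card_lcube_le _ _) _.
  by rewrite -expnMn; case: (n) => [|n1]; rewrite ?expn0 // leq_exp2r //; lia.
by rewrite leq_subLR in cd; apply: leq_trans cd _; rewrite leq_add2r.
Qed.

End lattice.

(** * Counts along orbits and the maximal inequality *)

Section counting.
Context {R : realType} {d : nat} {dT : measure_display} {T : measurableType dT}.
Variable S : model R d T.
Local Notation tau := (mtau S).
Local Notation P := (mP S).

Definition cnt (I : finType) (v : I -> 'rV[R]_d) (B : set T) w : nat :=
  #|[set i | `[< B (tau (v i) w) >]]%SET|.

Lemma cntE (I : finType) (v : I -> 'rV[R]_d) B w :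
  (cnt v B w)%:R = \sum_(i : I) \1_B (tau (v i) w) :> R.
Proof.
rewrite /cnt -sum1_card natr_sum big_mkcond /=; apply: eq_bigr => i _.
rewrite !inE indicE; case: asboolP => h; first by rewrite mem_set.
by rewrite memNset.
Qed.

Lemma measurable_cnt (I : finType) (v : I -> 'rV[R]_d) B : measurable B ->
  measurable_fun setT (fun w => (cnt v B w)%:R : R).
Proof.
move=> mB; rewrite (_ : (fun w => (cnt v B w)%:R : R) = fun w => \sum_(i : I) \1_B (tau (v i) w)).
  apply: measurable_sum => i.
  exact: (measurableT_comp (measurable_indic mB) (measurable_tau2 S (v i))).
by apply/funext => w; exact: cntE.
Qed.

Lemma int_cnt (I : finType) (v : I -> 'rV[R]_d) B : measurable B ->
  (\int[P]_w ((cnt v B w)%:R)%:E = (#|I|%:R)%:E * P B)%E.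
Proof.
move=> mB.
transitivity (\int[P]_w (\sum_(i : I) (\1_(tau (v i) @^-1` B) w)%:E))%E.
  by apply: eq_integral => w _; rewrite cntE sumEFin; congr (_%:E); apply: eq_bigr.
have mt i : measurable (tau (v i) @^-1` B).
  by have := measurable_tau2 S (v i) measurableT mB; rewrite setTI.
rewrite ge0_integral_sum //; last by move=> i; apply/measurable_EFinP; exact: measurable_indic.
rewrite (eq_bigr (fun=> P B)); last first.
  by move=> i _; rewrite integral_indic // setIT; exact: mtauP.
have [p ->] : exists p, P B = p%:E.
  by exists (fine (P B)); rewrite fineK // fin_num_measure.
by rewrite sumEFin sumr_const -EFinM; congr (_%:E); rewrite mulr_natl.
Qed.

(** Markov's inequality: by stationarity the mean count is #|I| times the probability of [B]. *)
Lemma cnt_markov (I : finType) (v : I -> 'rV[R]_d) B (a p : R) : measurable B -> 0 < a ->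
  (P B <= p%:E)%E -> (P [set w | (a * #|I|%:R < (cnt v B w)%:R)%R] <= (p / a)%:E)%E.
Proof.
move=> mB a0 hp; have mc := measurable_cnt v mB.
have [I0|I0] := posnP #|I|.
  rewrite [X in P X](_ : _ = set0) ?measure0 //.
    have p0 : 0 <= p by rewrite -lee_fin; apply: le_trans hp; exact: measure_ge0.
    by rewrite lee_fin divr_ge0 // ltW.
  apply/seteqP; split => // w /=; rewrite I0 mulr0 ltr0n => h.
  have : (cnt v B w <= #|I|)%N by exact: max_card.
  by rewrite I0 leqNgt h.
have I0' : 0 < #|I|%:R :> R by rewrite ltr0n.
set A := [set w | _]; have mA : measurable A.
  have := mc measurableT _ (measurable_itv `]a * #|I|%:R, +oo[); rewrite setTI.
  by congr measurable; apply/seteqP; split => w; rewrite /A /= in_itv /= andbT.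
have h : ((a * #|I|%:R)%:E * P A <= #|I|%:R%:E * p%:E)%E.
  apply: (@le_trans _ _ (\int[P]_w ((cnt v B w)%:R)%:E)%E); last first.
    by rewrite int_cnt // lee_pmul // lee_fin ltW.
  rewrite -[X in (_ * P X)%E]setIT -integral_indic //.
  rewrite -ge0_integralZl_EFin //; last 2 first.
  - by apply/measurable_EFinP; exact: measurable_indic.
  - by rewrite mulr_ge0 // ltW.
  apply: ge0_le_integral => //.
  - by move=> w _; rewrite -EFinM lee_fin mulr_ge0 ?indicE ?ler0n // mulr_ge0 // ltW.
  - by apply/measurable_EFinP; apply: measurable_funM => //; exact: measurable_indic.
  - exact/measurable_EFinP.
  move=> w _; rewrite -EFinM lee_fin indicE.
  have [/set_mem wA|] := boolP (w \in A); first by rewrite mulr1 ltW.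
  by rewrite mulr0.
have [pA EA] : exists p, P A = p%:E.
  by exists (fine (P A)); rewrite fineK // fin_num_measure.
move: h; rewrite EA -!EFinM !lee_fin => h.
by rewrite ler_pdivlMr // -(ler_pM2l I0'); apply: le_trans h; rewrite (_ : _ * (pA * a) = a * #|I|%:R * pA) //; ring.
Qed.

Variable p : nat.

(** Centred indexing: the index equal to m in all coordinates has offset 0, so a window of side 2m+1
    is symmetric about its base point. *)
Definition off (U : 'M[R]_(p, d)) N m (k : lat p N) : 'rV[R]_d :=
  (\row_i ((k i)%:R - m%:R)) *m U.

(** More than a fraction [th] of the orbit points in the centred window of radius m lies in [B]. The
    union over m is the event that the maximal function of the indicator of [B] exceeds [th]. *)
Definition Mx U (th : R) B m := [set w | th * (m.*2.+1 ^ p)%:R < (cnt (@off U m.*2.+1 m) B w)%:R].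

Lemma measurable_Mx U (th : R) B m : measurable B -> measurable (Mx U th B m).
Proof.
move=> mB; have := measurable_cnt (@off U m.*2.+1 m) mB measurableT
  (measurable_itv `]th * (m.*2.+1 ^ p)%:R, +oo[); rewrite setTI.
by congr measurable; apply/seteqP; split => w; rewrite /Mx /= in_itv /= andbT.
Qed.

Lemma tau_add x y w : tau x (tau y w) = tau (x + y) w.
Proof. by rewrite mtauD. Qed.

(** In the window about an interior k, the index l becomes k + l - j in the large window, because
    offsets add under [tau]. *)
Lemma cnt_sub U N m (k : lat p N) j B w : k \in inside p N j ->
  (cnt (@off U j.*2.+1 j) B (tau (@off U N m k) w) <=
   #|lcube k j :&: [set i | `[< B (tau (@off U N m i) w) >]]%SET|)%N.
Proof.
rewrite inE => /forallP hk.
have lt (l : lat p j.*2.+1) i : (k i + l i - j < N)%N.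
  by have := hk i; have := ltn_ord (l i); lia.
pose f (l : lat p j.*2.+1) : lat p N := [ffun i => Ordinal (lt l i)].
have fi : injective f.
  move=> l l' /ffunP e; apply/ffunP => i; have := congr1 val (e i); rewrite !ffunE /= => h.
  by apply: val_inj => /=; move: h; have := hk i; lia.
rewrite /cnt -(card_imset _ fi); apply: subset_leq_card; apply/fintype.subsetP => _ /imsetP[l + ->].
rewrite !inE => h; apply/andP; split.
  apply/forallP => i; rewrite ffunE /= /ndist; have := hk i; have := ltn_ord (l i); move: (nat_of_ord (l i)) (nat_of_ord (k i)) => a b.
  by lia.
have e : off U m (f l) = off U j l + off U m k.
  rewrite /off -mulmxDl; congr (_ *m _); apply/rowP => i; rewrite !mxE ffunE /=.
  by rewrite natrB ?natrD; [ring|have := hk i; lia].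
by move: h; rewrite tau_add -e => /asboolP.
Qed.

Lemma bern (a : R) m : 0 <= a -> a <= 1 -> 1 - m%:R * a <= (1 - a) ^+ m.
Proof.
move=> a0 a1; elim: m => [|m IH]; first by rewrite mul0r subr0 expr0.
rewrite exprS; have := ler_wpM2l (_ : 0 <= 1 - a) IH; rewrite subr_ge0 => /(_ a1).
apply: le_trans; rewrite -natr1; have : 0 <= m%:R * a * a by rewrite !mulr_ge0.
by nra.
Qed.

(** Transference to one finite window of side N. On an orbit, [Gd] is the set of interior indices
    that start a bad window of radius at most J; Vitali selects disjoint windows among them, each
    with more than a fraction [th] of its points in [B], so th #Gd is at most 2^p times the count of
    [B]. Integrate and use stationarity; one more factor 2 pays for the indices near the
    boundary. *)
Lemma maximal_fin U (th pr : R) B J : measurable B -> 0 < th -> (P B <= pr%:E)%E ->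
  (P (\bigcup_(j in [set j | (j <= J)%N]) Mx U th B j) <= (2 ^+ p.+1 / th * pr)%:E)%E.
Proof.
move=> mB th0 hB; set A := (\bigcup_(_ in _) _).
have mA : measurable A by apply: bigcup_measurable => j _; exact: measurable_Mx.
(* At least half of the indices then have distance J from the boundary: (1 - 2J/N)^p >= 1 - 2Jp/N >=
   1/2, since N >= 4Jp. *)
pose m := (2 * J * p + J)%N; pose N := m.*2.+1.
have NJ : (J.*2 <= N)%N by rewrite /N /m; lia.
pose f w (k : lat p N) := xget 0%N [set j | (j <= J)%N /\ Mx U th B j (tau (@off U N m k) w)].
have ct w : th * #|inside p N J :&: [set k | `[< A (tau (@off U N m k) w) >]]%SET|%:R <=
    2 ^+ p * (cnt (@off U N m) B w)%:R.
  set Gd := _ :&: _; have hG k : k \in Gd -> (f w k <= J)%N /\ Mx U th B (f w k) (tau (@off U N m k) w).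
    rewrite !inE => /andP[_ /asboolP[j jJ hj]].
    by rewrite /f; case: xgetP => [? _ []//|/(_ j)]; case; split.
  have [sel [sub fr cd]] := vitali Gd (f w).
  have inS k : k \in Gd -> k \in inside p N (f w k).
    move=> kG; have [+ _] := hG _ kG; move: kG; rewrite !inE => /andP[/forallP h _] le.
    by apply/forallP => i; have := h i; lia.
  apply: (@le_trans _ _ (th * (2 ^ p * \sum_(k in sel) (f w k).*2.+1 ^ p)%N%:R)).
    by rewrite ler_pM2l // ler_nat.
  rewrite natrM natrX mulrCA ler_wpM2l ?exprn_ge0 // natr_sum mulr_sumr.
  set Bd := [set i | `[< B (tau (@off U N m i) w) >]]%SET.
  apply: (@le_trans _ _ (\sum_(k in sel) #|lcube k (f w k) :&: Bd|%:R)).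
    apply: ler_sum => k /(fintype.subsetP sub) kG; have [_ h] := hG _ kG.
    by apply: ltW; apply: lt_le_trans h _; rewrite ler_nat; exact: cnt_sub (inS _ kG).
  rewrite -natr_sum ler_nat; apply: sum_card_disj => [k k' ks ks' kk|k _]; last exact: finset.subsetIr.
  apply/eqP; rewrite -finset.subset0 -(far_disjoint (fr _ _ ks ks' kk)).
  by apply: finset.setISS; exact: finset.subsetIl.
have mA' k : measurable (tau (@off U N m k) @^-1` A).
  by have := measurable_tau2 S (@off U N m k) measurableT mA; rewrite setTI.
pose I := {k : lat p N | k \in inside p N J}.
pose v (i : I) := @off U N m (val i).
have cI : #|{: I}| = #|inside p N J| by rewrite card_sig; apply: eq_card => k; rewrite inE.
have le2 : (th%:E * (#|{: I}|%:R%:E * P A) <= (2 ^+ p)%:E * (#|{: lat p N}|%:R%:E * P B))%E.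
  rewrite -(int_cnt v mA) -(int_cnt (@off U N m) mB) -!ge0_integralZl_EFin //;
    try exact: ltW; try exact: exprn_ge0; try exact/measurable_EFinP/measurable_cnt.
  apply: ge0_le_integral => //.
  - by move=> w _; rewrite -EFinM lee_fin mulr_ge0 // ltW.
  - by apply/measurable_EFinP; apply: measurable_funM => //; exact: measurable_cnt.
  - by apply/measurable_EFinP; apply: measurable_funM => //; exact: measurable_cnt.
  move=> w _; rewrite -!EFinM lee_fin; apply: le_trans (ct w).
  rewrite ler_pM2l // ler_nat /cnt.
  rewrite -(card_imset _ (val_inj : injective (val : I -> _))).
  apply: subset_leq_card; apply/fintype.subsetP => _ /imsetP[i + ->]; rewrite finset.in_setI (valP i).
  by rewrite !inE.
have [a Ea] : exists p, P A = p%:E by exists (fine (P A)); rewrite fineK // fin_num_measure.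
have [b Eb] : exists p, P B = p%:E by exists (fine (P B)); rewrite fineK // fin_num_measure.
have b0 : 0 <= b by rewrite -lee_fin -Eb measure_ge0.
have a0 : 0 <= a by rewrite -lee_fin -Ea measure_ge0.
move: le2 hB; rewrite Ea Eb -!EFinM !lee_fin cI card_inside card_lat => le2 hB.
have N0 : 0 < N%:R :> R by rewrite ltr0n.
have half : N%:R ^+ p / 2 <= (N - J.*2)%N%:R ^+ p :> R.
  have e : (N - J.*2)%N%:R = N%:R * (1 - (J.*2)%:R / N%:R) :> R.
    by rewrite natrB //; field; rewrite lt0r_neq0.
  rewrite e exprMn ler_pM2l ?exprn_gt0 //.
  have h0 : 0 <= (J.*2)%:R / N%:R :> R by rewrite divr_ge0.
  have h1 : (J.*2)%:R / N%:R <= 1 :> R by rewrite ler_pdivrMr // mul1r ler_nat.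
  apply: le_trans (bern p h0 h1).
  have : p%:R * ((J.*2)%:R / N%:R) <= 2^-1 :> R.
    rewrite mulrA ler_pdivrMr // -natrM mulrC ler_pdivlMr ?ltr0n // -natrM ler_nat /N /m.
    by move: (J) (p) => J' p'; nia.
  by move: (_ * (_ / _)) => y; lra.
have X0 : 0 < N%:R ^+ p :> R by rewrite exprn_gt0.
rewrite !natrX in le2.
have h2 : th * (N%:R ^+ p / 2) * a <= 2 ^+ p * N%:R ^+ p * b.
  apply: (@le_trans _ _ (th * ((N - J.*2)%:R ^+ p * a))); last by move: le2; rewrite mulrA.
  by rewrite -mulrA; apply: ler_wpM2l; [exact: ltW|exact: ler_wpM2r].
have h3 : th * a <= 2 ^+ p.+1 * b.
  rewrite -(ler_pM2r X0) exprS; set X := N%:R ^+ p in h2 *; set Y := 2 ^+ p in h2 *.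
  by move: h2; lra.
rewrite mulrAC ler_pdivlMr // mulrC; apply: le_trans h3 _.
by rewrite ler_wpM2l // exprn_ge0.
Qed.

(** The bound of [maximal_fin] does not depend on J, and the events increase with J. *)
Lemma maximal U (th pr : R) B : measurable B -> 0 < th -> (P B <= pr%:E)%E ->
  (P (\bigcup_j Mx U th B j) <= (2 ^+ p.+1 / th * pr)%:E)%E.
Proof.
move=> mB th0 hB; pose F J := \bigcup_(j in [set j | (j <= J)%N]) Mx U th B j.
have -> : \bigcup_j Mx U th B j = \bigcup_J F J.
  apply/seteqP; split => [w [j _ h]|w [J _ [j _ h]]]; last by exists j.
  by exists j => //; exists j => //=.
have mF J : measurable (F J) by apply: bigcup_measurable => j _; exact: measurable_Mx.
have mono : {homo F : a b / (a <= b)%N >-> (a <= b)%O}.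
  by move=> a b ab; apply/subsetPset => w [j /= ja h]; exists j => //=; exact: leq_trans ab.
have cv := @nondecreasing_cvg_mu _ _ _ P F mF (bigcup_measurable (fun J _ => mF J)) mono.
rewrite -(cvg_lim _ cv) //; apply: lime_le; first by apply/cvg_ex; exists (P (\bigcup_J F J)).
by apply: nearW => J; exact: maximal_fin.
Qed.

End counting.

(** * Tilings by lattice cubes *)

Section tiles.
Context {R : realType} {n : nat} {dT : measure_display} {T : measurableType dT}.
Variable S : model R n.+1 T.
Variable M : 'M[R]_n.+1.
Hypothesis MM : M *m M^T = 1%:M.

(** The tangential rows of the frame times r1: the offsets [off (Um r1)] form the square lattice of
    step r1 in the plane. *)
Definition Um (r1 : R) : 'M[R]_(n, n.+1) := \matrix_(i, j) (r1 * M (lift ord0 i) j).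

Lemma Um_frame r1 : Um r1 *m M^T = \matrix_(i < n, j < n.+1) (r1 * (lift ord0 i == j)%:R).
Proof.
apply/matrixP => i j; rewrite !mxE.
have /matrixP/(_ (lift ord0 i) j) := MM; rewrite !mxE => <-.
by rewrite mulr_sumr; apply: eq_bigr => l _; rewrite !mxE mulrA.
Qed.

Lemma co_off r1 N m (k : lat n N) x z : co M (x + off (Um r1) m k) z =
  co M x z - rvcons 0 (\row_i (r1 * ((k i)%:R - m%:R))).
Proof.
rewrite /co opprD addrA mulmxBl; congr (_ - _).
rewrite /off -mulmxA Um_frame; apply/rowP => j; rewrite !mxE.
case: (unliftP ord0 j) => [j'|] ->.
  rewrite (bigD1 j') //= big1 => [|i ij]; first by rewrite !mxE eqxx mulr1 addr0 mulrC.
  by rewrite !mxE (inj_eq (@lift_inj _ _)) (negbTE ij) !mulr0.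
by rewrite big1 // => i _; rewrite !mxE eq_sym (negbTE (neq_lift _ _)) !mulr0.
Qed.

Lemma dot_off r1 N m (k : lat n N) x : dotp (x + off (Um r1) m k - x) (row ord0 M) = 0.
Proof.
rewrite -coE; have := co_off r1 m k x (x + off (Um r1) m k).
rewrite {1}/co subrr mul0mx => /esym/eqP; rewrite subr_eq0 => /eqP ->.
by rewrite rvcons0.
Qed.

Lemma blockP r1 N m (k : lat n N) x a h z : box M (x + off (Um r1) m k) a h z <->
  `|co M x z ord0 ord0| < h /\
  (forall i, `|base M x z ord0 i - r1 * ((k i)%:R - m%:R)| < a / 2).
Proof.
have e0 : co M (x + off (Um r1) m k) z ord0 ord0 = co M x z ord0 ord0.
  by rewrite co_off !mxE unlift_none subr0.
have ei i : base M (x + off (Um r1) m k) z ord0 i = base M x z ord0 i - r1 * ((k i)%:R - m%:R).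
  have hb y : base M y z ord0 i = co M y z ord0 (lift ord0 i) by rewrite /base mxE.
  have mB (A B : 'rV[R]_n.+1) l : (A - B) ord0 l = A ord0 l - B ord0 l by rewrite !mxE.
  by rewrite !hb co_off mB rvconsS; congr (_ - _); rewrite mxE.
rewrite /box /= e0; split => -[h1 h2]; split => // i; have := h2 i; by rewrite ei.
Qed.

(** The 2m+1 open cells of width r1 fill the interval up to their endpoints. With the endpoints
    excluded, the cell found by truncation contains y strictly on both sides. *)
Lemma round_ex (m : nat) (r1 y : R) : 0 < r1 -> `|y| < m.*2.+1%:R * r1 / 2 ->
  (forall a : nat, y <> r1 * (a%:R - m.*2.+1%:R / 2)) ->
  exists a : 'I_(m.*2.+1), `|y - r1 * (a%:R - m%:R)| < r1 / 2.
Proof.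
move=> r0; set N := m.*2.+1; rewrite ltr_norml => /andP[y1 y2] hy.
have EN : N%:R = 2 * m%:R + 1 :> R by rewrite /N -natr1 -muln2 natrM mulrC.
pose t := y / r1 + N%:R / 2.
have E : y = r1 * (t - N%:R / 2) by rewrite /t; field; rewrite lt0r_neq0.
have t0 : 0 < t by rewrite -(pmulr_rgt0 _ r0); move: E; lra.
have tN : t < N%:R by rewrite -(ltr_pM2l r0); move: E; lra.
have /andP[a1 a2] := truncn_itv (ltW t0).
have aN : (Num.trunc t < N)%N by rewrite -(ltr_nat R); exact: le_lt_trans tN.
exists (Ordinal aN) => /=; set a := Num.trunc t in a1 a2 aN *.
have a3 : a%:R < t.
  rewrite lt_neqAle a1 andbT; apply/eqP => h; apply: (hy a); rewrite h; exact: E.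
rewrite -natr1 in a2.
have -> : y - r1 * (a%:R - m%:R) = r1 * (t - a%:R - 2^-1) by rewrite E EN; field.
by rewrite normrM gtr0_norm // ltr_pM2l // ltr_norml; apply/andP; split; lra.
Qed.

(** The walls of the tiles, as a countable union of hyperplanes indexed by the codes of pairs of a
    coordinate and a natural number. *)
Definition Zs (m : nat) r1 x : set (Rd R n.+1) := \bigcup_c
  (if unpickle c is Some p then
     [set z : Rd R n.+1 | co M x z ord0 (lift ord0 (p : 'I_n * nat).1) = r1 * (p.2%:R - m.*2.+1%:R / 2)]
   else set0).

Lemma measurable_coeq x i (c : R) : measurable [set z : Rd R n.+1 | co M x z ord0 i = c].
Proof.
have := continuous_measurableRd (@continuous_co R n M x i) measurableT (measurable_set1 c).
by rewrite setTI.
Qed.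

Lemma measurable_Zs m r1 x : measurable (Zs m r1 x).
Proof.
by apply: bigcup_measurable => c _; case: unpickle => [[i a]|//]; exact: measurable_coeq.
Qed.

Lemma mu_Zs m r1 x : muRd n.+1 (Zs m r1 x) = 0%E.
Proof.
apply: measure_negligible; first exact: measurable_Zs.
apply: negligible_bigcup => c; case: unpickle => [[i a]|]; last exact: negligible_set0.
apply/negligibleP; first exact: measurable_coeq.
exact: null_coord.
Qed.

Lemma tile_cover m r1 x z : 0 < r1 -> cubeRd n (m.*2.+1%:R * r1) (base M x z) -> ~ Zs m r1 x z ->
  exists k : lat n m.*2.+1, forall i, `|base M x z ord0 i - r1 * ((k i)%:R - m%:R)| < r1 / 2.
Proof.
move=> r0 hb nZ.
have h i : exists a : 'I_(m.*2.+1), `|base M x z ord0 i - r1 * (a%:R - m%:R)| < r1 / 2.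
  apply: round_ex => // a ha; apply: nZ; exists (pickle (i, a)) => //.
  by rewrite pickleK /= -ha /base [RHS]mxE.
exists [ffun i => projT1 (cid (h i))] => i; rewrite ffunE; exact: projT2 (cid (h i)).
Qed.

Lemma mu_annulus (a b : R) : 0 <= a -> a <= b ->
  measurable (cubeRd n b `\` cubeRd n a) /\
  (muRd n (cubeRd n b `\` cubeRd n a) <= (b ^+ n - a ^+ n)%:E)%E.
Proof.
move=> a0 ab; have ma := @measurable_cubeRd R n a; have mb := @measurable_cubeRd R n b.
split; first exact: measurableD.
have b0 : 0 <= b by exact: le_trans ab.
have fb : (muRd n (cubeRd n b) < +oo)%E by rewrite muRd_cube ?ltry.
have -> := @measureD _ _ _ (muRd n) _ _ mb ma fb.
rewrite (_ : cubeRd n b `&` cubeRd n a = cubeRd n a).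
  by have := muRd_cube n a0; have := muRd_cube n b0 => /= -> ->.
apply/seteqP; split => [z []//|z ha]; split => // i; apply: lt_le_trans (ha i) _; lra.
Qed.

Lemma dblS (j : nat) : j.*2.+1%:R = 2 * j%:R + 1 :> R.
Proof. by rewrite -natr1 -muln2 natrM mulrC. Qed.

Lemma ndist_le (a b j : nat) : (ndist a b <= j)%N ->
  a%:R - b%:R <= j%:R :> R /\ b%:R - a%:R <= j%:R :> R.
Proof. by rewrite /ndist !lerBlDr -!natrD !ler_nat; lia. Qed.

Lemma ndist_gt (a b u v : nat) : (u + v < ndist a b)%N ->
  (a + u + v < b)%N \/ (b + u + v < a)%N.
Proof. by rewrite /ndist => h; apply/orP; lia. Qed.

(** Odd sides (2j+1) r1 make every cube a union of lattice cells. Together the cubes cover the base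
    of side (2m+1) r1 up to height r1, so what is left lies at height at least r1, over the lateral
    annulus, or on the walls. *)
Lemma tiling w x r1 m (s : {set lat n m.*2.+1}) (j : lat n m.*2.+1 -> nat) (c : _ -> R) r h :
  0 < r1 -> m.*2.+1%:R * r1 <= r -> m.*2.+1%:R * r1 <= h ->
  (forall k k', k \in s -> k' \in s -> k != k' -> far j k k') ->
  (forall k, k \in s -> k \in inside n m.*2.+1 (j k) /\ (j k <= m)%N) ->
  (forall k, k \in s -> (Fc S w M (x + off (Um r1) m k)
      ((j k).*2.+1%:R * r1)%R ((j k).*2.+1%:R * r1)%R < (c k)%:E)%E) ->
  (forall k0, exists2 k, k \in s & k0 \in lcube k (j k)) ->
  (Fc S w M x r h <= (\sum_(k in s) c k +
     8 * (r ^+ n * tail S r1 + (r ^+ n - (m.*2.+1%:R * r1) ^+ n) * IE S))%:E)%E.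
Proof.
move=> r0 Nr Nh hf hi hc cov; set N := m.*2.+1 in Nr Nh *.
have EN : N%:R = 2 * m%:R + 1 :> R by exact: dblS.
have Nr0 : 0 <= N%:R * r1 by rewrite mulr_ge0 // ltW.
have [mB hB] := mu_annulus Nr0 Nr.
rewrite -big_enum.
apply: (@aligned_patch R n dT T S _ (enum s) M x (fun k => x + off (Um r1) m k)
  (fun k => (j k).*2.+1%:R * r1) (fun k => (j k).*2.+1%:R * r1) c r h r1
  (r ^+ n - (N%:R * r1) ^+ n) (cubeRd n r `\` cubeRd n (N%:R * r1)) (Zs m r1 x)) => //.
- exact: le_trans Nr.
- exact: enum_uniq.
- move=> k; rewrite mem_enum => ks z /blockP[h1 h2].
  have [+ jm] := hi _ ks; rewrite inE => /forallP hk; split.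
    apply: lt_le_trans h1 _; apply: le_trans Nh; rewrite ler_pM2r // ler_nat; lia.
  move=> i; have := h2 i; have /andP[k1 k2] := hk i.
  have k3 : (j k)%:R * r1 <= (k i)%:R * r1 by rewrite ler_pM2r // ler_nat.
  have k4 : ((k i)%:R + (j k)%:R) * r1 <= 2 * m%:R * r1.
    by rewrite ler_pM2r // -natrD -natrM ler_nat; move: k2; rewrite /N; move: (nat_of_ord (k i)) (j k) => a b; lia.
  by rewrite dblS !ltr_norml => /andP[b1 b2]; move: Nr; rewrite EN => Nr; apply/andP; split; lra.
- by move=> k _; exact: dot_off.
- move=> k k'; rewrite !mem_enum => ks ks' kk; have [i hfi] := hf _ _ ks ks' kk.
  apply/seteqP; split => // z [/blockP[_ /(_ i) +] /blockP[_ /(_ i)]].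
  rewrite !dblS !ltr_norml => /andP[a1 a2] /andP[b1 b2].
  have : ((k i)%:R + (j k)%:R + (j k')%:R + 1) * r1 <= (k' i)%:R * r1 \/
         ((k' i)%:R + (j k)%:R + (j k')%:R + 1) * r1 <= (k i)%:R * r1.
    rewrite !ler_pM2r // -!natrD !natr1 !ler_nat; exact: ndist_gt hfi.
  by case=> h3; lra.
- by move=> k; rewrite mem_enum; exact: hc.
- exact: measurable_Zs.
- exact: mu_Zs.
- move=> z [z1 z2] nz nZ; case: (pselect (cubeRd n (N%:R * r1) (base M x z))) => hb; last by right.
  left; rewrite -coE leNgt; apply/negP => zr.
  have [k0 hk0] := tile_cover r0 hb nZ; have [k ks kc] := cov k0.
  apply: (nz k); first by rewrite mem_enum.
  have jr : r1 <= (j k).*2.+1%:R * r1 by rewrite ler_peMl ?ler1n // ltW.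
  apply/blockP; split; first exact: lt_le_trans jr.
  move=> i; have := hk0 i; move: kc; rewrite inE => /forallP/(_ i) kc.
  have [n1 n2] := ndist_le kc.
  have : ((k0 i)%:R - (k i)%:R) * r1 <= (j k)%:R * r1 by rewrite ler_pM2r.
  have : ((k i)%:R - (k0 i)%:R) * r1 <= (j k)%:R * r1 by rewrite ler_pM2r.
  by rewrite dblS !ltr_norml => c1 c2 /andP[b1 b2]; apply/andP; split; lra.
Qed.

Lemma Fc_enlarge w x r h r' h' c : 0 <= r -> r <= r' -> h <= h' -> (Fc S w M x r h < c%:E)%E ->
  (Fc S w M x r' h' <= (c + 8 * (r' ^+ n * tail S h + (r' ^+ n - r ^+ n) * IE S))%:E)%E.
Proof.
move=> r0 rr hh hc; have [mB hB] := mu_annulus r0 rr.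
have := @aligned_patch R n dT T S unit [:: tt] M x (fun=> x) (fun=> r) (fun=> h) (fun=> c) r' h' h
  (r' ^+ n - r ^+ n) _ set0 w MM _ _ _ _ _ _ mB hB.
rewrite big_seq1; apply => //.
- exact: le_trans rr.
- move=> _ _ z [h1 h2]; split; first exact: lt_le_trans hh.
  by move=> i; apply: lt_le_trans (h2 i) _; lra.
- by move=> _ _; rewrite subrr dotp0l.
- move=> z [z1 z2] /(_ tt (mem_head _ _)) nz _.
  case: (pselect (cubeRd n r (base M x z))) => hb; last by right.
  by left; rewrite -coE leNgt; apply/negP => zr; apply: nz.
Qed.

End tiles.

Section probability.
Context {dT : measure_display} {T : measurableType dT} {R : realType} (P : probability T R).

Lemma mu_exhaust (G : nat -> set T) (eta : R) : (forall J, measurable (G J)) ->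
  {homo G : a b / (a <= b)%N >-> (a `<=` b)} -> {ae P, forall w, exists J, G J w} -> 0 < eta ->
  exists J, (P (~` G J) <= eta%:E)%E.
Proof.
move=> mG mono ae e0.
have mU : measurable (\bigcup_J G J) by exact: bigcup_measurable.
have mono' : {homo G : a b / (a <= b)%N >-> (a <= b)%O}.
  by move=> a b ab; apply/subsetPset; exact: mono.
have cv := @nondecreasing_cvg_mu _ _ _ P G mG mU mono'.
have PU : P (\bigcup_J G J) = 1%E.
  have N0 : P (~` \bigcup_J G J) = 0%E.
    apply: measure_negligible; first exact: measurableC.
    by apply: negligibleS ae => w h [J GJ]; apply: h; exists J.
  by have := probability_setC P (measurableC mU); rewrite setCK N0 sube0.
have cv1 : (P \o G) x @[x --> \oo] --> P (\bigcup_J G J) := cv.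
rewrite PU in cv1; have /fine_cvgP[_ cv'] := cv1.
have /cvgrPdist_lt/(_ _ e0)[J _ hJ] := cv'.
exists J; rewrite probability_setC //.
have [a Ea] : exists p, P (G J) = p%:E by exists (fine (P (G J))); rewrite fineK // fin_num_measure.
have := hJ J (leqnn J); rewrite /= Ea /= => h; rewrite -EFinB lee_fin.
by have := ler_norm (1 - a); lra.
Qed.

End probability.

(** * Convergence in probability of the planar energies *)

Lemma ndistC a b : ndist a b = ndist b a.
Proof. by rewrite /ndist addnC. Qed.

Lemma ndist_gt0 a b : a != b -> (0 < ndist a b)%N.
Proof. by rewrite /ndist; lia. Qed.

Lemma leq_subadd a b c : (b <= c)%N -> (a <= a - b + c)%N.
Proof. by lia. Qed.

Lemma insideS n N j J (k : lat n N) : (j <= J)%N -> k \in inside n N J -> k \in inside n N j.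
Proof.
rewrite !inE => jJ /forallP h; apply/forallP => i; have := h i.
by move: (nat_of_ord (k i)) => a; lia.
Qed.

Section liminf.
Context {R : realType}.
Implicit Types (f : R -> \bar R) (t : R).

Lemma liminf_lt f t (eps r0 : R) : liminf_pinfty f = t%:E -> 0 < eps ->
  exists2 r, r0 <= r & (f r < (t + eps)%:E)%E.
Proof.
move=> H e0; have h : (ereal_inf (f @` [set r | r0 <= r]%R) < (t + eps)%:E)%E.
  apply: (@le_lt_trans _ _ t%:E); last by rewrite lte_fin ltrDl.
  by rewrite -H; apply: ereal_sup_ubound; exists r0.
by have [_ [r /= hr <-] lt] := ereal_inf_lt h; exists r.
Qed.

Lemma liminf_gt f t (eps : R) : liminf_pinfty f = t%:E -> 0 < eps ->
  exists r0, forall r, r0 <= r -> ((t - eps)%:E <= f r)%E.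
Proof.
move=> H e0; have h : ((t - eps)%:E < liminf_pinfty f)%E by rewrite H lte_fin ltrBlDr ltrDl.
have [_ [r0 _ <-] lt] := ereal_sup_gt h; exists r0 => r hr.
by apply: ltW; apply: lt_le_trans lt _; apply: ereal_inf_lbound; exists r.
Qed.

(** Bernoulli's inequality for the power of a/b = 1 - (b-a)/b. *)
Lemma pow_diff (a b dl : R) n : 0 <= a -> a <= b -> 0 < b -> b - a <= dl ->
  b ^+ n - a ^+ n <= b ^+ n * (n%:R * dl / b).
Proof.
move=> a0 ab b0 dl0; have nb : b != 0 by rewrite lt0r_neq0.
have u0 : 0 <= (b - a) / b by rewrite divr_ge0 ?subr_ge0 // ltW.
have u1 : (b - a) / b <= 1 by rewrite ler_pdivrMr // mul1r; lra.
have := bern n u0 u1; have -> : 1 - (b - a) / b = a / b by field.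
move=> h; have e : a ^+ n = b ^+ n * (a / b) ^+ n by rewrite -exprMn mulrCA divff // mulr1.
rewrite e -[X in X - _]mulr1 -mulrBr ler_pM2l ?exprn_gt0 //.
have : n%:R * ((b - a) / b) <= n%:R * dl / b.
  by rewrite mulrA ler_pM2r ?invr_gt0 // ler_wpM2l.
by move: h; move: (n%:R * _) ((a / b) ^+ n) (n%:R * _ / _) => p q u; lra.
Qed.

End liminf.

Section inprob.
Context {R : realType} {n : nat} {dT : measure_display} {T : measurableType dT}.
Variable S : model R n.+1 T.
Variable M : 'M[R]_n.+1.
Hypothesis MM : M *m M^T = 1%:M.
Variable t : R.
Local Notation P := (mP S).
Local Notation F w r := (Fc S w M 0 r r).
Local Notation lim_at w :=
  (liminf_pinfty (fun r => ((r ^- n)%:E * F w r)%E) = t%:E).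
Hypothesis HT : {ae P, forall w, lim_at w}.

Lemma ae_ex (Q : T -> Prop) : {ae P, forall w, Q w} -> exists w, Q w.
Proof.
move=> h; apply: contrapT => nQ.
have : P setT = 0%E.
  apply: measure_negligible => //; apply: negligibleS h => w _ Qw; apply: nQ; by exists w.
by rewrite probability_setT => /eqP; rewrite onee_eq0.
Qed.

Lemma lim_lt w (eps r0 : R) : lim_at w -> 0 < eps -> 0 < r0 ->
  exists2 r, r0 <= r & (F w r < ((t + eps) * r ^+ n)%:E)%E.
Proof.
move=> H e0 p0; have [r hr hb] := liminf_lt r0 H e0; exists r => //.
have rp : 0 < r by exact: lt_le_trans hr.
by move: hb; rewrite lte_pdivrMl ?exprn_gt0 // -EFinM mulrC.
Qed.

Lemma lim_gt w (eps : R) : lim_at w -> 0 < eps ->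
  exists2 r0, 0 < r0 & forall r, r0 <= r -> (((t - eps) * r ^+ n)%:E <= F w r)%E.
Proof.
move=> H e0; have [r0 h] := liminf_gt H e0; exists (Num.max 1 r0); first by rewrite lt_max ltr01.
move=> r; rewrite ge_max => /andP[r1 hr]; have rp : 0 < r by exact: lt_le_trans r1.
by have := h _ hr; rewrite lee_pdivlMl ?exprn_gt0 // -EFinM mulrC.
Qed.

Lemma t_ge0 : 0 <= t.
Proof.
have [w H] := ae_ex HT; rewrite leNgt; apply/negP => t0.
have e0 : 0 < - t by rewrite oppr_gt0.
have [r _ h] := lim_lt H e0 (ltr01 : 0 < (1 : R)).
by move: h; rewrite subrr mul0r ltNge Fc_ge0.
Qed.

(** The liminf gives good sizes r that are arbitrarily large but of no prescribed form. Rounding up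
    to an odd multiple of r1 adds at most 3 r1, and [Fc_enlarge] makes this negligible for large
    r. *)
Lemma lim_odd w (r1 eps : R) : lim_at w -> 0 < r1 -> 0 < eps ->
  exists j : nat, (F w (j.*2.+1%:R * r1)%R <= ((t + eps) * (j.*2.+1%:R * r1) ^+ n)%:E)%E.
Proof.
move=> H r10 e0; have I0 := IE_ge0 S; have t0 := t_ge0.
have e32 : 0 < eps / 32 by rewrite divr_gt0.
have [h0 hh] := tail_small S e32.
(* For r' >= K the annulus of relative area n (3 r1) / r' costs at most eps / 32 per unit area. *)
pose K := n%:R * (3 * r1) * 32 * (IE S + 1) / eps.
have [r hr hF] := @lim_lt w (eps / 2) (Num.max 1 (Num.max h0 K)) H
  (ltac:(by rewrite divr_gt0)) (ltac:(by rewrite lt_max ltr01)).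
move: hr; rewrite !ge_max => /and3P[r1' rh rK].
have rp : 0 < r by exact: lt_le_trans r1'.
have /andP[a1 a2] := @truncn_itv R (r / (2 * r1)) ltac:(by rewrite divr_ge0 ?mulr_ge0 // ltW).
set a := Num.trunc _ in a1 a2; exists a.+1.
set r' := _ * r1 in hF *.
have E : r' = 2 * r1 * a%:R + 3 * r1 by rewrite /r' dblS -natr1; ring.
move: a1 a2; rewrite ler_pdivlMr ?mulr_gt0 // ltr_pdivrMr ?mulr_gt0 // -natr1 => a1 a2.
have rr : r <= r' by rewrite E; lra.
have dl : r' - r <= 3 * r1 by rewrite E; lra.
have r'p : 0 < r' by exact: lt_le_trans rr.
apply: le_trans (Fc_enlarge MM (ltW rp) rr rr hF) _; rewrite lee_fin.
have pd := pow_diff n (ltW rp) rr r'p dl.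
have q1 : n%:R * (3 * r1) / r' * IE S <= eps / 32.
  rewrite mulrAC ler_pdivrMr //.
  have : K <= r' by exact: le_trans rr.
  rewrite /K ler_pdivrMr // => hK.
  have : n%:R * (3 * r1) * IE S <= n%:R * (3 * r1) * (IE S + 1).
    by rewrite ler_wpM2l ?lerDl // !mulr_ge0 // ltW.
  by move: hK; set z := n%:R * (3 * r1) * (IE S + 1); set y := n%:R * (3 * r1) * IE S;
    rewrite (_ : n%:R * (3 * r1) * 32 * (IE S + 1) = 32 * z); [lra|rewrite /z; ring].
have q2 : tail S r <= eps / 32 by exact: hh.
have q3 : r ^+ n <= r' ^+ n by rewrite lerXn2r // nnegrE ltW.
have X0 : 0 < r' ^+ n by rewrite exprn_gt0.
have d1 : (r' ^+ n - r ^+ n) * IE S <= r' ^+ n * (eps / 32).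
  apply: le_trans (_ : r' ^+ n * (n%:R * (3 * r1) / r' * IE S) <= _).
    by rewrite mulrA ler_wpM2r.
  by rewrite ler_pM2l.
have d2 : r' ^+ n * tail S r <= r' ^+ n * (eps / 32) by rewrite ler_pM2l.
have d3 : (t + eps / 2) * r ^+ n <= (t + eps / 2) * r' ^+ n.
  by rewrite ler_wpM2l // addr_ge0 // divr_ge0 // ltW.
by move: d1 d2 d3; move: (r' ^+ n) (r ^+ n) (tail S r) X0 => X Y Z X0; nra.
Qed.

(** [X] collects the cells whose energy exceeds the current constant c, [Y] the cells around which
    no cube of radius at most J is almost optimal. Vitali cubes centred off [Y] cost t per unit area
    and cover at least the fraction 2^-n of the good interior cells; every other cell costs c, plus
    a multiple of its area if it is in [X]. *)
Lemma improve_det w (r1 c e1 r h : R) m J (X Y : {set lat n m.*2.+1}) :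
  0 < r1 -> 0 < e1 -> t <= c -> (J <= m)%N ->
  m.*2.+1%:R * r1 <= r -> m.*2.+1%:R * r1 <= h ->
  (forall k, k \notin X -> (Fc S w M (off (Um M r1) m k) r1 r1 <= ((c + e1) * r1 ^+ n)%:E)%E) ->
  (forall k, k \notin Y -> exists2 j, (j <= J)%N & (Fc S w M (off (Um M r1) m k)
     (j.*2.+1%:R * r1)%R (j.*2.+1%:R * r1)%R <= ((t + e1) * (j.*2.+1%:R * r1) ^+ n)%:E)%E) ->
  (Fc S w M 0 r h <= (r1 ^+ n * ((c + 2 * e1) * m.*2.+1%:R ^+ n -
      (c - t) / 2 ^+ n * (#|inside n m.*2.+1 J|%:R - #|Y|%:R) + (16 * IE S + 1) * #|X|%:R) +
     8 * (r ^+ n * tail S r1 + (r ^+ n - (m.*2.+1%:R * r1) ^+ n) * IE S))%:E)%E.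
Proof.
move=> r10 e10 tc Jm Nr Nh hX hY; have I0 := IE_ge0 S; have t0 := t_ge0.
set N := m.*2.+1 in Nr Nh X Y hX hY *.
pose G := inside n N J :\: Y.
(* The default radius 0 concerns only cells off [G], which are never selected. *)
pose f (k : lat n N) := xget 0%N [set j | (j <= J)%N /\ (Fc S w M (off (Um M r1) m k)
     (j.*2.+1%:R * r1)%R (j.*2.+1%:R * r1)%R <= ((t + e1) * (j.*2.+1%:R * r1) ^+ n)%:E)%E].
have hf k : k \in G -> (f k <= J)%N /\ (Fc S w M (off (Um M r1) m k)
     ((f k).*2.+1%:R * r1)%R ((f k).*2.+1%:R * r1)%R <= ((t + e1) * ((f k).*2.+1%:R * r1) ^+ n)%:E)%E.
  rewrite finset.in_setD => /andP[/hY[j jJ hj] _].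
  by rewrite /f; case: xgetP => [? _ []//|/(_ j)]; case.
have [sel [sub fr cd]] := vitali G f.
(* The cells outside the selected cubes; they enter the tiling one by one, with radius 0. *)
pose Un := [set k : lat n N | [forall k' in sel, k \notin lcube k' (f k')]]%SET.
pose j k := if k \in sel then f k else 0%N.
(* [tiling] wants strict inequalities, hence 2 e1 where the hypotheses have e1. *)
pose ck k := if k \in sel then (t + 2 * e1) * ((f k).*2.+1%:R * r1) ^+ n
  else (c + 2 * e1) * r1 ^+ n + (k \in X)%:R * ((16 * IE S + 1) * r1 ^+ n).
have rn0 : 0 < r1 ^+ n by rewrite exprn_gt0.
have self k l : k \in lcube k l by rewrite inE; apply/forallP => i; rewrite /ndist subnn.
have selU k : k \in sel -> k \notin Un.
  by move=> ks; rewrite inE; apply/negP => /forallP/(_ k); rewrite ks /= self.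
have Usel k : k \in Un -> (k \in sel) = false.
  by move=> kU; apply/negbTE/negP => /selU/negP; apply.
have inS k : k \in sel -> k \in inside n N (f k).
  move=> /(fintype.subsetP sub) kG; have [le _] := hf _ kG; move: kG.
  by rewrite finset.in_setD => /andP[_]; exact: insideS.
have in0 k : k \in inside n N 0 by rewrite inE; apply/forallP => i; rewrite addn0 ltn_ord.
have farU k k' : k \in sel -> k' \in Un -> far j k k'.
  move=> ks k'U; move: (k'U); rewrite inE => /forallP/(_ k); rewrite ks /= inE => /forallPn[i hi].
  by exists i; rewrite /j ks (Usel _ k'U) addn0 ltnNge.
have := @tiling R n dT T S M MM w 0 r1 m (sel :|: Un) j ck r h r10 Nr Nh.
have tl1 k k' : k \in sel :|: Un -> k' \in sel :|: Un -> k != k' -> far j k k'.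
  move=> /finset.setUP[ks|kU] /finset.setUP[k's|k'U] kk.
  - by have [i hi] := fr _ _ ks k's kk; exists i; rewrite /j ks k's.
  - exact: farU.
  - by have [i hi] := farU _ _ k's kU; exists i; rewrite ndistC (addnC (j k)).
  have [i hi] : exists i, k i != k' i.
    apply/existsP; rewrite -negb_forall; apply: contra kk => /forallP h1.
    by apply/eqP/ffunP => i; apply/eqP.
  exists i; rewrite /j (Usel _ kU) (Usel _ k'U).
  by rewrite addn0; apply: ndist_gt0; rewrite -val_eqE in hi.
move=> /(_ tl1).
have tl2 k : k \in sel :|: Un -> k \in inside n N (j k) /\ (j k <= m)%N.
  move=> _; rewrite /j; case: ifPn => ks; last by split => //; exact: in0.
  by split; [exact: inS|have [le _] := hf _ (fintype.subsetP sub _ ks); exact: leq_trans Jm].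
move=> /(_ tl2).
have tl3 k : k \in sel :|: Un -> (Fc S w M (0 + off (Um M r1) m k)
      ((j k).*2.+1%:R * r1)%R ((j k).*2.+1%:R * r1)%R < (ck k)%:E)%E.
  move=> _; rewrite add0r /j /ck; case: ifPn => ks.
    have [_ le] := hf _ (fintype.subsetP sub _ ks); apply: le_lt_trans le _.
    rewrite lte_fin ltr_pM2r; first by lra.
    by rewrite exprn_gt0 // mulr_gt0.
  rewrite mul1r; case: (boolP (k \in X)) => kX.
    apply: le_lt_trans (planar_bound _ _ _ _ MM (ltW r10)) _; rewrite lte_fin mul1r.
    have : 0 < (c + 2 * e1) * r1 ^+ n by rewrite mulr_gt0 //; lra.
    by move: (r1 ^+ n) rn0 => z; nra.
  apply: le_lt_trans (hX _ kX) _; rewrite lte_fin mul0r addr0 ltr_pM2r //; lra.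
move=> /(_ tl3).
have tl4 k0 : exists2 k, k \in sel :|: Un & k0 \in lcube k (j k).
  case: (boolP (k0 \in Un)) => kU; first by exists k0; [apply/finset.setUP; right|exact: self].
  move: kU; rewrite inE => /forallPn[k]; rewrite negb_imply negbK => /andP[ks kc].
  by exists k; [apply/finset.setUP; left|rewrite /j ks].
move=> /(_ tl4) => H; apply: le_trans H _; rewrite lee_fin lerD2r.
pose A := (\sum_(k in sel) (f k).*2.+1 ^ n)%N.
have cA : (A + #|Un| <= N ^ n)%N.
  rewrite -card_lat -(cardsC Un) addnC leq_add2l /A.
  rewrite (eq_bigr (fun k => #|lcube k (f k)|)); last by move=> k ks; rewrite card_lcube //; exact: inS.
  apply: sum_card_disj => [k k' ks ks' kk|k ks]; first exact: far_disjoint (fr _ _ ks ks' kk).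
  apply/fintype.subsetP => l lk; rewrite finset.in_setC inE; apply/negP => /forallP/(_ k).
  by rewrite ks /= lk.
have sumle : \sum_(k in sel :|: Un) ck k <= r1 ^+ n * ((t + 2 * e1) * A%:R +
    (c + 2 * e1) * #|Un|%:R + (16 * IE S + 1) * #|X|%:R).
  rewrite (bigID (mem sel)) /=.
  have -> : \sum_(k in sel :|: Un | k \in sel) ck k = r1 ^+ n * ((t + 2 * e1) * A%:R).
    rewrite /A natr_sum !mulr_sumr; rewrite (eq_bigl (mem sel)) /=; last first.
      by move=> k; rewrite finset.in_setU; apply/idP/idP => [/andP[_ ?]//|ks]; apply/andP; split => //; apply/orP; left.
    by apply: eq_bigr => k ks; rewrite /ck ks exprMn natrX; ring.
  rewrite -addrA mulrDr lerD2l.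
  rewrite (eq_bigl (mem Un)) /=; last first.
    move=> k; rewrite finset.in_setU; apply/idP/idP => [/andP[/orP[-> //|kU] _]//|kU].
    by apply/andP; split; [apply/orP; right|rewrite (Usel _ kU)].
  rewrite (eq_bigr (fun k => (c + 2 * e1) * r1 ^+ n + (k \in X)%:R * ((16 * IE S + 1) * r1 ^+ n))); last first.
    by move=> k kU; rewrite /ck (Usel _ kU).
  rewrite big_split /= sumr_const -mulr_suml.
  have hx : \sum_(k in Un) (k \in X)%:R <= #|X|%:R :> R.
    rewrite -sum1_card natr_sum [X in X <= _]big_mkcond [X in _ <= X]big_mkcond /=.
    by apply: ler_sum => k _; case: (k \in Un); case: (k \in X).
  have : (\sum_(k in Un) (k \in X)%:R) * ((16 * IE S + 1) * r1 ^+ n) <= #|X|%:R * ((16 * IE S + 1) * r1 ^+ n).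
    by rewrite ler_wpM2r // mulr_ge0 ?ltW //; lra.
  by rewrite -[(c + 2 * e1) * r1 ^+ n *+ _]mulr_natr; lra.
apply: le_trans sumle _; rewrite ler_pM2l // lerD2r.
have A1 : A%:R + #|Un|%:R <= N%:R ^+ n :> R by rewrite -natrD -natrX ler_nat.
have A2 : (#|inside n N J|%:R - #|Y|%:R) / 2 ^+ n <= A%:R :> R.
  rewrite ler_pdivrMr ?exprn_gt0 // lerBlDr -natrX -natrM -natrD ler_nat mulnC.
  apply: leq_trans (leq_add cd (leqnn #|Y|)).
  by rewrite /G cardsD; apply: leq_subadd; exact: subset_leq_card (finset.subsetIr _ _).
have A3 : (c - t) * ((#|inside n N J|%:R - #|Y|%:R) / 2 ^+ n) <= (c - t) * A%:R.
  by rewrite ler_wpM2l // subr_ge0.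
have A4 : (c + 2 * e1) * (A%:R + #|Un|%:R) <= (c + 2 * e1) * N%:R ^+ n.
  by rewrite ler_wpM2l //; lra.
by move: A3 A4; rewrite [_ / _ * (_ - _)]mulrAC -mulrA; lra.
Qed.

Lemma measurable_gtF x r h (a : R) : 0 <= r -> 0 <= h ->
  measurable [set w | (a%:E < Fc S w M x r h)%E].
Proof.
move=> r0 h0; have := measurable_Fc S x MM r0 h0 measurableT (emeasurable_itv `]a%:E, +oo[).
by rewrite setTI; congr measurable; apply/seteqP; split => w; rewrite /= in_itv /= andbT.
Qed.

Lemma measurable_gtcnt (I : finType) (v : I -> 'rV[R]_n.+1) B (a : R) : measurable B ->
  measurable [set w | a < (cnt S v B w)%:R].
Proof.
move=> mB; have := measurable_cnt S v mB measurableT (measurable_itv `]a, +oo[).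
by rewrite setTI; congr measurable; apply/seteqP; split => w; rewrite /= in_itv /= andbT.
Qed.

(** The upper limit in probability of F(r) / r^n is at most c. *)
Definition V c := forall eps eta : R, 0 < eps -> 0 < eta -> exists r0 : R, forall r, r0 <= r ->
  (P [set w | (((c + eps) * r ^+ n)%R%:E < F w r)%E] <= eta%:E)%E.

(** Outside an event of small probability, Markov's inequality bounds both exceptional sets of
    [improve_det] by the fraction e1 of the window. The gain is the fixed proportion 2^-n of the
    distance from c to t, so it can vanish only at c = t. *)
Lemma V_improve c : t <= c -> V c -> V (c - (c - t) / 2 ^+ n).
Proof.
move=> tc Vc eps eta e0 eta0; have I0 := IE_ge0 S; have t0 := t_ge0.
(* D adds up the coefficients of e1 in the final bound: 3 + 2(c-t) + 16 IE from the tiles, 8 from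
   the tail, 8 IE from the annulus. *)
set c' := c - _; set D := 11 + 2 * (c - t) + 24 * IE S.
have D0 : 0 < D by rewrite /D; lra.
have w2 : 1 <= 2 ^+ n :> R by rewrite exprn_ege1 // ler1n.
have c't : t <= c'.
  have : (c - t) / 2 ^+ n <= c - t.
    by rewrite ler_pdivrMr ?(lt_le_trans _ w2) // ler_peMr // subr_ge0.
  by rewrite /c'; lra.
pose e1 := eps / D; have e10 : 0 < e1 by rewrite divr_gt0.
have E1 : e1 * D = eps by rewrite /e1 divfK // lt0r_neq0.
(* Markov's inequality divides by e1, and there are two exceptional events. *)
pose eta1 := eta * e1 / 2.
have eta10 : 0 < eta1 by apply: divr_gt0 => //; exact: mulr_gt0.
have [rV hV] := Vc e1 eta1 e10 eta10.
have [h0 hh] := tail_small S e10.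
pose r1 := Num.max 1 (Num.max rV h0).
have r10 : 0 < r1 by rewrite lt_max ltr01.
have r1V : rV <= r1 by rewrite /r1 !le_max lexx !orbT.
have r1h : h0 <= r1 by rewrite /r1 !le_max lexx !orbT.
have odd0 j : 0 <= j.*2.+1%:R * r1 by rewrite mulr_ge0 // ltW.
pose BX := [set w | (((c + e1) * r1 ^+ n)%R%:E < F w r1)%E].
have mX : measurable BX by apply: measurable_gtF; exact: ltW.
have PX : (P BX <= eta1%:E)%E by exact: hV.
pose Gj j := [set w | (((t + e1) * (j.*2.+1%:R * r1) ^+ n)%R%:E < F w (j.*2.+1%:R * r1)%R)%E].
pose G J := \bigcup_(j in [set j | (j <= J)%N]) ~` Gj j.
have mG J : measurable (G J).
  by apply: bigcup_measurable => j _; apply: measurableC; exact: measurable_gtF.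
have monoG : {homo G : a b / (a <= b)%N >-> (a `<=` b)}.
  by move=> a b ab w [j /= ja hj]; exists j => //=; exact: leq_trans ab.
have aeG : {ae P, forall w, exists J, G J w}.
  apply: filterS HT => w H; have [j hj] := lim_odd H r10 e10.
  by exists j; exists j => //=; rewrite /Gj /= => /(le_lt_trans hj); rewrite ltxx.
have [J PJ] := mu_exhaust mG monoG aeG eta10.
have mY : measurable (~` G J) by exact: measurableC.
(* Read backwards from the estimates: the two terms with 1/e1 make the boundary layer of J cells and
   the uncovered annulus have relative area at most e1. *)
exists (r1 * (4 + 2 * J%:R + 2 * n%:R * J%:R / e1 + 2 * n%:R / e1)) => r hr.
have q1 : 0 <= 2 * n%:R * J%:R / e1 by rewrite divr_ge0 // ltW.
have q2 : 0 <= 2 * n%:R / e1 by rewrite divr_ge0 // ltW.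
have q3 : 0 <= J%:R :> R by [].
have p1 : 0 <= r1 * (2 * n%:R * J%:R / e1) by rewrite mulr_ge0 // ltW.
have p2 : 0 <= r1 * (2 * n%:R / e1) by rewrite mulr_ge0 // ltW.
have p3 : 0 <= r1 * J%:R by rewrite mulr_ge0 // ltW.
have rp : 0 < r by move: hr; rewrite !mulrDr; lra.
have /andP[m1 m2] := @truncn_itv R ((r - r1) / (2 * r1)) ltac:(apply: divr_ge0;
  [move: hr; rewrite !mulrDr; lra|rewrite mulr_ge0 // ltW //]).
set m := Num.trunc _ in m1 m2; set N := m.*2.+1.
have EN : N%:R = 2 * m%:R + 1 :> R by exact: dblS.
move: m1 m2; rewrite ler_pdivlMr ?mulr_gt0 // ltr_pdivrMr ?mulr_gt0 // -natr1 => m1 m2.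
have Nr : N%:R * r1 <= r by rewrite EN; lra.
have Nr2 : r - N%:R * r1 <= 2 * r1 by rewrite EN; lra.
have N0 : 0 < N%:R :> R by rewrite ltr0n.
have NJ : 2 + 2 * J%:R + 2 * n%:R * J%:R / e1 <= N%:R.
  by rewrite -(ler_pM2l r10) !mulrDr; move: hr; rewrite !mulrDr; lra.
have Jm : (J <= m)%N by rewrite -(ler_nat R); move: NJ; rewrite EN; lra.
pose EX := [set w | e1 * #|{: lat n N}|%:R < (cnt S (off (Um M r1) m : lat n N -> _) BX w)%:R].
pose EY := [set w | e1 * #|{: lat n N}|%:R < (cnt S (off (Um M r1) m : lat n N -> _) (~` G J) w)%:R].
have mEX : measurable EX by exact: measurable_gtcnt.
have mEY : measurable EY by exact: measurable_gtcnt.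
have hX : (P EX <= (eta1 / e1)%:E)%E by exact: cnt_markov.
have hY : (P EY <= (eta1 / e1)%:E)%E by exact: cnt_markov.
have half : eta1 / e1 = eta / 2 by rewrite /eta1; field; rewrite lt0r_neq0.
apply: (@le_trans _ _ (P (EX `|` EY))); last first.
  have hU : (P (EX `|` EY) <= P EX + P EY)%E by exact: measureU2.
  apply: le_trans hU _.
  by apply: le_trans (leeD hX hY) _; rewrite -EFinD lee_fin half; lra.
apply: le_measure; rewrite ?inE; [exact: measurable_gtF (ltW rp) (ltW rp)|exact: measurableU|].
move=> w /= hw; apply: contrapT => /not_orP[nX nY].
have cX : (cnt S (off (Um M r1) m : lat n N -> _) BX w)%:R <= e1 * N%:R ^+ n.
  by move: nX => /negP; rewrite -leNgt card_lat natrX.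
have cY : (cnt S (off (Um M r1) m : lat n N -> _) (~` G J) w)%:R <= e1 * N%:R ^+ n.
  by move: nY => /negP; rewrite -leNgt card_lat natrX.
have sh k r' : Fc S (mtau S (off (Um M r1) m (k : lat n N)) w) M 0 r' r' =
  Fc S w M (off (Um M r1) m k) r' r' by rewrite Fc_shift add0r.
have := @improve_det w r1 c e1 r r m J
  [set k | `[< BX (mtau S (off (Um M r1) m k) w) >]]%SET
  [set k | `[< (~` G J) (mtau S (off (Um M r1) m k) w) >]]%SET r10 e10 tc Jm Nr Nr.
have d1 k : k \notin [set k : lat n N | `[< BX (mtau S (off (Um M r1) m k) w) >]]%SET ->
    (Fc S w M (off (Um M r1) m k) r1 r1 <= ((c + e1) * r1 ^+ n)%:E)%E.
  by rewrite inE => /asboolPn; rewrite /BX /= sh => /negP; rewrite -leNgt.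
have d2 k : k \notin [set k : lat n N | `[< (~` G J) (mtau S (off (Um M r1) m k) w) >]]%SET ->
    exists2 j, (j <= J)%N & (Fc S w M (off (Um M r1) m k)
     (j.*2.+1%:R * r1)%R (j.*2.+1%:R * r1)%R <= ((t + e1) * (j.*2.+1%:R * r1) ^+ n)%:E)%E.
  rewrite inE => /asboolPn /contrapT[j /= jJ]; rewrite /Gj /= sh => /negP.
  by rewrite -leNgt => hj; exists j.
move=> /(_ d1 d2) H; have := lt_le_trans hw H; rewrite lte_fin; apply/negP; rewrite -leNgt.
move: cX cY; rewrite /cnt; set Xc := #|_|; set Yc := #|_| => cX cY.
have ins : (1 - e1) * N%:R ^+ n <= #|inside n N J|%:R :> R.
  rewrite card_inside natrX mulrC.
  have JN : (J.*2 <= N)%N by rewrite /N (leq_trans _ (leqnSn _)) // leq_double.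
  have -> : (N - J.*2)%N%:R = N%:R * (1 - (J.*2)%:R / N%:R) :> R.
    by rewrite natrB //; field; rewrite lt0r_neq0.
  rewrite exprMn ler_pM2l ?exprn_gt0 //.
  have u0 : 0 <= (J.*2)%:R / N%:R :> R by rewrite divr_ge0.
  have u1 : (J.*2)%:R / N%:R <= 1 :> R by rewrite ler_pdivrMr // mul1r ler_nat.
  apply: le_trans (bern n u0 u1); rewrite lerD2l lerN2 mulrA ler_pdivrMr // -muln2 natrM.
  have f1 : e1 * (2 * n%:R * J%:R / e1) = 2 * n%:R * J%:R by field; rewrite lt0r_neq0.
  have f2 : 0 <= e1 * (2 + 2 * J%:R) by rewrite mulr_ge0 // ltW.
  have := ler_wpM2l (ltW e10) NJ; rewrite mulrDr f1; move: f2 => f2 f3.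
  by apply: le_trans f3; rewrite (_ : n%:R * (J%:R * 2) = 2 * n%:R * J%:R); [rewrite lerDr|ring].
have pd := pow_diff n (ltW (mulr_gt0 N0 r10)) Nr rp Nr2.
have nr : n%:R * (2 * r1) / r <= e1.
  rewrite ler_pdivrMr //; move: hr; rewrite -(ler_pM2l e10) !mulrDr.
  rewrite (_ : e1 * (r1 * (2 * n%:R / e1)) = n%:R * (2 * r1)); last by field; rewrite lt0r_neq0.
  have := mulr_ge0 (ltW e10) p1; have := mulr_ge0 (ltW e10) p3; have := mulr_gt0 e10 r10.
  rewrite (_ : e1 * (r1 * (2 * J%:R)) = 2 * (e1 * (r1 * J%:R))); last by ring.
  by lra.
have X0 : 0 < r ^+ n by rewrite exprn_gt0.
have XZ : r ^+ n - (N%:R * r1) ^+ n <= r ^+ n * e1.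
  by apply: le_trans pd _; rewrite ler_pM2l.
have ZX : (N%:R * r1) ^+ n <= r ^+ n by rewrite lerXn2r // nnegrE ltW // mulr_gt0.
have Z0 : 0 < (N%:R * r1) ^+ n by rewrite exprn_gt0 // mulr_gt0.
have rn : 0 < r1 ^+ n by rewrite exprn_gt0.
have tl : tail S r1 <= e1 by exact: hh.
have al0 : 0 <= (c - t) / 2 ^+ n by rewrite divr_ge0 ?subr_ge0 // exprn_ge0.
have al1 : (c - t) / 2 ^+ n <= c - t by rewrite ler_pdivrMr ?(lt_le_trans _ w2) // ler_peMr // subr_ge0.
have b1 : r1 ^+ n * ((c + 2 * e1) * N%:R ^+ n -
      (c - t) / 2 ^+ n * (#|inside n N J|%:R - Yc%:R) + (16 * IE S + 1) * Xc%:R) <=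
    (N%:R * r1) ^+ n * (c' + e1 * (3 + 2 * (c - t) + 16 * IE S)).
  rewrite (_ : (N%:R * r1) ^+ n * _ =
    r1 ^+ n * (N%:R ^+ n * (c' + e1 * (3 + 2 * (c - t) + 16 * IE S)))); last by rewrite exprMn; ring.
  rewrite ler_pM2l // /c'.
  have y1 : (c - t) / 2 ^+ n * ((1 - e1) * N%:R ^+ n - e1 * N%:R ^+ n) <=
    (c - t) / 2 ^+ n * (#|inside n N J|%:R - Yc%:R) by rewrite ler_wpM2l //; lra.
  have y2 : (16 * IE S + 1) * Xc%:R <= (16 * IE S + 1) * (e1 * N%:R ^+ n).
    by rewrite ler_wpM2l //; lra.
  have y3 : (c - t) / 2 ^+ n * (2 * e1 * N%:R ^+ n) <= (c - t) * (2 * e1 * N%:R ^+ n).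
    by apply: ler_wpM2r => //; apply: mulr_ge0; [apply: mulr_ge0 => //; exact: ltW|exact: exprn_ge0].
  by move: y1 y2 y3; move: ((c - t) / 2 ^+ n) (N%:R ^+ n) (IE S) => al X I; nra.
have b2 : (N%:R * r1) ^+ n * (c' + e1 * (3 + 2 * (c - t) + 16 * IE S)) <=
    r ^+ n * (c' + e1 * (3 + 2 * (c - t) + 16 * IE S)).
  apply: ler_wpM2r => //; apply: addr_ge0; first exact: le_trans t0 c't.
  by apply: mulr_ge0; [exact: ltW|lra].
have b3 : (r ^+ n - (N%:R * r1) ^+ n) * IE S <= r ^+ n * e1 * IE S by rewrite ler_wpM2r.
have b4 : r ^+ n * tail S r1 <= r ^+ n * e1 by rewrite ler_pM2l.
apply: le_trans (lerD (le_trans b1 b2) (lexx _)) _.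
have -> : (c' + eps) * r ^+ n = r ^+ n * (c' + e1 * D) by rewrite E1 mulrC.
by rewrite /D; move: b3 b4; move: (r ^+ n) (tail S r1) ((N%:R * r1) ^+ n) (IE S) (c') => X tl' Z I c1; lra.
Qed.

(** The constants c >= t with [V c] form a nonempty set, by the planar bound, that contains its
    infimum. If the infimum exceeded t, [V_improve] would produce a smaller member. *)
Lemma V_t : V t.
Proof.
have I0 := IE_ge0 S; have t0 := t_ge0.
pose E := [set c | t <= c /\ V c].
have hE : has_inf E.
  split; last by exists t => c [].
  exists (t + 16 * IE S); split; first by lra.
  move=> eps eta e0 eta0; exists 0 => r r0.
  rewrite [X in P X](_ : _ = set0) ?measure0 ?lee_fin ?ltW //.
  apply/seteqP; split => // w /= /(lt_le_trans); move=> /(_ _ (planar_bound S w 0 r MM r0)).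
  by rewrite lte_fin ltNge => /negP; apply; rewrite ler_wpM2r ?exprn_ge0 //; lra.
have ti : t <= inf E by apply: lb_le_inf; [case: hE|move=> c []].
have VE : V (inf E).
  move=> eps eta e0 eta0; have e2 : 0 < eps / 2 by rewrite divr_gt0.
  have [c [tc Vc] ci] := inf_adherent e2 hE.
  have [r0 h] := Vc _ _ e2 eta0; exists (Num.max 0 r0) => r; rewrite ge_max => /andP[rp rr].
  apply: le_trans (h _ rr); apply: le_measure; rewrite ?inE; [exact: measurable_gtF|exact: measurable_gtF|].
  move=> w /=; apply: le_lt_trans; rewrite lee_fin ler_wpM2r ?exprn_ge0 //; lra.
have V2 := V_improve ti VE.
have p2 : 0 < 2 ^+ n :> R by rewrite exprn_gt0.
have ge : t <= inf E - (inf E - t) / 2 ^+ n.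
  have : (inf E - t) / 2 ^+ n <= inf E - t.
    by rewrite ler_pdivrMr // ler_peMr ?subr_ge0 // exprn_ege1 // ler1n.
  by lra.
have := ge_inf (proj2 hE) (conj ge V2 : E _).
rewrite lerBrDr gerDl => h; suff -> : t = inf E by [].
apply/eqP; rewrite eq_le ti /= -subr_le0.
by move: h; rewrite pmulr_lle0 // invr_gt0.
Qed.

End inprob.

(** * Abundance of good centers *)

Section approx.
Context {dT : measure_display} {T : measurableType dT} {R : realType} (P : probability T R).

(** [Q] may fail to be measurable; the intersection of the complements of the chosen events is a
    measurable null set that contains its failure set. *)
Lemma ae_approx (Q : T -> Prop) :
  (forall eta : R, 0 < eta -> exists E, [/\ measurable E, (P (~` E) <= eta%:E)%E & E `<=` Q]) ->
  {ae P, forall w, Q w}.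
Proof.
move=> h.
have h' (j : nat) : {E | [/\ measurable E, (P (~` E) <= (j.+1%:R^-1)%:E)%E & E `<=` Q]}.
  by apply: cid; apply: h; rewrite invr_gt0.
pose A := \bigcap_j ~` projT1 (h' j).
have mA : measurable A.
  by apply: bigcap_measurable => // j _; apply: measurableC; have [] := projT2 (h' j).
exists A; split => //; last first.
  move=> w /= nQ j _ /= Ew; apply: nQ; have [_ _] := projT2 (h' j); exact.
have [a Ea] : exists p, P A = p%:E by exists (fine (P A)); rewrite fineK // fin_num_measure.
have a0 : 0 <= a by rewrite -lee_fin -Ea measure_ge0.
rewrite Ea; congr (_%:E); apply/eqP; rewrite eq_le a0 andbT leNgt; apply/negP => ap.
have [j hj] : exists j : nat, j.+1%:R^-1 < a.
  exists (Num.trunc a^-1); rewrite invf_plt ?posrE // ?ltr0n //.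
  have a10 : 0 <= a^-1 by rewrite invr_ge0.
  by have /andP[_] := truncn_itv a10.
have [mE hE _] := projT2 (h' j).
have : (P A <= (j.+1%:R^-1)%:E)%E.
  apply: le_trans hE; apply: le_measure; rewrite ?inE //; first exact: measurableC.
  by move=> w; apply.
by rewrite Ea lee_fin leNgt hj.
Qed.

End approx.

Lemma card_asbool_le (I : finType) (Q1 Q2 : I -> Prop) : (forall i, Q1 i -> Q2 i) ->
  (#|[set i | `[< Q1 i >]]%SET| <= #|[set i | `[< Q2 i >]]%SET|)%N.
Proof.
move=> h; apply: subset_leq_card; apply/fintype.subsetP => i.
by rewrite !finset.in_set => /asboolP/h q; apply/asboolP.
Qed.

Section good.
Context {R : realType} {n : nat} {dT : measure_display} {T : measurableType dT}.
Variable S : model R n.+1 T.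
Variable M : 'M[R]_n.+1.
Hypothesis MM : M *m M^T = 1%:M.
Variable t : R.
Local Notation P := (mP S).
Local Notation F w r := (Fc S w M 0 r r).
Hypothesis HT : {ae P, forall w,
  liminf_pinfty (fun r => ((r ^- n)%:E * F w r)%E) = t%:E}.

(** A good centre: the lower bound holds at all odd multiples of r1 from m0 on, and in every centred
    window of tiles at most the fraction [th] is too expensive. The second condition is for all m at
    once, which is what the maximal inequality provides. *)
Definition Gp w (x : 'rV[R]_n.+1) (r1 eps th : R) (m0 : nat) : Prop :=
  (forall m, (m0 <= m)%N -> (((t - eps) * (m.*2.+1%:R * r1) ^+ n)%:E <=
     Fc S w M x (m.*2.+1%:R * r1)%R (m.*2.+1%:R * r1)%R)%E) /\
  (forall m, #|[set k : lat n m.*2.+1 |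
      `[< (((t + eps) * r1 ^+ n)%R%:E < Fc S w M (x + off (Um M r1) m k)%R r1 r1)%E >]]%SET|%:R
    <= th * m.*2.+1%:R ^+ n).

Lemma good_event (eps th eta rmin : R) : 0 < eps -> 0 < th -> 0 < eta ->
  exists r1 m0 (G : set T), [/\ 0 < r1, rmin <= r1, measurable G, (P (~` G) <= eta%:E)%E &
    forall w y, G (mtau S y w) -> Gp w y r1 eps th m0].
Proof.
move=> e0 th0 eta0.
have c0 : 0 < 2 ^+ n.+1 / th by rewrite divr_gt0 // exprn_gt0.
(* The probability of a bad tile for which the maximal inequality returns eta / 2. *)
pose p := eta / 2 / (2 ^+ n.+1 / th).
have eta2 : 0 < eta / 2 by rewrite divr_gt0.
have p0 : 0 < p by apply: divr_gt0.
have [rV hV] := V_t MM HT e0 p0.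
pose r1 := Num.max 1 (Num.max rV rmin).
have r10 : 0 < r1 by rewrite lt_max ltr01.
have r1V : rV <= r1 by rewrite /r1 !le_max lexx !orbT.
have r1m : rmin <= r1 by rewrite /r1 !le_max lexx !orbT.
have odd0 j : 0 <= j.*2.+1%:R * r1 by rewrite mulr_ge0 // ltW.
pose BX := [set w | (((t + eps) * r1 ^+ n)%R%:E < F w r1)%E].
have mX : measurable BX by apply: measurable_gtF => //; exact: ltW.
have PX : (P BX <= p%:E)%E by exact: hV.
pose MX := \bigcup_j Mx S (Um M r1) th BX j.
have mMX : measurable MX by apply: bigcup_measurable => j _; exact: measurable_Mx.
have PM : (P MX <= (eta / 2)%:E)%E.
  apply: le_trans (maximal (Um M r1) mX th0 PX) _; rewrite lee_fin /p.
  by rewrite mulrC divfK // lt0r_neq0.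
pose H m := ~` [set w | (F w (m.*2.+1%:R * r1)%R < ((t - eps) * (m.*2.+1%:R * r1) ^+ n)%R%:E)%E].
have mH m : measurable (H m).
  apply: measurableC; have := measurable_Fc S 0 MM (odd0 m) (odd0 m) measurableT
    (emeasurable_itv `]-oo, ((t - eps) * (m.*2.+1%:R * r1) ^+ n)%:E[).
  by rewrite setTI; congr measurable; apply/seteqP; split => w; rewrite /= in_itv.
pose G1 m0 := \bigcap_(m in [set m | (m0 <= m)%N]) H m.
have mG1 m0 : measurable (G1 m0) by apply: bigcap_measurable => [|m _]; [exists m0 => /=|exact: mH].
have mono : {homo G1 : a b / (a <= b)%N >-> (a `<=` b)}.
  by move=> a b ab w h m /= bm; apply: h; exact: leq_trans bm.
have ae1 : {ae P, forall w, exists J, G1 J w}.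
  apply: filterS HT => w L; have [r0 r00 h] := lim_gt L e0.
  exists (Num.trunc (r0 / r1)) => m /= hm.
  rewrite /H /=; apply/negP; rewrite -leNgt; apply: h.
  have q0 : 0 <= r0 / r1 by apply: divr_ge0; exact: ltW.
  have /andP[_] := truncn_itv q0; rewrite ltr_pdivrMr // => /ltW/le_trans; apply.
  by rewrite ler_pM2r // ler_nat ltnS; apply: leq_trans hm _; rewrite -addnn leq_addr.
have [m0 hm0] := mu_exhaust mG1 mono ae1 eta2.
pose G := G1 m0 `&` ~` MX.
have mG : measurable G by apply: measurableI => //; exact: measurableC.
exists r1, m0, G; split => //.
  rewrite /G setCI setCK.
  have hU : (P (~` G1 m0 `|` MX) <= P (~` G1 m0) + P MX)%E.
    by apply: measureU2 => //; exact: measurableC.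
  apply: le_trans hU _; apply: le_trans (leeD hm0 PM) _.
  by rewrite -EFinD lee_fin; lra.
move=> w y [h1 h2]; split => m.
  move=> mm; have := h1 m mm; rewrite /H /= => /negP; rewrite -leNgt.
  by rewrite Fc_shift add0r.
have hle : (cnt S (off (Um M r1) m : lat n m.*2.+1 -> _) BX (mtau S y w))%:R <=
    th * (m.*2.+1 ^ n)%:R.
  by rewrite leNgt; apply/negP => hc; apply: h2; exists m.
have eqs (k : lat n m.*2.+1) : Fc S (mtau S (off (Um M r1) m k) (mtau S y w)) M 0 r1 r1 =
    Fc S w M (y + off (Um M r1) m k) r1 r1.
  by rewrite (Fc_shift S (mtau S y w) M 0) add0r (Fc_shift S w M _ y) addrC.
have -> : th * m.*2.+1%:R ^+ n = th * (m.*2.+1 ^ n)%:R by rewrite natrX.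
apply: le_trans hle; rewrite ler_nat; apply: card_asbool_le => k; rewrite -eqs; exact: id.
Qed.

(** The maximal inequality for the unit lattice of the whole space, applied to the complement of the
    good event. If no lattice point near x were good, bad points would fill a fixed fraction of a
    window about the origin of size proportional to rho, more than [th'] allows. *)
Lemma ae_good (eps th dl K rmin : R) : 0 < eps -> 0 < th -> 0 < dl -> 0 < K ->
  {ae P, forall w, exists r1 m0 R1, [/\ 0 < r1, rmin <= r1 & forall rho, R1 <= rho ->
     forall x, enorm x <= K * rho ->
       exists2 x', enorm (x' - x) <= dl * rho & Gp w x' r1 eps th m0]}.
Proof.
move=> e0 th0 dl0 K0; apply: ae_approx => eta eta0.
(* A sup-norm cube of radius a rho then has Euclidean radius at most dl rho / 2; the other half
   absorbs the rounding. *)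
pose a := dl / (2 * n.+1%:R); have a0 : 0 < a by rewrite divr_gt0 // mulr_gt0.
(* The window has side 2s + 2u + 5, at most L rho once rho >= 1; [th'] is half the volume ratio of
   cubes of sides a rho and L rho. *)
pose L := 2 * a + 2 * K + 5; have L0 : 0 < L by rewrite /L; lra.
pose th' := (a / L) ^+ n.+1 / 2; have aL : 0 < a / L by rewrite divr_gt0.
have th'0 : 0 < th' by rewrite divr_gt0 // exprn_gt0.
have c0 : 0 < 2 ^+ n.+2 / th' by rewrite divr_gt0 // exprn_gt0.
pose p := eta / (2 ^+ n.+2 / th'); have p0 : 0 < p by rewrite divr_gt0.
have [r1 [m0 [G [r10 r1m mG PG hG]]]] := good_event rmin e0 th0 p0.
have mC : measurable (~` G) by exact: measurableC.
pose U : 'M[R]_(n.+1, n.+1) := 1%:M.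
pose MX := \bigcup_j Mx S U th' (~` G) j.
have mMX : measurable MX by apply: bigcup_measurable => j _; exact: measurable_Mx.
exists (~` MX); split; first exact: measurableC.
  rewrite setCK; apply: le_trans (maximal U mC th'0 PG) _; rewrite lee_fin /p.
  by rewrite mulrC divfK // lt0r_neq0.
move=> w hw; exists r1, m0, (1 + a^-1 + 2 * n.+1%:R / dl); split => // rho hrho x hx.
have q1 : 0 < a^-1 by rewrite invr_gt0.
have q2 : 0 < 2 * n.+1%:R / dl by rewrite divr_gt0 // mulr_gt0.
have rho1 : 1 <= rho by lra.
have rho0 : 0 < rho by lra.
have ar1 : 1 <= a * rho by rewrite -ler_pdivrMl // mulr1; lra.
have Kr0 : 0 <= K * rho by rewrite mulr_ge0 ?ltW.
have /andP[s1 s2] := truncn_itv (ltW (lt_le_trans ltr01 ar1)).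
have /andP[u1 u2] := truncn_itv Kr0.
set s := Num.trunc (a * rho) in s1 s2; set u := Num.trunc (K * rho) in u1 u2.
rewrite -natr1 in s2; rewrite -natr1 in u2.
pose m := (s + u + 2)%N; pose N := m.*2.+1.
have Em : m%:R = s%:R + u%:R + 2 :> R by rewrite /m !natrD.
have xi i : `|x ord0 i| <= K * rho by exact: le_trans (coord_le _ _) hx.
have xm i : 0 <= x ord0 i + m%:R.
  by have := xi i; rewrite ler_norml => /andP[h _]; have : 0 <= s%:R :> R by []; rewrite Em; lra.
have ki i := truncn_itv (xm i).
have kN i : (Num.trunc (x ord0 i + m%:R) < N)%N.
  have /andP[k1 _] := ki i; rewrite -(ltr_nat R) /N dblS; apply: le_lt_trans k1 _.
  have := xi i; rewrite ler_norml => /andP[_ h].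
  by have : 0 <= s%:R :> R by []; rewrite Em; lra.
pose k0 : lat n.+1 N := [ffun i => Ordinal (kN i)].
have k0in : k0 \in inside n.+1 N s.
  rewrite inE; apply/forallP => i; rewrite ffunE /=.
  have /andP[k1 k2] := ki i; rewrite -natr1 in k2.
  have := xi i; rewrite ler_norml => /andP[g1 g2]; apply/andP; split.
    by rewrite -ltnS -(ltr_nat R) -natr1; lra.
  by rewrite -(ltr_nat R) natrD /N dblS; rewrite Em in k1 *; lra.
have big : th' * N%:R ^+ n.+1 < s.*2.+1%:R ^+ n.+1.
  have N1 : N%:R <= L * rho by rewrite /N dblS Em /L; nra.
  have S1 : a * rho <= s.*2.+1%:R by rewrite dblS; lra.
  apply: (@le_lt_trans _ _ (th' * (L * rho) ^+ n.+1)).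
    by rewrite ler_pM2l // lerXn2r // nnegrE ?mulr_ge0 // ltW.
  apply: (@lt_le_trans _ _ ((a * rho) ^+ n.+1)); last by rewrite lerXn2r // nnegrE ?mulr_ge0 // ltW.
  have -> : th' * (L * rho) ^+ n.+1 = (a * rho) ^+ n.+1 / 2.
    rewrite /th' mulrAC -exprMn; congr (_ ^+ _ / 2); field; exact: lt0r_neq0.
  by rewrite ltr_pdivrMr // ltr_pMr ?exprn_gt0 ?mulr_gt0 //; lra.
have [k kc kG] : exists2 k, k \in lcube k0 s & G (mtau S (off U m k) w).
  apply: contrapT => nk; apply: hw; exists m => //.
  have big' : th' * (N ^ n.+1)%:R < s.*2.+1%:R ^+ n.+1 by rewrite natrX.
  apply: (lt_le_trans big'); rewrite -natrX -(card_lcube k0in) ler_nat /cnt.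
  apply: subset_leq_card; apply/fintype.subsetP => k kc; rewrite inE; apply/asboolP => kG.
  by apply: nk; exists k.
exists (off U m k); last exact: hG.
have hk i : `|(off U m k - x) ord0 i| <= s%:R + 1.
  rewrite /off mulmx1 !mxE; move: kc; rewrite inE => /forallP/(_ i); rewrite ffunE /= => /(@ndist_le R)[d1 d2].
  by have /andP[k1 k2] := ki i; rewrite -natr1 in k2; rewrite ler_norml; apply/andP; split; lra.
have s0 : 0 <= s%:R + 1 :> R by rewrite addr_ge0.
apply: le_trans (enorm_coord hk s0) _.
have : n.+1%:R * (s%:R + 1) <= n.+1%:R * (a * rho + 1) by rewrite ler_wpM2l //; lra.
move/le_trans; apply; rewrite mulrDr mulr1 mulrA.
have -> : n.+1%:R * a = dl / 2 by rewrite /a; field; rewrite lt0r_neq0.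
have : n.+1%:R <= dl / 2 * rho.
  rewrite mulrAC ler_pdivlMr // mulrC -ler_pdivrMl //.
  by rewrite mulrC; lra.
by lra.
Qed.

End good.

(** * Interpolation between two planes *)

Section cut.
Context {R : realType}.

Lemma sstep_derive1 : exists2 C : R, 0 < C & forall t : R,
  [/\ derivable (@sstep R) t 1, `|derive1 (@sstep R) t| <= C & 1 <= t -> derive1 (@sstep R) t = 0].
Proof.
have [ds [hd [C C0 hC]]] := @sstep_derive R; exists C => // t.
have dv u : derivable (@sstep R) u 1 by have [] := hd u.
have E u : derive1 (@sstep R) u = ds u by rewrite derive1E; exact: derive_val.
split; [exact: dv|by rewrite E|move=> t1].
(* [sstep] is nonnegative and vanishes at t, so t is a minimum; this covers t = 1 as well. *)
have := @derive1_at_min R (@sstep R) (t - 1) (t + 1) t _ _ _ _.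
have h1 : t - 1 <= t + 1 by lra.
have h2 u : u \in `](t - 1), (t + 1)[ -> derivable (@sstep R) u 1 by move=> _; exact: dv.
have h3 : t \in `](t - 1), (t + 1)[ by rewrite in_itv /=; apply/andP; split; lra.
have h4 u : u \in `](t - 1), (t + 1)[ -> @sstep R t <= sstep u.
  by move=> _; rewrite sstep1 // sstep_ge0.
by move=> /(_ h1 h2 h3 h4) h; rewrite derive1E; exact: derive_val.
Qed.

(** A product of smooth steps of affine functions, one for each half-space. Each factor contributes
    at most C A to the gradient, and a factor past its constraint by 1 kills both the product and
    its gradient. *)
Lemma cut_list n : exists2 C : R, 0 < C & forall (A : R) (s : seq ('rV[R]_n * R)), 0 <= A ->
  (forall c, c \in s -> enorm c.1 <= A) -> exists th G,
  [/\ smooth th /\ hasgrad th G, (forall z, 0 <= th z <= 1),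
      (forall z, enorm (G z) <= (size s)%:R * C * A),
      (forall z, (forall c, c \in s -> dotp z c.1 + c.2 <= 0) -> th z = 1) &
      (forall z c, c \in s -> 1 <= dotp z c.1 + c.2 -> th z = 0 /\ G z = 0)].
Proof.
have [C C0 hs] := sstep_derive1; exists C => // A s A0; elim: s => [|c s IH] hA.
  exists (fun=> 1), (fun=> 0); split => //.
  - split; first by move=> k; exact: Ck_cst.
    by move=> z v; rewrite dotp0l; exact: is_derive_cst.
  - by move=> z; rewrite ler01 lexx.
  - by move=> z; rewrite enorm0 !mul0r.
have hA' c' : c' \in s -> enorm c'.1 <= A by move=> h; apply: hA; rewrite inE h orbT.
have [th' [G' [[sm hg] b01 bG t1 t0]]] := IH hA'.
pose L (z : 'rV[R]_n) := dotp z c.1 + c.2.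
have dS t : derivable (@sstep R) t 1 by have [] := hs t.
have gL := hasgrad_comp (hasgrad_lin c.1 c.2) dS.
exists (fun z => sstep (L z) * th' z),
  (fun z => sstep (L z) *: G' z + th' z *: (derive1 (@sstep R) (L z) *: c.1)); split.
- split; last exact: (hasgradM gL hg).
  by move=> k; apply: CkM; [apply: Ck_sstep; exact: Ck_lin|exact: sm].
- move=> z; have /andP[a b] := b01 z; have c1 := sstep_ge0 (L z); have c2 := sstep_le1 (L z).
  by rewrite mulr_ge0 //= mulr_ile1.
- move=> z; apply: le_trans (enormD _ _) _; rewrite !enormZ.
  have /andP[a b] := b01 z; have c1 := sstep_ge0 (L z); have c2 := sstep_le1 (L z).
  rewrite (ger0_norm c1) (ger0_norm a).
  have -> : (size (c :: s))%:R * C * A = (size s)%:R * C * A + C * A by rewrite /= -natr1; ring.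
  apply: lerD.
    by apply: le_trans (bG z); rewrite ler_piMl ?enorm_ge0.
  apply: (@le_trans _ _ (`|derive1 (@sstep R) (L z)| * enorm c.1)).
    by rewrite ler_piMl // mulr_ge0 ?enorm_ge0.
  have [_ hC _] := hs (L z); apply: ler_pM => //; first exact: enorm_ge0.
  by apply: hA; rewrite mem_head.
- move=> z h; rewrite t1; last by move=> c' h'; apply: h; rewrite inE h' orbT.
  by rewrite mulr1 sstep0 //; apply: h; rewrite mem_head.
- move=> z c'; rewrite inE => /orP[/eqP ->|c's] h.
    have [_ _ h0] := hs (L z); rewrite sstep1 // h0 // mul0r scale0r add0r scale0r scaler0.
    by [].
  by have [-> ->] := t0 z c' c's h; rewrite mulr0 scaler0 scale0r addr0.
Qed.

Lemma enorm_unit n (e : 'rV[R]_n) : dotp e e = 1 -> enorm e = 1.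
Proof. by rewrite /enorm => ->; rewrite sqrtr1. Qed.

(** The gradient of l is eo + th (ei - eo) + (difference of the two planar coordinates) G. Each
    perturbation has length at most 1/4, so the gradient stays within 1/2 of eo, and likewise of ei;
    both slopes are then at least 1/2. *)
Lemma interp n (eo ei xo xi : 'rV[R]_n) (th : 'rV[R]_n -> R) G (A B : R) :
  dotp eo eo = 1 -> dotp ei ei = 1 -> enorm (ei - eo) <= 4^-1 ->
  smooth th -> hasgrad th G -> (forall z, 0 <= th z <= 1) -> 0 <= A -> 0 <= B -> A * B <= 4^-1 ->
  (forall z, G z = 0 \/ (enorm (G z) <= A /\ `|dotp (z - xi) ei - dotp (z - xo) eo| <= B)) ->
  let l := fun z => dotp (z - xo) eo + th z * (dotp (z - xi) ei - dotp (z - xo) eo) in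
  exists Gl, [/\ smooth l, hasgrad l Gl, (forall z, dotp (Gl z) (Gl z) <= 4),
    (forall z, 2^-1 <= dotp (Gl z) eo) & (forall z, 2^-1 <= dotp (Gl z) ei)].
Proof.
move=> ho hi hd sm hg b01 A0 B0 AB hG l.
have no := enorm_unit ho; have ni := enorm_unit hi.
pose df z := dotp (z - xi) ei - dotp (z - xo) eo.
have Eo : (fun z => dotp (z - xo) eo) = fun z => dotp z eo + - dotp xo eo.
  by apply/funext => z; rewrite dotpBl.
have Ed : df = fun z => dotp z (ei - eo) + (dotp xo eo - dotp xi ei).
  by apply/funext => z; rewrite /df !dotpBl dotpBr; lra.
pose Gl z := eo + (th z *: (ei - eo) + df z *: G z).
have hdf : hasgrad df (fun=> ei - eo) by rewrite Ed; exact: hasgrad_lin.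
have hlo : hasgrad (fun z => dotp (z - xo) eo) (fun=> eo) by rewrite Eo; exact: hasgrad_lin.
have bv z : enorm (df z *: G z) <= 4^-1.
  have [->|[h1 h2]] := hG z; first by rewrite scaler0 enorm0 invr_ge0.
  rewrite enormZ mulrC; apply: le_trans AB; apply: ler_pM => //; exact: enorm_ge0.
have b1 z : enorm (Gl z - eo) <= 2^-1.
  rewrite /Gl addrAC subrr add0r; apply: le_trans (enormD _ _) _.
  have : enorm (th z *: (ei - eo)) <= 4^-1.
    rewrite enormZ; have /andP[a b] := b01 z; rewrite ger0_norm //; apply: le_trans hd.
    by rewrite ler_piMl ?enorm_ge0.
  by have := bv z; lra.
have b2 z : enorm (Gl z - ei) <= 2^-1.
  have -> : Gl z - ei = (1 - th z) *: (eo - ei) + df z *: G z.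
    by apply/rowP => i; rewrite /Gl !mxE; ring.
  apply: le_trans (enormD _ _) _.
  have : enorm ((1 - th z) *: (eo - ei)) <= 4^-1.
    rewrite enormZ; have /andP[a b] := b01 z; rewrite ger0_norm ?subr_ge0 //.
    have -> : enorm (eo - ei) = enorm (ei - eo) by rewrite -enormN opprB.
    apply: le_trans hd.
    by rewrite ler_piMl ?enorm_ge0 //; lra.
  by have := bv z; lra.
have low z (e : 'rV[R]_n) : dotp e e = 1 -> enorm (Gl z - e) <= 2^-1 -> 2^-1 <= dotp (Gl z) e.
  move=> he hb; rewrite -[Gl z](subrK e) dotpDl he.
  have := cauchy_schwarz (Gl z - e) e; rewrite (enorm_unit he) mulr1 ler_norml => /andP[h _].
  by lra.
exists Gl; split.
- move=> k; apply: CkD; first by rewrite Eo; exact: Ck_lin.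
  by apply: CkM; [exact: sm|rewrite -/df Ed; exact: Ck_lin].
- exact: (hasgradD hlo (hasgradM hg hdf)).
- move=> z; rewrite -enorm_sq.
  have : enorm (Gl z) <= 3 / 2.
    rewrite -[Gl z](subrK eo); apply: le_trans (enormD _ _) _; rewrite no; have := b1 z; lra.
  by have := enorm_ge0 (Gl z); nra.
- by move=> z; exact: low.
- by move=> z; exact: low.
Qed.

Lemma compact_cobox n (M : 'M[R]_n.+1) x (a : 'I_n.+1 -> R) (D : R) : M *m M^T = 1%:M -> 0 <= D ->
  (forall i, a i <= D) -> compact [set z : 'rV[R]_n.+1 | forall i, `|co M x z ord0 i| <= a i].
Proof.
move=> MM D0 aD; apply: bounded_closed_compact.
  exists (n.+1%:R * D + enorm x); split; first exact: num_real.
  move=> B hB z hz; apply: le_trans (ltW hB).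
  have hc : enorm z <= n.+1%:R * D + enorm x.
    rewrite -[z](subrK x); apply: le_trans (enormD _ _) _; rewrite lerD2r -(enorm_co x z MM).
    by apply: enorm_coord => // i; exact: le_trans (hz i) (aD i).
  first [rewrite mx_normrE|rewrite /Num.norm /= mx_normrE].
  apply/bigmax_leP; split; first by rewrite addr_ge0 ?mulr_ge0 ?enorm_ge0.
  by move=> [i j] _ /=; rewrite ord1; exact: le_trans (coord_le _ _) hc.
rewrite (_ : [set z | _] = \bigcap_(i in setT) [set z : 'rV[R]_n.+1 | `|co M x z ord0 i| <= a i]).
  apply: closed_bigI => i _.
  apply: (@closed_comp _ _ (fun z : 'rV[R]_n.+1 => `|co M x z ord0 i|) [set y | y <= a i]).
    move=> z _; apply: (@continuous_comp _ _ _ (fun z => co M x z ord0 i) (fun y : R => `|y|)).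
      exact: continuous_co.
    exact: norm_continuous.
  exact: closed_le.
by apply/seteqP; split => [z h i _|z h i]; apply: h.
Qed.

End cut.

(** * Two nearby planes and the count of tiles *)

Section geometry.
Context {R : realType} {n : nat}.
Variables (M M' : 'M[R]_n.+1) (x x' : 'rV[R]_n.+1) (dl r r1 : R).
Hypothesis (MM : M *m M^T = 1%:M) (MM' : M' *m M'^T = 1%:M).
Local Notation e := (row ord0 M).
Local Notation e' := (row ord0 M').
Hypothesis (He : enorm (e' - e) <= dl) (Hx : enorm (x' - x) <= dl * r).
Hypothesis (r0 : 0 < r) (r10 : 0 < r1).

Lemma row_orth (N : 'M[R]_n.+1) i j : N *m N^T = 1%:M -> dotp (row i N) (row j N) = (i == j)%:R.
Proof.
move=> /matrixP/(_ i j); rewrite !mxE => <-.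
by apply: eq_bigr => l _; rewrite !mxE.
Qed.

Lemma baseE (N : 'M[R]_n.+1) c y i : base N c y ord0 i = dotp (y - c) (row (lift ord0 i) N).
Proof. by rewrite /base mxE coE. Qed.

Lemma he_diff z D : enorm (z - x') <= D * r ->
  `|dotp (z - x) e - dotp (z - x') e'| <= (D + 1) * (dl * r).
Proof.
move=> hz; have e1 : dotp e e = 1 by rewrite row_orth // eqxx.
have -> : dotp (z - x) e - dotp (z - x') e' = dotp (x' - x) e - dotp (z - x') (e' - e).
  by rewrite !dotpBl !dotpBr; lra.
have h1 : `|dotp (x' - x) e| <= dl * r.
  by apply: le_trans (cauchy_schwarz _ _) _; rewrite (enorm_unit e1) mulr1.
have h2 : `|dotp (z - x') (e' - e)| <= D * r * dl.
  by apply: le_trans (cauchy_schwarz _ _) _; apply: ler_pM => //; exact: enorm_ge0.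
by apply: le_trans (ler_normB _ _) _; lra.
Qed.

Lemma co_lip (N : 'M[R]_n.+1) c y z i : N *m N^T = 1%:M ->
  `|co N c y ord0 i - co N c z ord0 i| <= enorm (y - z).
Proof.
move=> NN; rewrite !coE (_ : _ - _ = co N z y ord0 i); first exact: co_le.
by rewrite coE !dotpBl; lra.
Qed.

Lemma tile_diam c y z : box M' c r1 r1 y -> box M' c r1 r1 z -> enorm (y - z) <= 4 * n.+1%:R * r1.
Proof.
move=> /(box_bound MM' (ltW r10) (ltW r10)) h1 /(box_bound MM' (ltW r10) (ltW r10)) h2.
have -> : y - z = (y - c) - (z - c) by rewrite opprB addrA subrK.
apply: le_trans (enormD _ _) _; rewrite enormN; lra.
Qed.

Variable m : nat.
Local Notation N := m.*2.+1.
Local Notation tl k s := (box M' (x' + off (Um M' r1) m k) r1 s).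

(** Sliding a point of a tall column along [e'] down to the plane lands in the tile. The base
    coordinates of the other frame change by at most |u| dl, because [e'] is within dl of [e], which
    is orthogonal to them. *)
Lemma tall_proj (k : lat n N) y s : tl k s y -> exists y0 (u : R), [/\ tl k r1 y0,
  `|u| < s, dotp (y - x') e' = u, enorm (y - y0) = `|u| &
  forall i, `|base M x y ord0 i - base M x y0 ord0 i| <= `|u| * dl].
Proof.
move=> /(blockP MM' r1 m)[h1 h2]; pose u := dotp (y - x') e'; exists (y - u *: e'), u.
have e1 : dotp e' e' = 1 by rewrite row_orth // eqxx.
have hu : y - (y - u *: e') = u *: e' by rewrite opprB addrC subrK.
split.
- apply/(blockP MM' r1 m); split.
    rewrite coE addrAC dotpBl dotpZl e1 mulr1 subrr normr0; exact: r10.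
  move=> i; have := h2 i; rewrite !baseE (_ : y - u *: e' - x' = y - x' - u *: e'); last by rewrite addrAC.
  have -> // : dotp (y - x' - u *: e') (row (lift ord0 i) M') = dotp (y - x') (row (lift ord0 i) M').
  by rewrite [LHS]dotpBl dotpZl row_orth // (negbTE (neq_lift _ _)) mulr0 subr0.
- by move: h1; rewrite coE.
- by [].
- by rewrite hu enormZ (enorm_unit e1) mulr1.
move=> i; rewrite !baseE -dotpBl.
rewrite (_ : y - x - _ = u *: e'); last by rewrite -[RHS]hu; apply/rowP => j; rewrite !mxE; ring.
have -> : dotp (u *: e') (row (lift ord0 i) M) = u * dotp (e' - e) (row (lift ord0 i) M).
  by rewrite dotpZl dotpBl [X in _ - X]row_orth // (negbTE (neq_lift _ _)) subr0.
rewrite normrM ler_wpM2l //; apply: le_trans (cauchy_schwarz _ _) _.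
by rewrite [X in _ * X]enorm_unit ?mulr1 // row_orth // eqxx.
Qed.

Lemma tall_disj (k k' : lat n N) s s' z : tl k s z -> tl k' s' z -> k = k'.
Proof.
move=> /(blockP MM' r1 m)[_ h1] /(blockP MM' r1 m)[_ h2]; apply/ffunP => i; apply: val_inj.
have := h1 i; have := h2 i; rewrite !ltr_norml => /andP[a1 a2] /andP[b1 b2].
have g1 : ((k i)%:R - (k' i)%:R) * r1 < 1 * r1 by lra.
have g2 : ((k' i)%:R - (k i)%:R) * r1 < 1 * r1 by lra.
move: g1 g2; rewrite !ltr_pM2r // !ltrBlDr ![1 + _]addrC !natr1 !ltr_nat !ltnS => q1 q2.
by apply/eqP; rewrite eqn_leq; apply/andP; split.
Qed.

(** Tiles are counted by the volume of the disjoint columns of half-height s over them. With columns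
    as tall as the cylinder, the tilt between the planes is a small proportion of the volume; it
    would be large compared with the height r1 of the tiles themselves. *)
Lemma tall_count (T : {set lat n N}) s (D : set (Rd R n.+1)) (c : R) : 0 <= s -> measurable D ->
  (muRd n.+1 D <= c%:E)%E ->
  (forall k, k \in T -> tl k s `<=` D) -> #|T|%:R * (s *+ 2 * r1 ^+ n) <= c.
Proof.
move=> s0 mD hD sub; rewrite -lee_fin; apply: le_trans hD.
have mt k : measurable (tl k s : set (Rd R n.+1)) by exact: measurable_box.
have E : ((#|T|%:R * (s *+ 2 * r1 ^+ n))%:E =
    \int[muRd n.+1]_z (\sum_(k <- enum T) (\1_(tl k s) z)%:E))%E.
  rewrite ge0_integral_sum //; last by move=> k; exact: emeasurable_indic.
  rewrite (eq_bigr (fun=> (s *+ 2 * r1 ^+ n)%:E)); last first.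
    by move=> k _; rewrite integral_indic // setIT; apply: mu_box => //; exact: ltW.
  by rewrite big_enum sumEFin sumr_const mulr_natl.
rewrite E -[X in (_ <= muRd _ X)%E]setIT -integral_indic //.
apply: ge0_le_integral => //.
- by move=> z _; apply: sume_ge0 => k _; rewrite lee_fin indicE ler0n.
- by apply: emeasurable_sum => k; exact: emeasurable_indic.
- exact: emeasurable_indic.
move=> z _; rewrite big_enum /= sumEFin lee_fin.
have [[k0 [kT kz]]|nk] := pselect (exists k, k \in T /\ tl k s z).
  rewrite (bigD1 k0) //= big1 => [|k /andP[_ kk]].
    by rewrite addr0 !indicE (mem_set kz) (mem_set (sub _ kT _ kz)).
  rewrite indicE memNset // => h; move/eqP: kk; apply; exact: tall_disj h kz.
rewrite big1 ?indicE ?ler0n // => k kT; rewrite indicE memNset // => h; apply: nk; by exists k.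
Qed.

End geometry.

(** * Comparison of a cube with a tiled plane *)

Section frames.
Context {R : realType} {n : nat}.
Local Notation N1 := (n.+1%:R : R).

Definition cut_bound (C : R) := forall (M : 'M[R]_n.+1) x (a b : 'I_n.+1 -> R) be,
  M *m M^T = 1%:M -> 0 < be -> (forall i, be <= b i) -> exists th G,
  [/\ smooth th /\ hasgrad th G, (forall z, 0 <= th z <= 1),
      (forall z, enorm (G z) <= 2 * N1 * C / be),
      (forall z, (forall i, `|co M x z ord0 i| <= a i) -> th z = 1) &
      (forall z i, a i + b i <= `|co M x z ord0 i| -> th z = 0 /\ G z = 0)].

(** [cut_list] for the two half-spaces of each coordinate, scaled by the widths b i; 2(n+1) is the
    number of half-spaces. The constant is independent of the frame. *)
Lemma cut_frame : exists2 C : R, 0 < C & cut_bound C.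
Proof.
have [C C0 hcut] := @cut_list R n.+1; exists C => // M x a b be MM be0 hb.
have b0 i : 0 < b i by exact: lt_le_trans (hb i).
have bn i : b i != 0 by rewrite lt0r_neq0.
pose p i := ((b i)^-1 *: row i M, - (dotp x (row i M) + a i) / b i).
pose q i := (- (b i)^-1 *: row i M, (dotp x (row i M) - a i) / b i).
have Ep z i : dotp z (p i).1 + (p i).2 = (co M x z ord0 i - a i) / b i.
  by rewrite /p /= dotpZr coE dotpBl; field.
have Eq z i : dotp z (q i).1 + (q i).2 = (- co M x z ord0 i - a i) / b i.
  by rewrite /q /= dotpZr coE dotpBl; field.
pose s := [seq p i | i <- enum 'I_n.+1] ++ [seq q i | i <- enum 'I_n.+1].
have hs c : c \in s -> exists i, c = p i \/ c = q i.
  by rewrite mem_cat => /orP[/mapP[i _ ->]|/mapP[i _ ->]]; exists i; [left|right].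
have ps i : p i \in s by rewrite mem_cat map_f // mem_enum.
have qs i : q i \in s by rewrite mem_cat (map_f q) ?mem_enum // orbT.
have n1 i : enorm (row i M) = 1 by apply: enorm_unit; exact: row0_unit.
have hA c : c \in s -> enorm c.1 <= be^-1.
  move=> /hs[i [->|->]] /=; rewrite enormZ ?normrN gtr0_norm ?invr_gt0 // n1 mulr1 lef_pV2 ?posrE //.
have be0' : 0 <= be^-1 by rewrite invr_ge0 ltW.
have [th [G [h1 h2 h3 h4 h5]]] := hcut be^-1 s be0' hA.
exists th, G; split => //.
- move=> z; apply: le_trans (h3 z) _; rewrite (_ : size s = (n.+1 + n.+1)%N); last by rewrite /s size_cat !size_map -enumT size_enum_ord.
  by rewrite natrD (_ : (_ + _) * C * _ = 2 * N1 * C / be) //; ring.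
- move=> z hz; apply: h4 => c /hs[i [->|->]]; rewrite ?Ep ?Eq pmulr_lle0 ?invr_gt0 //;
    have := hz i; rewrite ler_norml => /andP[u v]; lra.
- move=> z i hz; have [c0|c0] := leP 0 (co M x z ord0 i).
    apply: (h5 z (p i)) => //; rewrite Ep ler_pdivlMr // mul1r; move: hz; rewrite ger0_norm //; lra.
  apply: (h5 z (q i)) => //; rewrite Eq ler_pdivlMr // mul1r; move: hz; rewrite ltr0_norm //; lra.
Qed.

Lemma cost_sum (I : finType) (T B : {set I}) (al be : R) : 0 <= be ->
  \sum_(k <- enum T) (al + (k \in B)%:R * be) <= #|T|%:R * al + #|B|%:R * be.
Proof.
move=> be0; rewrite big_enum big_split /= sumr_const -[X in X + _]mulr_natl lerD2l -mulr_suml.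
rewrite ler_wpM2r // -[X in _ <= X%:R]sum1_card natr_sum [X in X <= _]big_mkcond [X in _ <= X]big_mkcond /=.
by apply: ler_sum => k _; case: (k \in T); case: (k \in B).
Qed.

Lemma far_bound (M : 'M[R]_n.+1) x z (D : R) : M *m M^T = 1%:M -> 0 <= D ->
  (forall i, `|co M x z ord0 i| <= D) -> enorm (z - x) <= N1 * D.
Proof. by move=> MM D0 h; rewrite -(enorm_co x z MM); exact: enorm_coord. Qed.

Lemma odd_cover (r1 a : R) : 0 < r1 -> 0 <= a ->
  exists m : nat, a <= m.*2.+1%:R * r1 /\ m.*2.+1%:R * r1 <= a + 3 * r1.
Proof.
move=> r10 a0; have h0 : 0 <= a / (2 * r1) by rewrite divr_ge0 // mulr_ge0 // ltW.
have /andP[q1 q2] := truncn_itv h0; set q := Num.trunc _ in q1 q2.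
exists q.+1; rewrite dblS -natr1; rewrite -natr1 in q2.
move: q1 q2; rewrite ler_pdivlMr ?mulr_gt0 // ltr_pdivrMr ?mulr_gt0 // => q1 q2.
by split; lra.
Qed.

Lemma nums (C dl kp : R) : 0 < C -> 0 <= dl -> 8 * 8 * 8 * (N1 ^+ 3 * (C + 1) * dl) <= kp ->
  [/\ 1 <= N1, 8 * 8 * 8 * dl <= kp, 8 * 8 * 8 * (N1 * dl) <= kp,
      8 * 8 * 8 * (N1 ^+ 2 * dl) <= kp & 8 * 8 * 8 * (N1 ^+ 3 * C * dl) <= kp].
Proof.
move=> C0 dl0 h; have N11 : 1 <= N1 by rewrite ler1n.
have a1 : dl <= N1 * dl by rewrite ler_peMl.
have a2 : N1 * dl <= N1 ^+ 2 * dl by rewrite ler_wpM2r // expr2 ler_peMl // (le_trans ler01).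
have a3 : N1 ^+ 2 * dl <= N1 ^+ 3 * dl.
  by rewrite ler_wpM2r // [X in _ <= X]exprS ler_peMl // exprn_ge0 // (le_trans ler01).
have a4 : 0 <= N1 ^+ 3 * dl by rewrite mulr_ge0 // exprn_ge0 // (le_trans ler01).
have a5 : 0 <= N1 ^+ 3 * C * dl by rewrite mulrAC mulr_ge0 // ltW.
have E : N1 ^+ 3 * (C + 1) * dl = N1 ^+ 3 * C * dl + N1 ^+ 3 * dl by ring.
rewrite E in h.
by move: (N1 ^+ 3 * C * dl) (N1 ^+ 3 * dl) (N1 ^+ 2 * dl) (N1 * dl) a1 a2 a3 a4 a5 h => u v y q *; split=> //; lra.
Qed.

(** The smallness used in both comparisons, derived once from the single condition tying dl to kp,
    so that later only linear combinations of these bounds occur. *)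
Lemma scales (C dl kp r r1 : R) : 0 < C -> 0 <= dl -> 8 * 8 * 8 * (N1 ^+ 3 * (C + 1) * dl) <= kp ->
  0 < kp -> kp <= 4^-1 -> 0 < r -> 0 < r1 -> r1 <= dl * r ->
  [/\ [/\ 0 < kp * r, kp * r <= r / 4 & dl <= 4^-1],
      [/\ r1 <= kp * r / 64, dl * r <= kp * r / 64 & 4 * N1 * r1 <= kp * r / 64],
      [/\ r <= N1 * r, N1 * r <= N1 ^+ 2 * r & 1 <= N1 ^+ 2],
      [/\ 23 * N1 ^+ 2 * dl * r <= kp * r / 20 & 0 <= 23 * N1 ^+ 2 * dl * r] &
      92 * (N1 ^+ 3 * C * dl) <= kp / 4].
Proof.
move=> C0 dl0 h kp0 kp4 r0 r10 r1d; have [N11 d1 d2 d3 d4] := nums C0 dl0 h.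
have w1 := ler_wpM2r (ltW r0) d1; have w2 := ler_wpM2r (ltW r0) d2; have w3 := ler_wpM2r (ltW r0) d3.
have NN : N1 <= N1 ^+ 2 by rewrite expr2 ler_peMl // (le_trans ler01).
have w4 : N1 * r1 <= N1 * (dl * r) by rewrite ler_wpM2l // (le_trans ler01).
have w5 := ler_wpM2r (ltW r0) kp4.
have kr0 : 0 < kp * r by rewrite mulr_gt0.
split.
- by split=> //; lra.
- by split; lra.
- by split; [rewrite ler_peMl // ltW|rewrite ler_pM2r|exact: le_trans NN].
- by split; [lra|rewrite !mulr_ge0 // ltW].
by lra.
Qed.

Lemma final_arith (t eps q Rn X Y I th tt B P nn kp c sg : R) :
  sg <= (t + 2 * eps) * (X - (1 - q) * Rn) + (16 * I + 1) * th * (Y * Rn) ->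
  (B - Rn) * I <= P * Rn * (nn * (3 * kp)) * I ->
  3 * eps * X <= 3 * eps * (Y * Rn) -> X * tt <= Y * Rn * tt ->
  0 <= 2 * eps * ((1 - q) * Rn) ->
  (t - eps) * X <= c + sg + 8 * (X * tt + (B - Rn) * I) ->
  (t * (1 - q) - (3 * eps + (16 * I + 1) * th + 8 * tt) * Y - 24 * P * nn * kp * I) * Rn <= c.
Proof. by move=> *; lra. Qed.

End frames.
Arguments cut_bound {R} n C.

Section compare.
Context {R : realType} {n : nat} {dT : measure_display} {T : measurableType dT}.
Variable S : model R n.+1 T.
Local Notation N1 := (n.+1%:R : R).
Variables (M' : 'M[R]_n.+1) (t : R) (x' : 'rV[R]_n.+1) (w : T) (r1 eps th : R) (m0 : nat).
Hypothesis MM' : M' *m M'^T = 1%:M.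
Local Notation e' := (row ord0 M').
Hypothesis r10 : 0 < r1.
Hypothesis (eps0 : 0 < eps) (t0 : 0 <= t) (th0 : 0 <= th).
Hypothesis HG : Gp S M' t w x' r1 eps th m0.

Let rn0 : 0 < r1 ^+ n. Proof. by rewrite exprn_gt0. Qed.

Definition badt m : {set lat n m.*2.+1} := [set k : lat n m.*2.+1 |
  `[< (((t + eps) * r1 ^+ n)%R%:E < Fc S w M' (x' + off (Um M' r1) m k)%R r1 r1)%E >]]%SET.
(** Every tile is charged slightly more than t per unit area, and a bad tile the planar bound in
    addition; 2 eps makes the bound strict. *)
Definition tcost m (k : lat n m.*2.+1) : R :=
  (t + 2 * eps) * r1 ^+ n + (k \in badt m)%:R * ((16 * IE S + 1) * r1 ^+ n).

Lemma tcostP m (k : lat n m.*2.+1) :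
  (Fc S w M' (x' + off (Um M' r1) m k)%R r1 r1 < (tcost k)%:E)%E.
Proof.
have t0_ := t0; have e0_ := eps0; rewrite /tcost; case: (boolP (k \in badt m)) => kB.
  apply: le_lt_trans (planar_bound _ _ _ _ MM' (ltW r10)) _; rewrite lte_fin mul1r.
  have p1 : 0 < (t + 2 * eps) * r1 ^+ n by rewrite mulr_gt0 //; lra.
  by move: rn0; nra.
rewrite mul0r addr0; move: kB; rewrite inE => /asboolPn/negP; rewrite -leNgt => /le_lt_trans; apply.
by rewrite lte_fin ltr_pM2r //; lra.
Qed.

Lemma tcost_sum m (Ts : {set lat n m.*2.+1}) (a c : R) : #|Ts|%:R * r1 ^+ n <= a ->
  m.*2.+1%:R * r1 <= c ->
  \sum_(k <- enum Ts) tcost k <= (t + 2 * eps) * a + (16 * IE S + 1) * th * c ^+ n.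
Proof.
move=> ha hc; have I0 := IE_ge0 S; have t0_ := t0; have e0_ := eps0; have r10_ := r10.
have be0 : 0 <= (16 * IE S + 1) * r1 ^+ n by rewrite mulr_ge0 ?(ltW rn0) //; lra.
apply: le_trans (cost_sum _ _ _ be0) _; apply: lerD.
  rewrite mulrCA ler_wpM2l //; lra.
have [_ /(_ m) hb] := HG.
have cn : (m.*2.+1%:R * r1) ^+ n <= c ^+ n.
  by rewrite lerXn2r // nnegrE ?(le_trans _ hc) // mulr_ge0 // ltW.
have I1 : 0 <= 16 * IE S + 1 by lra.
apply: (@le_trans _ _ (th * m.*2.+1%:R ^+ n * ((16 * IE S + 1) * r1 ^+ n))).
  by rewrite ler_wpM2r.
rewrite (_ : th * _ * _ = (16 * IE S + 1) * th * (m.*2.+1%:R * r1) ^+ n); last by rewrite exprMn; ring.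
by rewrite ler_wpM2l // mulr_ge0.
Qed.

Lemma tile_find m z : cubeRd n (m.*2.+1%:R * r1) (base M' x' z) -> ~ Zs M' m r1 x' z ->
  `|dotp (z - x') e'| < r1 -> exists k : lat n m.*2.+1, box M' (x' + off (Um M' r1) m k) r1 r1 z.
Proof.
move=> hb nZ hz; have [k hk] := tile_cover r10 hb nZ; exists k.
by apply/(blockP MM' r1 m); split => //; rewrite coE.
Qed.

End compare.

Ltac slra :=
  repeat match goal with
  | H : ?A |- _ => lazymatch A with
      | is_true (Order.le ?a _) =>
          let U := type of a in lazymatch U with extended _ => clear H | _ => fail end
      | is_true (Order.lt ?a _) =>
          let U := type of a in lazymatch U with extended _ => clear H | _ => fail end
      | _ => clear H
      end
  end; lra.

(** The competitor follows the plane of [M'] in an inner cylinder filled with tiles and returns to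
    the plane of [M] before the boundary of the box. Except for the few bad tiles, the tiles cost
    about t per unit area; what they leave uncovered is a tail and a lateral annulus of relative
    width 3 kp. *)
Lemma cmp_upper {R : realType} {n : nat} {dT : measure_display} {T : measurableType dT} (S : model R n.+1 T)
    (M M' : 'M[R]_n.+1) (t : R) (x x' : 'rV[R]_n.+1) (w : T) (C dl kp r h r1 eps th : R) (m0 : nat) :
  M *m M^T = 1%:M -> M' *m M'^T = 1%:M -> 0 < C -> cut_bound n C ->
  enorm (row ord0 M' - row ord0 M) <= dl -> enorm (x' - x) <= dl * r ->
  0 < r -> 0 < r1 -> r1 <= dl * r -> 0 <= dl -> 0 < kp -> kp <= 4^-1 ->
  8 * 8 * 8 * (n.+1%:R ^+ 3 * (C + 1) * dl) <= kp -> r / 2 <= h -> h <= r ->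
  0 < eps -> 0 <= t -> 0 <= th -> Gp S M' t w x' r1 eps th m0 ->
  (Fc S w M x r h <= (r ^+ n * ((t + 2 * eps) * (1 + 23 * (n.+1%:R) ^+ 2 * dl) +
   (16 * IE S + 1) * th * (7 * (n.+1%:R)) ^+ n + 8 * tail S (r1 / 2) + 24 * n%:R * kp * IE S))%:E)%E.
Proof.
move=> MM MM' C0 hcut He Hx r0 r10 r1d dl0 kp0 kp4 Hdl h1 h2 eps0 t0 th0 HG.
have [[kr0 kr4 dl4] [r1k drk N1r1] [NrN NrNN NN1] [De1 De0] C92] :=
  @scales R n C dl kp r r1 C0 dl0 Hdl kp0 kp4 r0 r10 r1d.
clear Hdl r1d.
pose De := 23 * (n.+1%:R) ^+ 2 * dl * r; rewrite -/De in De1 De0.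
have near z : enorm (z - x') <= 22 * (n.+1%:R) ^+ 2 * r -> `|dotp (z - x) (row ord0 M) - dotp (z - x') (row ord0 M')| <= De.
  move=> /(he_diff MM He Hx) hz; apply: le_trans hz _; rewrite /De.
  have : (22 * (n.+1%:R) ^+ 2 + 1) * (dl * r) <= (23 * (n.+1%:R) ^+ 2) * (dl * r).
    by rewrite ler_wpM2r ?mulr_ge0 ?(ltW r0) //; slra.
  by move/le_trans; apply; rewrite -!mulrA.
have tri z (c : R) : enorm (z - x) <= c -> enorm (z - x') <= c + dl * r.
  move=> hz; rewrite (_ : z - x' = (z - x) - (x' - x)); last by rewrite opprB addrA subrK.
  by apply: le_trans (enormD _ _) _; rewrite enormN lerD.
pose a (i : 'I_n.+1) := if i == ord0 then h / 2 else (1 - 2 * kp) * r / 2.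
pose b (i : 'I_n.+1) := if i == ord0 then h / 4 else kp * r / 2.
have bc z i : base M x z ord0 i = co M x z ord0 (lift ord0 i) by rewrite /base mxE.
have al i : a (lift ord0 i) = (1 - 2 * kp) * r / 2 by rewrite /a eq_sym (negbTE (neq_lift _ _)).
have bl i : b (lift ord0 i) = kp * r / 2 by rewrite /b eq_sym (negbTE (neq_lift _ _)).
have be0 : 0 < kp * r / 2 by slra.
have hb i : kp * r / 2 <= b i by rewrite /b; case: ifP => _; slra.
have [ct [G [[smt hgt] ct01 bG ct1 ct0]]] := hcut M x a b _ MM be0 hb.
have abr i : a i + b i <= r by rewrite /a /b; case: ifP => _; slra.
have ar i : a i <= r by have := abr i; have := hb i; slra.
have cor z : (forall i, `|co M x z ord0 i| <= r) -> enorm (z - x') <= 22 * (n.+1%:R) ^+ 2 * r.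
  move=> /(far_bound MM (ltW r0)) /tri; move/le_trans; apply; slra.
have e1 : dotp (row ord0 M) (row ord0 M) = 1 by rewrite row_orth // eqxx.
have e1' : dotp (row ord0 M') (row ord0 M') = 1 by rewrite row_orth // eqxx.
have A0 : 0 <= 2 * (n.+1%:R) * C / (kp * r / 2) by rewrite divr_ge0 ?(ltW be0) // !mulr_ge0 // ltW.
(* The gradient of the cutoff, of order 1/(kp r), times the distance of the planes, of order dl r:
   this is where dl must be small compared with kp. *)
have AB : 2 * (n.+1%:R) * C / (kp * r / 2) * De <= 4^-1.
  rewrite (_ : _ * De = 92 * ((n.+1%:R) ^+ 3 * C * dl) / kp).
    by rewrite ler_pdivrMr //; apply: le_trans C92 _; rewrite mulrC.
  by rewrite /De; field; rewrite ?lt0r_neq0.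
have hG z : G z = 0 \/ (enorm (G z) <= 2 * (n.+1%:R) * C / (kp * r / 2) /\
     `|dotp (z - x') (row ord0 M') - dotp (z - x) (row ord0 M)| <= De).
  have [[i hi]|ni] := pselect (exists i, a i + b i <= `|co M x z ord0 i|).
    by left; have [] := ct0 z i hi.
  right; split; first exact: bG.
  rewrite distrC; apply: near; apply: cor => i; rewrite leNgt; apply/negP => hi.
  by apply: ni; exists i; apply: le_trans (abr i) (ltW hi).
have dle4 : enorm ((row ord0 M') - (row ord0 M)) <= 4^-1 by exact: le_trans He dl4.
have [Gl [sl hl G4 Go Gi]] := interp e1 e1' dle4 smt hgt ct01 A0 De0 AB hG.
clear A0 AB hG C92 dle4 dl4 smt hgt bG C0.
set l := fun z => _ in sl hl.
(* Points of the box are within 2(n+1) r of x', so a window of side at least 6(n+1) r contains their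
   projections. *)
have [m [Nm1 Nm2]] := odd_cover r10 (ltac:(rewrite !mulr_ge0 // ltW //) : 0 <= 6 * (n.+1%:R) * r).
set N := m.*2.+1 in Nm1 Nm2.
pose tl (k : lat n N) s := box M' (x' + off (Um M' r1) m k) r1 s.
pose In := [set z : Rd R n.+1 | forall i, `|co M x z ord0 i| <= a i].
pose Ts : {set lat n N} := [set k : lat n N | `[< tl k r1 `<=` In >]]%SET.
have TsP k : k \in Ts -> tl k r1 `<=` In by rewrite inE => /asboolP.
have InBox : In `<=` box M x r h.
  move=> z hz; split; first by have := hz ord0; rewrite /a eqxx; slra.
  by move=> i; have := hz (lift ord0 i); rewrite al -bc; slra.
have lin z : In z -> l z = dotp (z - x') (row ord0 M') by move=> /ct1 c1; rewrite /l c1 mul1r addrC subrK.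
have lnear z : enorm (z - x') <= 22 * (n.+1%:R) ^+ 2 * r -> `|l z - dotp (z - x) (row ord0 M)| <= De.
  move=> /near hz; rewrite /l addrC addKr normrM; have /andP[c0 c1] := ct01 z.
  by rewrite (ger0_norm c0) distrC; apply: le_trans hz; rewrite ler_piMl.
have mu0 : 0 <= (1 - 3 * kp) * r by rewrite mulr_ge0 ?(ltW r0) //; slra.
have mur : (1 - 3 * kp) * r <= r by slra.
have [mB hB] := @mu_annulus R n _ _ mu0 mur.
have boxr z : box M x r h z -> forall i, `|co M x z ord0 i| <= r.
  move=> [z1 z2] i; case: (unliftP ord0 i) => [j|] ->; last by slra.
  by have := z2 j; rewrite bc; slra.
pose K := [set z : 'rV[R]_n.+1 | forall i, `|co M x z ord0 i| <= a i + b i].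
have cK : compact K by exact: (compact_cobox MM (ltW r0) abr).
have KA : K `<=` box M x r h.
  move=> z hz; split; first by have := hz ord0; rewrite /a /b eqxx; slra.
  by move=> i; have := hz (lift ord0 i); rewrite al bl -bc; slra.
have lK z : ~ K z -> l z = dotp (z - x) (row ord0 M).
  by move=> /existsNP[i /negP]; rewrite -ltNge => /ltW /ct0[c0 _]; rewrite /l c0 mul0r addr0.
have := @master_patch R n dT T S _ (enum Ts) (fun k => tl k r1) (fun=> (row ord0 M'))
  (fun k => x' + off (Um M' r1) m k) (tcost S M' t x' w r1 eps (m := m)) (row ord0 M) x (box M x r h) l Gl K M M x x
  (cubeRd n r) (cubeRd n r `\` cubeRd n ((1 - 3 * kp) * r)) set0
  (r ^+ n) (r ^+ n - ((1 - 3 * kp) * r) ^+ n) 0 (r1 / 2) (Zs M' m r1 x') w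
  (enum_uniq _) (@open_box R n M x r h) sl hl G4 cK KA lK.
have p1 k : k \in enum Ts -> open (tl k r1 : set 'rV[R]_n.+1) /\ tl k r1 `<=` box M x r h.
  by rewrite mem_enum => kT; split; [exact: open_box|move=> z /(TsP _ kT) /InBox].
have p2 k z : k \in enum Ts -> tl k r1 z -> l z = dotp (z - (x' + off (Um M' r1) m k)) (row ord0 M').
  rewrite mem_enum => kT /(TsP _ kT) /lin ->.
  have := dot_off MM' r1 m k x'; rewrite !dotpBl => /eqP; rewrite subr_eq0 => /eqP ->; by [].
have p3 k k' : k \in enum Ts -> k' \in enum Ts -> k != k' -> tl k r1 `&` tl k' r1 = set0.
  move=> _ _ kk; apply/seteqP; split => // z [z1 z2]; move/eqP: kk; apply.
  exact: (tall_disj MM' r10 z1 z2).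
have p4 k : k \in enum Ts -> (Phit (mPhi S) (mtau S) (mW S) (mq S) w (row ord0 M')
     (x' + off (Um M' r1) m k)%R (tl k r1) < (tcost S M' t x' w r1 eps k)%:E)%E by move=> _; exact: tcostP.
have p5 z : box M x r h z -> (forall k, k \in enum Ts -> ~ tl k r1 z) -> ~ Zs M' m r1 x' z ->
   r1 / 2 <= `|l z| \/ (cubeRd n r `\` cubeRd n ((1 - 3 * kp) * r)) (base M x z) \/ set0 (base M x z).
  move=> bz nt nZ; have [lz|lz] := leP (r1 / 2) `|l z|; [by left|right; left].
  split; first by have [_] := bz.
  move=> zb; have zr := boxr z bz; have zn := cor z zr.
  have lo : `|co M x z ord0 ord0| <= r1 / 2 + De.
    have := lnear z zn; rewrite coE; move: lz; move: (l z) (dotp _ _) => u v.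
    by rewrite distrC => q1 q2; have := ler_distD u v 0; rewrite !subr0; slra.
  have zb' i : `|co M x z ord0 (lift ord0 i)| < (1 - 3 * kp) * r / 2.
    by have := zb i; rewrite bc.
  have Inz : In z.
    move=> i; case: (unliftP ord0 i) => [j|] ->; last by rewrite /a eqxx; slra.
    by rewrite al; have := zb' j; slra.
  rewrite (lin _ Inz) in lz.
  have cz : cubeRd n (N%:R * r1) (base M' x' z).
    move=> i; rewrite /base mxE; apply: le_lt_trans (co_le x' z (lift ord0 i) MM') _.
    have : enorm (z - x') <= (n.+1%:R) * r + dl * r by apply: tri; exact: far_bound MM (ltW r0) zr.
    by slra.
  have [k kz] := tile_find MM' r10 cz nZ (ltac:(slra) : `|dotp (z - x') (row ord0 M')| < r1).
  (* The tile of z has diameter far below kp r, so a point at lateral depth 3 kp r / 2 has its whole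
     tile at depth at least kp r, that is, in the inner cylinder. *)
  apply: (nt k) => //; rewrite mem_enum inE; apply/asboolP => y ky i.
  have dy : enorm (y - z) <= kp * r / 64 by apply: le_trans (tile_diam MM' r10 ky kz) _.
  have cl := co_lip x y z i MM.
  have : `|co M x y ord0 i| <= `|co M x z ord0 i| + kp * r / 64.
    by rewrite -(subrK (co M x z ord0 i) (co M x y ord0 i)); apply: le_trans (ler_normD _ _) _; slra.
  move=> cy; apply: le_trans cy _; case: (unliftP ord0 i) => [j|] ->.
    by rewrite al; have := zb' j; slra.
  by rewrite /a eqxx; slra.
move=> /(_ p1 p2 p3 p4 MM Go MM Go (@measurable_cubeRd R n r) (muRd_cube n (ltW r0)) mB hB).
have m0' : measurable (set0 : set (Rd R n)) by [].
have u0 : (muRd n set0 <= 0%:E :> \bar R)%E by rewrite measure0.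
move=> /(_ m0' u0 (measurable_Zs _ _ _ _) (mu_Zs MM' _ _ _) (fun z bz => proj2 bz) p5) H.
apply: le_trans H _; rewrite lee_fin addr0.
(* The columns of half-height r over the chosen tiles are disjoint and lie in the box of half-height
   r + De; comparing volumes bounds the area of the tiles. *)
have cT : #|Ts|%:R * r1 ^+ n <= (1 + 23 * (n.+1%:R) ^+ 2 * dl) * r ^+ n.
  have sub k : k \in Ts -> tl k r `<=` box M x r (r + De).
    move=> kT y /(tall_proj x MM MM' He r10)[y0 [u [k0 ur hu ny bu]]].
    have iy := TsP _ kT _ k0.
    have yn : enorm (y - x') <= 22 * (n.+1%:R) ^+ 2 * r.
      have g1 : enorm (y0 - x') <= (n.+1%:R) * r + dl * r.
        by apply: tri; apply: far_bound MM (ltW r0) _ => i; apply: le_trans (iy i) (ar i).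
      rewrite (_ : y - x' = (y - y0) + (y0 - x')); last by rewrite addrA subrK.
      by apply: le_trans (enormD _ _) _; rewrite ny; slra.
    split.
      rewrite coE; have := near y yn; rewrite hu => g2.
      rewrite -(subrK u (dotp (y - x) (row ord0 M))); apply: le_lt_trans (ler_normD _ _) _; slra.
    move=> i; have := iy (lift ord0 i); rewrite al -bc => g3.
    have g4 := bu i; have g5 : `|u| * dl <= r * dl by rewrite ler_wpM2r // ltW.
    rewrite -(subrK (base M x y0 ord0 i) (base M x y ord0 i)).
    apply: le_lt_trans (ler_normD _ _) _.
    by slra.
  have rDe : 0 <= r + De by slra.
  have hm : (muRd n.+1 (box M x r (r + De)) <= ((r + De) *+ 2 * r ^+ n)%:E)%E by rewrite mu_box // ltW.
  have := tall_count MM' r10 (ltW r0) (@measurable_box R n M x r (r + De)) hm sub.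
  have -> : #|Ts|%:R * (r *+ 2 * r1 ^+ n) = 2 * r * (#|Ts|%:R * r1 ^+ n) by rewrite mulr2n; ring.
  have -> : (r + De) *+ 2 * r ^+ n = 2 * r * ((1 + 23 * (n.+1%:R) ^+ 2 * dl) * r ^+ n) by rewrite mulr2n /De; ring.
  by rewrite ler_pM2l // mulr_gt0.
have Nc : N%:R * r1 <= 7 * (n.+1%:R) * r by slra.
have sm := tcost_sum r10 eps0 t0 th0 HG cT Nc.
have pd := pow_diff n mu0 mur r0 (ltac:(slra) : r - (1 - 3 * kp) * r <= 3 * kp * r).
have pd2 : (r ^+ n - ((1 - 3 * kp) * r) ^+ n) * IE S <= r ^+ n * (n%:R * (3 * kp)) * IE S.
  apply: ler_wpM2r; first exact: IE_ge0.
  apply: le_trans pd _; rewrite le_eqVlt; apply/orP; left; apply/eqP.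
  by field; rewrite lt0r_neq0.
apply: le_trans (lerD sm (lexx _)) _; rewrite exprMn.
clear p1 p2 p3 p4 p5 mB hB Nm1 Nm2 N1r1 NrN NrNN NN1 De1 De0 r1k drk kr0 kr4 be0 hb abr ar.
have X0 : 0 < r ^+ n by rewrite exprn_gt0.
by move: pd2; move: (r ^+ n) (((1 - 3 * kp) * r) ^+ n) (tail S (r1 / 2)) ((7 * (n.+1%:R)) ^+ n) ((n.+1%:R) ^+ 2) (n%:R : R) (IE S) => X1 X2 X3 X4 X5 X6 X7; slra.
Qed.

(** Here the tiled plane is the larger object: a cylinder of side between 10(n+1) r and 11(n+1) r
    adapted to [M'], whose energy is at least t - eps per unit area because x' is good. The given
    box and the tiles away from it form a competitor there; subtracting the cost of those tiles
    bounds the box from below. *)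
Lemma cmp_lower {R : realType} {n : nat} {dT : measure_display} {T : measurableType dT} (S : model R n.+1 T)
    (M M' : 'M[R]_n.+1) (t : R) (x x' : 'rV[R]_n.+1) (w : T) (C dl kp r h r1 eps th : R) (m0 : nat) :
  M *m M^T = 1%:M -> M' *m M'^T = 1%:M -> 0 < C -> cut_bound n C ->
  enorm (row ord0 M' - row ord0 M) <= dl -> enorm (x' - x) <= dl * r ->
  0 < r -> 0 < r1 -> r1 <= dl * r -> 0 <= dl -> 0 < kp -> kp <= 4^-1 ->
  8 * 8 * 8 * (n.+1%:R ^+ 3 * (C + 1) * dl) <= kp -> r / 2 <= h -> h <= r ->
  0 < eps -> 0 <= t -> 0 <= th -> Gp S M' t w x' r1 eps th m0 ->
  m0%:R * r1 <= r ->
  (((t * (1 - 23 * (n.+1%:R) ^+ 2 * dl) -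
     (3 * eps + (16 * IE S + 1) * th + 8 * tail S (r1 / 2)) * (11 * (n.+1%:R)) ^+ n -
     24 * 2 ^+ n * n%:R * kp * IE S) * r ^+ n)%:E <= Fc S w M x r h)%E.
Proof.
move=> MM MM' C0 hcut He Hx r0 r10 r1d dl0 kp0 kp4 Hdl h1 h2 eps0 t0 th0 HG.
move=> m0r.
have [[kr0 kr4 dl4] [r1k drk N1r1] [NrN NrNN NN1] [De1 De0] C92] :=
  @scales R n C dl kp r r1 C0 dl0 Hdl kp0 kp4 r0 r10 r1d.
clear Hdl r1d.
pose De := 23 * (n.+1%:R) ^+ 2 * dl * r; rewrite -/De in De1 De0.
have near z : enorm (z - x') <= 22 * (n.+1%:R) ^+ 2 * r -> `|dotp (z - x) (row ord0 M) - dotp (z - x') (row ord0 M')| <= De.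
  move=> /(he_diff MM He Hx) hz; apply: le_trans hz _; rewrite /De.
  have : (22 * (n.+1%:R) ^+ 2 + 1) * (dl * r) <= (23 * (n.+1%:R) ^+ 2) * (dl * r).
    by rewrite ler_wpM2r ?mulr_ge0 ?(ltW r0) //; slra.
  by move/le_trans; apply; rewrite -!mulrA.
have tri z (c : R) : enorm (z - x) <= c -> enorm (z - x') <= c + dl * r.
  move=> hz; rewrite (_ : z - x' = (z - x) - (x' - x)); last by rewrite opprB addrA subrK.
  by apply: le_trans (enormD _ _) _; rewrite enormN lerD.
(* The transition now lies outside the box: l is the planar coordinate of [M] on all of it and that
   of [M'] beyond the widths [b]. *)
pose a (i : 'I_n.+1) := if i == ord0 then h else r / 2.
pose b (i : 'I_n.+1) := if i == ord0 then r / 4 else kp * r / 2.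
have bc z i : base M x z ord0 i = co M x z ord0 (lift ord0 i) by rewrite /base mxE.
have al i : a (lift ord0 i) = r / 2 by rewrite /a eq_sym (negbTE (neq_lift _ _)).
have bl i : b (lift ord0 i) = kp * r / 2 by rewrite /b eq_sym (negbTE (neq_lift _ _)).
have be0 : 0 < kp * r / 2 by slra.
have hb i : kp * r / 2 <= b i by rewrite /b; case: ifP => _; slra.
have [ct [G [[smt hgt] ct01 bG ct1 ct0]]] := hcut M x a b _ MM be0 hb.
have r20 : 0 <= 2 * r by slra.
have abr i : a i + b i <= 2 * r by rewrite /a /b; case: ifP => _; slra.
have cor z : (forall i, `|co M x z ord0 i| <= 2 * r) -> enorm (z - x') <= 3 * (n.+1%:R) * r.
  by move=> /(far_bound MM r20) /tri /le_trans; apply; slra.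
have e1 : dotp (row ord0 M) (row ord0 M) = 1 by rewrite row_orth // eqxx.
have e1' : dotp (row ord0 M') (row ord0 M') = 1 by rewrite row_orth // eqxx.
have A0 : 0 <= 2 * (n.+1%:R) * C / (kp * r / 2) by rewrite divr_ge0 ?(ltW be0) // !mulr_ge0 // ltW.
have AB : 2 * (n.+1%:R) * C / (kp * r / 2) * De <= 4^-1.
  rewrite (_ : _ * De = 92 * ((n.+1%:R) ^+ 3 * C * dl) / kp).
    by rewrite ler_pdivrMr //; apply: le_trans C92 _; rewrite mulrC.
  by rewrite /De; field; rewrite ?lt0r_neq0.
have hG z : G z = 0 \/ (enorm (G z) <= 2 * (n.+1%:R) * C / (kp * r / 2) /\
     `|dotp (z - x) (row ord0 M) - dotp (z - x') (row ord0 M')| <= De).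
  have [[i hi]|ni] := pselect (exists i, a i + b i <= `|co M x z ord0 i|).
    by left; have [] := ct0 z i hi.
  right; split; first exact: bG.
  apply: near; apply: (@le_trans _ _ (3 * (n.+1%:R) * r)); last by slra.
  apply: cor => i; rewrite leNgt; apply/negP => hi.
  by apply: ni; exists i; apply: le_trans (abr i) (ltW hi).
have dle4 : enorm ((row ord0 M) - (row ord0 M')) <= 4^-1 by rewrite -enormN opprB; exact: le_trans He dl4.
have [Gl [sl hl G4 Go Gi]] := interp e1' e1 dle4 smt hgt ct01 A0 De0 AB hG.
clear A0 AB hG C92 dle4 dl4 smt hgt bG C0.
set l := fun z => _ in sl hl.
have [m [Nm1 Nm2]] := odd_cover r10 (ltac:(rewrite !mulr_ge0 // ltW //) : 0 <= 10 * (n.+1%:R) * r).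
set N := m.*2.+1 in Nm1 Nm2.
have EN : N%:R = 2 * m%:R + 1 :> R by exact: dblS.
have Nc : N%:R * r1 <= 11 * (n.+1%:R) * r by slra.
have Nr0 : 0 <= N%:R * r1 by rewrite mulr_ge0 // ltW.
have mm0 : (m0 <= m)%N.
  rewrite -(ler_nat R) -(ler_pM2r r10); rewrite EN in Nm1; slra.
pose tl (k : lat n N) s := box M' (x' + off (Um M' r1) m k) r1 s.
pose A2 := box M' x' (N%:R * r1) (N%:R * r1).
pose Ot := [set z : Rd R n.+1 | exists i, (1 + kp) * r / 2 <= `|base M x z ord0 i|].
pose Ts : {set lat n N} := [set k : lat n N | `[< tl k r1 `<=` Ot >]]%SET.
have TsP k : k \in Ts -> tl k r1 `<=` Ot by rewrite inE => /asboolP.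
have A2n z : A2 z -> enorm (z - x') <= 22 * (n.+1%:R) ^+ 2 * r.
  move=> /(box_bound MM' Nr0 Nr0) hz; apply: le_trans hz _.
  have := ler_wpM2l (le_trans ler01 (ltac:(rewrite ler1n //) : 1 <= (n.+1%:R))) Nc.
  by rewrite expr2; slra.
have inA z : (forall i, `|co M x z ord0 i| <= 2 * r) -> A2 z.
  move=> /cor zc; have hc i := le_trans (co_le x' z i MM') zc.
  split; first by have := hc ord0; slra.
  by move=> i; rewrite /base mxE; have := hc (lift ord0 i); slra.
have tlb k s z : tl k s z -> cubeRd n (N%:R * r1) (base M' x' z).
  move=> /(blockP MM' r1 m)[_ hz] i; have := hz i; rewrite !ltr_norml => /andP[u1 u2].
  have v1 : 0 <= (k i)%:R * r1 by rewrite mulr_ge0 // ltW.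
  have v2 : (k i)%:R * r1 <= 2 * m%:R * r1.
    by rewrite ler_pM2r // -natrM ler_nat mul2n -ltnS; exact: ltn_ord.
  by rewrite EN; apply/andP; split; slra.
have tlA k : tl k r1 `<=` A2.
  move=> z kz; split; last exact: tlb kz.
  have := kz => /(blockP MM' r1 m)[hz _]; apply: lt_le_trans hz _.
  by rewrite ler_peMl ?ler1n // ltW.
have lO z i : a i + b i <= `|co M x z ord0 i| -> l z = dotp (z - x') (row ord0 M').
  by move=> /ct0[c0 _]; rewrite /l c0 mul0r addr0.
have lOt z : Ot z -> l z = dotp (z - x') (row ord0 M').
  by move=> [i hi]; apply: (lO z (lift ord0 i)); rewrite al bl -bc; slra.
have pco z : box M x r h z -> forall i, `|co M x z ord0 i| <= a i.
  move=> [z1 z2] i; case: (unliftP ord0 i) => [j|] ->; last by rewrite /a eqxx ltW.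
  by rewrite al -bc ltW.
have lP z : box M x r h z -> l z = dotp (z - x) (row ord0 M).
  by move=> /pco /ct1 c1; rewrite /l c1 mul1r addrC subrK.
have ar i : a i <= 2 * r by have := abr i; have := hb i; slra.
have lnear z : enorm (z - x') <= 22 * (n.+1%:R) ^+ 2 * r -> `|l z - dotp (z - x) (row ord0 M)| <= De.
  move=> /near hz; have /andP[c0 c1] := ct01 z.
  have -> : l z - dotp (z - x) (row ord0 M) = (ct z - 1) * (dotp (z - x) (row ord0 M) - dotp (z - x') (row ord0 M')) by rewrite /l; ring.
  rewrite normrM; apply: le_trans hz; rewrite ler_piMl //.
  by rewrite ler_norml; apply/andP; split; slra.
have mu0 : 0 <= (1 + 3 * kp) * r by rewrite mulr_ge0 ?(ltW r0) //; slra.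
have mur : r <= (1 + 3 * kp) * r by slra.
have [mB hB] := @mu_annulus R n _ _ (ltW r0) mur.
pose K := [set z : 'rV[R]_n.+1 | forall i, `|co M x z ord0 i| <= a i + b i].
have cK : compact K by exact: (compact_cobox MM r20 abr).
have KA : K `<=` A2 by move=> z hz; apply: inA => i; exact: le_trans (hz i) (abr i).
have lK z : ~ K z -> l z = dotp (z - x') (row ord0 M').
  by move=> /existsNP[i /negP]; rewrite -ltNge => /ltW; exact: lO.
(* The columns over the tiles of [Ts] lie in [D1] and avoid the slightly lower box [D2], itself
   contained in [D1]; the volume of the difference bounds their number. *)
have cT : #|Ts|%:R * r1 ^+ n <= (N%:R * r1) ^+ n - (1 - 23 * (n.+1%:R) ^+ 2 * dl) * r ^+ n.
  pose D1 := box M' x' (N%:R * r1) r; pose D2 := box M x r (r - De).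
  have rDe : 0 <= r - De by slra.
  have D21 : D2 `<=` D1.
    move=> y [y1 y2]; have yc i : `|co M x y ord0 i| <= 2 * r.
      case: (unliftP ord0 i) => [j|] ->; last by slra.
      by have := y2 j; rewrite bc; slra.
    have yn := cor _ yc; have yA := inA _ yc; split; last by have [] := yA.
    have := near y (ltac:(slra) : enorm (y - x') <= 22 * (n.+1%:R) ^+ 2 * r); rewrite coE in y1.
    move: y1; rewrite coE; move: (dotp _ (row ord0 M)) (dotp _ (row ord0 M')) => u v u1 u2.
    have := ler_distD u v 0; rewrite !subr0 distrC; slra.
  have mD1 : measurable D1 by exact: measurable_box.
  have mD2 : measurable D2 by exact: measurable_box.
  have hm : (muRd n.+1 (D1 `\` D2) <= (r *+ 2 * (N%:R * r1) ^+ n - (r - De) *+ 2 * r ^+ n)%:E)%E.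
    have fD : (muRd n.+1 D1 < +oo)%E by rewrite mu_box ?ltry // ltW.
    have -> := @measureD _ _ _ (muRd n.+1) _ _ mD1 mD2 fD.
    rewrite (_ : D1 `&` D2 = D2); last by apply/seteqP; split => [z []//|z hz]; split => //; exact: D21.
    by have := mu_box x' MM' Nr0 (ltW r0); have := mu_box x MM (ltW r0) rDe => /= -> ->.
  have sub k : k \in Ts -> tl k r `<=` D1 `\` D2.
    move=> kT y ky; split.
      by split; [have := ky => /(blockP MM' r1 m)[]|exact: tlb ky].
    move=> [y1 y2]; have [y0 [u [k0 ur hu ny bu]]] := tall_proj x MM MM' He r10 ky.
    have [i hi] := TsP _ kT _ k0; have g4 := bu i; have g2 := y2 i.
    have g5 : `|u| * dl <= r * dl by rewrite ler_wpM2r // ltW.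
    have : `|base M x y0 ord0 i| <= `|base M x y ord0 i| + `|u| * dl.
      rewrite -(subrK (base M x y ord0 i) (base M x y0 ord0 i)); apply: le_trans (ler_normD _ _) _.
      by rewrite distrC; slra.
    by slra.
  have := tall_count MM' r10 (ltW r0) (measurableD mD1 mD2) hm sub.
  have -> : #|Ts|%:R * (r *+ 2 * r1 ^+ n) = 2 * r * (#|Ts|%:R * r1 ^+ n) by rewrite mulr2n; ring.
  have -> : r *+ 2 * (N%:R * r1) ^+ n - (r - De) *+ 2 * r ^+ n =
     2 * r * ((N%:R * r1) ^+ n - (1 - 23 * (n.+1%:R) ^+ 2 * dl) * r ^+ n) by rewrite !mulr2n /De; ring.
  by rewrite ler_pM2l // mulr_gt0.
have sm := tcost_sum r10 eps0 t0 th0 HG cT Nc.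
have pd := pow_diff n (ltW r0) mur (lt_le_trans r0 mur) (ltac:(slra) : (1 + 3 * kp) * r - r <= 3 * kp * r).
have X0 : 0 < r ^+ n by rewrite exprn_gt0.
have pd2 : (((1 + 3 * kp) * r) ^+ n - r ^+ n) * IE S <= 2 ^+ n * r ^+ n * (n%:R * (3 * kp)) * IE S.
  apply: ler_wpM2r; first exact: IE_ge0.
  apply: le_trans pd _; apply: ler_pM.
  - by apply: exprn_ge0.
  - by rewrite divr_ge0 // mulr_ge0 // mulr_ge0 ?(ltW r0) //; slra.
  - by rewrite -exprMn lerXn2r // ?nnegrE //; slra.
  - rewrite ler_pdivrMr ?(lt_le_trans r0 mur) //.
    have -> : n%:R * (3 * kp * r) = n%:R * (3 * kp) * r by ring.
    by apply: ler_wpM2l; [apply: mulr_ge0 => //; slra|slra].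
have XY : (N%:R * r1) ^+ n <= (11 * (n.+1%:R)) ^+ n * r ^+ n.
  by rewrite -exprMn lerXn2r // nnegrE // !mulr_ge0 // ltW.
have qle1 : 23 * (n.+1%:R) ^+ 2 * dl <= 1.
  by rewrite -(ler_pM2r r0) mul1r -/De; slra.
have Xn0 : 0 <= (N%:R * r1) ^+ n by rewrite exprn_ge0.
have tl0 := tail_ge0 S (r1 / 2).
have ze1 : 3 * eps * (N%:R * r1) ^+ n <= 3 * eps * ((11 * (n.+1%:R)) ^+ n * r ^+ n) by rewrite ler_wpM2l //; slra.
have ze2 : (N%:R * r1) ^+ n * tail S (r1 / 2) <= (11 * (n.+1%:R)) ^+ n * r ^+ n * tail S (r1 / 2) by rewrite ler_wpM2r.
have ze3 : 0 <= 2 * eps * ((1 - 23 * (n.+1%:R) ^+ 2 * dl) * r ^+ n).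
  by rewrite !mulr_ge0 ?(ltW X0) ?(ltW eps0) //; slra.
(* By contradiction, so that the energy is finite and a real c strictly between it and [LOW] can be
   the cost of the box in the gluing; the outcome LOW <= c is then absurd. *)
rewrite leNgt; apply/negP => ltF; set LOW := (_ * r ^+ n) in ltF.
have [f Ef] : exists f, Fc S w M x r h = f%:E.
  exists (fine (Fc S w M x r h)); rewrite fineK // ge0_fin_numE ?Fc_ge0 //.
  by apply: lt_trans ltF _; rewrite ltry.
rewrite Ef lte_fin in ltF; pose c := (f + LOW) / 2.
have cF : (Fc S w M x r h < c%:E)%E by rewrite Ef lte_fin /c; slra.
suff : LOW <= c by rewrite /c; slra.
(* [None] stands for the box itself, [Some k] for a tile. *)
pose A_ (o : option (lat n N)) := if o is Some k then tl k r1 else box M x r h.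
pose e_ (o : option (lat n N)) := if o is Some k then (row ord0 M') else (row ord0 M).
pose x_ (o : option (lat n N)) := if o is Some k then x' + off (Um M' r1) m k else x.
pose c_ (o : option (lat n N)) := if o is Some k then tcost S M' t x' w r1 eps k else c.
pose s := None :: [seq Some k | k <- enum Ts].
have sP k : (Some k \in s) = (k \in Ts).
  by rewrite inE /= mem_map ?mem_enum // => u v [].
have us : uniq s.
  rewrite /s /= map_inj_uniq ?enum_uniq ?andbT; last by move=> u v [].
  by apply/mapP => -[].
have := @master_patch R n dT T S _ s A_ e_ x_ c_ (row ord0 M') x' A2 l Gl K M' M x' x
  (cubeRd n (N%:R * r1)) set0 (cubeRd n ((1 + 3 * kp) * r) `\` cubeRd n r)
  ((N%:R * r1) ^+ n) 0 (((1 + 3 * kp) * r) ^+ n - r ^+ n) (r1 / 2) (Zs M' m r1 x') w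
  us (@open_box R n M' x' _ _) sl hl G4 cK KA lK.
have p1 o : o \in s -> open (A_ o : set 'rV[R]_n.+1) /\ A_ o `<=` A2.
  case: o => [k|] _; split; try exact: open_box; first exact: tlA.
  by move=> z /pco hz; apply: inA => i; exact: le_trans (hz i) (ar i).
have p2 o z : o \in s -> A_ o z -> l z = dotp (z - x_ o) (e_ o).
  case: o => [k|] /=; last by move=> _; exact: lP.
  rewrite sP => kT /(TsP _ kT) /lOt ->.
  have := dot_off MM' r1 m k x'; rewrite !dotpBl => /eqP; rewrite subr_eq0 => /eqP ->; by [].
have dj k z : k \in Ts -> tl k r1 z -> box M x r h z -> False.
  move=> kT /(TsP _ kT)[i hi] [_ /(_ i)]; slra.
have p3 o o' : o \in s -> o' \in s -> o != o' -> A_ o `&` A_ o' = set0.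
  case: o => [k|]; case: o' => [k'|]; rewrite ?sP => os os' oo; apply/seteqP; split => // z [z1 z2] //.
  - by move/eqP: oo; apply; congr Some; exact: (tall_disj MM' r10 z1 z2).
  - exact: (dj k z).
  - exact: (dj k' z).
have p4 o : o \in s -> (Phit (mPhi S) (mtau S) (mW S) (mq S) w (e_ o) (x_ o) (A_ o) < (c_ o)%:E)%E.
  by case: o => [k|] _; [exact: tcostP|exact: cF].
have p5 z : A2 z -> (forall o, o \in s -> ~ A_ o z) -> ~ Zs M' m r1 x' z ->
   r1 / 2 <= `|l z| \/ set0 (base M' x' z) \/
   (cubeRd n ((1 + 3 * kp) * r) `\` cubeRd n r) (base M x z).
  move=> az nt nZ; have [lz|lz] := leP (r1 / 2) `|l z|; [by left|right; right].
  have zn := A2n z az.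
  have lo : `|co M x z ord0 ord0| <= r1 / 2 + De.
    have := lnear z zn; rewrite coE; move: lz; move: (l z) (dotp _ _) => u v.
    by rewrite distrC => q1 q2; have := ler_distD u v 0; rewrite !subr0; slra.
  split; last first.
    move=> zb; apply: (nt None); first by rewrite mem_head.
    by split => //; apply: le_lt_trans lo _; slra.
  apply: contrapT => /existsNP[i /negP]; rewrite -leNgt => hi.
  have lz' : l z = dotp (z - x') (row ord0 M') by apply: (lO z (lift ord0 i)); rewrite al bl -bc; slra.
  rewrite lz' in lz.
  have [k kz] := tile_find MM' r10 (proj2 az) nZ (ltac:(slra) : `|dotp (z - x') (row ord0 M')| < r1).
  apply: (nt (Some k)) => //; rewrite sP inE; apply/asboolP => y ky; exists i.
  have dy : enorm (y - z) <= kp * r / 64 by apply: le_trans (tile_diam MM' r10 ky kz) _.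
  have := co_lip x y z (lift ord0 i) MM; rewrite -!bc => cl.
  have : `|base M x z ord0 i| <= `|base M x y ord0 i| + kp * r / 64.
    rewrite -(subrK (base M x y ord0 i) (base M x z ord0 i)); apply: le_trans (ler_normD _ _) _.
    by rewrite distrC; slra.
  by slra.
have m0' : measurable (set0 : set (Rd R n)) by [].
have u0 : (muRd n set0 <= 0%:E :> \bar R)%E by rewrite measure0.
move=> /(_ p1 p2 p3 p4 MM' Go MM Gi (@measurable_cubeRd R n _) (muRd_cube n Nr0) m0' u0 mB hB).
move=> /(_ (measurable_Zs _ _ _ _) (mu_Zs MM' _ _ _) (fun z az => proj2 az) p5) H.
have [/(_ m mm0) Glow _] := HG; have := le_trans Glow H; rewrite lee_fin add0r.
rewrite /s big_cons big_map /=.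
move: sm; rewrite [(11 * (n.+1%:R) * r) ^+ n]exprMn /LOW => sm Hf.
exact: (final_arith sm pd2 ze1 ze2 ze3 Hf).
Qed.

Section uniform_comparison.
Context {R : realType} {n : nat} {dT : measure_display} {T : measurableType dT}.
Variable S : model R n.+1 T.
Local Notation P := (mP S).
Local Notation N1 := (n.+1%:R : R).
Local Notation plane_limit M t := ({ae P, forall w,
  liminf_pinfty (fun r => ((r ^- n)%:E * Fc S w M 0 r r)%E) = t%:E}).

Lemma t_le (M : 'M[R]_n.+1) t : M *m M^T = 1%:M -> plane_limit M t -> t <= 16 * IE S.
Proof.
move=> MM HT; have [w H] := ae_ex HT; rewrite leNgt; apply/negP => lt.
have e0 : 0 < (t - 16 * IE S) / 2 by rewrite divr_gt0 // subr_gt0.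
have [r0 r00 h] := lim_gt H e0; have := le_trans (h _ (lexx r0)) (planar_bound S w 0 r0 MM (ltW r00)).
rewrite lee_fin ler_pM2r ?exprn_gt0 //; lra.
Qed.

Lemma err_upper (I Y Z g kp q t eps0 nn P2 tt X : R) : 0 <= I -> 1 <= Y -> Z <= Y -> 0 <= Z -> 1 <= P2 -> 0 <= nn ->
  0 < g -> g * (Y * (16 * I + 1)) = eps0 / 64 -> 0 <= q -> q <= kp -> kp <= 1 -> 0 <= kp ->
  kp * (16 * I + 24 * P2 * nn * I + 1) <= eps0 / 4 -> 0 <= t -> t <= 16 * I -> tt <= g -> 0 <= X ->
  X * ((t + 2 * g) * (1 + q) + (16 * I + 1) * g * Z + 8 * tt + 24 * nn * kp * I) <= (t + eps0) * X.
Proof.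
move=> I0 Y1 ZY Z0 P1 nn0 g0 Eg q0 qk k1 k0 hk t0 tI tg X0.
rewrite mulrC ler_wpM2r //.
have a1 : t * q <= 16 * I * kp by apply: ler_pM.
have a2 : g * q <= g by rewrite ler_piMr //; [exact: ltW|exact: le_trans k1].
have a3 : (16 * I + 1) * g * Z <= g * (Y * (16 * I + 1)).
  by rewrite (_ : g * (Y * (16 * I + 1)) = (16 * I + 1) * g * Y); [rewrite ler_wpM2l // mulr_ge0 ?(ltW g0) //; lra|ring].
have a4 : g <= g * (Y * (16 * I + 1)).
  by rewrite ler_peMr ?(ltW g0) //; apply: mulr_ege1 => //; lra.
have a5 : 24 * nn * kp * I <= kp * (24 * P2 * nn * I).
  rewrite (_ : kp * _ = 24 * nn * kp * I * P2); last by ring.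
  by rewrite ler_peMr // !mulr_ge0.
by rewrite Eg in a3 a4; move: a5 hk; rewrite !mulrDr; lra.
Qed.

Lemma err_lower (I Y g kp q t eps0 nn P2 tt X : R) : 0 <= I -> 1 <= Y -> 1 <= P2 -> 0 <= nn ->
  0 < g -> g * (Y * (16 * I + 1)) = eps0 / 64 -> 0 <= q -> q <= kp -> 0 <= kp ->
  kp * (16 * I + 24 * P2 * nn * I + 1) <= eps0 / 4 -> 0 <= t -> t <= 16 * I -> tt <= g -> 0 <= X ->
  (t - eps0) * X <= (t * (1 - q) - (3 * g + (16 * I + 1) * g + 8 * tt) * Y - 24 * P2 * nn * kp * I) * X.
Proof.
move=> I0 Y1 P1 nn0 g0 Eg q0 qk k0 hk t0 tI tg X0; rewrite ler_wpM2r //.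
have Y0 : 0 <= Y by exact: le_trans Y1.
have a1 : t * q <= 16 * I * kp by apply: ler_pM.
have a2 : tt * Y <= g * Y by rewrite ler_wpM2r.
have a3 : g * Y <= g * (Y * (16 * I + 1)).
  by rewrite ler_wpM2l ?(ltW g0) // ler_peMr //; lra.
have a6 : (16 * I + 1) * g * Y = eps0 / 64 by rewrite -Eg; ring.
have a7 : 0 <= g * Y by rewrite mulr_ge0 // ltW.
by rewrite Eg in a3; lra.
Qed.

(** dl is chosen from the error alone, before the direction [M'] and its constant t. A countable
    dense set of directions thus comes with neighbourhoods of a common size. *)
Lemma cmp_final (ep : R) : 0 < ep -> exists2 dl : R, 0 < dl & forall (M' : 'M[R]_n.+1) t,
  M' *m M'^T = 1%:M -> plane_limit M' t -> forall K : R, 0 < K ->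
  {ae P, forall w, exists R1, forall (M : 'M[R]_n.+1) x r h, M *m M^T = 1%:M ->
     enorm (row ord0 M' - row ord0 M) <= dl -> R1 <= r -> r / 2 <= h -> h <= r -> enorm x <= K * r ->
     (((t - ep) * r ^+ n)%:E <= Fc S w M x r h)%E /\ (Fc S w M x r h <= ((t + ep) * r ^+ n)%:E)%E}.
Proof.
move=> ep0; have [C C0 hcut] := @cut_frame R n; have I0 := IE_ge0 S.
pose Y : R := (11 * N1) ^+ n; pose Q := 16 * IE S + 24 * 2 ^+ n * n%:R * IE S + 1.
have N11 : 1 <= N1 by rewrite ler1n.
have Y1 : 1 <= Y by rewrite exprn_ege1 //; lra.
have P1 : 1 <= 2 ^+ n :> R by rewrite exprn_ege1 // ler1n.
have Q1 : 1 <= Q by rewrite /Q lerDr addr_ge0 // !mulr_ge0 // (le_trans ler01).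
have Q0 : 0 < Q by exact: lt_le_trans Q1.
(* kp makes the boundary annuli and the relative error in area, each weighted by its cost, amount to
   at most ep / 4; the bound 1/4 is for the geometry. *)
pose kp := Num.min 4^-1 (ep / 4 / Q).
have kp0 : 0 < kp by rewrite lt_min; apply/andP; split; [rewrite invr_gt0|apply: divr_gt0 => //; exact: divr_gt0].
have kp4 : kp <= 4^-1 by rewrite ge_min lexx.
have kpQ : kp * Q <= ep / 4 by rewrite -ler_pdivlMr // ge_min lexx orbT.
have I1 : 0 < 16 * IE S + 1 by lra.
(* One value for the energy error, the fraction of bad tiles and the tail; the divisor combines the
   area ratio of the large cylinder with the cost of a bad tile. *)
pose g := ep / 64 / (Y * (16 * IE S + 1)).
have YI : 0 < Y * (16 * IE S + 1) by rewrite mulr_gt0 // (lt_le_trans ltr01).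
have g0 : 0 < g by rewrite !divr_gt0.
have Eg : g * (Y * (16 * IE S + 1)) = ep / 64 by rewrite /g divfK // lt0r_neq0.
have W0 : 0 < N1 ^+ 3 * (C + 1) by rewrite mulr_gt0 ?exprn_gt0 //; lra.
have W8 : 0 < 8 * 8 * 8 * (N1 ^+ 3 * (C + 1)) by rewrite mulr_gt0 // !mulr_gt0.
pose dl := kp / (8 * 8 * 8 * (N1 ^+ 3 * (C + 1))).
have dl0 : 0 < dl by rewrite divr_gt0.
have Hdl : 8 * 8 * 8 * (N1 ^+ 3 * (C + 1) * dl) <= kp.
  by rewrite mulrA mulrC /dl divfK // lt0r_neq0.
exists dl => // M' t MM' HT K K0.
have t0 := t_ge0 HT; have tI := t_le MM' HT.
have [h0 hh] := tail_small S g0.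
apply: filterS (ae_good MM' HT (2 * h0) g0 g0 dl0 K0) => w [r1 [m0 [R1 [r10 r1h hg]]]].
exists (Num.max 1 (Num.max R1 (Num.max (r1 / dl) (m0%:R * r1)))) => M x r h MM He.
rewrite !ge_max => /and4P[rr1 rR1 rdl rm0] hr1 hr2 hx.
have r0 : 0 < r by exact: lt_le_trans rr1.
have r1d : r1 <= dl * r by rewrite mulrC -ler_pdivrMr.
have [x' Hx HG] := hg r rR1 x hx.
have tt : tail S (r1 / 2) <= g by apply: hh; lra.
have [[kr0 kr4 dl4] _ [_ _ NN1] [De1 De0] _] :=
  @scales R n C dl kp r r1 C0 (ltW dl0) Hdl kp0 kp4 r0 r10 r1d.
have q0 : 0 <= 23 * N1 ^+ 2 * dl by rewrite -(pmulr_lge0 _ r0).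
have qk : 23 * N1 ^+ 2 * dl <= kp by rewrite -(ler_pM2r r0); lra.
have X0 : 0 <= r ^+ n by rewrite exprn_ge0 // ltW.
have Z0 : 0 <= (7 * N1) ^+ n by rewrite exprn_ge0 // mulr_ge0.
have ZY : (7 * N1) ^+ n <= Y by rewrite lerXn2r // ?nnegrE ?mulr_ge0 //; lra.
have k1 : kp <= 1 by lra.
split.
  apply: le_trans (cmp_lower MM MM' C0 hcut He Hx r0 r10 r1d (ltW dl0) kp0 kp4 Hdl hr1 hr2 g0 t0 (ltW g0) HG rm0).
  by rewrite lee_fin; exact: (err_lower I0 Y1 P1 (ler0n _ _) g0 Eg q0 qk (ltW kp0) kpQ t0 tI tt X0).
apply: le_trans (cmp_upper MM MM' C0 hcut He Hx r0 r10 r1d (ltW dl0) kp0 kp4 Hdl hr1 hr2 g0 t0 (ltW g0) HG) _.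
by rewrite lee_fin; exact: (err_upper I0 Y1 ZY Z0 P1 (ler0n _ _) g0 Eg q0 qk k1 (ltW kp0) kpQ t0 tI tt X0).
Qed.

End uniform_comparison.

(** * The invariant event *)

Section invariant.
Context {R : realType} {n : nat} {dT : measure_display} {T : measurableType dT}.
Variable S : model R n T.
Local Notation P := (mP S).
Local Notation tau := (mtau S).

(** [Oh] consists of the w for which the set of x with tau_x w in [A] is Lebesgue null. Translation
    invariance makes it invariant, Tonelli and stationarity give it full probability, and as the
    whole space has positive measure each of its points has a translate off [A]. *)
Lemma invariant_core (A : set T) : measurable A -> P A = 0%E ->
  exists Oh : set T, [/\ measurable Oh, (forall x, tau x @^-1` Oh = Oh), P Oh = 1%E &
    forall w, Oh w -> exists x, ~ A (tau x w)].
Proof.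
move=> mA A0.
pose f (xw : Rd R n * T) := (\1_A (tau xw.1 xw.2) : R)%:E.
have mf : measurable_fun setT f.
  by apply/measurable_EFinP; exact: (measurableT_comp (measurable_indic mA) (measurable_tau S)).
have f0 xw : (0 <= f xw)%E by rewrite lee_fin indicE ler0n.
pose g w := (\int[muRd n]_x f (x, w))%E.
have mg : measurable_fun setT g.
  rewrite (_ : g = fubini_G (muRd n) f) //.
  exact: measurable_fun_fubini_tonelli_G.
have g0 w : (0 <= g w)%E by apply: integral_ge0 => x _.
have mO : measurable (g @^-1` [set 0%E]).
  by have := mg measurableT _ (emeasurable_set1 0%E); rewrite setTI.
exists (g @^-1` [set 0%E]); split => //.
- move=> y; have mfx w : measurable_fun setT (fun x => f (x, w)).
    exact: (measurableT_comp mf (measurable_pair2 w)).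
  have sh w : g (tau y w) = g w.
    rewrite /g -[RHS](muRd_shift y (mfx w) (fun x => f0 (x, w))).
    by apply: eq_integral => x _; rewrite /f /= tau_add.
  by apply/seteqP; split => w; rewrite /= sh.
- have ig : (\int[P]_w g w = 0)%E.
    rewrite -(@fubini_tonelli _ _ _ _ R (muRd n) P f mf f0).
    rewrite (eq_integral (fun=> 0%E)) ?integral0 // => x _.
    have mt : measurable (tau x @^-1` A) by have := measurable_tau2 S x measurableT mA; rewrite setTI.
    transitivity (\int[P]_y (\1_(tau x @^-1` A) y)%:E)%E; first by apply: eq_integral.
    by rewrite integral_indic // setIT; rewrite -A0; exact: mtauP.
  have ig' : (\int[P]_w `|g w| = 0)%E.
    by rewrite -[RHS]ig; apply: eq_integral => w _; rewrite gee0_abs.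
  have ae := (ae_eq_integral_abs P measurableT mg).1 ig'.
  have N0 : P (~` (g @^-1` [set 0%E])) = 0%E.
    apply: measure_negligible; first exact: measurableC.
    by apply: negligibleS ae => w /= h hT; apply: h; exact: hT.
  by have := probability_setC P (measurableC mO); rewrite setCK N0 sube0.
move=> w /= gw; apply: contrapT => nx.
have hA x : A (tau x w) by apply: contrapT => h; apply: nx; exists x.
have : (1%:E <= g w)%E.
  rewrite /g (eq_integral (fun=> 1%:E)); last by move=> x _; rewrite /f /= indicE mem_set.
  rewrite integral_cst // mul1e.
  have <- : muRd n (cubeRd n 1) = 1%:E :> \bar R by rewrite muRd_cube // expr1n.
  by apply: le_measure => //; rewrite inE //; exact: measurable_cubeRd.
by rewrite gw lee_fin ler10.
Qed.

End invariant.

(** * From countably many directions to all of them *)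

Section directions.
Context {R : realType} {n : nat} {dT : measure_display} {T : measurableType dT}.
Variable S : model R n.+1 T.
Local Notation P := (mP S).
Variables (Fr : 'rV[R]_n.+1 -> 'M[R]_n.+1) (tphi : 'rV[R]_n.+1 -> R).
Hypothesis FrM : forall e, sphere R n.+1 e -> Fr e *m (Fr e)^T = 1%:M.
Hypothesis Fr0 : forall e, row ord0 (Fr e) = e.
Hypothesis HT : forall e, sphere R n.+1 e -> {ae P, forall w,
  liminf_pinfty (fun r => ((r ^- n)%:E * Fc S w (Fr e) 0 r r)%E) = (tphi e)%:E}.

Definition dir (c : 'rV[rat]_n.+1) : 'rV[R]_n.+1 :=
  (enorm (map_mx ratr c : 'rV[R]_n.+1))^-1 *: map_mx ratr c.

Lemma dir_dense e (dl : R) : sphere R n.+1 e -> 0 < dl ->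
  exists2 c : 'rV[rat]_n.+1, sphere R n.+1 (dir c) & enorm (dir c - e) <= dl.
Proof.
move=> e1 dl0; pose q := Num.min 2^-1 (dl / 2).
have q0 : 0 < q by rewrite lt_min invr_gt0 ltr0n divr_gt0.
have q2 : q <= 2^-1 by rewrite ge_min lexx.
have qd : q <= dl / 2 by rewrite ge_min lexx orbT.
have [c hc] := enorm_rat_dense e q0; set v := map_mx ratr c in hc.
have hc' : enorm (v - e) < q by rewrite -enormN opprB.
have a1 : enorm v <= 1 + q.
  rewrite -[v](subrK e); apply: le_trans (enormD _ _) _; rewrite e1; lra.
have a2 : 1 - q <= enorm v.
  have : enorm e <= enorm (e - v) + enorm v by rewrite -{1}[e](subrK v); exact: enormD.
  by rewrite e1; lra.
have v0 : 0 < enorm v by lra.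
exists c; first by apply: sphere_normalize; rewrite -enorm_eq0 lt0r_neq0.
rewrite (_ : dir c - e = (dir c - v) + (v - e)); last by rewrite addrA subrK.
apply: le_trans (enormD _ _) _.
have -> : dir c - v = ((enorm v)^-1 - 1) *: v by rewrite scalerBl scale1r.
rewrite enormZ -[X in _ * X](ger0_norm (enorm_ge0 v)) -normrM mulrBl mulVf ?lt0r_neq0 // mul1r.
have : `|1 - enorm v| <= q by rewrite ler_norml; apply/andP; split; lra.
by lra.
Qed.

Definition ep (j : nat) : R := j.+1%:R^-1.
Lemma ep_gt0 j : 0 < ep j. Proof. by rewrite invr_gt0. Qed.
Definition dlt j : R := sval (cid2 (cmp_final S (ep_gt0 j))).

(** The conclusion of [cmp_final] for the direction of a rational vector c, error 1/(j+1) and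
    centres within (k+1) r. The guard sets aside the vector that cannot be normalised. *)
Definition cmpP (c : 'rV[rat]_n.+1) (j k : nat) w := sphere R n.+1 (dir c) ->
  exists R1, forall (M : 'M[R]_n.+1) x r h, M *m M^T = 1%:M ->
     enorm (dir c - row ord0 M) <= dlt j -> R1 <= r -> r / 2 <= h -> h <= r ->
     enorm x <= k.+1%:R * r ->
     (((tphi (dir c) - ep j) * r ^+ n)%:E <= Fc S w M x r h)%E /\
     (Fc S w M x r h <= ((tphi (dir c) + ep j) * r ^+ n)%:E)%E.

Lemma dlt_gt0 j : 0 < dlt j.
Proof. by rewrite /dlt; case: cid2. Qed.

Lemma cmpP_ae c j k : {ae P, forall w, cmpP c j k w}.
Proof.
have [hs|hs] := pselect (sphere R n.+1 (dir c)); last by apply: aeW => w.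
have h : forall (M' : 'M[R]_n.+1) t, M' *m M'^T = 1%:M -> _ := s2valP' (cid2 (cmp_final S (ep_gt0 j))).
have := h _ _ (FrM hs) (HT hs) k.+1%:R (ltr0Sn _ _).
apply: filterS => w [R1 hR] _; exists R1 => M x r h' MM he.
by apply: hR => //; rewrite Fr0.
Qed.

Lemma cmpP_all : {ae P, forall w, forall c j k, cmpP c j k w}.
Proof.
pose B i := if unpickle i is Some p then [set w | ~ cmpP (p : 'rV[rat]_n.+1 * nat * nat).1.1 p.1.2 p.2 w]
  else set0.
have nB i : P.-negligible (B i).
  rewrite /B; case: unpickle => [[[c j] k]|]; last exact: negligible_set0.
  exact: cmpP_ae.
apply: negligibleS (negligible_bigcup nB) => w /= nw; apply: contrapT => nb; apply: nw => c j k.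
apply: contrapT => nc; apply: nb; exists (pickle (c, j, k)) => //; rewrite /B pickleK /=.
exact: nc.
Qed.

(** The cylinders at the origin adapted to e are controlled both by their own liminf and by the
    comparison with [dir c]. This gives the continuity of [tphi]. *)
Lemma tphi_close e c j : sphere R n.+1 e -> sphere R n.+1 (dir c) -> enorm (dir c - e) <= dlt j ->
  `|tphi e - tphi (dir c)| <= ep j.
Proof.
move=> e1 c1 he; have [w [He Hc]] := ae_ex (filterI (HT e1) (cmpP_ae c j 0)).
have [R1 hR] := Hc c1.
have x0 (r : R) : 0 < r -> enorm (0 : 'rV[R]_n.+1) <= 1%:R * r by move=> r0; rewrite enorm0 mul1r ltW.
have bd (r : R) : 0 < r -> R1 <= r ->
    (((tphi (dir c) - ep j) * r ^+ n)%:E <= Fc S w (Fr e) 0 r r)%E /\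
    (Fc S w (Fr e) 0 r r <= ((tphi (dir c) + ep j) * r ^+ n)%:E)%E.
  move=> r0 rR; apply: hR => //; [exact: FrM|by rewrite Fr0|by lra|exact: x0].
rewrite ler_norml; apply/andP; split.
  apply/ler_addgt0Pr => d d0; have m0 : 0 < Num.max 1 R1 by rewrite lt_max ltr01.
  have [r hr hF] := lim_lt He d0 m0; have r0 : 0 < r by exact: lt_le_trans hr.
  have [b1 _] := bd r r0 (le_trans (ltac:(by rewrite le_max lexx orbT) : R1 <= Num.max 1 R1) hr).
  have := le_lt_trans b1 hF; rewrite lte_fin ltr_pM2r ?exprn_gt0 //; lra.
apply/ler_addgt0Pr => d d0; have [r0 r00 h] := lim_gt He d0.
have r1 : 0 < Num.max r0 R1 by rewrite lt_max r00.
have [_ b2] := bd _ r1 (ltac:(by rewrite le_max lexx orbT) : R1 <= Num.max r0 R1).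
have := le_trans (h _ (ltac:(by rewrite le_max lexx) : r0 <= Num.max r0 R1)) b2.
rewrite lee_fin ler_pM2r ?exprn_gt0 //; lra.
Qed.

(** For w in the invariant set one translate tau_y w satisfies all the countably many conditions
    [cmpP]. Passing back to w displaces the centre by the fixed vector y, which the bound on centres
    proportional to r absorbs. *)
Lemma cube_limit : exists Oh : set T,
  [/\ measurable Oh, (forall x, mtau S x @^-1` Oh = Oh), P Oh = 1%E &
   forall w, Oh w -> forall e, sphere R n.+1 e -> forall x0 (rho : R), 0 < rho ->
     ((r ^- n)%:E * Fc S w (Fr e) (r *: x0)%R (r * rho)%R (r * rho / 2)%R)%E
       @[r --> +oo%R] --> (tphi e * rho ^+ n)%:E].
Proof.
have [A [mA A0 hA]] := cmpP_all.
have [Oh [mO iO PO hO]] := invariant_core mA A0; exists Oh; split => // w /hO[y ny] e e1 x0 rho rho0.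
have gd c j k : cmpP c j k (mtau S y w).
  by have := contrapT (fun h => ny (hA (mtau S y w) h)); exact.
have rn0 : 0 < rho ^+ n by rewrite exprn_gt0.
have key (eps : R) : 0 < eps -> exists2 R2 : R, 0 < R2 & forall r, R2 <= r -> exists2 v : R,
    ((r ^- n)%:E * Fc S w (Fr e) (r *: x0)%R (r * rho)%R (r * rho / 2)%R)%E = v%:E &
    `|tphi e * rho ^+ n - v| <= eps.
  move=> eps0.
  (* Two errors 1/(j+1), one from the comparison and one from [tphi_close], must amount to at most
     eps after multiplication by rho^n. *)
  have /andP[_ j2] := truncn_itv (ltac:(by rewrite divr_ge0 ?mulr_ge0 // ltW) : 0 <= 2 * rho ^+ n / eps).
  set j := Num.trunc _ in j2.
  have ej : ep j * (2 * rho ^+ n) <= eps.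
    by rewrite /ep ler_pdivrMl ?ltr0n //; move: j2; rewrite ltr_pdivrMr // => /ltW.
  have [c c1 ce] := dir_dense e1 (dlt_gt0 j).
  have tc := tphi_close e1 c1 ce.
  (* k is chosen so that r x0 - y is within (k+1) r rho for every r >= 1. *)
  have q0 : 0 <= (enorm x0 + enorm y) / rho by rewrite divr_ge0 ?addr_ge0 ?enorm_ge0 // ltW.
  have /andP[_ k2] := truncn_itv q0; set k := Num.trunc _ in k2.
  have [R1 hR] := gd c j k c1.
  exists (Num.max 1 (R1 / rho)); first by rewrite lt_max ltr01.
  move=> r; rewrite ge_max => /andP[r1]; rewrite ler_pdivrMr // => rR.
  have r0 : 0 < r by exact: lt_le_trans r1.
  have rr0 : 0 < r * rho by rewrite mulr_gt0.
  have hx : enorm (r *: x0 - y) <= k.+1%:R * (r * rho).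
    apply: le_trans (enormD _ _) _; rewrite enormN enormZ gtr0_norm //.
    apply: (@le_trans _ _ (r * (enorm x0 + enorm y))).
      by rewrite mulrDr lerD2l ler_peMl ?enorm_ge0.
    by rewrite mulrCA ler_pM2l //; move: k2; rewrite ltr_pdivrMr // => /ltW.
  have he : enorm (dir c - row ord0 (Fr e)) <= dlt j by rewrite Fr0.
  have [b1 b2] := hR (Fr e) (r *: x0 - y) (r * rho) (r * rho / 2) (FrM e1) he rR (lexx _)
    (ltac:(lra)) hx.
  rewrite Fc_shift subrK in b1 b2.
  have [f Ef] : exists f, Fc S w (Fr e) (r *: x0) (r * rho) (r * rho / 2) = f%:E.
    exists (fine (Fc S w (Fr e) (r *: x0) (r * rho) (r * rho / 2))); rewrite fineK //.
    by rewrite ge0_fin_numE ?Fc_ge0 //; apply: le_lt_trans b2 _; rewrite ltry.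
  exists (r ^- n * f); first by rewrite Ef EFinM.
  rewrite Ef !lee_fin exprMn in b1 b2.
  have X0 : 0 < r ^+ n by rewrite exprn_gt0.
  have v1 : (tphi (dir c) - ep j) * rho ^+ n <= r ^- n * f.
    by rewrite ler_pdivlMl //; apply: le_trans b1; rewrite le_eqVlt; apply/orP; left; apply/eqP; ring.
  have v2 : r ^- n * f <= (tphi (dir c) + ep j) * rho ^+ n.
    by rewrite ler_pdivrMl //; apply: le_trans b2 _; rewrite le_eqVlt; apply/orP; left; apply/eqP; ring.
  move: tc; rewrite ler_norml => /andP[t1 t2].
  have u1 : (tphi e - tphi (dir c)) * rho ^+ n <= ep j * rho ^+ n by rewrite ler_pM2r.
  have u2 : - ep j * rho ^+ n <= (tphi e - tphi (dir c)) * rho ^+ n by rewrite ler_pM2r.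
  by rewrite ler_norml; apply/andP; split; lra.
apply/fine_cvgP; split.
  have [R2 _ h2] := key 1 ltr01; near=> r.
  have hr : R2 <= r by near: r; exact: nbhs_pinfty_ge (num_real _).
  by have [v -> _] := h2 r hr.
apply/cvgrPdist_le => eps eps0; have [R2 _ h2] := key eps eps0; near=> r.
have hr : R2 <= r by near: r; exact: nbhs_pinfty_ge (num_real _).
by have [v /= -> hv] := h2 r hr.
Unshelve. all: by end_near. Qed.

End directions.

Theorem theorem1p3 (R : realType) (d : nat) (lam Lam : R)
  (dT : measure_display) (T : measurableType dT) (P : probability T R)
  (Phi : T -> 'rV[R]_d -> R) (tau : 'rV[R]_d -> T -> T)
  (W : R -> R) (q : R -> R)
  (O : 'rV[R]_d -> 'rV[R]_d.-1 -> 'rV[R]_d) (b : 'I_d.-1 -> 'rV[R]_d.-1)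
  (tphi : 'rV[R]_d -> R) :
  (1 <= d)%N -> 0 < lam -> 0 < Lam ->
  (* Phi : Omega -> F_d(lam, Lam), measurable for the Borel sets of the sup norm *)
  (forall w, Fd R d lam Lam (Phi w)) ->
  (forall B, Fd_borel R d lam Lam B -> measurable (Phi @^-1` B)) ->
  (* tau : jointly measurable, measure-preserving, ergodic group action *)
  jointly_measurable tau ->
  (forall x y, tau (x + y) = tau x \o tau y) -> tau 0 = id ->
  (forall x E, measurable E -> P (tau x @^-1` E) = P E) ->
  (forall E, measurable E -> (forall x, tau x @^-1` E = E) -> P E = 0%E \/ P E = 1%E) ->
  (* the double-well potential W *)
  {within `[-1, 1], continuous W} ->
  (forall s, -1 <= s <= 1 -> 0 <= W s) ->
  (forall s, -1 <= s <= 1 -> (W s = 0 <-> s = -1 \/ s = 1)) ->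
  (* the profile q *)
  (forall n x, derivable (iter n (@derive1 R R) q) x 1) ->
  (forall s, -1 <= q s <= 1) ->
  (\int[@lebesgue_measure R]_s ((Lam / 2) * (derive1 q s) ^+ 2 + W (q s))%:E < +oo)%E ->
  q x @[x --> +oo%R] --> (1 : R) -> q x @[x --> -oo%R] --> (-1 : R) ->
  (* the isometries O_e : R^{d-1} -> <e>^perp and the orthonormal basis b *)
  (forall e, sphere R d e ->
     (forall (a : R) u v, O e (a *: u + v) = a *: O e u + O e v) /\
     (forall u v, dotp (O e u) (O e v) = dotp u v) /\
     (forall z, dotp z e = 0 <-> exists a, O e a = z)) ->
  (forall i j, dotp (b i) (b j) = (i == j)%:R) ->
  (* tphi e is the deterministic a.s. value of tilde phi^omega(e) *)
  (forall e, sphere R d e ->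
     {ae P, forall w, tphiw Phi tau W q O b w e = (tphi e)%:E}) ->
  exists Oh : set T,
    [/\ measurable Oh, (forall x, tau x @^-1` Oh = Oh), P Oh = 1%E &
     forall w, Oh w -> forall e, sphere R d e -> forall x0 (rho : R), 0 < rho ->
       ((r ^- d.-1)%:E *
           Phit Phi tau W q w e (r *: x0) (scale_set r (Qe O b e x0 rho)))%E
         @[r --> +oo%R] --> (tphi e * rho ^+ d.-1)%:E].
Proof.
case: d Phi tau O b tphi => [|n] Phi tau O b tphi //= _ _ Lam0 PhiF Phim taum tauD tau0 tauP _.
move=> Wc W0 _ qs q1 Eoo _ _ hO hb hphi.
pose S := Model Lam0 PhiF Phim taum tauD tau0 tauP Wc W0 (C1k_iter qs) q1 Eoo.
(* Row 0 is the normal e and the other rows are the images of the basis [b] under [O e]; in this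
   orthonormal frame the sets of the statement are boxes. *)
pose Fr (e : 'rV[R]_n.+1) : 'M[R]_n.+1 :=
  \matrix_(i, j) (if unlift ord0 i is Some k then O e (b k) else e) ord0 j.
have Fr0 e : row ord0 (Fr e) = e by apply/rowP => j; rewrite !mxE unlift_none.
have FrS e k : row (lift ord0 k) (Fr e) = O e (b k) by apply/rowP => j; rewrite !mxE liftK.
have Oe e a : sphere R n.+1 e -> dotp (O e a) e = 0.
  by move=> /hO[_ [_ h]]; apply/h; exists a.
have ee e : sphere R n.+1 e -> dotp e e = 1 by rewrite -enorm_sq => ->; rewrite expr1n.
have FrM e : sphere R n.+1 e -> Fr e *m (Fr e)^T = 1%:M.
  move=> e1; apply/matrixP => i j.
  transitivity (dotp (row i (Fr e)) (row j (Fr e))).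
    by rewrite !mxE; apply: eq_bigr => l _; rewrite !mxE.
  rewrite !mxE; case: (unliftP ord0 i) => [i'|] ->; case: (unliftP ord0 j) => [j'|] ->;
    rewrite ?FrS ?Fr0.
  - by have [_ [h _]] := hO _ e1; rewrite h hb (inj_eq (@lift_inj _ _)).
  - by rewrite Oe // eq_sym (negbTE (neq_lift _ _)).
  - by rewrite dotpC Oe // (negbTE (neq_lift _ _)).
  - by rewrite ee // eqxx.
have opE e r h : sphere R n.+1 e ->
    oplus_e O e (Qcube b 0 r) `](- h)%R, h%R[ = box (Fr e) 0 r h.
  move=> e1; have [_ [iso ort]] := hO _ e1; apply/seteqP; split => z.
    move=> [a qa [s hs <-]]; apply/boxP; rewrite Fr0 subr0; split.
      by rewrite dotpDl Oe // dotpZl ee // mulr1 add0r; move: hs; rewrite /= in_itv /= ltr_norml.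
    move=> i; rewrite FrS dotpDl iso dotpZl [dotp e _]dotpC Oe // mulr0 addr0.
    by have := qa i; rewrite subr0.
  move=> /boxP; rewrite Fr0 subr0 => -[z1 z2].
  (* Removing the normal component leaves a vector orthogonal to e, hence in the range of [O e]. *)
  have /ort[a ha] : dotp (z - dotp z e *: e) e = 0 by rewrite dotpBl dotpZl ee // mulr1 subrr.
  exists a; last first.
    exists (dotp z e); first by rewrite /= in_itv /= -ltr_norml.
    by rewrite ha subrK.
  move=> i; rewrite subr0 -iso ha dotpBl dotpZl [dotp e _]dotpC Oe // mulr0 subr0 -FrS.
  exact: z2.
(* The scaled cube has side r rho and half-height r rho / 2. The identity is for r > 0, which holds
   eventually in the limit. *)
have scE e r x0 rho : sphere R n.+1 e -> 0 < r ->
    scale_set r (Qe O b e x0 rho) = box (Fr e) (r *: x0) (r * rho) (r * rho / 2).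
  move=> e1 r0; rewrite /scale_set /Qe opE //; apply/seteqP; split => z.
    move=> [_ [u /boxP[u1 u2] <-] <-]; rewrite subr0 in u1; apply/boxP.
    have E : r *: (x0 + u) - r *: x0 = r *: u by rewrite scalerDr addrC addKr.
    rewrite E dotpZl normrM gtr0_norm // -mulrA ltr_pM2l //; split => // i.
    by rewrite dotpZl normrM gtr0_norm // ltr_pM2l //; have := u2 i; rewrite subr0.
  move=> /boxP[z1 z2]; exists (x0 + r^-1 *: (z - r *: x0)); last first.
    by rewrite scalerDr scalerA divff ?lt0r_neq0 // scale1r addrC subrK.
  exists (r^-1 *: (z - r *: x0)) => //; apply/boxP; rewrite subr0; split => [|i].
    by rewrite dotpZl normrM gtr0_norm ?invr_gt0 // ltr_pdivrMl // mulrA.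
  by rewrite dotpZl normrM gtr0_norm ?invr_gt0 // ltr_pdivrMl // mulrA.
have FcE w e x r h : Fc S w (Fr e) x r h = Phit Phi tau W q w e x (box (Fr e) x r h).
  by rewrite /Fc Fr0.
have HT e : sphere R n.+1 e -> {ae mP S, forall w,
    liminf_pinfty (fun r => ((r ^- n)%:E * Fc S w (Fr e) 0 r r)%E) = (tphi e)%:E}.
  move=> e1; apply: filterS (hphi e e1) => w hw; rewrite -hw /tphiw; congr (liminf_pinfty _).
  by apply/funext => r; rewrite FcE -(opE e r r e1).
have [Oh [mO iO PO lim]] := cube_limit FrM Fr0 HT.
exists Oh; split => // w Ow e e1 x0 rho rho0.
apply: cvg_trans (lim w Ow e e1 x0 rho rho0); apply: near_eq_cvg; near=> r.
have r0 : 0 < r by near: r; exact: nbhs_pinfty_gt (num_real _).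
by rewrite (scE e r x0 rho e1 r0) FcE.
Unshelve. all: by end_near. Qed.
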